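(* Let $T>0$, let $(\omega^0,v^0)\in L^1(\mathbb{R}^2)\times M^2(\mathbb{R}^2)$ with $\omega^0=\operatorname{curl}v^0$, let $\omega\in L^\infty((0,T);L^1(\mathbb{R}^2))$ and $v(t,\cdot)=K*\omega(t,\cdot)$. (1) $(\omega,v)$ is a symmetrized velocity solution with initial datum $(\omega^0,v^0)$ if and only if it is a symmetrized vorticity solution with initial datum $(\omega^0,v^0)$. (2) If $v\in L^\infty((0,T);L^2_{\rm loc}(\mathbb{R}^2))$ and $v^0\in L^2_{\rm loc}(\mathbb{R}^2)$, then $(\omega,v)$ is a symmetrized velocity solution with initial datum $(\omega^0,v^0)$ if and only if $v$ is a weak solution of the Euler velocity formulation with initial datum $v^0$.
   Context: Notation. $(x_1,x_2)^\perp=(-x_2,x_1)$, $\operatorname{curl}v=\partial_1v_2-\partial_2v_1$ (in the sense of distributions), $K(x)=\frac{1}{2\pi}\frac{x^\perp}{|x|^2}$ is the Biot-Savart kernel on $\mathbb{R}^2$; convolution is in the space variable only. $M^2(\mathbb{R}^2)$ is the space of measurable $u$ with $\sup_{\lambda>0}\lambda^2\mathcal{L}^2(\{|u|>\lambda\})<\infty$. $v\in L^\infty((0,T);L^2_{\rm loc})$ means $\operatorname{ess\,sup}_t\|v(t)\|_{L^2(B_R)}<\infty$ for all $R$, where $B_R$ is the ball of radius $R$ centered at $0$. Symmetrized velocity solution with initial datum $(\omega^0,v^0)\in L^1(\mathbb{R}^2)\times M^2(\mathbb{R}^2)$, $\omega^0=\operatorname{curl}v^0$: $\omega\in L^\infty((0,T);L^1(\mathbb{R}^2))$,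 $v=K*\omega$, and for all $\phi\in C^1_c([0,T)\times\mathbb{R}^2,\mathbb{R}^2)$ with $\operatorname{div}\phi=0$, $$\int_0^T\!\!\int_{\mathbb{R}^2}\partial_t\phi\cdot v\,dx\,dt-\int_0^T\!\!\int_{\mathbb{R}^2}\int_{\mathbb{R}^2}\bar H_\phi(t,x,y)\omega(t,x)\omega(t,y)\,dx\,dy\,dt+\int_{\mathbb{R}^2}\phi(0,x)\cdot v^0(x)\,dx=0,$$ where $\bar H_\phi(t,x,y)=\frac12K(x-y)^\perp\cdot(\phi(t,x)-\phi(t,y))$ (a bounded function). Symmetrized vorticity solution with initial datum $(\omega^0,v^0)\in L^1(\mathbb{R}^2)\times M^2(\mathbb{R}^2)$, $\omega^0=\operatorname{curl}v^0$: $\omega\in L^\infty((0,T);L^1(\mathbb{R}^2))$, $v=K*\omega$, and for all $\phi\in C^2_c([0,T)\times\mathbb{R}^2)$, $$\int_0^T\!\!\int_{\mathbb{R}^2}\partial_t\phi\,\omega\,dx\,dt-\int_0^T\!\!\int_{\mathbb{R}^2}\int_{\mathbb{R}^2}H_\phi(t,x,y)\omega(t,x)\omega(t,y)\,dx\,dy\,dt+\int_{\mathbb{R}^2}\phi(0,x)\omega^0(x)\,dx=0,$$ where $H_\phi(t,x,y)=-\frac12K(x-y)\cdot(\nabla\phi(t,x)-\nabla\phi(t,y))$. Weak solution of the Euler velocity formulation with initial datum $v^0\in L^2_{\rm loc}(\mathbb{R}^2)$: $v\in L^\infty((0,T);L^2_{\rm loc}(\mathbb{R}^2))$ is divergence free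 in the distributional sense and for all $\phi\in C^1_c([0,T)\times\mathbb{R}^2,\mathbb{R}^2)$ with $\operatorname{div}\phi=0$, $$\int_0^T\!\!\int_{\mathbb{R}^2}\partial_t\phi\cdot v+\nabla\phi:(v\otimes v)\,dx\,dt+\int_{\mathbb{R}^2}\phi(0,x)\cdot v^0(x)\,dx=0.$$ *)

(* Defs.v *)
From HB Require Export structures.
From mathcomp Require Export all_boot all_order all_algebra.
From mathcomp Require Export all_classical all_reals all_analysis.
From mathcomp Require Export ess_sup_inf.
Export Order.TTheory GRing.Theory Num.Theory.
Export numFieldNormedType.Exports.
Set Implicit Arguments.
Unset Strict Implicit.
Unset Printing Implicit Defensive.
Local Open Scope classical_set_scope.
Local Open Scope ring_scope.

Notation leb R := (@lebesgue_measure R).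

(* Lebesgue measure on R * R. The sigma-finite structure of product measures is
   hidden by the one for products of sub-probabilities, hence it is restated. *)
Definition leb2 (R : realType) :
    set (measurableTypeR R * measurableTypeR R)%type -> \bar R :=
  (leb R \x leb R)%E.
Arguments leb2 R : clear implicits.

HB.instance Definition _ (R : realType) := Measure.copy (leb2 R)
  (leb R \x leb R)%E.

HB.instance Definition _ (R : realType) : isSFinite _ _ _ (leb2 R) :=
  lebesgue_integral_fubini.measure_function_Measure_isSigmaFinite__to__measure_function_isSFinite
    (leb R) (leb R).
HB.instance Definition _ (R : realType) : isSigmaFinite _ _ _ (leb2 R) :=
  lebesgue_integral_fubini.measure_function_Measure_isSigmaFinite__to__measure_function_isSigmaFinite
    (leb R) (leb R).

Section Plane.
Variable R : realType.
Implicit Types x y : R * R.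

(* The library norm on a product is the max norm, hence a separate one here. *)
Definition dot x y : R := x.1 * y.1 + x.2 * y.2.
Definition enorm x : R := Num.sqrt (dot x x).
Definition eball (r : R) : set (R * R) := [set x | enorm x < r].
Definition perp x : R * R := (- x.2, x.1).

Definition bsK x : R * R := (2 * pi * enorm x ^+ 2)^-1 *: perp x.

Definition bs_conv (w : R * R -> R) x : R * R :=
  (\int[leb2 R]_y ((bsK (x - y)).1 * w y),
   \int[leb2 R]_y ((bsK (x - y)).2 * w y)).

End Plane.

Section TestFunctions.
Variables (R : realType) (V W : normedModType R).
Implicit Types (D : set V) (f : V -> W).

(* f is C^n up to the part of the boundary contained in D: f and its partial
   derivatives of order <= n, taken in the interior of D, extend continuously
   to D. Values outside D are irrelevant. *)
Fixpoint Ck D (n : nat) f : Prop :=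
  {within D, continuous f} /\
  if n is m.+1 then
    forall u : V, exists g : V -> W,
      Ck D m g /\ forall p, interior D p -> is_derive p u f (g p)
  else True.

Definition compactly_supported_in D f : Prop :=
  exists K : set V, [/\ compact K, K `<=` D & forall p, D p -> ~ K p -> f p = 0].

Definition Cc D (n : nat) f : Prop := Ck D n f /\ compactly_supported_in D f.

Definition Cc_infty D f : Prop :=
  (forall n, Ck D n f) /\ compactly_supported_in D f.

End TestFunctions.

Section SpaceTime.
Variables (R : realType) (T : R).

Definition slab0 : set (R * (R * R)) := `[0, T[%classic `*` setT.
Definition slab : set (R * (R * R)) := `]0, T[%classic `*` setT.

Section Derivatives.
Variable W : normedModType R.
Implicit Types (f : R * (R * R) -> W) (p : R * (R * R)).
Definition dt f p : W := 'D_((1, (0, 0)) : R * (R * R)) f p.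
Definition dx1 f p : W := 'D_((0, (1, 0)) : R * (R * R)) f p.
Definition dx2 f p : W := 'D_((0, (0, 1)) : R * (R * R)) f p.
End Derivatives.

Definition gradx (f : R * (R * R) -> R) p : R * R := (dx1 f p, dx2 f p).
Definition divx (f : R * (R * R) -> R * R) p : R := (dx1 f p).1 + (dx2 f p).2.

(* phi in C^1_c([0,T) x R^2, R^2) with div phi = 0; at t = 0 the divergence
   vanishes by continuity. *)
Definition solenoidal_test (phi : R * (R * R) -> R * R) : Prop :=
  Cc slab0 1 phi /\ forall p, slab p -> divx phi p = 0.

Definition curl_eq (v : R * R -> R * R) (w : R * R -> R) : Prop :=
  forall psi : R * R -> R, Cc_infty setT psi ->
    \int[leb2 R]_x ((v x).1 * 'D_((0, 1) : R * R) psi x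
                    - (v x).2 * 'D_((1, 0) : R * R) psi x)
    = \int[leb2 R]_x (w x * psi x).

Definition in_L1 (w : R * R -> R) : Prop :=
  (leb2 R).-integrable setT (EFin \o w).

Definition in_M2 (u : R * R -> R * R) : Prop :=
  measurable_fun setT u /\
  (ereal_sup [set (l ^+ 2)%:E * leb2 R [set x | (l < enorm (u x))%R]
             | l in `]0%R, +oo[%classic] < +oo)%E.

Definition in_L2loc (u : R * R -> R * R) : Prop :=
  measurable_fun setT u /\
  forall r : R, 0 < r ->
    ('N[leb2 R]_(2%:E)[(fun x => (enorm (u x))%:E) \_ (eball r)] < +oo)%E.

(* The norms are nonnegative, so extending them by 0 outside ]0, T[ does not
   change the finiteness of the essential supremum over ]0, T[. *)
Definition in_Linf_L1 (w : R * (R * R) -> R) : Prop :=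
  measurable_fun slab w /\
  (ess_sup (leb R)
     ((fun t => 'N[leb2 R]_1[(fun x => (w (t, x))%:E)]) \_ `]0%R, T[%classic)
   < +oo)%E.

Definition in_Linf_L2loc (v : R * (R * R) -> R * R) : Prop :=
  measurable_fun slab v /\
  forall r : R, 0 < r ->
  (ess_sup (leb R)
     ((fun t => 'N[leb2 R]_(2%:E)[(fun x => (enorm (v (t, x)))%:E) \_ (eball r)])
        \_ `]0%R, T[%classic)
   < +oo)%E.

(* v = K * omega as classes of measurable functions on (0,T) x R^2. *)
Definition is_bs_velocity (w : R * (R * R) -> R) (v : R * (R * R) -> R * R) :
    Prop :=
  measurable_fun slab v /\
  {ae leb R, forall t, `]0, T[%classic t ->
    {ae leb2 R, forall x, v (t, x) = bs_conv (fun y => w (t, y)) x}}.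

Definition initial_datum (w0 : R * R -> R) (v0 : R * R -> R * R) : Prop :=
  [/\ in_L1 w0, in_M2 v0 & curl_eq v0 w0].

Definition Hbar_kernel (phi : R * (R * R) -> R * R) (t : R) (x y : R * R) : R :=
  2^-1 * dot (perp (bsK (x - y))) (phi (t, x) - phi (t, y)).

Definition H_kernel (phi : R * (R * R) -> R) (t : R) (x y : R * R) : R :=
  - 2^-1 * dot (bsK (x - y)) (gradx phi (t, x) - gradx phi (t, y)).

Definition symmetrized_velocity_solution (w0 : R * R -> R) (v0 : R * R -> R * R)
    (w : R * (R * R) -> R) (v : R * (R * R) -> R * R) : Prop :=
  [/\ initial_datum w0 v0, in_Linf_L1 w, is_bs_velocity w v &
    forall phi : R * (R * R) -> R * R, solenoidal_test phi ->
      \int[leb R]_(t in `]0, T[) (\int[leb2 R]_x dot (dt phi (t, x)) (v (t, x)))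
      - \int[leb R]_(t in `]0, T[) (\int[leb2 R]_y (\int[leb2 R]_x
          (Hbar_kernel phi t x y * w (t, x) * w (t, y))))
      + \int[leb2 R]_x dot (phi (0, x)) (v0 x) = 0].

Definition symmetrized_vorticity_solution (w0 : R * R -> R)
    (v0 : R * R -> R * R)
    (w : R * (R * R) -> R) (v : R * (R * R) -> R * R) : Prop :=
  [/\ initial_datum w0 v0, in_Linf_L1 w, is_bs_velocity w v &
    forall phi : R * (R * R) -> R, Cc slab0 2 phi ->
      \int[leb R]_(t in `]0, T[) (\int[leb2 R]_x (dt phi (t, x) * w (t, x)))
      - \int[leb R]_(t in `]0, T[) (\int[leb2 R]_y (\int[leb2 R]_x
          (H_kernel phi t x y * w (t, x) * w (t, y))))
      + \int[leb2 R]_x (phi (0, x) * w0 x) = 0].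

Definition div_free (v : R * (R * R) -> R * R) : Prop :=
  forall psi : R * (R * R) -> R, Cc_infty slab psi ->
    \int[leb R]_(t in `]0, T[)
      (\int[leb2 R]_x dot (v (t, x)) (gradx psi (t, x))) = 0.

(* grad phi : (a (x) a) *)
Definition grad_tensor (phi : R * (R * R) -> R * R) p (a : R * R) : R :=
  dot (a.1 *: dx1 phi p + a.2 *: dx2 phi p) a.

Definition euler_velocity_weak_solution (v0 : R * R -> R * R)
    (v : R * (R * R) -> R * R) : Prop :=
  [/\ in_L2loc v0, in_Linf_L2loc v, div_free v &
    forall phi : R * (R * R) -> R * R, solenoidal_test phi ->
      \int[leb R]_(t in `]0, T[) (\int[leb2 R]_x
          (dot (dt phi (t, x)) (v (t, x)) + grad_tensor phi (t, x) (v (t, x))))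
      + \int[leb2 R]_x dot (phi (0, x)) (v0 x) = 0].

End SpaceTime.

(* Main.v *)
(** A solenoidal test field is the rotated gradient of a stream function.  If phi is
a C^2_c function then (-d2 phi, d1 phi) is an admissible test for the velocity
formulation, and since v = K * w satisfies int v . grad^perp psi = - int w psi for
every psi in C^1_c, the two left-hand sides agree up to sign.  Conversely a
solenoidal field Phi of class C^1_c has a stream function which is C^2 in space but
only C^1 in time; its Steklov averages in time are admissible for the vorticity
formulation, and the left-hand side of the velocity formulation is continuous for
uniform convergence of Phi and its first derivatives, because H is controlled by the
Lipschitz constant of Phi and v is bounded in L^1_loc uniformly in time.

For the Euler formulation one shows at almost every time that
int grad Phi : (v (x) v) = - int int H_Phi w w as soon as v = K * w is in L^2_loc.
For a mollified w this is the integral of div((Phi . v) v - |v|^2 Phi / 2),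
combined with the symmetrization of int w v^perp . Phi; then one lets the
mollification parameter tend to 0. *)
From mathcomp Require Import measurable_realfun ring lra.
Require Import Defs.
Set Implicit Arguments.
Unset Strict Implicit.
Unset Printing Implicit Defensive.
Local Open Scope classical_set_scope.
Local Open Scope ring_scope.

(** A field [v = K * omega] with omega in L1 need not be locally square integrable, so [v (x) v] has
    no meaning in general; the quadratic term is defined by the symmetrized kernel, whose
    singularity 1/|x - y| is absorbed by a Lipschitz bound. The nonlinearity is therefore treated on
    one time slice, first for mollified vorticity and then by continuity of a bounded bilinear form
    on L1. The identities curl K = delta and div K = 0 are computed with abscissa and slope as
    coordinates: the constant 2 pi is twice the integral of 1 / (1 + s^2). Test functions have
    derivatives only for 0 < t < T. They are reflected evenly at t = 0 to be globally continuous,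
    and averaged forward, over [t, t + e], so that an average at t > 0 sees only times where
    derivatives exist and a support in t <= S is kept. The bound on [v0] in M^2 enters through local
    integrability, which lets the smooth tests in curl v0 = omega0 be replaced by C1 ones. *)

Notation intg m f := (m.-integrable setT (EFin \o f)).

(** * Integration on the plane *)

Section IntegralToolkit.
Context d (T : measurableType d) (R : realType) (m : {measure set T -> \bar R}).
Implicit Types f g : T -> R.

Lemma intg_mfun f : intg m f -> measurable_fun setT f.
Proof. by move=> /integrableP[/measurable_EFinP]. Qed.

Lemma intg_le f g : measurable_fun setT f -> (forall x, `|f x| <= g x) ->
  intg m g -> intg m f.
Proof.
move=> mf fg ig; apply: le_integrable ig => //; first exact/measurable_EFinP.
by move=> x _ /=; rewrite lee_fin (le_trans (fg x))// ler_norm.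
Qed.

Lemma intgD f g : intg m f -> intg m g -> intg m (fun x => f x + g x).
Proof.
move=> fi gi; have := integrableD measurableT fi gi.
by apply: eq_integrable => // x _; rewrite /= EFinD.
Qed.

Lemma intgB f g : intg m f -> intg m g -> intg m (fun x => f x - g x).
Proof.
move=> fi gi; have := integrableB measurableT fi gi.
by apply: eq_integrable => // x _; rewrite /= EFinB.
Qed.

Lemma intgZ k f : intg m f -> intg m (fun x => k * f x).
Proof.
move=> fi; have := integrableZl measurableT k fi.
by apply: eq_integrable => // x _; rewrite /= EFinM.
Qed.

Lemma intg_norm f : intg m f -> intg m (fun x => `|f x|).
Proof.
move=> fi; have := integrable_abse fi.
by apply: eq_integrable => // x _; rewrite /= EFinM.
Qed.

Lemma intg_ext f g : (forall x, f x = g x) -> intg m f -> intg m g.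
Proof. by move=> fg; rewrite (_ : f = g)//; exact/funext. Qed.

Lemma intg0 : intg m (fun=> 0 : R).
Proof. exact: integrable0. Qed.

Lemma RintD f g : intg m f -> intg m g ->
  \int[m]_x (f x + g x) = \int[m]_x f x + \int[m]_x g x.
Proof. by move=> fi gi; rewrite RintegralD. Qed.

Lemma RintB f g : intg m f -> intg m g ->
  \int[m]_x (f x - g x) = \int[m]_x f x - \int[m]_x g x.
Proof. by move=> fi gi; rewrite RintegralB. Qed.

Lemma RintZ k f : intg m f -> \int[m]_x (k * f x) = k * \int[m]_x f x.
Proof. by move=> fi; rewrite RintegralZl. Qed.

(** When a positive or negative part has infinite integral, both sides are 0, because [fine] sends
    the infinities to 0. *)
Lemma RintN f : \int[m]_x (- f x) = - \int[m]_x f x.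
Proof.
rewrite /Rintegral [in LHS]integralE [in RHS]integralE.
have mx (a b : \bar R) : (0 <= a -> 0 <= b -> fine (b - a) = (- fine (a - b))%R)%E.
  by case: a b => [a| |] [b| |]//= _ _; rewrite ?oppr0// opprB.
rewrite (_ : (fun x => (- f x)%:E) = \- (EFin \o f))%E; last first.
  by apply/funext => x /=; rewrite EFinN.
rewrite (funeposN (EFin \o f)) (funenegN (EFin \o f)).
by apply: mx; exact: integral_ge0.
Qed.

Lemma Rint_ext f g : (forall x, f x = g x) -> \int[m]_x f x = \int[m]_x g x.
Proof. by move=> fg; rewrite (_ : f = g)//; exact/funext. Qed.

Lemma Rint_ae f g : measurable_fun setT f -> measurable_fun setT g ->
  {ae m, forall x, f x = g x} -> \int[m]_x f x = \int[m]_x g x.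
Proof.
move=> mf mg fg; congr fine; apply: ae_eq_integral => //.
- exact/measurable_EFinP.
- exact/measurable_EFinP.
- by apply: filterS fg => x /= -> _.
Qed.

Lemma intg_ae f g : measurable_fun setT g ->
  {ae m, forall x, f x = g x} -> intg m f -> intg m g.
Proof.
move=> mg fg /integrableP[mf fi]; apply/integrableP; split.
  exact/measurable_EFinP.
rewrite (ae_eq_integral (fun x => `|(f x)%:E|%E))//.
- by apply: measurableT_comp => //; exact/measurable_EFinP.
- exact: measurableT_comp mf.
- by apply: filterS fg => x /= -> _.
Qed.

Lemma Rint_ge0 f : (forall x, 0 <= f x) -> 0 <= \int[m]_x f x.
Proof. by move=> f0; exact: Rintegral_ge0. Qed.

Lemma Rint_le f g : intg m f -> intg m g -> (forall x, f x <= g x) ->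
  \int[m]_x f x <= \int[m]_x g x.
Proof. by move=> fi gi fg; apply: le_Rintegral. Qed.

Lemma Rint_norm f : intg m f -> `|\int[m]_x f x| <= \int[m]_x `|f x|.
Proof. by move=> fi; apply: le_normr_Rintegral. Qed.

Lemma Rint_norm_le f g : measurable_fun setT f -> intg m g ->
  (forall x, `|f x| <= g x) -> `|\int[m]_x f x| <= \int[m]_x g x.
Proof.
move=> mf gi fg; have fi := intg_le mf fg gi.
by apply: le_trans (Rint_norm fi) _; apply: Rint_le => //; exact: intg_norm.
Qed.

Lemma intg_EFin f : intg m f -> (\int[m]_x (f x)%:E)%E = (\int[m]_x f x)%:E.
Proof.
by move=> fi; rewrite /Rintegral fineK//; exact: integrable_fin_num.
Qed.

Lemma intg_ge0P f : measurable_fun setT f -> (forall x, 0 <= f x) ->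
  (\int[m]_x (f x)%:E < +oo)%E -> intg m f.
Proof.
move=> mf f0 fi; apply/integrableP; split; first exact/measurable_EFinP.
by under eq_integral => x _ do rewrite /= ger0_norm//.
Qed.

Lemma intg_restrict (D : set T) f : measurable D ->
  intg m (f \_ D) <-> m.-integrable D (EFin \o f).
Proof. by move=> mD; rewrite -restrict_EFin; exact: (iff_sym (integrable_mkcond _ mD)). Qed.

Lemma Rint_restrict (D : set T) f : \int[m]_(x in D) f x = \int[m]_x (f \_ D) x.
Proof. exact: Rintegral_mkcond. Qed.

Lemma Rint_cvg (f_ : nat -> T -> R) f g :
  (forall n, measurable_fun setT (f_ n)) -> measurable_fun setT f ->
  {ae m, forall x, f_ ^~ x @ \oo --> f x} -> intg m g ->
  (forall n, {ae m, forall x, `|f_ n x| <= g x}) ->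
  \int[m]_x (f_ n x) @[n --> \oo] --> \int[m]_x f x.
Proof.
move=> mf_ mf fcv ig fg.
have fg' : {ae m, forall x n, [set: T] x -> (`|(f_ n x)%:E| <= (EFin \o g) x)%E}.
  apply/ae_foralln => n; apply: filterS (fg n) => x /= h _.
  by rewrite lee_fin.
have fcv' : {ae m, forall x, [set: T] x ->
    (fun n => (f_ n x)%:E) @ \oo --> (EFin \o f) x}.
  by apply: filterS fcv => x h _; apply: cvg_EFin => //; exact: nearW.
have [fi _ cv] := @dominated_convergence _ _ _ m setT measurableT
  (fun n x => (f_ n x)%:E) (EFin \o f) (EFin \o g)
  (fun n => (measurable_EFinP _ _).2 (mf_ n)) ((measurable_EFinP _ _).2 mf)
  fcv' ig fg'.
apply: fine_cvg.
have -> : (fine (\int[m]_x (f x)%:E))%:E = (\int[m]_x (EFin \o f) x)%E.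
  by rewrite fineK//; exact: integrable_fin_num.
exact: cv.
Qed.

End IntegralToolkit.

Section FubiniToolkit.
Context d1 d2 (T1 : measurableType d1) (T2 : measurableType d2) (R : realType).
Variables (m1 : {sigma_finite_measure set T1 -> \bar R})
  (m2 : {sigma_finite_measure set T2 -> \bar R}).
Implicit Types f : T1 * T2 -> R.

(** Both parts are measurable by Tonelli and [fine] is measurable, so sections with divergent
    integral do no harm. Functions of time get their measurability here before any bound on them is
    known. *)
Lemma measurable_Rint f : measurable_fun setT f ->
  measurable_fun setT (fun x => \int[m2]_y f (x, y)).
Proof.
move=> mf; rewrite /Rintegral; apply: (measurableT_comp (fine_measurable measurableT)) => //.
have mEf : measurable_fun setT (EFin \o f) by exact/measurable_EFinP.
rewrite (_ : (fun x => _) = fun x => (\int[m2]_y ((EFin \o f)^\+ (x, y)) -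
    \int[m2]_y ((EFin \o f)^\- (x, y)))%E); last first.
  apply/funext => x; rewrite integralE; congr (_ - _)%E.
    by congr integral; exact: (funepos_comp (EFin \o f) (pair x)).
  by congr integral; exact: (funeneg_comp (EFin \o f) (pair x)).
apply: emeasurable_funB.
  apply: (measurable_fun_fubini_tonelli_F ((EFin \o f)^\+)%E) => //.
  exact: measurable_funepos.
apply: (measurable_fun_fubini_tonelli_F ((EFin \o f)^\-)%E) => //.
exact: measurable_funeneg.
Qed.

(** The real inner integral differs from the extended one only where the section is not integrable,
    which is a null set. *)
Lemma Rfubini1 f : intg (m1 \x m2)%E f ->
  \int[m1]_x (\int[m2]_y f (x, y)) = \int[(m1 \x m2)%E]_z f z.
Proof.
move=> fi; rewrite /Rintegral -(integral12_prod_meas1 fi); congr fine.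
apply: ae_eq_integral => //.
- apply/measurable_EFinP; apply: measurable_Rint; exact: intg_mfun fi.
- exact: measurable_fubini_F fi.
- apply: filterS (ae_integrable1 fi) => x /= ix _.
  by rewrite fineK//; exact: integrable_fin_num.
Qed.

Lemma intg_fubini1 f : intg (m1 \x m2)%E f ->
  intg m1 (fun x => \int[m2]_y f (x, y)).
Proof.
move=> fi; have := integrable_fubini_F fi.
move=> /integrableP[mF Fi]; apply/integrableP; split.
  by apply/measurable_EFinP; apply: measurable_Rint; exact: (intg_mfun fi).
apply: le_lt_trans Fi; apply: ge0_le_integral => //.
- apply/measurable_EFinP; apply: measurableT_comp => //.
  by apply: measurable_Rint; exact: (intg_mfun fi).
- exact: measurableT_comp.
- move=> x _ /=; rewrite /Rintegral /fubini_F /=.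
  by case: (integral _ _ _) => [r| |] //=; rewrite ?normr0 ?leey.
Qed.

Lemma intg_section1 f : intg (m1 \x m2)%E f ->
  {ae m1, forall x, intg m2 (fun y => f (x, y))}.
Proof. by move=> fi; exact: ae_integrable1 fi. Qed.

(** The form in which absolute convergence of double integrals is checked below: [g] dominates the
    L1 norms of the sections. *)
Lemma intg_tonelli1 f g : measurable_fun setT f ->
  {ae m1, forall x, intg m2 (fun y => f (x, y)) /\
     \int[m2]_y `|f (x, y)| <= g x} -> intg m1 g -> intg (m1 \x m2)%E f.
Proof.
move=> mf fg gi; apply/(integrable12ltyP).
  exact/measurable_EFinP.
have mnf : measurable_fun setT (EFin \o (fun x => `|f x|)).
  by apply/measurable_EFinP/measurableT_comp.
apply: (@le_lt_trans _ _ (\int[m1]_x `|(g x)%:E|)%E).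
  apply: ae_ge0_le_integral => //.
  - by move=> x _; exact: integral_ge0.
  - apply: (measurable_fun_fubini_tonelli_F (fun z => `|(EFin \o f) z|%E)) => //.
  - by apply: measurableT_comp => //; apply/measurable_EFinP; exact: intg_mfun gi.
  - apply: filterS fg => x [ix h] _.
    rewrite (_ : (\int[m2]_y `|(EFin \o f) (x, y)|)%E =
      (\int[m2]_y `|f (x, y)|)%:E); last first.
      by rewrite -intg_EFin//; exact: (intg_norm ix).
    by rewrite lee_fin (le_trans h)// ler_norm.
by case/integrableP: gi.
Qed.

End FubiniToolkit.

Section FubiniSwap.
Context d1 d2 (T1 : measurableType d1) (T2 : measurableType d2) (R : realType).
Variables (m1 : {sigma_finite_measure set T1 -> \bar R})
  (m2 : {sigma_finite_measure set T2 -> \bar R}).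
Implicit Types f : T1 * T2 -> R.

Lemma intg_swap f : intg (m1 \x m2)%E f -> intg (m2 \x m1)%E (fun z => f (z.2, z.1)).
Proof.
move=> fi; apply/integrable12ltyP.
  apply/measurable_EFinP; apply: measurableT_comp (intg_mfun fi) _.
  exact: measurable_fun_pair.
by have /integrable21ltyP := fi; apply; exact: (measurable_int _ fi).
Qed.

Lemma Rfubini2 f : intg (m1 \x m2)%E f ->
  \int[m2]_y (\int[m1]_x f (x, y)) = \int[(m1 \x m2)%E]_z f z.
Proof.
move=> fi; rewrite /Rintegral -(integral21_prod_meas1 fi); congr fine.
apply: ae_eq_integral => //.
- apply/measurable_EFinP; exact: (measurable_Rint m1 (intg_mfun (intg_swap fi))).
- exact: measurable_fubini_G fi.
- apply: filterS (ae_integrable2 fi) => x /= ix _.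
  by rewrite fineK//; exact: integrable_fin_num.
Qed.

Lemma Rfubini f : intg (m1 \x m2)%E f ->
  \int[m1]_x (\int[m2]_y f (x, y)) = \int[m2]_y (\int[m1]_x f (x, y)).
Proof. by move=> fi; rewrite Rfubini1// Rfubini2. Qed.

Lemma intg_fubini2 f : intg (m1 \x m2)%E f ->
  intg m2 (fun y => \int[m1]_x f (x, y)).
Proof. by move=> /intg_swap /intg_fubini1. Qed.

Lemma intg_section2 f : intg (m1 \x m2)%E f ->
  {ae m2, forall y, intg m1 (fun x => f (x, y))}.
Proof. by move=> fi; exact: ae_integrable2 fi. Qed.

End FubiniSwap.

Section FubiniSwap2.
Context d1 d2 (T1 : measurableType d1) (T2 : measurableType d2) (R : realType).
Variables (m1 : {sigma_finite_measure set T1 -> \bar R})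
  (m2 : {sigma_finite_measure set T2 -> \bar R}).

Lemma intg_tonelli2 (f : T1 * T2 -> R) g : measurable_fun setT f ->
  {ae m2, forall y, intg m1 (fun x => f (x, y)) /\
     \int[m1]_x `|f (x, y)| <= g y} -> intg m2 g -> intg (m1 \x m2)%E f.
Proof.
move=> mf fg gi; have := @intg_tonelli1 _ _ _ _ _ m2 m1 (fun z => f (z.2, z.1)) g.
move=> /(_ (measurableT_comp mf (measurable_fun_pair measurable_snd measurable_fst)) fg gi) /intg_swap.
by apply: intg_ext => -[].
Qed.

Lemma intg_prod (f : T1 -> R) (g : T2 -> R) : intg m1 f -> intg m2 g ->
  intg (m1 \x m2)%E (fun z => f z.1 * g z.2).
Proof.
move=> fi gi; apply: (@intg_tonelli1 _ _ _ _ _ m1 m2 _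
    (fun x => (\int[m2]_y `|g y|) * `|f x|)).
- apply: measurable_funM.
  + by apply: measurableT_comp (intg_mfun fi) _; exact: measurable_fst.
  + by apply: measurableT_comp (intg_mfun gi) _; exact: measurable_snd.
- apply: aeW => x; split; first exact: (@intgZ _ _ _ m2 (f x) g gi).
  under Rint_ext do rewrite normrM.
  by rewrite (@RintZ _ _ _ m2 `|f x| (fun y => `|g y|)) ?intg_norm// mulrC.
- exact/intgZ/intg_norm.
Qed.

End FubiniSwap2.

Lemma continuous_pairl (T U : topologicalType) (y : U) :
  continuous (fun x : T => (x, y)).
Proof. by move=> x; apply: cvg_pair; [exact: cvg_id|exact: cvg_cst]. Qed.

Lemma continuous_pairr (T U : topologicalType) (x : T) :
  continuous (fun y : U => (x, y)).
Proof. by move=> y; apply: cvg_pair; [exact: cvg_cst|exact: cvg_id]. Qed.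

(** * Measurability of continuous functions of several variables *)

Section Caratheodory.
Variable R : realType.

Lemma cvg_floor_grid (x : R) :
  (Num.floor (n.+1%:R * x))%:~R / n.+1%:R @[n --> \oo] --> x.
Proof.
apply/cvgrPdist_le => e e0.
near=> n.
have n0 : (0 : R) < n.+1%:R by rewrite ltr0n.
have /andP[h1 h2] := floor_itv (n.+1%:R * x).
rewrite ger0_norm ?subr_ge0 ?ler_pdivrMr//; last by rewrite (mulrC x).
rewrite -(ler_pM2l n0) mulrBr mulrCA divff ?lt0r_neq0// mulr1.
rewrite intrD in h2.
apply: (@le_trans _ _ 1); first by move: h2; lra.
rewrite -ler_pdivrMl// mulr1; near: n.
have [N _ hN] := near_infty_natSinv_lt (PosNum e0).
by exists N => // k /hN /ltW.
Unshelve. all: end_near. Qed.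

(* Borel sets of a product are not identified with the product sigma-algebra in
   the library: this is how continuous functions of several variables are seen to
   be measurable. *)
Lemma caratheodory_measurable d (Y : measurableType d)
    (f : measurableTypeR R * Y -> R) :
  (forall y, continuous (fun x : R => f (x, y))) ->
  (forall x, measurable_fun setT (fun y => f (x, y))) ->
  measurable_fun setT f.
Proof.
move=> cf mf.
pose r (n : nat) (x : R) : R := (Num.floor (n.+1%:R * x))%:~R / n.+1%:R.
apply: (@measurable_fun_cvg _ _ _ setT (fun n z => f (r n z.1, z.2))) => //.
- move=> n _ B mB; rewrite setTI.
  (* The approximation [r n] takes countably many values k / (n + 1), each on a half-open interval,
     so the preimage is a countable union of strips. *)
  rewrite (_ : _ @^-1` B = \bigcup_(k : int)
      ([set x | Num.floor (n.+1%:R * x) = k] `*`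
       ((fun y => f (k%:~R / n.+1%:R, y)) @^-1` B))); last first.
    apply/seteqP; split => -[x y] /=.
      by move=> h; exists (Num.floor (n.+1%:R * x)).
    by move=> [k _ [/= <-]].
  apply: countable_bigcupT_measurable => // k; apply: measurableX; last first.
    by rewrite -[X in measurable X]setTI; exact: mf.
  rewrite (_ : [set _ | _] = [set` `[k%:~R / n.+1%:R, (k + 1)%:~R / n.+1%:R[]).
    exact: measurable_itv.
  apply/seteqP; split => x /=; rewrite in_itv/=.
    by move=> /eqP; rewrite floor_eq ler_pdivrMr// ltr_pdivlMr// (mulrC x).
  by rewrite ler_pdivrMr// ltr_pdivlMr// (mulrC x) -floor_eq => /eqP.
- move=> [x y] _ /=.
  apply: (@continuous_cvg _ _ _ _ _ (fun n => r n x) (fun x => f (x, y))).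
    exact: cf.
  exact: cvg_floor_grid.
Qed.

Lemma continuous_measurable2 (f : R * R -> R) : continuous f ->
  measurable_fun (setT : set (measurableTypeR R * measurableTypeR R)%type) f.
Proof.
move=> cf; apply: caratheodory_measurable => [y|x].
  move=> x; apply: (@continuous_comp _ _ _ (fun x => (x, y)) f); last exact: cf.
  exact: (@continuous_pairl R R).
apply: continuous_measurable_fun.
move=> y; apply: (@continuous_comp _ _ _ (fun y => (x, y)) f); last exact: cf.
exact: (@continuous_pairr R R).
Qed.

Lemma continuous_measurable3 (f : R * (R * R) -> R) : continuous f ->
  measurable_fun (setT : set (measurableTypeR R *
    (measurableTypeR R * measurableTypeR R))%type) f.
Proof.
move=> cf; apply: caratheodory_measurable => [y|x].
  move=> x; apply: (@continuous_comp _ _ _ (fun x => (x, y)) f); last exact: cf.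
  exact: (@continuous_pairl R (R * R)%type).
apply: continuous_measurable2.
move=> y; apply: (@continuous_comp _ _ _ (fun y => (x, y)) f); last exact: cf.
exact: (@continuous_pairr R (R * R)%type).
Qed.

End Caratheodory.

(** * Affine changes of variables *)

Section AffineChange.
Variable R : realType.
Local Notation mu := (leb R).
Local Open Scope ereal_scope.

Lemma measurable_affine (a c : R) :
  measurable_fun (setT : set (measurableTypeR R))
    ((fun x => c + a * x)%R : _ -> measurableTypeR R).
Proof. by apply: measurable_funD => //; exact: measurable_funM. Qed.

(** The right-hand side is a measure, and Lebesgue measure is determined by its values on half-open
    intervals. *)
Lemma lebesgue_measure_affine (a c : R) (A : set R) : (0 < a)%R ->
  measurable A ->
  mu A = a%:E * pushforward mu ((fun x => c + a * x)%R : _ -> measurableTypeR R) A.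
Proof.
move=> a0 mA.
pose m0 := [the measure _ _ of pushforward mu
  ((fun x => c + a * x)%R : _ -> measurableTypeR R)].
pose m := mscale (NngNum (ltW a0)) (m0 (measurable_affine a c)).
suff : mu A = m A by [].
apply: lebesgue_measure_unique => //= _ [[x y]] _ <-.
rewrite /m /mscale /= /pushforward.
rewrite (_ : _ @^-1` _ = `]((x - c) / a)%R, ((y - c) / a)%R]%classic).
  rewrite !lebesgue_measure_itv/= !lte_fin ltr_pM2r ?invr_gt0// ltrD2r.
  case: ifPn => _; last by rewrite mule0.
  rewrite -!EFinD -EFinM; congr (_%:E).
  by field; exact: lt0r_neq0.
apply/seteqP; split => z /=; rewrite !in_itv/= ltr_pdivrMr// ler_pdivlMr//.
  by rewrite ltrBlDl lerBrDl (mulrC z).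
by rewrite ltrBlDl lerBrDl (mulrC z).
Qed.

Lemma ge0_integral_affine (a c : R) (f : R -> \bar R) : (a != 0)%R ->
  measurable_fun setT f -> (forall x, 0 <= f x) ->
  \int[mu]_x f x = (`|a|%R)%:E * \int[mu]_x f (c + a * x)%R.
Proof.
(* A negative slope is reduced to a positive one by the reflection x -> - x, which preserves
   Lebesgue measure. *)
wlog a0 : a f / (0 < a)%R.
  move=> h aN0 mf f0.
  have [|aneg] := ltP 0%R a; first by move=> a0; exact: h.
  have {}aneg : (a < 0)%R by rewrite lt_neqAle aN0.
  rewrite (h (- a)%R f)//= ?oppr_gt0 ?oppr_eq0// normrN; congr (_ * _).
  transitivity (\int[mu]_(x in (-%R : R -> R) @^-1` setT)
      ((fun x => f (c + a * x)%R) \o -%R) x).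
    by rewrite preimage_setT; apply: eq_integral => x _ /=; rewrite mulrN mulNr.
  have mN : measurable_fun setT (-%R : measurableTypeR R -> measurableTypeR R).
    exact: oppr_measurable.
  rewrite -[LHS](@ge0_integral_pushforward _ _ _ _ _ _ mN mu setT
      (fun x => f (c + a * x)%R))//=; last first.
    by apply: measurableT_comp => //; exact: measurable_affine.
  by apply: eq_measure_integral => //= A mA _; exact: lebesgue_measureN.
move=> _ mf f0.
rewrite gtr0_norm//.
pose m0 := [the measure _ _ of pushforward mu
  ((fun x => c + a * x)%R : _ -> measurableTypeR R)].
pose m := mscale (NngNum (ltW a0)) (m0 (measurable_affine a c)).
transitivity (\int[m]_x f x).
  apply: eq_measure_integral => //= A mA _; exact: lebesgue_measure_affine.
rewrite ge0_integral_mscale//=; congr (_ * _).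
exact: (@ge0_integral_pushforward _ _ _ _ _ _ (measurable_affine a c) mu setT f).
Qed.

End AffineChange.

Section Leb2.
Variable R : realType.
Local Notation R2 := (measurableTypeR R * measurableTypeR R)%type.
Implicit Types f : R * R -> R.

Lemma leb2_tonelli (f : R * R -> \bar R) :
  measurable_fun (setT : set R2) f -> (forall x, 0 <= f x)%E ->
  (\int[leb2 R]_x f x = \int[leb R]_a \int[leb R]_b f (a, b))%E.
Proof. by move=> mf f0; apply: fubini_tonelli1. Qed.

Lemma measurable_translate2 (c : R * R) :
  measurable_fun (setT : set R2) ((fun x => c + x) : R2 -> R2).
Proof.
apply: (@measurable_fun_pair _ _ _ _ _ _ (fun x : R2 => c.1 + x.1)
    (fun x : R2 => c.2 + x.2)).
  by apply: measurable_funD => //; exact: measurable_fst.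
by apply: measurable_funD => //; exact: measurable_snd.
Qed.

Lemma measurable_opp2 :
  measurable_fun (setT : set R2) ((fun x : R * R => - x) : R2 -> R2).
Proof.
apply: (@measurable_fun_pair _ _ _ _ _ _ (fun x : R2 => - x.1)
    (fun x : R2 => - x.2)).
  by apply: measurable_funN; exact: measurable_fst.
by apply: measurable_funN; exact: measurable_snd.
Qed.

Lemma ge0_integral_leb2_translate (c : R * R) (f : R * R -> \bar R) :
  measurable_fun (setT : set R2) f -> (forall x, 0 <= f x)%E ->
  (\int[leb2 R]_x f x = \int[leb2 R]_x f (c + x)%R)%E.
Proof.
move=> mf f0.
have mfc : measurable_fun (setT : set R2) (fun x => f (c + x)).
  by apply: measurableT_comp => //; exact: measurable_translate2.
rewrite (leb2_tonelli mf f0) (leb2_tonelli mfc (fun x => f0 _)).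
rewrite (@ge0_integral_affine R 1 c.1)//; last 2 first.
- exact: (@measurable_fun_fubini_tonelli_F _ _ _ _ _ (leb R) f mf f0).
- by move=> x; exact: integral_ge0.
rewrite normr1 mul1e; apply: eq_integral => x _; rewrite mul1r.
rewrite (@ge0_integral_affine R 1 c.2)//; last first.
  exact: measurableT_comp.
by rewrite normr1 mul1e; apply: eq_integral => y _; rewrite mul1r.
Qed.

Lemma ge0_integral_leb2_opp (f : R * R -> \bar R) :
  measurable_fun (setT : set R2) f -> (forall x, 0 <= f x)%E ->
  (\int[leb2 R]_x f x = \int[leb2 R]_x f (- x)%R)%E.
Proof.
move=> mf f0.
have mfc : measurable_fun (setT : set R2) (fun x : R * R => f (- x)).
  by apply: measurableT_comp => //; exact: measurable_opp2.
rewrite (leb2_tonelli mf f0) (leb2_tonelli mfc (fun x => f0 _)).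
rewrite (@ge0_integral_affine R (-1) 0)// ?oppr_eq0 ?oner_eq0//; last 2 first.
- exact: (@measurable_fun_fubini_tonelli_F _ _ _ _ _ (leb R) f mf f0).
- by move=> x; exact: integral_ge0.
rewrite normrN1 mul1e; apply: eq_integral => x _; rewrite mulN1r add0r.
rewrite (@ge0_integral_affine R (-1) 0)// ?oppr_eq0 ?oner_eq0//; last first.
  exact: measurableT_comp.
by rewrite normrN1 mul1e; apply: eq_integral => y _; rewrite mulN1r add0r.
Qed.

(** A change of variables for nonnegative functions is applied to the positive and negative parts
    for the integral, and to the absolute value for integrability. *)
Lemma ge0_change_Rint d (T : measurableType d) (mu : {measure set T -> \bar R})
    (h : T -> T) (f : T -> R) :
  measurable_fun setT h ->
  (forall f : T -> \bar R, measurable_fun setT f -> (forall x, 0 <= f x)%E ->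
    (\int[mu]_x f x = \int[mu]_x f (h x))%E) ->
  measurable_fun setT f ->
  \int[mu]_x f x = \int[mu]_x f (h x) /\ (intg mu f -> intg mu (fun x => f (h x))).
Proof.
move=> mh H mf; have mEf : measurable_fun setT (EFin \o f) by exact/measurable_EFinP.
split.
  rewrite /Rintegral [in LHS]integralE [in RHS]integralE.
  rewrite (H (EFin \o f)^\+%E)//; last exact: measurable_funepos.
  rewrite (H (EFin \o f)^\-%E)//; last exact: measurable_funeneg.
  congr (fine (_ - _)%E).
    by congr integral; exact/esym/(funepos_comp (EFin \o f) h).
  by congr integral; exact/esym/(funeneg_comp (EFin \o f) h).
move=> /integrableP[_ fi]; apply/integrableP; split.
  by apply/measurable_EFinP; exact: measurableT_comp.
by move: fi; rewrite (H (fun x => `|(f x)%:E|%E))//; exact: measurableT_comp.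
Qed.

Lemma Rint_translate c f : measurable_fun (setT : set R2) f ->
  \int[leb2 R]_x f x = \int[leb2 R]_x f (c + x).
Proof.
by move=> mf; apply: (ge0_change_Rint (measurable_translate2 c)
  (@ge0_integral_leb2_translate c) mf).1.
Qed.

Lemma intg_translate c f : intg (leb2 R) f -> intg (leb2 R) (fun x => f (c + x)).
Proof.
by move=> fi; apply: (ge0_change_Rint (measurable_translate2 c)
  (@ge0_integral_leb2_translate c) (intg_mfun fi)).2.
Qed.

Lemma Rint_opp f : measurable_fun (setT : set R2) f ->
  \int[leb2 R]_x f x = \int[leb2 R]_x f (- x).
Proof.
by move=> mf; apply: (ge0_change_Rint measurable_opp2
  ge0_integral_leb2_opp mf).1.
Qed.

Lemma intg_opp f : intg (leb2 R) f -> intg (leb2 R) (fun x => f (- x)).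
Proof.
by move=> fi; apply: (ge0_change_Rint measurable_opp2
  ge0_integral_leb2_opp (intg_mfun fi)).2.
Qed.

Lemma Rint_reflect c f : measurable_fun (setT : set R2) f ->
  \int[leb2 R]_x f x = \int[leb2 R]_x f (c - x).
Proof.
move=> mf; rewrite (Rint_translate c)//.
by rewrite Rint_opp//; apply: measurableT_comp mf (measurable_translate2 c).
Qed.

Lemma intg_reflect c f : intg (leb2 R) f -> intg (leb2 R) (fun x => f (c - x)).
Proof. by move=> /(intg_translate c)/intg_opp. Qed.

End Leb2.

(** * Directional derivatives and compact supports *)

Section CompactSupport.
Variable R : realType.

Lemma compact_square (L : R) : compact [set x : R * R | `|x| <= L].
Proof.
have -> : [set x : R * R | `|x| <= L] = `[- L, L] `*` `[- L, L].
  apply/seteqP; split => -[a b] /=; rewrite prod_normE ge_max/= !ler_norml !in_itv/=.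
    by move=> /andP[].
  by move=> [-> ->].
by apply: compact_setX; exact: segment_compact.
Qed.

Lemma compact_cube (L M : R) :
  compact [set p : R * (R * R) | `|p.1| <= M /\ `|p.2| <= L].
Proof.
have -> : [set p : R * (R * R) | `|p.1| <= M /\ `|p.2| <= L] =
    `[- M, M] `*` [set x : R * R | `|x| <= L].
  by apply/seteqP; split => -[a b] /=; rewrite ler_norml in_itv.
by apply: compact_setX; [exact: segment_compact|exact: compact_square].
Qed.

(** Uniform continuity on the compact K, with one of the two points allowed outside it; the case of
    both points outside is trivial as f vanishes there. *)
Lemma csupp_uniform (V : normedModType R) (K : set V) (f : V -> R) :
  compact K -> continuous f -> (forall x, ~ K x -> f x = 0) ->
  forall e, 0 < e -> exists2 d, 0 < d &
    forall x y, `|x - y| < d -> `|f x - f y| < e.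
Proof.
move=> /compact_near_coveringP cK cf f0 e e0.
have e20 : 0 < e / 2 by rewrite divr_gt0.
have [d /= d0 hd] : \forall d \near 0^'+,
    K `<=` (fun x => forall y, `|x - y| < d -> `|f x - f y| < e).
  apply: cK => x Kx.
  have /cvgrPdist_lt /(_ _ e20) /nbhs_normP[r /= r0 hr] := cf x.
  exists (ball x (r / 2), [set d | d < r / 2]) => /=.
    split; first by apply: nbhsx_ballx; rewrite divr_gt0.
    by apply: nbhs_right_lt; rewrite divr_gt0.
  move=> [x' d] /= []; rewrite -ball_normE /= => xx' dr y x'y.
  have h1 : `|f x - f x'| < e / 2 by apply: hr => /=; lra.
  have h2 : `|f x - f y| < e / 2.
    apply: hr => /=; rewrite -(subrK x' x) -addrA.
    by apply: le_lt_trans (ler_normD _ _) _; lra.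
  rewrite -(subrK (f x) (f x')) -addrA (le_lt_trans (ler_normD _ _))//.
  by rewrite (distrC (f x')); lra.
have {}hd x y : K x -> `|x - y| < d / 2 -> `|f x - f y| < e.
  move=> Kx xy; apply: (hd (d / 2)) => //=; last by rewrite divr_gt0.
  by rewrite sub0r normrN gtr0_norm ?divr_gt0// ltr_pdivrMr// ltr_pMr// ltr1n.
exists (d / 2); first by rewrite divr_gt0.
move=> x y xy; have [Kx|nKx] := pselect (K x); first exact: hd.
have [Ky|nKy] := pselect (K y); first by rewrite distrC; apply: hd; rewrite // distrC.
by rewrite !f0// subrr normr0.
Qed.

Lemma csupp_bounded (V : normedModType R) (K : set V) (f : V -> R) :
  compact K -> continuous f -> (forall x, ~ K x -> f x = 0) ->
  exists2 C, 0 <= C & forall x, `|f x| <= C.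
Proof.
move=> cK cf f0.
have [K0|K0] := pselect (K !=set0); last first.
  by exists 0 => // x; rewrite f0 ?normr0// => Kx; apply: K0; exists x.
have [|c _ hc] := @compact_EVT_max _ _ (fun x => `|f x|) K K0 cK.
  by apply: continuous_subspaceT => x; apply: cvg_norm; exact: cf.
exists `|f c| => // x; have [Kx|nKx] := pselect (K x).
  by apply: hc; rewrite inE.
by rewrite f0// normr0.
Qed.

End CompactSupport.

Section Directional.
Variable R : realType.

Lemma near_norm (V : normedModType R) (p : V) (P : set V) : nbhs p P ->
  exists2 r, 0 < r & forall q, `|p - q| < r -> P q.
Proof. by move=> /nbhs_normP[r /= r0 h]; exists r. Qed.

Lemma is_deriveE (V W : normedModType R) (f : V -> W) (p u : V) (d : W) :
  is_derive p u f d <->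
  (fun h : R => h^-1 *: (f (h *: u + p) - f p)) @ 0^' --> d.
Proof.
split=> [[ex <-]|h]; first exact: ex.
split; first by apply/cvg_ex; exists d.
exact: cvg_lim.
Qed.

(** Turns directional derivatives into ordinary ones, so that the chain rule and the mean value
    theorem in one variable apply. *)
Lemma is_derive_line (V : normedModType R) (f : V -> R) (p u : V) (r d : R) :
  is_derive (r *: u + p) u f d <-> is_derive r (1 : R) (fun s => f (s *: u + p)) d.
Proof.
rewrite !is_deriveE.
suff -> : (fun h : R => h^-1 *: (f (h *: u + (r *: u + p)) - f (r *: u + p))) =
  (fun h : R => h^-1 *: (f ((h *: (1 : R) + r) *: u + p) - f (r *: u + p))) by [].
by apply/funext => h; rewrite addrA -scalerDl [h *: 1]mulr1.
Qed.

Lemma is_derive_lin0 (V : normedModType R) (f : V -> R) (p u : V) (d : R) :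
  is_derive p u f d <-> is_derive (0 : R) (1 : R) (fun s => f (s *: u + p)) d.
Proof. by rewrite -is_derive_line scale0r add0r. Qed.

Lemma dirZ (V : normedModType R) (f : V -> R) (p u : V) (c d : R) :
  is_derive p u f d -> is_derive p (c *: u) f (c * d).
Proof.
move=> /is_derive_lin0 h; apply/is_derive_lin0.
have -> : (fun s : R => f (s *: (c *: u) + p)) =
    (fun s => f (s *: u + p)) \o (fun s => s * c).
  by apply/funext => s /=; rewrite scalerA.
rewrite mulrC; apply: is_derive1_comp; first by rewrite mul0r.
have := is_deriveZ c (is_derive_id (0 : R) (1 : R)).
rewrite [c *: _]mulr1 (_ : (c \*: id) = (fun s : R => s * c))//.
by apply/funext => s /=; rewrite mulrC.
Qed.

Lemma MVT_dir (V : normedModType R) (f : V -> R) (p w : V) (G : R -> R) :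
  (forall r, 0 <= r <= 1 -> is_derive (r *: w + p) w f (G r)) ->
  exists2 r, 0 <= r <= 1 & f (w + p) - f p = G r.
Proof.
move=> h.
have h' (r : R) : r \in `[0, 1] -> is_derive r 1 (fun s => f (s *: w + p)) (G r).
  by rewrite in_itv/= => /h /is_derive_line.
have h1 (r : R) : r \in `]0, 1[ -> is_derive r 1 (fun s => f (s *: w + p)) (G r).
  by move=> r01; apply: h'; apply: subset_itv_oo_cc.
have h2 : {within `[0, 1], continuous (fun s : R => f (s *: w + p))}.
  apply: derivable_within_continuous => x x01.
  by have [] := h' x x01.
have [r r01 E] := @MVT_segment R (fun s : R => f (s *: w + p)) G 0 1 ler01 h1 h2.
by exists r; [rewrite in_itv/= in r01|move: E; rewrite scale1r scale0r add0r subr0 mulr1].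
Qed.

(** The increment along u + v is taken first along v, then along u; on the second leg the mean value
    theorem produces [g] at a point close to p, which is why [g] has to be continuous. *)
Lemma dirD (V : normedModType R) (f g : V -> R) (p u v : V) (d : R) :
  (\forall q \near p, is_derive q u f (g q)) -> {for p, continuous g} ->
  is_derive p v f d -> is_derive p (u + v) f (g p + d).
Proof.
move=> fu cg /is_deriveE fv; apply/is_deriveE.
have -> : (fun h : R => h^-1 *: (f (h *: (u + v) + p) - f p)) =
    (fun h : R => h^-1 *: (f (h *: u + (h *: v + p)) - f (h *: v + p)) +
                  h^-1 *: (f (h *: v + p) - f p)).
  apply/funext => h; rewrite -scalerDr; congr (_ *: _).
  by rewrite addrA subrK scalerDr addrA.
apply: cvgD => //; apply/cvgrPdist_le => e e0.
have /cvgrPdist_le /(_ _ e0) cge := cg.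
have [r r0 hr] := near_norm (filterI fu cge).
pose M := `|u| + `|v| + 1.
have M0 : 0 < M by rewrite ltr_wpDl// addr_ge0.
near=> h.
have hn0 : h != 0 by near: h; exact: nbhs_dnbhs_neq.
have hs : `|h| * M < r.
  rewrite -ltr_pdivlMr//; near: h.
  have := @dnbhs0_lt R R (r / M); apply.
  by rewrite divr_gt0.
have inb s : 0 <= s <= 1 -> `|p - (s *: (h *: u) + (h *: v + p))| < r.
  move=> /andP[s0 s1]; rewrite addrA opprD addrCA subrr addr0 normrN.
  apply: le_lt_trans hs; apply: (le_trans (ler_normD _ _)); rewrite !normrZ.
  rewrite ger0_norm// /M !mulrDr mulr1.
  rewrite -[leRHS]addrA lerD ?ler_piMl ?mulr_ge0// lerDl.
  by rewrite normr_ge0.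
have [|s s01 ->] := @MVT_dir _ f (h *: v + p) (h *: u)
    (fun s => h * g (s *: (h *: u) + (h *: v + p))).
  by move=> s s01; apply: dirZ; have [] := hr _ (inb s s01).
rewrite [_ *: _]mulrA mulVf// mul1r.
by have [] := hr _ (inb s s01).
Unshelve. all: end_near. Qed.

(** The mixed second difference of f with step h equals h^2 times [a] at one point near p and h^2
    times [b] at another; continuity of both at p concludes. *)
Lemma schwarz_dir (V : normedModType R) (f fu fv a b : V -> R) (p u v : V) :
  (\forall q \near p, is_derive q u f (fu q)) ->
  (\forall q \near p, is_derive q v f (fv q)) ->
  (\forall q \near p, is_derive q v fu (a q)) ->
  (\forall q \near p, is_derive q u fv (b q)) ->
  {for p, continuous a} -> {for p, continuous b} -> a p = b p.
Proof.
move=> fu_ fv_ a_ b_ ca cb; apply/eqP; rewrite -subr_eq0 -normr_le0.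
apply/ler_addgt0Pr => e e0; rewrite add0r.
have e20 : 0 < e / 2 by rewrite divr_gt0.
have /cvgrPdist_le /(_ _ e20) cae := ca.
have /cvgrPdist_le /(_ _ e20) cbe := cb.
have [r r0 hr] := near_norm (filterI (filterI (filterI fu_ fv_) (filterI a_ b_))
  (filterI cae cbe)).
pose M := `|u| + `|v| + 1.
have M0 : 0 < M by rewrite ltr_wpDl// addr_ge0.
have [h h0 hMr] : exists2 h, 0 < h & h * M < r.
  exists (r / M / 2); first by rewrite !divr_gt0.
  by rewrite mulrAC mulfVK ?lt0r_neq0// ltr_pdivrMr// ltr_pMr// ltr1n.
have inb s t : 0 <= s <= 1 -> 0 <= t <= 1 ->
    `|p - (s *: (h *: u) + (t *: (h *: v) + p))| < r.
  move=> /andP[s0 s1] /andP[t0 t1]; rewrite addrA opprD addrCA subrr addr0 normrN.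
  apply: le_lt_trans hMr.
  apply: (le_trans (ler_normD _ _)); rewrite !normrZ.
  rewrite (ger0_norm s0) (ger0_norm t0) (gtr0_norm h0) /M !mulrDr mulr1.
  rewrite -[leRHS]addrA lerD ?ler_piMl ?mulr_ge0 ?(ltW h0)//.
  by rewrite ler_wpDr ?(ltW h0)// ler_piMl ?mulr_ge0 ?(ltW h0).
have o1 : 0 <= (1 : R) <= 1 by rewrite ler01 lexx.
have o0 : 0 <= (0 : R) <= 1 by rewrite ler01 lexx.
(* The second difference is evaluated by the mean value theorem in U1, then in V1; this is used for
   both orders of u and v. *)
have key (U1 V1 : V) (f1 a1 : V -> R) :
    (forall s t, 0 <= s <= 1 -> 0 <= t <= 1 ->
      is_derive (s *: (h *: U1) + (t *: (h *: V1) + p)) U1 f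
        (f1 (s *: (h *: U1) + (t *: (h *: V1) + p))) /\
      is_derive (s *: (h *: U1) + (t *: (h *: V1) + p)) V1 f1
        (a1 (s *: (h *: U1) + (t *: (h *: V1) + p)))) ->
    exists s t, [/\ 0 <= s <= 1, 0 <= t <= 1 &
      f (h *: U1 + (h *: V1 + p)) - f (h *: V1 + p) - (f (h *: U1 + p) - f p) =
      h * (h * a1 (s *: (h *: U1) + (t *: (h *: V1) + p)))].
  move=> H.
  have [|s s01 Es] := @MVT_dir _ (fun q => f (h *: V1 + q) - f q) p (h *: U1)
    (fun s => h * f1 (h *: V1 + (s *: (h *: U1) + p)) - h * f1 (s *: (h *: U1) + p)).
    move=> s s01; rewrite -mulrBr; apply: dirZ; apply: is_deriveB.
      have [+ _] := H s 1 s01 o1; rewrite scale1r => /is_derive_lin0 hh.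
      apply/is_derive_lin0; rewrite addrCA.
      by under eq_fun do rewrite addrCA (addrCA (h *: V1)).
    by have [+ _] := H s 0 s01 o0; rewrite scale0r add0r.
  have [|t t01 Et] := @MVT_dir _ f1 (s *: (h *: U1) + p) (h *: V1)
    (fun t => h * a1 (s *: (h *: U1) + (t *: (h *: V1) + p))).
    move=> t t01; apply: dirZ; have [_] := H s t s01 t01.
    by rewrite (addrCA (t *: _)).
  exists s, t; split => //.
  by rewrite -Et mulrBr -Es (addrCA (h *: U1)); ring.
have [|s [t [s01 t01 E1]]] := key u v fu a.
  move=> s t s01 t01; have [[[F1 _] [A1 _]] _] := hr _ (inb s t s01 t01).
  split; [exact: F1|exact: A1].
have [|s' [t' [s01' t01' E2]]] := key v u fv b.
  move=> s' t' s01' t01'; have := hr _ (inb t' s' t01' s01').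
  by rewrite addrCA => -[[[_ F1] [_ A1]] _]; split; [exact: F1|exact: A1].
have EE : a (s *: (h *: u) + (t *: (h *: v) + p)) =
    b (s' *: (h *: v) + (t' *: (h *: u) + p)).
  apply: (mulfI (lt0r_neq0 h0)); apply: (mulfI (lt0r_neq0 h0)).
  by rewrite -E1 -E2 (addrCA (h *: u)); ring.
have [_ [Ha _]] := hr _ (inb s t s01 t01).
have [_ [_ +]] := hr _ (inb t' s' t01' s01'); rewrite addrCA => Hbar.
rewrite -(subrK (a (s *: (h *: u) + (t *: (h *: v) + p))) (a p)) -addrA.
rewrite {2}EE; apply: le_trans (ler_normD _ _) _.
by rewrite (distrC _ (b p)); lra.
Qed.

Lemma is_derive_pair (V : normedModType R) (f g : V -> R) (p u : V) (a b : R) :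
  is_derive p u f a -> is_derive p u g b ->
  is_derive p u (fun x => (f x, g x)) ((a, b) : R * R).
Proof.
move=> /is_deriveE fa /is_deriveE gb; apply/is_deriveE.
exact: (cvg_pair fa gb).
Qed.

Lemma is_derive_fst (V : normedModType R) (f : V -> R * R) (p u : V) (d : R * R) :
  is_derive p u f d -> is_derive p u (fun x => (f x).1) d.1.
Proof.
move=> /is_deriveE fd; apply/is_deriveE.
exact: (cvg_comp _ fst fd cvg_fst).
Qed.

Lemma is_derive_snd (V : normedModType R) (f : V -> R * R) (p u : V) (d : R * R) :
  is_derive p u f d -> is_derive p u (fun x => (f x).2) d.2.
Proof.
move=> /is_deriveE fd; apply/is_deriveE.
exact: (cvg_comp _ snd fd cvg_snd).
Qed.

End Directional.

Lemma near_all (R : realType) (V : normedModType R) (p : V) (P : V -> Prop) :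
  (forall q, P q) -> \forall q \near p, P q.
Proof. by move=> h; apply: nearW. Qed.

(** * The fundamental theorem of calculus on the line *)

Section FTCLine.
Variable R : realType.
Implicit Types F f : R -> R.

Lemma FTC_itv F f a b : a < b -> continuous f ->
  (forall x, is_derive x (1 : R) F (f x)) ->
  \int[leb R]_(x in `[a, b]) f x = F b - F a.
Proof.
move=> ab cf dF; rewrite /Rintegral (@continuous_FTC2 _ f F a b)//.
- exact: continuous_subspaceT.
- split.
  + by move=> x _; have [] := dF x.
  + apply: cvg_at_right_filter.
    by apply: differentiable_continuous; apply/derivable1_diffP; have [] := dF a.
  + apply: cvg_at_left_filter.
    by apply: differentiable_continuous; apply/derivable1_diffP; have [] := dF b.
- by move=> x _; rewrite derive1E; have [_ ->] := dF x.
Qed.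

Lemma intg_itv f a b : continuous f -> intg (leb R) (f \_ `[a, b]).
Proof.
move=> cf; apply/intg_restrict => //.
apply: continuous_compact_integrable; first exact: segment_compact.
exact: continuous_subspaceT.
Qed.

Lemma FTC_csupp F f L : continuous f ->
  (forall x, is_derive x (1 : R) F (f x)) ->
  (forall x, L < `|x| -> F x = 0) -> (forall x, L < `|x| -> f x = 0) ->
  \int[leb R]_x f x = 0.
Proof.
move=> cf dF F0 f0; pose M := `|L| + 1.
have LM : L < M by rewrite /M (le_lt_trans (ler_norm _))// ltrDl.
have M0 : 0 < M by rewrite /M ltr_wpDl.
transitivity (\int[leb R]_(x in `[- M, M]) f x).
  rewrite [RHS]Rint_restrict; apply: Rint_ext => x; rewrite patchE.
  case: ifPn => //; rewrite notin_setE /= in_itv /= -ler_norml => /negP.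
  by rewrite -ltNge => h; apply: f0; exact: lt_trans LM h.
rewrite (FTC_itv _ cf dF); last by rewrite gtrN.
by rewrite !F0 ?subrr// ?normrN gtr0_norm.
Qed.

(** Each half-line contributes [- F 0]. This is where the point evaluation in [Rint_radial], the
    Dirac mass of curl K, originates. *)
Lemma FTC_sign F f L : continuous f ->
  (forall x, is_derive x (1 : R) F (f x)) ->
  (forall x, L < `|x| -> F x = 0) -> (forall x, L < `|x| -> f x = 0) ->
  \int[leb R]_x (Num.sg x * f x) = - 2 * F 0.
Proof.
move=> cf dF F0 f0; pose M := `|L| + 1.
have LM : L < M by rewrite /M (le_lt_trans (ler_norm _))// ltrDl.
have M0 : 0 < M by rewrite /M ltr_wpDl.
have E (x : R) : Num.sg x * f x = (f \_ `[0, M]) x - (f \_ `[- M, 0]) x.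
  rewrite !patchE !mem_setE/= !in_itv/=.
  have [x0|x0|<-] := ltgtP 0 x.
  - rewrite gtr0_sg// mul1r /= andbF subr0.
    case: ifPn => //; rewrite -ltNge => h; apply: f0; rewrite gtr0_norm//.
    exact: lt_trans LM h.
  - rewrite ltr0_sg// mulN1r /= andbT sub0r; congr (- _).
    case: ifPn => //; rewrite -ltNge => h; apply: f0; rewrite ltr0_norm//.
    by rewrite ltrNr in h; exact: lt_trans LM h.
  - by rewrite sgr0 mul0r (ltW M0) oppr_le0 (ltW M0) subrr.
transitivity (\int[leb R]_x ((f \_ `[0, M]) x - (f \_ `[- M, 0]) x)).
  exact: Rint_ext.
rewrite RintB; [|exact: intg_itv|exact: intg_itv].
rewrite -!Rint_restrict (FTC_itv M0 cf dF) (FTC_itv _ cf dF) ?oppr_lt0//.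
by rewrite !(F0 M) ?(F0 (- M)) ?normrN ?gtr0_norm//; ring.
Qed.

(** Integration over slopes leaves the weight 1 / (1 + s^2); its mass is the pi that the
    normalization of K compensates. *)
Lemma Rint_oneDsqr : intg (leb R) (fun x => (1 + x ^+ 2)^-1) /\
  \int[leb R]_x (1 + x ^+ 2)^-1 = pi.
Proof.
have p0 (x : R) : 0 < 1 + x ^+ 2 by rewrite ltr_pwDl// sqr_ge0.
have c : continuous (fun x : R => (1 + x ^+ 2)^-1) by exact: continuous_oneDsqrV.
have E : (\int[leb R]_x ((1 + x ^+ 2)^-1)%:E = (pi : R)%:E)%E.
  rewrite ge0_symfun_integralT//.
  - rewrite (_ : [set x | _] = `[0, +oo[%classic); last by rewrite set_itvcy.
    by rewrite integral0y_oneDsqr -EFinM mulrCA divff// mulr1.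
  - by move=> x; rewrite invr_ge0 ltW.
  - by move=> x /=; rewrite sqrrN.
split; last by rewrite /Rintegral E.
apply: intg_ge0P; last by rewrite E ltry.
- exact: continuous_measurable_fun.
- by move=> x; rewrite invr_ge0 ltW.
Qed.

End FTCLine.

(** * C1 functions of the plane with named partial derivatives *)

Section C1Plane.
Variable R : realType.
Implicit Types f g : R * R -> R.

(** The partial derivatives are data, so that identities between them can be stated and rewritten;
    [C1_dir] recovers the other directions from these two. *)
Record C1 f f1 f2 : Prop := MkC1 {
  C1_cont : continuous f;
  C1_cont1 : continuous f1;
  C1_cont2 : continuous f2;
  C1_d1 : forall a b, is_derive a (1 : R) (fun s => f (s, b)) (f1 (a, b));
  C1_d2 : forall a b, is_derive b (1 : R) (fun s => f (a, s)) (f2 (a, b)) }.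

Definition vanish (L : R) f := forall x, L < `|x| -> f x = 0.

Record C1c L f f1 f2 : Prop := MkC1c {
  C1c_C1 : C1 f f1 f2;
  C1c_0 : vanish L f;
  C1c_1 : vanish L f1;
  C1c_2 : vanish L f2 }.

Lemma vanish_bounded L f : continuous f -> vanish L f ->
  exists2 C, 0 <= C & forall x, `|f x| <= C.
Proof.
move=> cf f0; apply: (csupp_bounded (@compact_square R L) cf) => x /=.
by move/negP; rewrite -ltNge; exact: f0.
Qed.

(** Indicator of the closed max-norm ball, written as a product so that its integrability reduces to
    that of two intervals. *)
Definition box (L : R) (x : R * R) : R :=
  \1_(`[- L, L]%classic : set R) x.1 * \1_(`[- L, L]%classic : set R) x.2.

Lemma boxE L x : box L x = if `|x| <= L then 1 else 0.
Proof.
rewrite /box !indicE prod_normE ge_max !ler_norml -[in LHS]natrM mulnb !mem_setE/= !in_itv/=.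
by case: ifP.
Qed.

Lemma box_ge0 L x : 0 <= box L x.
Proof. by rewrite boxE; case: ifP. Qed.

Lemma intg_indic_itv (a b : R) : intg (leb R) (\1_(`[a, b]%classic : set R) : R -> R).
Proof.
have := @intg_itv R (fun=> 1) a b (@cst_continuous _ _ _); apply: intg_ext => x.
by rewrite patchE indicE; case: ifP.
Qed.

Lemma intg_box L : intg (leb2 R) (box L).
Proof. by have := intg_prod (intg_indic_itv (- L) L) (intg_indic_itv (- L) L). Qed.

Lemma measurable_box L :
  measurable_fun (setT : set (measurableTypeR R * measurableTypeR R)%type) (box L).
Proof. exact: intg_mfun (intg_box L). Qed.

Lemma intg_vanish L f C :
  measurable_fun (setT : set (measurableTypeR R * measurableTypeR R)%type) f ->
  (forall x, `|f x| <= C) -> vanish L f -> intg (leb2 R) f.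
Proof.
move=> mf fC f0; apply: (@intg_le _ _ _ (leb2 R) f (fun x => C * box L x)) => //.
  move=> x; rewrite boxE; case: ifPn => h; first by rewrite mulr1.
  by rewrite f0 ?normr0 ?mulr0// ltNge.
exact/intgZ/intg_box.
Qed.

Lemma intg_cont_vanish L f : continuous f -> vanish L f -> intg (leb2 R) f.
Proof.
move=> cf f0; have [C _ hC] := vanish_bounded cf f0.
apply: intg_vanish hC f0; exact: continuous_measurable2.
Qed.

Lemma leb2_Rfubini1 f : intg (leb2 R) f ->
  \int[leb2 R]_x f x = \int[leb R]_a (\int[leb R]_b f (a, b)).
Proof. by move=> fi; apply/esym; apply: Rfubini1. Qed.

Lemma leb2_Rfubini2 f : intg (leb2 R) f ->
  \int[leb2 R]_x f x = \int[leb R]_b (\int[leb R]_a f (a, b)).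
Proof. by move=> fi; apply/esym; apply: Rfubini2. Qed.

Lemma cont_row f (b : R) : continuous f -> continuous (fun a : R => f (a, b)).
Proof.
move=> cf x; apply: (@continuous_comp _ _ _ (fun x => (x, b)) f); last exact: cf.
exact: continuous_pairl.
Qed.

Lemma cont_col f (a : R) : continuous f -> continuous (fun b : R => f (a, b)).
Proof.
move=> cf x; apply: (@continuous_comp _ _ _ (fun x => (a, x)) f); last exact: cf.
exact: continuous_pairr.
Qed.

Lemma norm_fst_le (x : R * R) : `|x.1| <= `|x|.
Proof. by rewrite prod_normE le_max lexx. Qed.

Lemma norm_snd_le (x : R * R) : `|x.2| <= `|x|.
Proof. by rewrite prod_normE le_max lexx orbT. Qed.

Lemma C1c_int1 L f f1 f2 : C1c L f f1 f2 -> \int[leb2 R]_x f1 x = 0.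
Proof.
move=> [[cf cf1 cf2 d1 d2] f0 f10 f20].
rewrite leb2_Rfubini2; last exact: intg_cont_vanish f10.
transitivity (\int[leb R]_b (fun=> 0 : R) b); last by rewrite /Rintegral integral0.
apply: Rint_ext => b.
apply: (@FTC_csupp _ (fun a => f (a, b)) _ L) => //.
- exact: cont_row.
- by move=> x Lx; apply: f0; exact: lt_le_trans Lx (norm_fst_le (x, b)).
- by move=> x Lx; apply: f10; exact: lt_le_trans Lx (norm_fst_le (x, b)).
Qed.

Lemma C1c_int2 L f f1 f2 : C1c L f f1 f2 -> \int[leb2 R]_x f2 x = 0.
Proof.
move=> [[cf cf1 cf2 d1 d2] f0 f10 f20].
rewrite leb2_Rfubini1; last exact: intg_cont_vanish f20.
transitivity (\int[leb R]_b (fun=> 0 : R) b); last by rewrite /Rintegral integral0.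
apply: Rint_ext => b.
apply: (@FTC_csupp _ (fun a => f (b, a)) _ L) => //.
- exact: cont_col.
- by move=> x Lx; apply: f0; exact: lt_le_trans Lx (norm_snd_le (b, x)).
- by move=> x Lx; apply: f20; exact: lt_le_trans Lx (norm_snd_le (b, x)).
Qed.

Lemma C1_dir1 f f1 f2 p : C1 f f1 f2 -> is_derive p ((1, 0) : R * R) f (f1 p).
Proof.
case: p => a b [_ _ _ d1 _].
have E (s : R) : s *: ((1, 0) : R * R) + (0, b) = (s, b).
  by apply/pair_equal_spec; rewrite /= [s *: 1]mulr1 [s *: 0]mulr0 addr0 add0r.
by rewrite -[in is_derive (a, b)](E a); apply/is_derive_line; under eq_fun do rewrite E.
Qed.

Lemma C1_dir2 f f1 f2 p : C1 f f1 f2 -> is_derive p ((0, 1) : R * R) f (f2 p).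
Proof.
case: p => a b [_ _ _ _ d2].
have E (s : R) : s *: ((0, 1) : R * R) + (a, 0) = (a, s).
  by apply/pair_equal_spec; rewrite /= [s *: 1]mulr1 [s *: 0]mulr0 addr0 add0r.
by rewrite -[in is_derive (a, b)](E b); apply/is_derive_line; under eq_fun do rewrite E.
Qed.

Lemma C1_dir f f1 f2 p (u : R * R) : C1 f f1 f2 ->
  is_derive p u f (u.1 * f1 p + u.2 * f2 p).
Proof.
move=> h; have [_ c1 c2 _ _] := h.
have -> : u = u.1 *: ((1, 0) : R * R) + u.2 *: ((0, 1) : R * R).
  case: u => a b; apply/pair_equal_spec; rewrite /=.
  by rewrite ![_ *: 1]mulr1 ![_ *: 0]mulr0 addr0 add0r.
rewrite /= ![_ *: 1]mulr1 ![_ *: 0]mulr0 addr0 add0r.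
apply: (@dirD _ _ _ (fun q => u.1 * f1 q)).
- by apply: near_all => q; apply: dirZ; exact: C1_dir1 h.
- by apply: cvgM; [exact: cvg_cst|exact: c1].
- by apply: dirZ; exact: C1_dir2 h.
Qed.

Lemma C1_ray f f1 f2 (s a : R) : C1 f f1 f2 ->
  is_derive a (1 : R) (fun a => f (a, a * s)) (f1 (a, a * s) + s * f2 (a, a * s)).
Proof.
move=> h.
have E (r : R) : r *: ((1, s) : R * R) + (0, 0) = (r, r * s).
  by apply/pair_equal_spec; rewrite /= [r *: 1]mulr1 !addr0.
have -> : (fun a => f (a, a * s)) = (fun r : R => f (r *: ((1, s) : R * R) + (0, 0))).
  by apply/funext => r; rewrite E.
apply: (@is_derive_line R (R * R)%type f (0, 0) (1, s) a _).1; rewrite E.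
by have := C1_dir (a, a * s) (1, s) h; rewrite /= mul1r.
Qed.

End C1Plane.

Lemma continuous_pair (T U W : topologicalType) (f : T -> U) (g : T -> W) :
  continuous f -> continuous g -> continuous (fun x => (f x, g x)).
Proof. by move=> cf cg x; apply: cvg_pair; [exact: cf|exact: cg]. Qed.

(** * The Biot-Savart kernel *)

Section Cone.
Variable R : realType.
Local Notation R2 := (measurableTypeR R * measurableTypeR R)%type.

(** The inverse is the pointwise limit of continuous functions; at 0 they all vanish, in agreement
    with the convention that the inverse of 0 is 0. *)
Lemma measurable_invr : measurable_fun (setT : set R) (fun x : R => x^-1).
Proof.
apply: (@measurable_fun_cvg _ _ _ setT (fun n (x : R) => x / (x ^+ 2 + n.+1%:R^-1))) => //.
- move=> n; apply: continuous_measurable_fun => x.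
  apply: cvgM; first exact: cvg_id.
  apply: cvgV; first by rewrite lt0r_neq0// ltr_wpDl ?sqr_ge0// invr_gt0.
  apply: cvgD; last exact: cvg_cst.
  exact: exprn_continuous.
- move=> x _ /=; have [->|x0] := eqVneq x 0.
    by rewrite invr0; under eq_fun do rewrite mul0r; exact: cvg_cst.
  rewrite -[X in _ --> X](_ : x / (x ^+ 2 + 0) = _); last first.
    by rewrite addr0 expr2 invfM mulrA divff// mul1r.
  apply: cvgM; first exact: cvg_cst.
  apply: cvgV; first by rewrite addr0 sqrf_eq0.
  by apply: cvgD; [exact: cvg_cst|exact: cvg_harmonic].
Qed.

Lemma measurable_funV d (T : measurableType d) (f : T -> R) :
  measurable_fun setT f -> measurable_fun setT (fun x => (f x)^-1).
Proof. by move=> mf; apply: (measurableT_comp measurable_invr). Qed.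

(** Abscissa and slope as coordinates: fixing the second argument gives a line through the origin,
    and [|x.1|] is the Jacobian. *)
Definition cone (x : R * R) : R * R := (x.1, x.1 * x.2).

Lemma measurable_cone : measurable_fun (setT : set R2) (cone : R2 -> R2).
Proof.
apply: (@measurable_fun_pair _ _ _ _ _ _ (fun x : R2 => x.1)
    (fun x : R2 => x.1 * x.2)); first exact: measurable_fst.
by apply: measurable_funM; [exact: measurable_fst|exact: measurable_snd].
Qed.

Lemma measurable_fst_norm : measurable_fun (setT : set R2) (fun x => `|x.1|).
Proof. by apply: measurableT_comp => //; exact: measurable_fst. Qed.

(* The substitution b = a s on each vertical line replaces polar coordinates. *)
Lemma ge0_integral_cone (F : R * R -> \bar R) :
  measurable_fun (setT : set R2) F -> (forall x, 0 <= F x)%E ->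
  (\int[leb2 R]_x F x = \int[leb2 R]_x ((`|x.1|%R)%:E * F (cone x)))%E.
Proof.
move=> mF F0.
have mFc : measurable_fun (setT : set R2) (fun x => (`|x.1|%R)%:E * F (cone x))%E.
  apply: emeasurable_funM.
    by apply/measurable_EFinP; exact: measurable_fst_norm.
  by apply: measurableT_comp => //; exact: measurable_cone.
have Fc0 x : (0 <= (`|x.1|%R)%:E * F (cone x))%E.
  by apply: mule_ge0 => //; rewrite lee_fin.
rewrite (leb2_tonelli mF F0) (leb2_tonelli mFc Fc0).
apply: ae_eq_integral => //.
- exact: (@measurable_fun_fubini_tonelli_F _ _ _ _ _ (leb R) F mF F0).
- exact: (@measurable_fun_fubini_tonelli_F _ _ _ _ _ (leb R) _ mFc Fc0).
exists [set 0]; split => //.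
  exact: lebesgue_measure_set1.
move=> a /= h; apply: contrapT => /eqP a0; apply: h => _.
rewrite (@ge0_integral_affine R a 0)//; last exact: measurableT_comp.
rewrite -ge0_integralZl//.
- by apply: eq_integral => s _; rewrite /cone/= add0r.
- apply: measurableT_comp => //.
  apply: (@measurableT_comp _ _ _ _ _ _ (pair a)) => //.
  exact: measurable_affine.
Qed.

Lemma intg_cone (F : R * R -> R) : measurable_fun (setT : set R2) F ->
  intg (leb2 R) (fun x => `|x.1| * F (cone x)) <-> intg (leb2 R) F.
Proof.
move=> mF.
have mE : measurable_fun (setT : set R2) (fun x => `|(F x)%:E|%E).
  by apply: measurableT_comp => //; exact/measurable_EFinP.
have mFc : measurable_fun (setT : set R2) (fun x => `|x.1| * F (cone x)).
  apply: measurable_funM; first exact: measurable_fst_norm.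
  exact: measurableT_comp measurable_cone.
have E : (\int[leb2 R]_x `|(F x)%:E| =
    \int[leb2 R]_x `|(`|x.1| * F (cone x))%:E|)%E.
  rewrite (ge0_integral_cone mE)//; apply: eq_integral => x _.
  by rewrite EFinM abseM /= normr_id.
split=> /integrableP[_ fi]; apply/integrableP; split.
- exact/measurable_EFinP.
- by move: fi; rewrite /= -E.
- exact/measurable_EFinP.
- by move: fi; rewrite /= E.
Qed.

Lemma Rint_cone (F : R * R -> R) : measurable_fun (setT : set R2) F ->
  \int[leb2 R]_x F x = \int[leb2 R]_x (`|x.1| * F (cone x)).
Proof.
move=> mF; have mE : measurable_fun (setT : set R2) (EFin \o F).
  exact/measurable_EFinP.
rewrite /Rintegral [in LHS]integralE [in RHS]integralE.
rewrite (ge0_integral_cone (measurable_funepos mE))//.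
rewrite (ge0_integral_cone (measurable_funeneg mE))//.
congr (fine (_ - _)%E); apply: eq_integral => x _.
  by rewrite !funeposE/= EFinM maxe_pMr// mule0.
by rewrite !funenegE/= -mulrN EFinM maxe_pMr// mule0.
Qed.

Lemma norm_cone (x : R * R) : `|cone x| = `|x.1| * Num.max 1 `|x.2|.
Proof. by rewrite prod_normE/= normrM maxr_pMr// mulr1. Qed.

Lemma Rint_indic_itv (c : R) : 0 <= c ->
  \int[leb R]_x (\1_(`[- c, c]%classic : set R) x) = 2 * c.
Proof.
move=> c0; transitivity (\int[leb R]_(x in `[- c, c]) cst (1 : R) x).
  by rewrite [RHS]Rint_restrict; apply: Rint_ext => x; rewrite patchE indicE; case: ifP.
rewrite Rintegral_cst// mul1r.
transitivity (fine (leb R [set` `[- c, c]])) => //.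
rewrite lebesgue_measure_itv/= lte_fin; case: ltrP => h /=; first by rewrite opprK; ring.
by have -> : c = 0; [lra|rewrite mulr0].
Qed.

Lemma continuous_norm2 : continuous (fun x : R * R => `|x| : R).
Proof. by move=> x; apply: cvg_norm; exact: cvg_id. Qed.

Lemma measurable_rho : measurable_fun (setT : set R2) (fun x : R * R => `|x|^-1).
Proof.
by apply: measurable_funV; apply: continuous_measurable2; exact: continuous_norm2.
Qed.

(** In the coordinates of [cone] the norm is |a| m(s) with m(s) = max(1, |s|), so the Jacobian
    cancels the singularity and leaves 1 / m(s) on |a| <= |L| / m(s). The integral in a is 2 |L| /
    m(s)^2, at most 4 |L| / (1 + s^2). *)
Lemma intg_rho (L : R) : intg (leb2 R) (fun x => box L x * `|x|^-1).
Proof.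
apply/intg_cone.
  by apply: measurable_funM; [exact: measurable_box|exact: measurable_rho].
pose m (s : R) : R := Num.max 1 `|s|.
have m1 s : 1 <= m s by rewrite /m le_max lexx.
have m0 s : 0 < m s by apply: lt_le_trans (m1 s).
have mV s : (m s)^-1 ^+ 2 <= 2 * (1 + s ^+ 2)^-1.
  have p : 0 < 1 + s ^+ 2 by rewrite ltr_pwDl// sqr_ge0.
  rewrite exprVn ler_pdivlMr// ler_pdivrMl ?exprn_gt0//.
  rewrite -[s ^+ 2]real_normK ?num_real//.
  have := normr_ge0 s; rewrite /m; case: (leP 1 `|s|) => h h0; nra.
pose c (s : R) : R := `|L| / m s.
have c0 s : 0 <= c s by rewrite /c divr_ge0// ltW.
have bnd a s : `|(`|(a, s).1| * (box L (cone (a, s)) * `|cone (a, s)|^-1)) : R| <=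
    (m s)^-1 * \1_(`[- c s, c s]%classic : set R) a.
  rewrite ger0_norm; last by rewrite !mulr_ge0// ?box_ge0// invr_ge0.
  rewrite norm_cone /= -/(m s) boxE norm_cone/= -/(m s) indicE mem_setE/= in_itv/= -ler_norml.
  case: ifPn => h; last by rewrite mul0r mulr0 mulr_ge0// invr_ge0 ltW.
  have -> : `|a| <= c s.
    by rewrite /c ler_pdivlMr// (le_trans h)// ler_norm.
  rewrite mul1r mulr1; have [->|a0] := eqVneq a 0.
    by rewrite normr0 mul0r invr_ge0 ltW.
  by rewrite invfM mulrA divff ?normr_eq0// mul1r.
have mG : measurable_fun (setT : set R2)
    (fun x => `|x.1| * (box L (cone x) * `|cone x|^-1)).
  apply: measurable_funM; first exact: measurable_fst_norm.
  apply: measurable_funM.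
    exact: (measurableT_comp (measurable_box L) measurable_cone).
  exact: (measurableT_comp measurable_rho measurable_cone).
apply: (@intg_tonelli2 _ _ _ _ _ (leb R) (leb R) _
    (fun s => 4 * `|L| * (1 + s ^+ 2)^-1)) => //; last first.
  by apply: intgZ; have [] := Rint_oneDsqr R.
apply: aeW => s.
have mGs : measurable_fun (setT : set (measurableTypeR R))
    (fun a => `|(a, s).1| * (box L (cone (a, s)) * `|cone (a, s)|^-1)).
  apply: (measurableT_comp mG); exact: (measurable_pair2 s).
have ib : intg (leb R) (fun a : R => (m s)^-1 * \1_(`[- c s, c s]%classic : set R) a).
  by apply: intgZ; exact: intg_indic_itv.
have ig : intg (leb R) (fun a => `|(a, s).1| * (box L (cone (a, s)) * `|cone (a, s)|^-1)).
  by apply: (intg_le mGs _ ib) => a; exact: bnd.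
split => //.
apply: (@le_trans _ _ (\int[leb R]_a ((m s)^-1 * \1_(`[- c s, c s]%classic : set R) a))).
  by apply: Rint_le; [exact: intg_norm|exact: ib|move=> a; exact: bnd].
rewrite RintZ ?Rint_indic_itv//; last exact: intg_indic_itv.
rewrite /c [leLHS](_ : _ = 2 * `|L| * ((m s)^-1 ^+ 2)); last by rewrite expr2; ring.
rewrite [leRHS](_ : _ = 2 * `|L| * (2 * (1 + s ^+ 2)^-1)); last by ring.
by rewrite ler_wpM2l// mulr_ge0.
Qed.

(** The squared Euclidean norm, whereas [|x|] is the max norm; [sqn_ge] compares them. *)
Definition sqn (x : R * R) : R := x.1 ^+ 2 + x.2 ^+ 2.

Lemma sqn_ge x : `|x| ^+ 2 <= sqn x.
Proof.
rewrite prod_normE /sqn; case: (leP `|x.1| `|x.2|) => h.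
  by rewrite real_normK ?num_real// lerDr sqr_ge0.
by rewrite real_normK ?num_real// lerDl sqr_ge0.
Qed.

Lemma sqn_ge0 x : 0 <= sqn x.
Proof. by rewrite addr_ge0 ?sqr_ge0. Qed.

Lemma div_sqn_le (x : R * R) (t : R) : `|t| <= `|x| -> `|t / sqn x| <= `|x|^-1.
Proof.
move=> tx; have [->|x0] := eqVneq x 0.
  by rewrite /sqn/= expr0n/= addr0 invr0 mulr0 !normr0 invr0.
have n0 : 0 < `|x| by rewrite normr_gt0.
have s0 : 0 < sqn x by apply: lt_le_trans (sqn_ge x); rewrite exprn_gt0.
rewrite normrM normfV (gtr0_norm s0) ler_pdivrMr//.
apply: le_trans tx _; rewrite ler_pdivlMl// -expr2; exact: sqn_ge.
Qed.

Lemma continuous_sqn : continuous sqn.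
Proof.
move=> x; apply: cvgD.
  by apply: (cvg_comp fst (fun t => t ^+ 2) cvg_fst); exact: exprn_continuous.
by apply: (cvg_comp snd (fun t => t ^+ 2) cvg_snd); exact: exprn_continuous.
Qed.

Lemma measurable_sqn : measurable_fun (setT : set R2) sqn.
Proof. by apply: continuous_measurable2; exact: continuous_sqn. Qed.

(** The pairing of (f1, f2) with the gradient of the logarithm of the Euclidean norm. *)
Definition radial (f1 f2 : R * R -> R) (x : R * R) : R :=
  x.1 / sqn x * f1 x + x.2 / sqn x * f2 x.

Lemma measurable_quot1 : measurable_fun (setT : set R2) (fun x => x.1 / sqn x).
Proof.
by apply: measurable_funM; [exact: measurable_fst|exact: (measurable_funV measurable_sqn)].
Qed.

Lemma measurable_quot2 : measurable_fun (setT : set R2) (fun x => x.2 / sqn x).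
Proof.
by apply: measurable_funM; [exact: measurable_snd|exact: (measurable_funV measurable_sqn)].
Qed.

Lemma quot_vanish_le (f : R * R -> R) (L C : R) (x : R * R) (t : R) : `|t| <= `|x| ->
  (forall x, `|f x| <= C) -> vanish L f ->
  `|t / sqn x * f x| <= C * (box L x * `|x|^-1).
Proof.
move=> tx fC f0; rewrite normrM boxE; case: ifPn => h; last first.
  by rewrite f0 ?normr0 ?mul0r ?mulr0// ltNge.
by rewrite mul1r mulrC; apply: ler_pM => //; exact: div_sqn_le.
Qed.

Lemma intg_quot (q : R * R -> R) (f : R * R -> R) (L : R) :
  measurable_fun (setT : set R2) (fun x => q x / sqn x) ->
  (forall x, `|q x| <= `|x|) ->
  continuous f -> vanish L f -> intg (leb2 R) (fun x => q x / sqn x * f x).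
Proof.
move=> mq qx cf f0; have [C _ hC] := vanish_bounded cf f0.
have ib : intg (leb2 R) (fun x => C * (box L x * `|x|^-1)).
  by apply: intgZ; exact: intg_rho.
apply: intg_le ib.
  by apply: measurable_funM => //; exact: continuous_measurable2.
by move=> x; exact: quot_vanish_le.
Qed.

Lemma measurable_sgr : measurable_fun (setT : set R) (@Num.sg R).
Proof.
have -> : @Num.sg R = fun x => x / `|x|.
  apply/funext => x; have [->|x0] := eqVneq x 0; first by rewrite sgr0 mul0r.
  by rewrite {2}[x]numEsg mulfK// normr_eq0.
by apply: measurable_funM => //; apply: measurable_funV; exact: normr_measurable.
Qed.

Lemma radial_cone_eq (f1 f2 : R * R -> R) (a s : R) :
  `|a| * radial f1 f2 (cone (a, s)) =
  (1 + s ^+ 2)^-1 * (Num.sg a * (f1 (a, a * s) + s * f2 (a, a * s))).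
Proof.
rewrite /radial /cone/= /sqn/=.
have s1 : 1 + s ^+ 2 != 0 by rewrite lt0r_neq0// ltr_pwDl// sqr_ge0.
have [->|a0] := eqVneq a 0; first by rewrite normr0 sgr0 !mul0r mulr0.
rewrite (_ : a ^+ 2 + _ = a ^+ 2 * (1 + s ^+ 2)); last by ring.
by rewrite normrEsg; field; rewrite ?a0 ?s1.
Qed.

Lemma intg_cont_line (h : R -> R) (L : R) : continuous h ->
  (forall x, L < `|x| -> h x = 0) -> intg (leb R) h.
Proof.
move=> ch h0; apply: intg_ext (intg_itv (- L) L ch) => x.
rewrite patchE mem_setE/= in_itv/= -ler_norml; case: ifPn => //.
by rewrite -ltNge => /h0.
Qed.

(** On the line of slope s the integrand becomes the derivative of f along the line times its sign,
    so [FTC_sign] gives - 2 f(0) / (1 + s^2); integrating over s yields the factor pi. In other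
    words the logarithm is 2 pi times a fundamental solution of the Laplacian. *)
Lemma Rint_radial L f f1 f2 : C1c L f f1 f2 ->
  \int[leb2 R]_x radial f1 f2 x = - (2 * pi) * f 0.
Proof.
move=> [h f0 f10 f20]; have [cf c1 c2 _ _] := h.
have mr : measurable_fun (setT : set R2) (radial f1 f2).
  apply: measurable_funD; apply: measurable_funM.
  - exact: measurable_quot1.
  - exact: continuous_measurable2.
  - exact: measurable_quot2.
  - exact: continuous_measurable2.
have ir : intg (leb2 R) (radial f1 f2).
  apply: intgD; apply: (@intg_quot _ _ L) => //.
  - exact: measurable_quot1.
  - exact: norm_fst_le.
  - exact: measurable_quot2.
  - exact: norm_snd_le.
have /intg_cone ic := ir.
rewrite Rint_cone// leb2_Rfubini2; last by apply: ic.
transitivity (\int[leb R]_s ((- 2 * f 0) * (1 + s ^+ 2)^-1)); last first.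
  by have [i1 E1] := Rint_oneDsqr R; rewrite RintZ// E1; ring.
apply: Rint_ext => s.
have s1 : 1 + s ^+ 2 != 0 by rewrite lt0r_neq0// ltr_pwDl// sqr_ge0.
transitivity (\int[leb R]_a ((1 + s ^+ 2)^-1 *
    (Num.sg a * (f1 (a, a * s) + s * f2 (a, a * s))))).
  by apply: Rint_ext => a; exact: radial_cone_eq.
have cs : continuous (fun a : R => f1 (a, a * s) + s * f2 (a, a * s)).
  have cc : continuous (fun a : R => (a, a * s)).
    apply: (@continuous_pair R R R); first by move=> a; exact: cvg_id.
    by move=> a; apply: cvgM; [exact: cvg_id|exact: cvg_cst].
  move=> a; apply: cvgD.
    apply: (@continuous_comp _ _ _ (fun a : R => (a, a * s)) f1); [exact: cc|exact: c1].
  apply: cvgM; first exact: cvg_cst.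
  apply: (@continuous_comp _ _ _ (fun a : R => (a, a * s)) f2); [exact: cc|exact: c2].
have van g : vanish L g -> forall a : R, L < `|a| -> g (a, a * s) = 0.
  by move=> g0 a La; apply: g0; exact: lt_le_trans La (norm_fst_le (a, a * s)).
have dF a : is_derive a (1 : R) (fun a : R => f (a, a * s)) (f1 (a, a * s) + s * f2 (a, a * s)).
  exact: C1_ray h.
have g0 a : L < `|a| -> f1 (a, a * s) + s * f2 (a, a * s) = 0.
  by move=> La; rewrite !van// mulr0 addr0.
have H := FTC_sign cs dF (van f f0) g0.
rewrite RintZ; first by rewrite H mul0r [LHS]mulrC.
have mh := continuous_measurable_fun cs.
apply: (@intg_le _ _ _ (leb R) _ (fun a => `|f1 (a, a * s) + s * f2 (a, a * s)|)).
- apply: measurable_funM => //.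
  exact: measurable_sgr.
- by move=> a; rewrite normrM normr_sg; case: eqP => _; rewrite ?mul0r ?mul1r.
- by apply: intg_norm; exact: intg_cont_line g0.
Qed.

End Cone.

Section Derive1.
Variable R : realType.
Implicit Types (f g : R -> R) (x a b : R).

Lemma derD f g x a b : is_derive x (1 : R) f a -> is_derive x (1 : R) g b ->
  is_derive x (1 : R) (fun s => f s + g s) (a + b).
Proof. by move=> fa gb; exact: is_deriveD. Qed.

Lemma derM f g x a b : is_derive x (1 : R) f a -> is_derive x (1 : R) g b ->
  is_derive x (1 : R) (fun s => f s * g s) (a * g x + f x * b).
Proof.
move=> fa gb; have := is_deriveM fa gb.
by rewrite [_ *: _ + _]addrC [g x *: _]mulrC.
Qed.

Lemma derV f x a : f x != 0 -> is_derive x (1 : R) f a ->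
  is_derive x (1 : R) (fun s => (f s)^-1) (- (f x) ^- 2 * a).
Proof. by move=> f0 fa; exact: is_deriveV. Qed.

End Derive1.

Section C1Algebra.
Variable R : realType.
Implicit Types f g : R * R -> R.

Lemma C1_eq f f1 f2 g1 g2 : C1 f f1 f2 -> (forall x, f1 x = g1 x) ->
  (forall x, f2 x = g2 x) -> C1 f g1 g2.
Proof. by move=> h /funext <- /funext <-. Qed.

Lemma C1_cst (c : R) : C1 (fun=> c) (fun=> 0) (fun=> 0).
Proof.
by split; [exact: cst_continuous|exact: cst_continuous|exact: cst_continuous|
  move=> a b; exact: is_derive_cst|move=> a b; exact: is_derive_cst].
Qed.

Lemma C1_fst : C1 (fun x : R * R => x.1) (fun=> 1) (fun=> 0).
Proof.
split; [by move=> x; exact: cvg_fst|exact: cst_continuous|exact: cst_continuous|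
  move=> a b; exact: is_derive_id|move=> a b; exact: is_derive_cst].
Qed.

Lemma C1_snd : C1 (fun x : R * R => x.2) (fun=> 0) (fun=> 1).
Proof.
split; [by move=> x; exact: cvg_snd|exact: cst_continuous|exact: cst_continuous|
  move=> a b; exact: is_derive_cst|move=> a b; exact: is_derive_id].
Qed.

Lemma C1_add f f1 f2 g g1 g2 : C1 f f1 f2 -> C1 g g1 g2 ->
  C1 (fun x => f x + g x) (fun x => f1 x + g1 x) (fun x => f2 x + g2 x).
Proof.
move=> [cf cf1 cf2 d1 d2] [cg cg1 cg2 e1 e2]; split.
- by move=> x; apply: cvgD; [exact: cf|exact: cg].
- by move=> x; apply: cvgD; [exact: cf1|exact: cg1].
- by move=> x; apply: cvgD; [exact: cf2|exact: cg2].
- by move=> a b; exact: derD.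
- by move=> a b; exact: derD.
Qed.

Lemma C1_mul f f1 f2 g g1 g2 : C1 f f1 f2 -> C1 g g1 g2 ->
  C1 (fun x => f x * g x) (fun x => f1 x * g x + f x * g1 x)
     (fun x => f2 x * g x + f x * g2 x).
Proof.
move=> [cf cf1 cf2 d1 d2] [cg cg1 cg2 e1 e2]; split.
- by move=> x; apply: cvgM; [exact: cf|exact: cg].
- by move=> x; apply: cvgD; apply: cvgM;
    [exact: cf1|exact: cg|exact: cf|exact: cg1].
- by move=> x; apply: cvgD; apply: cvgM;
    [exact: cf2|exact: cg|exact: cf|exact: cg2].
- by move=> a b; exact: derM.
- by move=> a b; exact: derM.
Qed.

Lemma C1_inv f f1 f2 : (forall x, f x != 0) -> C1 f f1 f2 ->
  C1 (fun x => (f x)^-1) (fun x => - (f x) ^- 2 * f1 x)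
     (fun x => - (f x) ^- 2 * f2 x).
Proof.
move=> f0 [cf cf1 cf2 d1 d2].
have cV : continuous (fun x => - (f x) ^- 2).
  move=> x; apply: cvgN; apply: cvgV; first by rewrite expf_neq0.
  apply: (@continuous_comp _ _ _ f (fun t => t ^+ 2)); first exact: cf.
  exact: exprn_continuous.
split.
- by move=> x; apply: cvgV => //; exact: cf.
- by move=> x; apply: cvgM; [exact: cV|exact: cf1].
- by move=> x; apply: cvgM; [exact: cV|exact: cf2].
- by move=> a b; exact: (derV (f0 _) (d1 a b)).
- by move=> a b; exact: (derV (f0 _) (d2 a b)).
Qed.

Lemma C1c_mul L f f1 f2 g g1 g2 : C1 f f1 f2 -> C1c L g g1 g2 ->
  C1c L (fun x => f x * g x) (fun x => f1 x * g x + f x * g1 x)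
     (fun x => f2 x * g x + f x * g2 x).
Proof.
move=> Cf [Cg g0 g10 g20]; split; first exact: C1_mul.
- by move=> x Lx; rewrite g0// mulr0.
- by move=> x Lx; rewrite g0// g10// !mulr0 addr0.
- by move=> x Lx; rewrite g0// g20// !mulr0 addr0.
Qed.

Lemma C1c_add L f f1 f2 g g1 g2 : C1c L f f1 f2 -> C1c L g g1 g2 ->
  C1c L (fun x => f x + g x) (fun x => f1 x + g1 x) (fun x => f2 x + g2 x).
Proof.
move=> [Cf f0 f10 f20] [Cg g0 g10 g20]; split; first exact: C1_add.
- by move=> x Lx; rewrite f0// g0// addr0.
- by move=> x Lx; rewrite f10// g10// addr0.
- by move=> x Lx; rewrite f20// g20// addr0.
Qed.

Lemma C1_shift f f1 f2 (y : R * R) : C1 f f1 f2 ->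
  C1 (fun x => f (y + x)) (fun x => f1 (y + x)) (fun x => f2 (y + x)).
Proof.
move=> [cf cf1 cf2 d1 d2].
have cs g : continuous g -> continuous (fun x => g (y + x)).
  move=> cg x; apply: (@continuous_comp _ _ _ (fun x => y + x) g); last exact: cg.
  by apply: cvgD; [exact: cvg_cst|exact: cvg_id].
have ds (c a : R) : is_derive a (1 : R) (fun s => c + s) 1.
  rewrite -[X in is_derive _ _ _ X]add0r.
  exact: (derD (is_derive_cst c a 1) (is_derive_id a 1)).
split; [exact: cs|exact: cs|exact: cs| |] => a b.
- rewrite -[f1 _]mulr1.
  exact: (@is_derive1_comp _ (fun s => f (s, y.2 + b)) (fun s => y.1 + s)).
- rewrite -[f2 _]mulr1.
  exact: (@is_derive1_comp _ (fun s => f (y.1 + a, s)) (fun s => y.2 + s)).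
Qed.

Lemma C1c_shift L f f1 f2 (y : R * R) : C1c L f f1 f2 ->
  C1c (L + `|y|) (fun x => f (y + x)) (fun x => f1 (y + x)) (fun x => f2 (y + x)).
Proof.
have v g : vanish L g -> vanish (L + `|y|) (fun x => g (y + x)).
  move=> g0 x Lx; apply: g0; have := lerB_dist x (- y).
  by rewrite opprK normrN (addrC x); lra.
by move=> [Cf f0 f10 f20]; split; [exact: C1_shift|exact: v|exact: v|exact: v].
Qed.

End C1Algebra.

(** * Weak curl and divergence of the kernel *)

Section KernelIdentities.
Variable R : realType.
Local Notation R2 := (measurableTypeR R * measurableTypeR R)%type.
Implicit Types f g : R * R -> R.

(** The pairing of (f1, f2) with the gradient of the polar angle, that is (- x.2, x.1) divided by
    [sqn x]. *)
Definition angular (f1 f2 : R * R -> R) (x : R * R) : R :=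
  x.1 / sqn x * f2 x - x.2 / sqn x * f1 x.

Lemma C1_quot (e : R) : 0 < e -> forall q q1 q2, C1 q q1 q2 ->
  C1 (fun x => q x / (sqn x + e))
     (fun x => q1 x / (sqn x + e) + q x * (- (sqn x + e) ^- 2 * (2 * x.1)))
     (fun x => q2 x / (sqn x + e) + q x * (- (sqn x + e) ^- 2 * (2 * x.2))).
Proof.
move=> e0 q q1 q2 Cq.
have Cs : C1 (fun x => sqn x + e) (fun x => 2 * x.1) (fun x => 2 * x.2).
  have H := C1_add (C1_add (C1_mul (C1_fst R) (C1_fst R))
    (C1_mul (C1_snd R) (C1_snd R))) (C1_cst e).
  by apply: C1_eq H _ _ => x; ring.
apply: C1_mul => //; apply: C1_inv => // x.
by rewrite lt0r_neq0// ltr_wpDl// sqn_ge0.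
Qed.

(** With e > 0 in the denominator the field is C1 and divergence free, so the integrand is a
    difference of two partial derivatives of compactly supported functions. *)
Lemma Rint_angular_reg L f f1 f2 (e : R) : 0 < e -> C1c L f f1 f2 ->
  \int[leb2 R]_x (x.1 / (sqn x + e) * f2 x - x.2 / (sqn x + e) * f1 x) = 0.
Proof.
move=> e0 Cf.
have C1_ := C1c_mul (C1_quot e0 (C1_fst R)) Cf.
have C2_ := C1c_mul (C1_quot e0 (C1_snd R)) Cf.
have I1 := C1c_int2 C1_; have I2 := C1c_int1 C2_.
transitivity (0 - 0 : R); last by rewrite subrr.
rewrite -[X in _ = X - _]I1 -[X in _ = _ - X]I2 -RintB.
- by apply: Rint_ext => x; ring.
- by case: C1_ => -[_ _ c _ _] _ _ v; exact: intg_cont_vanish v.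
- by case: C2_ => -[_ c _ _ _] _ v _; exact: intg_cont_vanish v.
Qed.

(** Dominated convergence as e tends to 0, with the locally integrable 1/|x| as majorant; hence the
    origin carries no mass and div K = 0 weakly. *)
Lemma Rint_angular L f f1 f2 : C1c L f f1 f2 ->
  \int[leb2 R]_x angular f1 f2 x = 0.
Proof.
move=> Cf; have [[_ c1 c2 _ _] _ f10 f20] := Cf.
have [A A0 hA] := vanish_bounded c1 f10.
have [B B0 hB] := vanish_bounded c2 f20.
pose e n : R := n.+1%:R^-1.
have e0 n : 0 < e n by rewrite /e invr_gt0.
pose h n x := x.1 / (sqn x + e n) * f2 x - x.2 / (sqn x + e n) * f1 x.
have lim : \int[leb2 R]_x h n x @[n --> \oo] --> \int[leb2 R]_x angular f1 f2 x.
  apply: (@Rint_cvg _ _ _ (leb2 R) h (angular f1 f2)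
      (fun x => (A + B) * (box L x * `|x|^-1))).
  - move=> n; apply: continuous_measurable2.
    have [cq1 _ _ _ _] := C1_quot (e0 n) (C1_fst R).
    have [cq2 _ _ _ _] := C1_quot (e0 n) (C1_snd R).
    by move=> x; apply: cvgB; apply: cvgM; [exact: cq1|exact: c2|exact: cq2|exact: c1].
  - apply: measurable_funB; apply: measurable_funM.
    + exact: measurable_quot1.
    + exact: continuous_measurable2.
    + exact: measurable_quot2.
    + exact: continuous_measurable2.
  - apply: aeW => x; have [->|x0] := eqVneq x 0.
      rewrite /h /angular /= !mul0r subrr; under eq_fun do rewrite !mul0r subrr.
      exact: cvg_cst.
    have s0 : 0 < sqn x.
      by apply: lt_le_trans (sqn_ge x); rewrite exprn_gt0// normr_gt0.
    have ce : (sqn x + e n)^-1 @[n --> \oo] --> (sqn x)^-1.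
      have ce : sqn x + e n @[n --> \oo] --> sqn x + 0.
        by apply: cvgD; [exact: cvg_cst|exact: cvg_harmonic].
      by rewrite addr0 in ce; apply: cvgV ce; exact: lt0r_neq0.
    apply: cvgB; (apply: cvgM; last exact: cvg_cst); apply: cvgM => //;
      exact: cvg_cst.
  - exact/intgZ/intg_rho.
  - move=> n; apply: aeW => x.
    have q (t : R) : `|t| <= `|x| -> `|t / (sqn x + e n)| <= `|t / sqn x|.
      move=> tx; have [x0|x0] := eqVneq x 0.
        move: tx; rewrite x0 normr0 normr_le0 => /eqP ->.
        by rewrite !mul0r.
      have s0 : 0 < sqn x.
        by rewrite (lt_le_trans _ (sqn_ge x))// exprn_gt0// normr_gt0.
      have s1 := addr_gt0 s0 (e0 n).
      rewrite !normrM ler_wpM2l// !normfV (gtr0_norm s0) (gtr0_norm s1).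
      by rewrite lef_pV2; [rewrite lerDl ltW|rewrite posrE|rewrite posrE].
    apply: (le_trans (ler_normB _ _)); rewrite addrC mulrDl lerD//.
      apply: le_trans (quot_vanish_le (norm_snd_le x) hA f10).
      by rewrite !(normrM _ (f1 x)) ler_wpM2r// q// norm_snd_le.
    apply: le_trans (quot_vanish_le (norm_fst_le x) hB f20).
    by rewrite !(normrM _ (f2 x)) ler_wpM2r// q// norm_fst_le.
have : \int[leb2 R]_x h n x @[n --> \oo] --> (0 : R).
  rewrite (_ : (fun n => _) = fun=> 0); first exact: cvg_cst.
  by apply/funext => n; exact: (Rint_angular_reg (e0 n) Cf).
by move=> l0; rewrite -(cvg_lim (@Rhausdorff R) lim); exact: cvg_lim.
Qed.

Lemma bsK1E (z : R * R) : (bsK z).1 = (2 * pi)^-1 * - (z.2 / sqn z).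
Proof.
rewrite /bsK /= sqr_sqrtr; last by rewrite addr_ge0// -expr2 sqr_ge0.
have -> : dot z z = sqn z by rewrite /dot /sqn !expr2.
by rewrite invfM -[LHS]mulrA; congr (_ * _); rewrite ?mulrN mulrC.
Qed.

Lemma bsK2E (z : R * R) : (bsK z).2 = (2 * pi)^-1 * (z.1 / sqn z).
Proof.
rewrite /bsK /= sqr_sqrtr; last by rewrite addr_ge0// -expr2 sqr_ge0.
have -> : dot z z = sqn z by rewrite /dot /sqn !expr2.
by rewrite invfM -[LHS]mulrA; congr (_ * _); rewrite ?mulrN mulrC.
Qed.

Lemma twopi_gt0 : 0 < 2 * pi :> R.
Proof. by rewrite mulr_gt0// pi_gt0. Qed.

Lemma twopiV_le1 : (2 * pi)^-1 <= 1 :> R.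
Proof.
have : 2 <= pi :> R by exact: pi_ge2.
by rewrite invf_le1 ?twopi_gt0//; lra.
Qed.

Lemma bsK1_le (z : R * R) : `|(bsK z).1| <= `|z|^-1.
Proof.
rewrite bsK1E normrM normrN gtr0_norm ?invr_gt0 ?twopi_gt0//.
rewrite -[leRHS]mul1r; apply: ler_pM => //.
- by rewrite invr_ge0 ltW ?twopi_gt0.
- exact: twopiV_le1.
- by apply: div_sqn_le; exact: norm_snd_le.
Qed.

Lemma bsK2_le (z : R * R) : `|(bsK z).2| <= `|z|^-1.
Proof.
rewrite bsK2E normrM gtr0_norm ?invr_gt0 ?twopi_gt0//.
rewrite -[leRHS]mul1r; apply: ler_pM => //.
- by rewrite invr_ge0 ltW ?twopi_gt0.
- exact: twopiV_le1.
- by apply: div_sqn_le; exact: norm_fst_le.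
Qed.

Lemma measurable_bsK1 : measurable_fun (setT : set R2) (fun z => (bsK z).1).
Proof.
under eq_fun do rewrite bsK1E.
by apply: measurable_funM => //; apply: measurable_funN; exact: measurable_quot2.
Qed.

Lemma measurable_bsK2 : measurable_fun (setT : set R2) (fun z => (bsK z).2).
Proof.
under eq_fun do rewrite bsK2E.
by apply: measurable_funM => //; exact: measurable_quot1.
Qed.

Lemma measurable_sub2 :
  measurable_fun (setT : set (R2 * R2)%type) ((fun z => z.1 - z.2) : _ -> R2).
Proof.
apply: (@measurable_fun_pair _ _ _ _ _ _ (fun z : R2 * R2 => z.1.1 - z.2.1)
    (fun z : R2 * R2 => z.1.2 - z.2.2)).
  apply: measurable_funB.
    by apply: (measurableT_comp measurable_fst); exact: measurable_fst.
  by apply: (measurableT_comp measurable_fst); exact: measurable_snd.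
apply: measurable_funB.
  by apply: (measurableT_comp measurable_snd); exact: measurable_fst.
by apply: (measurableT_comp measurable_snd); exact: measurable_snd.
Qed.

(** The weak form of curl K = delta, from [Rint_radial] after translation by y; the factor 1 / (2
    pi) of the kernel cancels the 2 pi found there. *)
Lemma Rint_bsK_perp L f f1 f2 (y : R * R) : C1c L f f1 f2 ->
  \int[leb2 R]_x ((bsK (x - y)).2 * f1 x - (bsK (x - y)).1 * f2 x) = - f y.
Proof.
move=> Cf; have Cs := C1c_shift y Cf.
have [[cf c1 c2 _ _] f0 f10 f20] := Cf.
rewrite (Rint_translate y); last first.
  apply: measurable_funB; apply: measurable_funM.
  - apply: (measurableT_comp measurable_bsK2).
    under eq_fun do rewrite addrC; exact: measurable_translate2.
  - exact: continuous_measurable2.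
  - apply: (measurableT_comp measurable_bsK1).
    under eq_fun do rewrite addrC; exact: measurable_translate2.
  - exact: continuous_measurable2.
transitivity (\int[leb2 R]_x ((2 * pi)^-1 *
    radial (fun x => f1 (y + x)) (fun x => f2 (y + x)) x)).
  apply: Rint_ext => x; rewrite addrAC subrr add0r bsK1E bsK2E /radial; ring.
have := Rint_radial Cs.
have [[cfs cs1 cs2 _ _] _ fs10 fs20] := Cs.
move=> E; rewrite RintZ; last first.
  apply: intgD; [apply: (intg_quot (q := fst)) cs1 fs10|
                 apply: (intg_quot (q := snd)) cs2 fs20].
  - exact: measurable_quot1.
  - exact: norm_fst_le.
  - exact: measurable_quot2.
  - exact: norm_snd_le.
by rewrite E addr0 mulNr mulrN mulKf// lt0r_neq0// twopi_gt0.
Qed.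

Lemma Rint_bsK_grad L f f1 f2 (y : R * R) : C1c L f f1 f2 ->
  \int[leb2 R]_x ((bsK (x - y)).1 * f1 x + (bsK (x - y)).2 * f2 x) = 0.
Proof.
move=> Cf; have Cs := C1c_shift y Cf.
have [[cf c1 c2 _ _] f0 f10 f20] := Cf.
rewrite (Rint_translate y); last first.
  apply: measurable_funD; apply: measurable_funM.
  - apply: (measurableT_comp measurable_bsK1).
    under eq_fun do rewrite addrC; exact: measurable_translate2.
  - exact: continuous_measurable2.
  - apply: (measurableT_comp measurable_bsK2).
    under eq_fun do rewrite addrC; exact: measurable_translate2.
  - exact: continuous_measurable2.
transitivity (\int[leb2 R]_x ((2 * pi)^-1 *
    angular (fun x => f1 (y + x)) (fun x => f2 (y + x)) x)).
  apply: Rint_ext => x; rewrite addrAC subrr add0r bsK1E bsK2E /angular; ring.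
have := Rint_angular Cs.
have [[cfs cs1 cs2 _ _] _ fs10 fs20] := Cs.
move=> E; rewrite RintZ; first by rewrite E mulr0.
apply: intgB; [apply: (intg_quot (q := fst)) cs2 fs20|
               apply: (intg_quot (q := snd)) cs1 fs10].
- exact: measurable_quot1.
- exact: norm_fst_le.
- exact: measurable_quot2.
- exact: norm_snd_le.
Qed.

End KernelIdentities.

(** If the integral of one part of f is infinite, [fine] gives 0 on both sides. This takes a factor
    out of [kconv], whose integral need not converge at every point. *)
Lemma RintZ_mfun d (T : measurableType d) (R : realType)
    (m : {measure set T -> \bar R}) (c : R) (f : T -> R) :
  measurable_fun setT f -> \int[m]_x (c * f x) = c * \int[m]_x f x.
Proof.
move=> mf; have mE : measurable_fun setT (EFin \o f) by exact/measurable_EFinP.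
wlog c0 : c / 0 <= c.
  move=> h; have [/h//|/ltW c0] := leP 0 c.
  have := h (- c); rewrite oppr_ge0 => /(_ c0).
  by under Rint_ext do rewrite mulNr; rewrite RintN mulNr => /oppr_inj.
have fineM (a b : \bar R) : (0 <= a -> 0 <= b ->
    fine (c%:E * a - c%:E * b) = (c * fine (a - b))%R)%E.
  move: c0; rewrite le_eqVlt => /predU1P[<-|c0].
    by rewrite !mul0e subee// mul0r.
  case: a b => [a| |] [b| |]//= _ _.
  - by rewrite mulrBr.
  - by rewrite mulry gtr0_sg// mul1e mulr0.
  - by rewrite mulry gtr0_sg// mul1e mulr0.
  - by rewrite mulry gtr0_sg// mul1e mulr0.
rewrite /Rintegral [in LHS]integralE [in RHS]integralE.
rewrite (_ : (fun x => (c * f x)%:E) = (fun x => c%:E * (EFin \o f) x)%E)//.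
rewrite ge0_funeposM// ge0_funenegM// !ge0_integralZl_EFin//.
- by apply: fineM; exact: integral_ge0.
- exact: measurable_funeneg.
- exact: measurable_funepos.
Qed.

(** * Convolution with kernels of size 1/|z| *)

Section KernelConvolution.
Variable R : realType.
Local Notation R2 := (measurableTypeR R * measurableTypeR R)%type.
Implicit Types f g om : R * R -> R.

(** Bounds the integral over x in the box of radius L of |k(x - y)|, uniformly in y: the first term
    covers |x - y| <= 1, the second the rest, where |k| <= 1. *)
Definition kmass (L : R) : R :=
  \int[leb2 R]_x (box 1 x * `|x|^-1) + \int[leb2 R]_x box L x.

Variable k : R * R -> R.
Hypothesis mk : measurable_fun (setT : set R2) k.
Hypothesis k_le : forall z, `|k z| <= `|z|^-1.

Lemma measurable_ksub : measurable_fun (setT : set (R2 * R2)%type)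
  (fun z => k (z.1 - z.2)).
Proof. exact: (measurableT_comp mk (@measurable_sub2 R)). Qed.

Lemma measurable_kx (y : R * R) : measurable_fun (setT : set R2) (fun x => k (x - y)).
Proof.
by apply: (measurableT_comp mk); under eq_fun do rewrite addrC;
  exact: measurable_translate2.
Qed.

Lemma measurable_ky (x : R * R) : measurable_fun (setT : set R2) (fun y => k (x - y)).
Proof.
apply: (measurableT_comp mk).
exact: (measurableT_comp (measurable_translate2 x) (@measurable_opp2 R)).
Qed.

Lemma k_split_le L (x y : R * R) :
  `|k (x - y)| * box L x <= box 1 (x - y) * `|x - y|^-1 + box L x.
Proof.
rewrite (boxE 1); case: ifPn => h.
  rewrite mul1r -[leLHS]addr0 lerD ?box_ge0//.
  rewrite -[leRHS]mulr1; apply: ler_pM => //; first exact: box_ge0.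
  by rewrite boxE; case: ifP.
rewrite mul0r add0r -[leRHS]mul1r ler_wpM2r ?box_ge0//.
apply: le_trans (k_le _) _; rewrite invf_le1; first by rewrite ltW// ltNge.
by rewrite (lt_trans ltr01)// ltNge.
Qed.

Lemma intg_k_split L (y : R * R) :
  intg (leb2 R) (fun x => box 1 (x - y) * `|x - y|^-1 + box L x).
Proof.
apply: intgD; last exact: intg_box.
by have := intg_translate (- y) (@intg_rho R 1); apply: intg_ext => x; rewrite addrC.
Qed.

Lemma Rint_k_split L (y : R * R) :
  \int[leb2 R]_x (box 1 (x - y) * `|x - y|^-1 + box L x) = kmass L.
Proof.
rewrite RintD; [|by have := intg_translate (- y) (@intg_rho R 1);
  apply: intg_ext => x; rewrite addrC|exact: intg_box].
rewrite /kmass; congr (_ + _).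
rewrite [RHS](Rint_translate (- y)); first by apply: Rint_ext => x; rewrite addrC.
by apply: intg_mfun; exact: intg_rho.
Qed.

Lemma kmass_ge0 L : 0 <= kmass L.
Proof.
rewrite /kmass addr_ge0// ; apply: Rint_ge0 => x; last exact: box_ge0.
by rewrite mulr_ge0 ?box_ge0// invr_ge0.
Qed.

Lemma intg_kx L C g (y : R * R) : measurable_fun (setT : set R2) g ->
  (forall x, `|g x| <= C * box L x) -> 0 <= C ->
  intg (leb2 R) (fun x => k (x - y) * g x) /\
  \int[leb2 R]_x `|k (x - y) * g x| <= C * kmass L.
Proof.
move=> mg gC C0.
have bnd x : `|k (x - y) * g x| <= C * (box 1 (x - y) * `|x - y|^-1 + box L x).
  apply: le_trans (_ : C * (`|k (x - y)| * box L x) <= _); last first.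
    by rewrite ler_wpM2l// k_split_le.
  by rewrite normrM mulrCA ler_wpM2l.
have mf : measurable_fun (setT : set R2) (fun x => k (x - y) * g x).
  by apply: measurable_funM => //; exact: measurable_kx.
have ib := intgZ C (intg_k_split L y).
have ikg := intg_le mf bnd ib.
split=> //; apply: le_trans (Rint_le (intg_norm ikg) ib bnd) _.
by rewrite RintZ ?Rint_k_split//; exact: intg_k_split.
Qed.

Lemma intg_kprod L C g om : measurable_fun (setT : set R2) g ->
  (forall x, `|g x| <= C * box L x) -> 0 <= C -> intg (leb2 R) om ->
  intg (leb2 R \x leb2 R)%E (fun z => k (z.1 - z.2) * om z.2 * g z.1).
Proof.
move=> mg gC C0 iom.
have mo := intg_mfun iom.
have mF : measurable_fun (setT : set (R2 * R2)%type)
    (fun z => k (z.1 - z.2) * om z.2 * g z.1).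
  apply: measurable_funM; last by apply: (measurableT_comp mg); exact: measurable_fst.
  apply: measurable_funM; first exact: measurable_ksub.
  by apply: (measurableT_comp mo); exact: measurable_snd.
apply: (@intg_tonelli2 _ _ _ _ _ (leb2 R) (leb2 R) _
   (fun y => C * kmass L * `|om y|)) => //; last first.
  by apply: intgZ; exact: intg_norm.
apply: aeW => y /=.
have [ik Ek] := intg_kx y mg gC C0.
have E x : k (x - y) * om y * g x = om y * (k (x - y) * g x) by ring.
split; first by apply: intg_ext (intgZ (om y) ik) => x; rewrite E.
rewrite [leLHS](_ : _ = `|om y| * \int[leb2 R]_x `|k (x - y) * g x|).
  by rewrite mulrC ler_wpM2r.
rewrite -RintZ; last exact: intg_norm.
by apply: Rint_ext => x; rewrite E normrM.
Qed.

Definition kconv om x : R := \int[leb2 R]_y (k (x - y) * om y).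

Lemma measurable_kconv om : measurable_fun (setT : set R2) om ->
  measurable_fun (setT : set R2) (kconv om).
Proof.
move=> mo.
have mF : measurable_fun (setT : set (R2 * R2)%type)
    (fun z => k (z.1 - z.2) * om z.2).
  apply: measurable_funM; first exact: measurable_ksub.
  by apply: (measurableT_comp mo); exact: measurable_snd.
exact: (measurable_Rint (leb2 R) mF).
Qed.

(** Fubini moves the convolution onto the test function. The double integral converges absolutely
    because g is bounded with support in a box, although [kconv om x] may diverge at some x. *)
Lemma kconv_test L C g om : measurable_fun (setT : set R2) g ->
  (forall x, `|g x| <= C * box L x) -> 0 <= C -> intg (leb2 R) om ->
  intg (leb2 R) (fun x => kconv om x * g x) /\
  \int[leb2 R]_x (kconv om x * g x) =
  \int[leb2 R]_y (om y * \int[leb2 R]_x (k (x - y) * g x)).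
Proof.
move=> mg gC C0 iom; have ip := intg_kprod mg gC C0 iom.
have mo := intg_mfun iom.
have E x : \int[leb2 R]_y (k (x - y) * om y * g x) = kconv om x * g x.
  rewrite mulrC -RintZ_mfun.
    by apply: Rint_ext => y; rewrite mulrC.
  by apply: measurable_funM => //; exact: measurable_ky.
split; first by apply: intg_ext (intg_fubini1 ip) => x; exact: E.
transitivity (\int[leb2 R]_x (\int[leb2 R]_y (k (x - y) * om y * g x))).
  by apply: Rint_ext => x; rewrite E.
rewrite (Rfubini ip); apply: Rint_ext => y.
rewrite -RintZ_mfun; first by apply: Rint_ext => x /=; ring.
by apply: measurable_funM => //; exact: measurable_kx.
Qed.

(** By duality: [kconv_test] applied to the sign of the convolution on the box. The constant depends
    on om through its L1 norm alone, hence is uniform in time later. *)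
Lemma kconv_L1loc L om : intg (leb2 R) om ->
  intg (leb2 R) (fun x => `|kconv om x| * box L x) /\
  \int[leb2 R]_x (`|kconv om x| * box L x) <= kmass L * \int[leb2 R]_x `|om x|.
Proof.
move=> iom; have mo := intg_mfun iom; have mv := measurable_kconv mo.
pose g x := Num.sg (kconv om x) * box L x.
have mg : measurable_fun (setT : set R2) g.
  apply: measurable_funM; last exact: measurable_box.
  exact: (measurableT_comp (@measurable_sgr R) mv).
have gC x : `|g x| <= 1 * box L x.
  rewrite normrM (ger0_norm (box_ge0 _ _)) ler_wpM2r ?box_ge0// normr_sg.
  by case: eqP.
have E x : kconv om x * g x = `|kconv om x| * box L x.
  by rewrite /g mulrA [_ * Num.sg _]mulrC -normrEsg.
have [i1 E1] := kconv_test mg gC ler01 iom.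
split; first by apply: intg_ext i1 => x; rewrite E.
have -> : \int[leb2 R]_x (`|kconv om x| * box L x) = \int[leb2 R]_x (kconv om x * g x).
  by apply: Rint_ext => x; rewrite E.
rewrite E1 -RintZ; last exact: intg_norm.
apply: le_trans (ler_norm _) _.
have mi : measurable_fun (setT : set R2) (fun y => \int[leb2 R]_x (k (x - y) * g x)).
  have mF : measurable_fun (setT : set (R2 * R2)%type)
      (fun z => k (z.2 - z.1) * g z.2).
    apply: measurable_funM; last by apply: (measurableT_comp mg); exact: measurable_snd.
    exact: (measurableT_comp measurable_ksub
      (measurable_fun_pair measurable_snd measurable_fst)).
  exact: (measurable_Rint (leb2 R) mF).
apply: Rint_norm_le.
- exact: measurable_funM.
- exact/intgZ/intg_norm.
- move=> y; have [ik Ek] := intg_kx y mg gC ler01.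
  rewrite normrM mulrC ler_wpM2r//; apply: le_trans (Rint_norm ik) _.
  by rewrite mul1r in Ek.
Qed.

End KernelConvolution.

Section BiotSavart.
Variable R : realType.
Local Notation R2 := (measurableTypeR R * measurableTypeR R)%type.
Implicit Types f om : R * R -> R.

Lemma vanish_box L f : continuous f -> vanish L f ->
  exists2 C, 0 <= C & forall x, `|f x| <= C * box L x.
Proof.
move=> cf f0; have [C C0 hC] := vanish_bounded cf f0; exists C => // x.
rewrite boxE; case: ifPn => h; first by rewrite mulr1.
by rewrite f0 ?normr0 ?mulr0// ltNge.
Qed.

Lemma bs_test1 L om f : intg (leb2 R) om -> continuous f -> vanish L f ->
  intg (leb2 R) (fun x => (bs_conv om x).1 * f x) /\
  \int[leb2 R]_x ((bs_conv om x).1 * f x) =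
  \int[leb2 R]_y (om y * \int[leb2 R]_x ((bsK (x - y)).1 * f x)).
Proof.
move=> iom cf f0; have [C C0 hC] := vanish_box cf f0.
exact: (kconv_test (@measurable_bsK1 R) (@bsK1_le R) (continuous_measurable2 cf) hC C0 iom).
Qed.

Lemma bs_test2 L om f : intg (leb2 R) om -> continuous f -> vanish L f ->
  intg (leb2 R) (fun x => (bs_conv om x).2 * f x) /\
  \int[leb2 R]_x ((bs_conv om x).2 * f x) =
  \int[leb2 R]_y (om y * \int[leb2 R]_x ((bsK (x - y)).2 * f x)).
Proof.
move=> iom cf f0; have [C C0 hC] := vanish_box cf f0.
exact: (kconv_test (@measurable_bsK2 R) (@bsK2_le R) (continuous_measurable2 cf) hC C0 iom).
Qed.

Lemma intg_om_kint (k : R * R -> R) om f L :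
  measurable_fun (setT : set R2) k -> (forall z, `|k z| <= `|z|^-1) ->
  intg (leb2 R) om -> continuous f -> vanish L f ->
  intg (leb2 R) (fun y => om y * \int[leb2 R]_x (k (x - y) * f x)).
Proof.
move=> mk kle iom cf f0; have [C C0 hC] := vanish_box cf f0.
have ip := intg_kprod mk kle (continuous_measurable2 cf) hC C0 iom.
apply: intg_ext (intg_fubini2 ip) => y /=.
rewrite -RintZ_mfun; first by apply: Rint_ext => x; ring.
by apply: measurable_funM; [exact: measurable_kx|exact: continuous_measurable2].
Qed.

Lemma intg_kx_cont (k : R * R -> R) f L (y : R * R) :
  measurable_fun (setT : set R2) k -> (forall z, `|k z| <= `|z|^-1) ->
  continuous f -> vanish L f -> intg (leb2 R) (fun x => k (x - y) * f x).
Proof.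
move=> mk kle cf f0; have [C C0 hC] := vanish_box cf f0.
by have [] := intg_kx mk kle y (continuous_measurable2 cf) hC C0.
Qed.

(** The convolution is transferred to the test function, where [Rint_bsK_perp] evaluates the inner
    integral at each y: the curl of K * om is om. *)
Lemma bs_perp_test L om f f1 f2 : intg (leb2 R) om -> C1c L f f1 f2 ->
  \int[leb2 R]_x ((bs_conv om x).2 * f1 x - (bs_conv om x).1 * f2 x) =
  - \int[leb2 R]_x (om x * f x).
Proof.
move=> iom Cf; have [[_ c1 c2 _ _] _ f10 f20] := Cf.
have [i1 E1] := bs_test2 iom c1 f10; have [i2 E2] := bs_test1 iom c2 f20.
rewrite RintB// E1 E2 -RintB; last 2 first.
- exact: (intg_om_kint (@measurable_bsK2 R) (@bsK2_le R) iom c1 f10).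
- exact: (intg_om_kint (@measurable_bsK1 R) (@bsK1_le R) iom c2 f20).
rewrite -RintN; apply: Rint_ext => y; rewrite -mulrBr -RintB.
- by rewrite (Rint_bsK_perp y Cf) mulrN.
- exact: (intg_kx_cont y (@measurable_bsK2 R) (@bsK2_le R) c1 f10).
- exact: (intg_kx_cont y (@measurable_bsK1 R) (@bsK1_le R) c2 f20).
Qed.

Lemma bs_grad_test L om f f1 f2 : intg (leb2 R) om -> C1c L f f1 f2 ->
  \int[leb2 R]_x ((bs_conv om x).1 * f1 x + (bs_conv om x).2 * f2 x) = 0.
Proof.
move=> iom Cf; have [[_ c1 c2 _ _] _ f10 f20] := Cf.
have [i1 E1] := bs_test1 iom c1 f10; have [i2 E2] := bs_test2 iom c2 f20.
rewrite RintD// E1 E2 -RintD; last 2 first.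
- exact: (intg_om_kint (@measurable_bsK1 R) (@bsK1_le R) iom c1 f10).
- exact: (intg_om_kint (@measurable_bsK2 R) (@bsK2_le R) iom c2 f20).
transitivity (\int[leb2 R]_y (fun=> 0 : R) y); last by rewrite /Rintegral integral0.
apply: Rint_ext => y; rewrite -mulrDr -RintD.
- by rewrite (Rint_bsK_grad y Cf) mulr0.
- exact: (intg_kx_cont y (@measurable_bsK1 R) (@bsK1_le R) c1 f10).
- exact: (intg_kx_cont y (@measurable_bsK2 R) (@bsK2_le R) c2 f20).
Qed.

End BiotSavart.

(** * Mollification *)

Section CkAlgebra.
Variables (R : realType) (V : normedModType R).
Implicit Types (D : set V) (f g : V -> R).

Lemma CkW (W : normedModType R) D n (f : V -> W) : Ck D n.+1 f -> Ck D n f.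
Proof.
elim: n f => [|n IH] f [cf h]; first by split.
split=> // u; have [g [Cg dg]] := h u; exists g; split => //; exact: IH.
Qed.

Lemma Ck0 (W : normedModType R) D n (f : V -> W) : Ck D n f -> {within D, continuous f}.
Proof. by case: n => [|n] []. Qed.

Lemma Ck_add D n f g : Ck D n f -> Ck D n g -> Ck D n (fun x => f x + g x).
Proof.
elim: n f g => [|n IH] f g [cf hf] [cg hg]; split => //.
- by move=> x; apply: cvgD; [exact: cf|exact: cg].
- by move=> x; apply: cvgD; [exact: cf|exact: cg].
move=> u; have [f' [Cf' df']] := hf u; have [g' [Cg' dg']] := hg u.
exists (fun x => f' x + g' x); split; first exact: IH.
by move=> p Dp; apply: is_deriveD; [exact: df'|exact: dg'].
Qed.

Lemma Ck_mul D n f g : Ck D n f -> Ck D n g -> Ck D n (fun x => f x * g x).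
Proof.
elim: n f g => [|n IH] f g [cf hf] [cg hg]; split => //.
- by move=> x; apply: cvgM; [exact: cf|exact: cg].
- by move=> x; apply: cvgM; [exact: cf|exact: cg].
move=> u; have [f' [Cf' df']] := hf u; have [g' [Cg' dg']] := hg u.
exists (fun x => f' x * g x + f x * g' x); split.
  by apply: Ck_add; apply: IH => //; apply: CkW; split.
move=> p Dp; have := is_deriveM (df' p Dp) (dg' p Dp).
by rewrite [_ *: _ + _]addrC [g p *: _]mulrC.
Qed.

Lemma Ck_cst D n (c : R) : Ck D n (fun=> c).
Proof.
elim: n c => [|n IH] c; split => //; try by move=> x; exact: cvg_cst.
move=> u; exists (fun=> 0); split => // p _; exact: is_derive_cst.
Qed.

Lemma Ck_scale D n (c : R) f : Ck D n f -> Ck D n (fun x => c * f x).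
Proof. by move=> h; apply: Ck_mul => //; exact: Ck_cst. Qed.

Lemma Ck_ext D n f g : (forall x, f x = g x) -> Ck D n f -> Ck D n g.
Proof. by move=> /funext ->. Qed.

End CkAlgebra.

Section ExpInv.
Variable R : realType.
Implicit Types (P : {poly R}) (r : R).

(** With P arbitrary the family is stable under differentiation, so smoothness of the standard bump
    is one induction over all P; the bump itself is the case P = 1. *)
Definition expinv P r : R := if r <= 0 then 0 else P.[r^-1] * expR (- r^-1).

Lemma poly_growth P : exists C n, 0 <= C /\ forall y, 1 <= y -> `|P.[y]| <= C * y ^+ n.
Proof.
elim/poly_ind: P => [|P c [C [n [C0 h]]]].
  by exists 0, 0%N; split => // y _; rewrite horner0 normr0 mul0r.
exists (C + `|c|), n.+1; split; first exact: addr_ge0.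
move=> y y1; have y0 : 0 <= y by apply: le_trans y1.
rewrite hornerMXaddC; apply: le_trans (ler_normD _ _) _; rewrite mulrDl lerD//.
  by rewrite normrM exprSr mulrA (ger0_norm y0) ler_wpM2r// h.
by rewrite ler_peMr// exprn_ege1.
Qed.

(** With y = 1/r, the bound exp(y) >= y^(n+1) / (n+1)! beats the growth y^n of P by one power of
    r. *)
Lemma expinv_small P : exists2 C, 0 <= C &
  forall r, 0 < r <= 1 -> `|expinv P r| <= C * r.
Proof.
have [C [n [C0 h]]] := poly_growth P.
exists (C * n.+1`!%:R); first by rewrite mulr_ge0.
move=> r /andP[r0 r1]; rewrite /expinv (leNgt r 0) r0/=.
have y1 : 1 <= r^-1 by rewrite invf_ge1.
have y0 : 0 <= r^-1 by apply: le_trans y1.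
rewrite normrM (gtr0_norm (expR_gt0 _)) expRN.
rewrite ler_pdivrMr ?expR_gt0//; apply: le_trans (h _ y1) _.
rewrite -!mulrA ler_wpM2l//.
have := expR_ge1Dxn n y0; rewrite exprSr => H.
have {}H : r^-1 ^+ n * r^-1 / n.+1`!%:R <= expR r^-1 by apply: le_trans H; rewrite lerDr.
rewrite ler_pdivrMr ?ltr0n ?fact_gt0// in H.
rewrite -(@ler_pM2r _ r^-1) ?invr_gt0//; apply: le_trans H _.
by rewrite le_eqVlt; apply/orP; left; apply/eqP; field; exact: lt0r_neq0.
Qed.

(* d/dr (P(1/r) exp(-1/r)) = Q(1/r) exp(-1/r) with Q = X^2 (P - P'). *)
Definition expinv' P : {poly R} := 'X^2 * (P - P^`()).

Lemma is_derive_expinv P r : is_derive r (1 : R) (expinv P) (expinv (expinv' P) r).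
Proof.
have [r0|r0|->] := ltgtP r 0.
- rewrite {2}/expinv (ltW r0).
  apply: (@near_eq_is_derive _ _ _ (fun=> 0)).
  + by near=> s; rewrite /expinv ifT// ltW//; near: s; exact: lt_nbhsl.
- have rn0 : r != 0 by exact: lt0r_neq0.
  have dV : is_derive r (1 : R) (fun s : R => s^-1) (- r ^- 2 * 1).
    exact: (derV (f := id) rn0 (is_derive_id r 1)).
  have dN : is_derive r (1 : R) (fun s : R => - s^-1) (- (- r ^- 2 * 1)).
    exact: is_deriveN.
  have d1 := @is_derive1_comp _ _ (fun s : R => s^-1) _ _ _ (is_derive_poly P r^-1) dV.
  have d2 := @is_derive1_comp _ _ (fun s : R => - s^-1) _ _ _ (is_derive_expR (- r^-1)) dN.
  have d3 : is_derive r (1 : R) (fun s => P.[s^-1] * expR (- s^-1))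
      (expinv (expinv' P) r).
    have := derM d1 d2.
    rewrite /expinv (leNgt r 0) r0/= /expinv' !hornerE/= -exprVn => H.
    by apply: is_derive_eq H _; ring.
  apply: near_eq_is_derive d3.
  near=> s; rewrite /expinv ifF// (leNgt s 0); apply/negbTE/negPn; near: s.
  exact: lt_nbhsr.
- rewrite {2}/expinv lexx; apply/is_deriveE.
  (* The extra factor X, worth 1/h at h, absorbs the division by h, so the difference quotient at 0
     is itself an [expinv], of size O(h). *)
  have [C C0 hC] := expinv_small ('X * P).
  apply/cvgrPdist_le => e e0; near=> h.
  rewrite sub0r normrN {2}/expinv lexx subr0 addr0 [h *: 1]mulr1.
  have [h0|h0] := leP h 0; first by rewrite /expinv h0 scaler0 normr0 ltW.
  have -> : h^-1 *: expinv P h = expinv ('X * P) h.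
    by rewrite /expinv (leNgt h 0) h0/= hornerM hornerX [_ *: _]mulrA.
  apply: (@le_trans _ _ (C * h)).
    apply: hC; rewrite h0/=.
    have : `|h| < 1 by near: h; exact: dnbhs0_lt.
    by rewrite gtr0_norm// => /ltW.
  have : `|h| <= e / (C + 1).
    by near: h; apply: dnbhs0_le; rewrite divr_gt0// ltr_wpDl.
  rewrite gtr0_norm// ler_pdivlMr ?ltr_wpDl// mulrDr mulr1 mulrC => H.
  by apply: le_trans H; rewrite lerDl ltW.
Unshelve. all: end_near. Qed.

Lemma expinv_continuous P : continuous (expinv P).
Proof.
move=> r; apply: differentiable_continuous; apply/derivable1_diffP.
by have [] := is_derive_expinv P r.
Qed.

Lemma Ck_expinv n P (c a b : R) :
  Ck [set: R * R] n (fun x : R * R => expinv P (c + a * x.1 + b * x.2)).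
Proof.
have cl : continuous (fun x : R * R => c + a * x.1 + b * x.2).
  move=> x; apply: cvgD; last by apply: cvgM; [exact: cvg_cst|exact: cvg_snd].
  apply: cvgD; first exact: cvg_cst.
  by apply: cvgM; [exact: cvg_cst|exact: cvg_fst].
have cc Q : continuous (fun x : R * R => expinv Q (c + a * x.1 + b * x.2)).
  move=> x; apply: (@continuous_comp _ _ _ (fun x : R * R => c + a * x.1 + b * x.2) (expinv Q)).
    exact: cl.
  exact: expinv_continuous.
elim: n P => [|n IH] P; split => //; try exact: continuous_subspaceT.
move=> u; exists (fun x => (a * u.1 + b * u.2) * expinv (expinv' P) (c + a * x.1 + b * x.2)).
split; first exact: Ck_scale.
move=> p _; apply/is_derive_lin0.
have -> : (fun s : R => expinv P (c + a * (s *: u + p).1 + b * (s *: u + p).2)) =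
    expinv P \o (fun s : R => (c + a * p.1 + b * p.2) + (a * u.1 + b * u.2) * s).
  apply/funext => s /=; congr expinv.
  rewrite -![s *: _]/(s * _); ring.
rewrite [X in is_derive _ _ _ X]mulrC; apply: is_derive1_comp.
  by rewrite mulr0 addr0; exact: is_derive_expinv.
have := derD (is_derive_cst (c + a * p.1 + b * p.2) (0 : R) 1)
  (derM (is_derive_cst (a * u.1 + b * u.2) (0 : R) 1) (is_derive_id (0 : R) 1)).
by move=> H; apply: is_derive_eq H _; rewrite /=; ring.
Qed.

End ExpInv.

Section Mollifier.
Variable R : realType.
Local Notation R2 := (measurableTypeR R * measurableTypeR R)%type.
Implicit Types f g : R * R -> R.

Record mollifier (d : R) (eta : R * R -> R) : Prop := Mollifier {
  mol_Ck : forall n, Ck [set: R * R] n eta;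
  mol_cont : continuous eta;
  mol_ge0 : forall x, 0 <= eta x;
  mol_vanish : vanish d eta;
  mol_int : \int[leb2 R]_x eta x = 1 }.

Lemma expinv1_ge0 (r : R) : 0 <= expinv 1 r.
Proof. by rewrite /expinv; case: ifP => // _; rewrite hornerC mul1r expR_ge0. Qed.

Lemma expinv1_gt (r d : R) : 0 < d <= r -> expinv 1 d <= expinv 1 r.
Proof.
move=> /andP[d0 dr]; have r0 := lt_le_trans d0 dr.
rewrite /expinv (leNgt d 0) (leNgt r 0) d0 r0/= !hornerC !mul1r ler_expR lerN2.
by rewrite lef_pV2 ?posrE.
Qed.

Lemma expinv1_gt0 (r : R) : 0 < r -> 0 < expinv 1 r.
Proof. by move=> r0; rewrite /expinv (leNgt r 0) r0/= hornerC mul1r expR_gt0. Qed.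

Lemma continuous_within_setT (V W : topologicalType) (f : V -> W) :
  {within [set: V], continuous f} -> continuous f.
Proof.
move=> cf x; have := cf x; rewrite /continuous_at.
by rewrite (nbhs_subspaceT x).
Qed.

Lemma mollifier_exists (d : R) : 0 < d -> exists eta, mollifier d eta.
Proof.
move=> d0.
pose e (c a b : R) (x : R * R) := expinv 1 (c + a * x.1 + b * x.2).
(* One factor for each side of the square of radius d: it vanishes on and beyond that side. *)
pose h (x : R * R) := (e d (-1) 0 x * e d 1 0 x) * (e d 0 (-1) x * e d 0 1 x).
have hC n : Ck [set: R * R] n h.
  by apply: Ck_mul; apply: Ck_mul; exact: Ck_expinv.
have hc : continuous h by apply: continuous_within_setT; exact: Ck0 (hC 0%N).
have h0 x : 0 <= h x by rewrite !mulr_ge0// expinv1_ge0.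
have hv : vanish d h.
  move=> x; rewrite prod_normE lt_max => /orP[]; rewrite lter_normr => /orP[] H.
  - by rewrite /h {1}/e /expinv ifT ?mul0r//; rewrite -subr_ge0; lra.
  - by rewrite /h {2}/e /expinv ifT ?(mul0r, mulr0)//; lra.
  - by rewrite /h {3}/e /expinv ifT ?(mul0r, mulr0)//; lra.
  - by rewrite /h {4}/e /expinv ifT ?(mul0r, mulr0)//; lra.
have ih : intg (leb2 R) h by exact: intg_cont_vanish hv.
have I0 : 0 < \int[leb2 R]_x h x.
  (* On the square of half size each of the four affine forms is at least d / 2, so the product is
     at least this constant and the integral is positive. *)
  pose c := expinv 1 (d / 2) ^+ 4.
  have c0 : 0 < c by rewrite exprn_gt0// expinv1_gt0// divr_gt0.
  have hb x : c * box (d / 2) x <= h x.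
    rewrite boxE; case: ifPn => [|_]; last by rewrite mulr0.
    rewrite prod_normE ge_max !ler_norml mulr1 => /andP[/andP[a1 a2] /andP[b1 b2]].
    have m t : d / 2 <= t -> expinv 1 (d / 2) <= expinv 1 t.
      by move=> dt; rewrite expinv1_gt// divr_gt0.
    rewrite /c (exprD _ 2 2) !expr2 /h.
    by apply: ler_pM; rewrite ?mulr_ge0 ?expinv1_ge0//; apply: ler_pM;
      rewrite ?expinv1_ge0//; apply: m; lra.
  apply: lt_le_trans (Rint_le (intgZ c (intg_box (d / 2))) ih hb).
  rewrite RintZ ?intg_box// mulr_gt0// leb2_Rfubini1 ?intg_box//.
  have E a : \int[leb R]_b box (d / 2) (a, b) =
      d * \1_(`[- (d / 2), d / 2]%classic : set R) a.
    transitivity (\int[leb R]_b (\1_(`[- (d / 2), d / 2]%classic : set R) a *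
      \1_(`[- (d / 2), d / 2]%classic : set R) b)) => //.
    rewrite (@RintZ _ _ _ (leb R)); last exact: intg_indic_itv.
    rewrite Rint_indic_itv ?divr_ge0 ?(ltW d0)//.
    by rewrite [RHS]mulrC; congr (_ * _); rewrite mulrC mulfVK.
  rewrite (_ : \int[leb R]_a _ = \int[leb R]_a (d * \1_(`[- (d / 2), d / 2]%classic : set R) a)).
    rewrite RintZ ?intg_indic_itv// Rint_indic_itv ?divr_ge0 ?(ltW d0)//.
    by rewrite !mulr_gt0// divr_gt0.
  by apply: Rint_ext => a; exact: E.
exists (fun x => (\int[leb2 R]_x h x)^-1 * h x); split.
- by move=> n; exact: Ck_scale.
- by move=> x; apply: cvgM; [exact: cvg_cst|exact: hc].
- by move=> x; rewrite mulr_ge0// invr_ge0 ltW.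
- by move=> x dx; rewrite hv// mulr0.
- by rewrite RintZ// mulVf// lt0r_neq0.
Qed.

End Mollifier.

Section Convolution.
Variable R : realType.
Local Notation R2 := (measurableTypeR R * measurableTypeR R)%type.
Implicit Types f g eta : R * R -> R.

Definition L1loc g : Prop := measurable_fun (setT : set R2) g /\
  forall L, intg (leb2 R) (fun x => `|g x| * box L x).

Lemma L1loc_intg L C f g : L1loc g -> measurable_fun (setT : set R2) f ->
  (forall x, `|f x| <= C * box L x) -> 0 <= C ->
  intg (leb2 R) (fun x => f x * g x) /\
  \int[leb2 R]_x `|f x * g x| <= C * \int[leb2 R]_x (`|g x| * box L x).
Proof.
move=> [mg ig] mf fC C0.
have b x : `|f x * g x| <= C * (`|g x| * box L x).
  by rewrite normrM mulrC mulrCA ler_wpM2l.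
have i : intg (leb2 R) (fun x => f x * g x).
  by apply: intg_le (intgZ C (ig L)) => //; exact: measurable_funM.
split => //; rewrite -RintZ//; apply: Rint_le => //; first exact: intg_norm.
exact: intgZ.
Qed.

Lemma intg_L1loc g : intg (leb2 R) g -> L1loc g.
Proof.
move=> ig; split; first exact: intg_mfun ig.
move=> L; apply: intg_le (intg_norm ig).
  apply: measurable_funM; last exact: measurable_box.
  by apply: measurableT_comp => //; exact: intg_mfun ig.
move=> x; rewrite normrM normr_id boxE; case: ifP => _.
  by rewrite normr1 mulr1.
by rewrite normr0 mulr0.
Qed.

Lemma cont_L1loc g : continuous g -> L1loc g.
Proof.
move=> cg; split; first exact: continuous_measurable2.
move=> L.
have [C C0 hC] : exists2 C, 0 <= C & forall x, `|x| <= L -> `|g x| <= C.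
  have [K0|K0] := pselect ([set x : R * R | `|x| <= L] !=set0); last first.
    by exists 0 => // x xL; exfalso; apply: K0; exists x.
  have [|c _ hc] := @compact_EVT_max _ _ (fun x => `|g x|) _ K0 (@compact_square R L).
    by apply: continuous_subspaceT => x; apply: cvg_norm; exact: cg.
  by exists `|g c| => // x xL; apply: hc; rewrite inE.
apply: (@intg_vanish _ L _ C).
- apply: measurable_funM; last exact: measurable_box.
  by apply: measurableT_comp => //; exact: continuous_measurable2.
- move=> x; rewrite normrM normr_id boxE; case: ifPn => xL.
    by rewrite normr1 mulr1 hC.
  by rewrite normr0 mulr0.
- by move=> x Lx; rewrite boxE leNgt Lx mulr0.
Qed.

Definition conv f g (x : R * R) : R := \int[leb2 R]_y (f (x - y) * g y).

Lemma measurable_sub_l (x : R * R) : measurable_fun (setT : set R2) ((fun y => x - y) : R2 -> R2).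
Proof. exact: (measurableT_comp (measurable_translate2 x) (@measurable_opp2 R)). Qed.

Lemma convC f g : measurable_fun (setT : set R2) f ->
  measurable_fun (setT : set R2) g -> conv f g =1 conv g f.
Proof.
move=> mf mg x; rewrite /conv (Rint_reflect x); last first.
  by apply: measurable_funM => //; exact: (measurableT_comp mf (measurable_sub_l x)).
by apply: Rint_ext => y; rewrite opprB addrC subrK mulrC.
Qed.

Lemma vanish_sub_box L f C (x y : R * R) N : 0 <= C -> (forall x, `|f x| <= C * box L x) ->
  `|x| <= N -> `|f (x - y)| <= C * box (L + N) y.
Proof.
move=> C0 fC xN; apply: le_trans (fC _) _; rewrite ler_wpM2l// !boxE.
case: ifPn => h; last by case: ifP.
by rewrite ifT//; have := lerB_dist y x; rewrite distrC; lra.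
Qed.

Lemma conv_int_intg L f g (x : R * R) : continuous f -> vanish L f -> L1loc g ->
  intg (leb2 R) (fun y => f (x - y) * g y).
Proof.
move=> cf f0 lg; have [C C0 hC] := vanish_box cf f0.
have [] := @L1loc_intg (L + `|x|) C (fun y => f (x - y)) g lg _ _ C0 => //.
- exact: (measurableT_comp (continuous_measurable2 cf) (measurable_sub_l x)).
- by move=> y; exact: vanish_sub_box.
Qed.

Lemma conv_continuous L f g : continuous f -> vanish L f -> L1loc g ->
  continuous (conv f g).
Proof.
move=> cf f0 lg x; apply/cvgrPdist_le => e e0.
pose N := `|x| + 1.
pose I := \int[leb2 R]_y (`|g y| * box (L + N) y).
have I0 : 0 <= I by apply: Rint_ge0 => y; rewrite mulr_ge0 ?box_ge0.
have e1 : 0 < e / (I + 1) by rewrite divr_gt0// ltr_wpDl.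
have f0' z : ~ [set x : R * R | `|x| <= L] z -> f z = 0.
  by move=> /= /negP; rewrite -ltNge; exact: f0.
have [d d0 hd] := csupp_uniform (@compact_square R L) cf f0' e1.
near=> x'.
have xx' : `|x - x'| < d by near: x'; exact: cvgr_dist_lt.
have x'N : `|x'| <= N.
  have : `|x - x'| < 1 by near: x'; exact: cvgr_dist_lt.
  by have := lerB_dist x' x; rewrite distrC /N; lra.
have xN : `|x| <= N by rewrite /N lerDl.
rewrite /conv -RintB; [|exact: conv_int_intg f0 lg|exact: conv_int_intg f0 lg].
have E y : f (x - y) * g y - f (x' - y) * g y = (f (x - y) - f (x' - y)) * g y by ring.
rewrite (_ : \int[leb2 R]_y _ = \int[leb2 R]_y ((f (x - y) - f (x' - y)) * g y));
  last by apply: Rint_ext => y; rewrite E.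
have b y : `|f (x - y) - f (x' - y)| <= e / (I + 1) * box (L + N) y.
  rewrite boxE; case: ifPn => yL.
    rewrite mulr1 ltW//; apply: hd.
    by rewrite opprB addrA subrK.
  have far z : `|z| <= N -> f (z - y) = 0.
    move=> zN; apply: f0; move: yL; rewrite -ltNge => yL.
    by have := lerB_dist y z; rewrite distrC; lra.
  by rewrite !far// subrr normr0 mulr0.
have mm : measurable_fun (setT : set R2) (fun y => f (x - y) - f (x' - y)).
  by apply: measurable_funB; apply: (measurableT_comp (continuous_measurable2 cf));
    exact: measurable_sub_l.
have [i1 i2] := L1loc_intg lg mm b (ltW e1).
apply: le_trans (Rint_norm i1) _; apply: le_trans i2 _; rewrite -/I.
by rewrite mulrAC ler_pdivrMr ?ltr_wpDl// ler_wpM2l ?(ltW e0)// lerDl.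
Unshelve. all: end_near. Qed.

Lemma conv_vanish L M f g : vanish L f -> vanish M g -> vanish (L + M) (conv f g).
Proof.
move=> f0 g0 x Lx; transitivity (\int[leb2 R]_y (fun=> 0 : R) y); last first.
  by rewrite /Rintegral integral0.
apply: Rint_ext => y; have [yM|yM] := leP `|y| M; last by rewrite g0// mulr0.
rewrite f0 ?mul0r//; have := lerB_dist x y; lra.
Qed.

(** Differentiation under the integral: for |r| < 1 the points r u + x stay in the ball of radius
    |u| + |x|, so the integrands are dominated by a multiple of |g| on one fixed box. *)
Lemma conv_derive L f fu g (x u : R * R) : continuous f -> vanish L f ->
  continuous fu -> vanish L fu -> L1loc g ->
  (forall x, is_derive x u f (fu x)) ->
  is_derive x u (conv f g) (conv fu g x).
Proof.
move=> cf f0 cfu fu0 lg df; have [mg ig] := lg.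
pose F (r : R) y := f (r *: u + x - y) * g y.
have dF (r : R) (y : R * R) : is_derive r (1 : R) (F ^~ y) (fu (r *: u + x - y) * g y).
  have h : is_derive r (1 : R) (fun s : R => f (s *: u + (x - y))) (fu (r *: u + (x - y))).
    exact: (@is_derive_line R (R * R)%type f (x - y) u r _).1 (df _).
  have := derM h (is_derive_cst (g y) r 1).
  rewrite mulr0 addr0 addrA (_ : (fun s : R => _) = F ^~ y)//.
  by apply/funext => s; rewrite /F addrA.
have [C C0 hC] := vanish_box cfu fu0.
pose N := `|u| + `|x|.
have sN (r : R) : r \in `]-1, 1[ -> `|r *: u + x| <= N.
  rewrite in_itv/= => /andP[r1 r2]; apply: le_trans (ler_normD _ _) _.
  rewrite /N lerD2r normrZ ler_piMl//; rewrite ler_norml; lra.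
have partE (r : R) (y : R * R) : partial1of2 F r y = fu (r *: u + x - y) * g y.
  by rewrite partial1of2E; have [_ ->] := dF r y.
have key := @cvg_differentiation_under_integral R _ R2 (leb2 R) F setT measurableT
  0 (-1) 1 _ _ _ (fun y => C * (`|g y| * box (L + N) y)) _ _ _.
apply/is_derive_lin0/is_deriveE.
have -> : conv fu g x = \int[leb2 R]_y partial1of2 F 0 y.
  by apply: Rint_ext => y; rewrite partE scale0r add0r.
have -> : (fun h : R => h^-1 *: (conv f g ((h *: (1 : R) + 0) *: u + x) - conv f g (0 *: u + x))) =
   (fun h : R => h^-1 *: (\int[leb2 R]_y F (h + 0) y - \int[leb2 R]_y F 0 y)).
  by apply/funext => h; rewrite [h *: 1]mulr1.
apply: key.
- by rewrite /= in_itv/= ltrN10 ltr01.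
- by move=> r _; exact: conv_int_intg f0 lg.
- by move=> r y _ _; have [] := dF r y.
- by move=> y; rewrite mulr_ge0// mulr_ge0// box_ge0.
- exact/intgZ/ig.
- move=> r y Ir _; rewrite partE normrM mulrC mulrCA ler_wpM2l//.
  by apply: vanish_sub_box => //; exact: sN.
Qed.

End Convolution.

Section MollifiedTest.
Variable R : realType.
Local Notation R2 := (measurableTypeR R * measurableTypeR R)%type.
Implicit Types f g eta : R * R -> R.

Lemma derive_vanish L f fu (u : R * R) : vanish L f ->
  (forall x, is_derive x u f (fu x)) -> vanish L fu.
Proof.
move=> f0 df x Lx; have [_ <-] := df x.
suff : is_derive x u f 0 by case.
apply: (@near_eq_is_derive _ _ _ (fun=> 0)).
have e0 : 0 < `|x| - L by rewrite subr_gt0.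
apply/nbhs_normP; exists (`|x| - L) => //= y xy.
rewrite f0//; have := lerB_dist x y; move: xy; rewrite /=; lra.
Qed.

Lemma conv_Ck n L eta g : Ck [set: R * R] n eta -> vanish L eta -> L1loc g ->
  Ck [set: R * R] n (conv eta g).
Proof.
move=> + + lg; elim: n eta => [|n IH] eta Ce v.
  split => //; apply: continuous_subspaceT; apply: (conv_continuous (L := L)) => //.
  by apply: continuous_within_setT; exact: Ck0 Ce.
have ce : continuous eta by apply: continuous_within_setT; exact: Ck0 Ce.
split; first by apply: continuous_subspaceT; exact: (conv_continuous ce v lg).
move=> u; have [_ /(_ u) [eu [Ceu deu]]] := Ce.
have deu' x : is_derive x u eta (eu x) by apply: deu; rewrite interiorT.
have veu := derive_vanish v deu'.
exists (conv eu g); split; first exact: IH.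
move=> p _; apply: (conv_derive (L := L)) => //.
by apply: continuous_within_setT; exact: Ck0 Ceu.
Qed.

Lemma mollifier_int d eta x : mollifier d eta ->
  intg (leb2 R) (fun y => eta (x - y)) /\ \int[leb2 R]_y eta (x - y) = 1.
Proof.
move=> m; have ie := intg_cont_vanish (mol_cont m) (mol_vanish m).
split; first exact: (intg_reflect x ie).
by rewrite -(Rint_reflect x) ?(mol_int m)//; exact: intg_mfun ie.
Qed.

Lemma mollifier_close d eta f e : mollifier d eta -> continuous f -> 0 <= e ->
  (forall x y, `|x - y| <= d -> `|f x - f y| <= e) ->
  forall x, `|conv eta f x - f x| <= e.
Proof.
move=> m cf e0 h x; have [i1 E1] := mollifier_int x m.
have ic := conv_int_intg x (mol_cont m) (mol_vanish m) (cont_L1loc cf).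
rewrite (_ : conv eta f x - f x = \int[leb2 R]_y (eta (x - y) * (f y - f x))); last first.
  transitivity (\int[leb2 R]_y (eta (x - y) * f y - f x * eta (x - y))).
    by rewrite RintB//; [rewrite RintZ// E1 mulr1|exact: intgZ].
  by apply: Rint_ext => y; ring.
rewrite -[leRHS]mulr1 -E1 -RintZ//; apply: Rint_norm_le.
- apply: measurable_funM; first exact: intg_mfun i1.
  by apply: measurable_funB => //; exact: continuous_measurable2.
- exact: intgZ.
- move=> y; rewrite normrM (ger0_norm (mol_ge0 m _)) mulrC.
  have [xy|xy] := leP `|x - y| d.
    by rewrite ler_wpM2r ?(mol_ge0 m)// h// distrC.
  by rewrite (mol_vanish m)// !mulr0.
Qed.

(** The error is a multiple of a fixed constant, the form in which the approximation estimates below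
    come out. *)
Lemma eq_by_eps (a b S : R) : 0 <= S -> (forall e, 0 < e -> `|a - b| <= e * S) -> a = b.
Proof.
move=> S0 h; apply/eqP; rewrite -subr_eq0 -normr_le0.
apply/ler_addgt0Pr => e e0; rewrite add0r.
have e1 : 0 < e / (S + 1) by rewrite divr_gt0// ltr_wpDl.
apply: le_trans (h _ e1) _.
by rewrite mulrAC ler_pdivrMr ?ltr_wpDl// ler_wpM2l ?(ltW e0)// lerDl.
Qed.

Lemma vanish_uniform L f : continuous f -> vanish L f -> forall e, 0 < e ->
  exists2 d, 0 < d & forall x y, `|x - y| <= d -> `|f x - f y| <= e.
Proof.
move=> cf f0 e e0.
have f0' z : ~ [set x : R * R | `|x| <= L] z -> f z = 0.
  by move=> /= /negP; rewrite -ltNge; exact: f0.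
have [d d0 hd] := csupp_uniform (@compact_square R L) cf f0' e0.
exists (d / 2); first by rewrite divr_gt0.
move=> x y xy; apply/ltW/hd/(le_lt_trans xy).
by rewrite ltr_pdivrMr// ltr_pMr// ltr1n.
Qed.

Lemma normr_diff3_le (A1 A2 A3 B1 B2 B3 J1 J2 J3 e : R) :
  `|A1 - B1| <= e * J1 -> `|A2 - B2| <= e * J2 -> `|A3 - B3| <= e * J3 ->
  B1 - B2 = B3 -> `|A1 - A2 - A3| <= e * (J1 + J2 + J3).
Proof.
rewrite !ler_norml !mulrDr.
by move=> /andP[? ?] /andP[? ?] /andP[? ?] ?; apply/andP; split; lra.
Qed.

(** [curl_eq] speaks of smooth tests. Here the test function is mollified, not the velocity: f and
    its two derivatives are approximated uniformly within a fixed box, on which v and w are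
    integrable. *)
Lemma curl_eq_C1c L (v : R * R -> R * R) (w f f1 f2 : R * R -> R) :
  L1loc (fun x => (v x).1) -> L1loc (fun x => (v x).2) -> L1loc w ->
  curl_eq v w -> C1c L f f1 f2 ->
  \int[leb2 R]_x ((v x).1 * f2 x - (v x).2 * f1 x) = \int[leb2 R]_x (w x * f x).
Proof.
move=> l1 l2 lw hv Cf; have [CC f0 f10 f20] := Cf.
have [cf c1 c2 _ _] := CC.
pose I (g : R * R -> R) := \int[leb2 R]_x (`|g x| * box (L + 1) x).
have I0 g : 0 <= I g by apply: Rint_ge0 => x; rewrite mulr_ge0// box_ge0.
apply: (@eq_by_eps _ _ (I (fun x => (v x).1) + I (fun x => (v x).2) + I w)).
  by rewrite !addr_ge0.
move=> e e0.
have [d0 d00 h0] := vanish_uniform cf f0 e0.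
have [d1 d10 h1] := vanish_uniform c1 f10 e0.
have [d2 d20 h2] := vanish_uniform c2 f20 e0.
(* The bound 1 keeps the mollified test inside the box of radius L + 1. *)
pose d := Num.min 1 (Num.min d0 (Num.min d1 d2)).
have dpos : 0 < d by rewrite /d !lt_min ltr01 d00 d10 d20.
have [dd1 dd0 dd1' dd2] : [/\ d <= 1, d <= d0, d <= d1 & d <= d2].
  by rewrite /d !ge_min !lexx !orbT.
have [eta m] := mollifier_exists dpos.
have [ce ve] := (mol_cont m, mol_vanish m).
have me := continuous_measurable2 ce.
pose g := conv eta f.
(* Commuting the convolution puts the derivative on f, so the derivatives of the mollified test are
   the mollified derivatives of f. *)
have gd (u : R * R) fu (x : R * R) : continuous fu -> vanish L fu ->
    (forall x, is_derive x u f (fu x)) -> is_derive x u g (conv eta fu x).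
  move=> cu vu du; rewrite (convC me (continuous_measurable2 cu)).
  rewrite (_ : g = conv f eta).
    exact: (conv_derive x cf f0 cu vu (cont_L1loc ce)).
  by apply/funext => z; rewrite /g convC//; exact: continuous_measurable2.
have vd h : vanish L h -> vanish (L + 1) (conv eta h).
  move=> h0' x Lx; apply: (conv_vanish ve h0'); lra.
have close h : continuous h -> vanish L h ->
    (forall x y, `|x - y| <= d -> `|h x - h y| <= e) ->
    forall x, `|conv eta h x - h x| <= e * box (L + 1) x.
  move=> ch vh hh x; rewrite boxE; case: ifPn => xL.
    by rewrite mulr1; exact: (mollifier_close m ch (ltW e0) hh).
  by rewrite vd ?vh ?subrr ?normr0 ?mulr0// -?ltNge//; move: xL; rewrite -ltNge; lra.
have Dg : \int[leb2 R]_x ((v x).1 * conv eta f2 x - (v x).2 * conv eta f1 x) =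
    \int[leb2 R]_x (w x * g x).
  rewrite -hv.
    apply: Rint_ext => x.
    have [_ ->] := gd (0, 1) f2 x c2 f20 (fun x => C1_dir2 x CC).
    by have [_ ->] := gd (1, 0) f1 x c1 f10 (fun x => C1_dir1 x CC).
  split; first by move=> n; exact: (conv_Ck (mol_Ck m n) ve (cont_L1loc cf)).
  exists [set x : R * R | `|x| <= L + 1]; split => //; first exact: compact_square.
  by move=> x _ /= /negP; rewrite -ltNge => xL; exact: vd.
have cc h : continuous h -> vanish L h -> measurable_fun (setT : set R2) (conv eta h).
  move=> ch vh; apply: continuous_measurable2.
  exact: (conv_continuous ce ve (cont_L1loc ch)).
have diff h (p : R * R -> R) : L1loc p -> continuous h -> vanish L h ->
    (forall x y, `|x - y| <= d -> `|h x - h y| <= e) ->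
    [/\ intg (leb2 R) (fun x => p x * h x), intg (leb2 R) (fun x => p x * conv eta h x) &
    `|\int[leb2 R]_x (p x * h x) - \int[leb2 R]_x (p x * conv eta h x)| <= e * I p].
  move=> lp ch vh hh.
  have [C C0 hC] := vanish_box ch vh.
  have chh := conv_continuous ce ve (cont_L1loc ch).
  have [C' C0' hC'] := vanish_box chh (vd _ vh).
  have [i1 _] := L1loc_intg lp (continuous_measurable2 ch) hC C0.
  have [i2 _] := L1loc_intg lp (continuous_measurable2 chh) hC' C0'.
  have {}i1 : intg (leb2 R) (fun x => p x * h x).
    by apply: intg_ext i1 => x; rewrite mulrC.
  have {}i2 : intg (leb2 R) (fun x => p x * conv eta h x).
    by apply: intg_ext i2 => x; rewrite mulrC.
  split => //; rewrite -RintB//.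
  have md : measurable_fun (setT : set R2) (fun x => conv eta h x - h x).
    by apply: measurable_funB; [exact: cc|exact: continuous_measurable2].
  have [i3 i4] := L1loc_intg lp md (close _ ch vh hh) (ltW e0).
  apply: le_trans i4; rewrite (_ : (\int[leb2 R]_x _) = - \int[leb2 R]_x ((conv eta h x - h x) * p x)).
    by rewrite normrN; exact: Rint_norm.
  by rewrite -RintN; apply: Rint_ext => x; ring.
have [a1 b1 E1] := diff f2 _ l1 c2 f20 (fun x y xy => h2 x y (le_trans xy dd2)).
have [a2 b2 E2] := diff f1 _ l2 c1 f10 (fun x y xy => h1 x y (le_trans xy dd1')).
have [a3 b3 E3] := diff f _ lw cf f0 (fun x y xy => h0 x y (le_trans xy dd0)).
move: Dg; rewrite !RintB// => Dg.
exact: normr_diff3_le E1 E2 E3 Dg.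
Qed.

End MollifiedTest.

(** * Weak L2 functions are locally integrable *)

Section WeakL2.
Variable R : realType.
Local Notation R2 := (measurableTypeR R * measurableTypeR R)%type.

Lemma dyadic_bracket (y : R) : 1 < y -> exists k, 2 ^+ k < y /\ y <= 2 ^+ k.+1.
Proof.
move=> y1.
have [n hn] : exists n, y <= 2 ^+ n.
  exists (Num.bound y).
  have h := archi_boundP (ltW (lt_trans ltr01 y1)).
  apply: le_trans (ltW h) _.
  by rewrite -natrX ler_nat ltnW// ltn_expl.
case: (ex_minnP (ex_intro (fun n => y <= 2 ^+ n) n hn)) => -[|k] hk min.
  by move: hk; rewrite expr0 leNgt y1.
by exists k; split => //; rewrite ltNge; apply/negP => /min; rewrite ltnn.
Qed.

Lemma enorm_ge0 (x : R * R) : 0 <= enorm x.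
Proof. exact: sqrtr_ge0. Qed.

Lemma enormE (x : R * R) : enorm x = Num.sqrt (sqn x).
Proof. by rewrite /enorm /dot /sqn !expr2. Qed.

Lemma norm_le_enorm (x : R * R) : `|x| <= enorm x.
Proof.
rewrite enormE -(ler_pXn2r (n := 2))// ?nnegrE ?sqrtr_ge0//.
by rewrite sqr_sqrtr ?sqn_ge0// sqn_ge.
Qed.

(** Dyadic layers: |u| is at most 1 plus the sum of 2^(k+1) over the k with |u| > 2^k. The level set
    has measure at most C / 4^k, so the k-th layer contributes at most 2 C / 2^k; the term 1 is
    integrable on a box. *)
Lemma in_M2_L1loc (u : R * R -> R * R) : in_M2 u ->
  L1loc (fun x => (u x).1) /\ L1loc (fun x => (u x).2).
Proof.
move=> [mu0 hsup].
have m1 : measurable_fun (setT : set R2) (fun x => (u x).1).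
  exact: (measurableT_comp measurable_fst mu0).
have m2 : measurable_fun (setT : set R2) (fun x => (u x).2).
  exact: (measurableT_comp measurable_snd mu0).
pose f x := enorm (u x).
have mf : measurable_fun (setT : set R2) f.
  rewrite (_ : f = fun x => Num.sqrt (sqn (u x))); last first.
    by apply/funext => x; rewrite /f enormE.
  apply: (measurableT_comp (continuous_measurable_fun (@sqrt_continuous R))).
  by apply: measurable_funD; exact: measurable_funX.
have f0 x : 0 <= f x by exact: enorm_ge0.
set S := ereal_sup _ in hsup.
have [C C0 hC] : exists2 C : R, 0 <= C &
    forall l : R, 0 < l -> ((l ^+ 2)%:E * leb2 R [set x | (l < f x)%R] <= C%:E)%E.
  have S0 : (0 <= S)%E.
    apply: le_trans (_ : (((1 : R) ^+ 2)%:E * leb2 R [set x | (1 < f x)%R] <= _))%E.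
      by apply: mule_ge0.
    by apply: ereal_sup_ubound; exists 1 => //=; rewrite in_itv/= ltr01.
  exists (fine S); first exact: fine_ge0.
  move=> l l0; rewrite fineK; last by rewrite ge0_fin_numE.
  by apply: ereal_sup_ubound; exists l => //=; rewrite in_itv/= l0.
suff H L : intg (leb2 R) (fun x => f x * box L x).
  have aux (p : R * R -> R) : measurable_fun (setT : set R2) p ->
      (forall x, `|p x| <= f x) -> L1loc p.
    move=> mp pf; split => // L; apply: intg_le (H L).
      by apply: measurable_funM; [exact: measurableT_comp|exact: measurable_box].
    by move=> x; rewrite normrM normr_id (ger0_norm (box_ge0 _ _)) ler_wpM2r ?box_ge0.
  split; apply: aux => // x.
    exact: le_trans (norm_fst_le _) (norm_le_enorm _).
  exact: le_trans (norm_snd_le _) (norm_le_enorm _).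
have mset k : measurable ([set x | (2 ^+ k < f x)%R] : set R2).
  rewrite -[X in measurable X]setTI.
  exact: (measurable_fun_ltr (measurable_cst _) mf).
pose g k (x : R * R) : \bar R := ((2 ^+ k.+1) * \1_[set x | (2 ^+ k < f x)%R] x)%:E.
have mi k : measurable_fun (setT : set R2)
    (\1_[set x | (2 ^+ k < f x)%R] : R * R -> R).
  apply: measurable_indic; exact: mset k.
have mg k : measurable_fun (setT : set R2) (g k).
  by apply/measurable_EFinP/measurable_funM => //; exact: mi.
have g0 k x : (0 <= g k x)%E by rewrite lee_fin mulr_ge0// exprn_ge0.
apply: intg_ge0P.
- by apply: measurable_funM => //; exact: measurable_box.
- by move=> x; rewrite mulr_ge0 ?box_ge0.
apply: (@le_lt_trans _ _ (\int[leb2 R]_x ((box L x)%:E + \sum_(k <oo) g k x))%E).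
  apply: ge0_le_integral => //.
  - by move=> x _; rewrite lee_fin mulr_ge0 ?box_ge0.
  - by apply/measurable_EFinP/measurable_funM => //; exact: measurable_box.
  - apply: emeasurable_funD; first by apply/measurable_EFinP; exact: measurable_box.
    by apply: ge0_emeasurable_sum => // k x _ _; exact: g0.
  move=> x _; rewrite boxE; case: ifP => _; last first.
    by rewrite mulr0 add0e; apply: nneseries_ge0 => k _ _; exact: g0.
  rewrite mulr1; have [y1|y1] := leP (f x) 1.
    apply: le_trans (_ : 1%:E <= _)%E; first by rewrite lee_fin.
    by rewrite leeDl//; apply: nneseries_ge0 => k _ _; exact: g0.
  have [k [k1 k2]] := dyadic_bracket y1.
  apply: le_trans (_ : g k x <= _)%E.
    by rewrite lee_fin indicE mem_set//= mulr1.
  apply: le_trans (_ : \sum_(k <oo) g k x <= _)%E; last by rewrite leeDr// lee_fin.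
  apply: le_trans (nneseries_lim_ge k.+1 _); last by move=> ? _ _; exact: g0.
  rewrite big_mkord big_ord_recr /= leeDr//; apply: sume_ge0 => i _; exact: g0.
rewrite ge0_integralD//; last 4 first.
- by move=> x _; rewrite lee_fin box_ge0.
- by apply/measurable_EFinP; exact: measurable_box.
- by move=> x _; apply: nneseries_ge0 => k _ _; exact: g0.
- by apply: ge0_emeasurable_sum => // k x _ _; exact: g0.
rewrite lte_add_pinfty//; first by rewrite intg_EFin ?ltry//; exact: intg_box.
rewrite integral_nneseries//.
(* 4 C is the sum over k of the bounds 2 C / 2^k. *)
apply: (@le_lt_trans _ _ (4 * C)%:E); last by rewrite ltry.
apply: le_trans (epsilon_trick0 xpredT _); last by rewrite mulr_ge0.
apply: lee_nneseries => [k _ _|k _]; first by apply: integral_ge0 => x _; exact: g0.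
rewrite /g; under eq_integral do rewrite EFinM.
rewrite ge0_integralZl_EFin//; last by apply/measurable_EFinP; exact: mi.
rewrite integral_indic// setIT.
have k0 : (0 : R) < 2 ^+ k by rewrite exprn_gt0.
have := hC _ k0; set M := leb2 R _ => hM.
have -> : ((2 ^+ k.+1 : R)%:E * M = (2 / 2 ^+ k : R)%:E * ((2 ^+ k ^+ 2)%:E * M))%E.
  rewrite muleA -EFinM; congr (_%:E * _)%E.
  by rewrite exprS expr2 mulrA mulfVK ?lt0r_neq0.
apply: (@le_trans _ _ ((2 / 2 ^+ k)%:E * C%:E)%E).
  by rewrite lee_wpmul2l// lee_fin divr_ge0// ltW.
rewrite -EFinM lee_fin natrX exprS invfM.
by rewrite le_eqVlt; apply/orP; left; apply/eqP; field; exact: lt0r_neq0.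
Qed.

End WeakL2.

(** * Continuity of translations in L1 *)

Section L1Translation1.
Variable R : realType.
Implicit Types (f g : R -> R) (h : nat -> R).

Lemma measurable_translate1 (c : R) :
  measurable_fun setT ((fun x => c + x) : measurableTypeR R -> measurableTypeR R).
Proof. exact: measurable_funD. Qed.

Lemma ge0_integral_translate1 (c : R) (f : R -> \bar R) :
  measurable_fun setT f -> (forall x, 0 <= f x)%E ->
  (\int[leb R]_x f x = \int[leb R]_x f (c + x)%R)%E.
Proof.
move=> mf f0; rewrite (@ge0_integral_affine R 1 c)// normr1 mul1e.
by apply: eq_integral => x _; rewrite mul1r.
Qed.

Lemma Rint_translate1 c f : measurable_fun (setT : set (measurableTypeR R)) f ->
  \int[leb R]_x f x = \int[leb R]_x f (c + x).
Proof.
by move=> mf; apply: (ge0_change_Rint (measurable_translate1 c)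
  (@ge0_integral_translate1 c) mf).1.
Qed.

Lemma intg_translate1 c f : intg (leb R) f -> intg (leb R) (fun x => f (c + x)).
Proof.
by move=> fi; apply: (ge0_change_Rint (measurable_translate1 c)
  (@ge0_integral_translate1 c) (intg_mfun fi)).2.
Qed.

Lemma ae_leb_neq (a : R) : {ae leb R, forall x, x != a}.
Proof.
exists [set a]; split => //; first exact: lebesgue_measure_set1.
by move=> x /= /negP; rewrite negbK => /eqP.
Qed.

(** f is cut to a large interval, then approximated there by a continuous function, each at cost e /
    2. The approximant, extended by 0, may jump at the two endpoints. *)
Lemma L1_approx1 f e : intg (leb R) f -> 0 < e -> exists N (G : R -> R),
  [/\ 0 < N, continuous G & \int[leb R]_x `|f x - (G \_ `[- N, N]) x| <= e].
Proof.
move=> fi e0; have mf := intg_mfun fi.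
have e2 : 0 < e / 2 by rewrite divr_gt0.
have tl : \int[leb R]_x `|f x - (f \_ `[- n.+1%:R, n.+1%:R]) x| @[n --> \oo]
    --> \int[leb R]_x (fun=> 0 : R) x.
  apply: (@Rint_cvg _ _ _ (leb R) (fun n x => `|f x - (f \_ `[- n.+1%:R, n.+1%:R]) x|)
    (fun=> 0) (fun x => 2 * `|f x|)) => //.
  - move=> n; apply: measurableT_comp => //; apply: measurable_funB => //.
    apply/measurable_restrict => //; rewrite setTI; exact: measurable_funTS.
  - apply: aeW => x; apply: cvg_near_cst; near=> n.
    rewrite patchE mem_setE in_itv/= -ler_norml ifT ?subrr ?normr0//.
    by rewrite (@le_trans _ _ n%:R) ?ler_nat//; near: n; exact: nbhs_infty_ger.
  - exact/intgZ/intg_norm.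
  - move=> n; apply: aeW => x; rewrite normr_id patchE; case: ifP => _.
      by rewrite subrr normr0 mulr_ge0.
    by rewrite subr0 ler_peMl// ler1n.
move/cvgrPdist_le : tl => /(_ _ e2) [n _ /(_ n (leqnn n))].
rewrite /Rintegral integral0 add0r normrN => tn.
pose N : R := n.+1%:R; have N0 : 0 < N by [].
have [] := @approximation_continuous_integrable R `[- N, N]%classic f.
- by [].
- by rewrite /= lebesgue_measure_itv/= lte_fin gtrN// -EFinD ltry.
- exact: (integrableS measurableT).
move=> g_ [cg _ /fine_cvgP[_ /cvgrPdist_le /(_ _ e2) [m _ /(_ m (leqnn m)) hm]]].
exists N, (g_ m); split => //.
rewrite -/(Rintegral _ _ _) in tn.
pose E := `[- N, N]%classic : set R.
have ifE : intg (leb R) (f \_ E).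
  apply/intg_restrict; first exact: measurable_itv.
  by apply: (@integrableS _ _ _ (leb R) setT) fi => //; exact: measurable_itv.
have igE : intg (leb R) (g_ m \_ E) by exact: intg_itv.
have i1 : intg (leb R) (fun x => `|f x - (f \_ E) x|) by exact/intg_norm/intgB.
have i2 : intg (leb R) (fun x => `|(f \_ E) x - (g_ m \_ E) x|) by exact/intg_norm/intgB.
apply: (@le_trans _ _ (\int[leb R]_x (`|f x - (f \_ E) x| + `|(f \_ E) x - (g_ m \_ E) x|))).
  apply: Rint_le; [exact/intg_norm/intgB|exact: intgD|move=> x].
  by rewrite (le_trans _ (ler_normD _ _))// addrA subrK.
rewrite RintD// (splitr e) lerD//.
  by rewrite -[leLHS]ger0_norm ?Rint_ge0.
have -> : \int[leb R]_x `|(f \_ E) x - (g_ m \_ E) x| = \int[leb R]_(x in E) `|f x - g_ m x|.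
  transitivity (\int[leb R]_x ((fun x => `|f x - g_ m x|) \_ E) x); last by symmetry; exact: Rint_restrict.
  apply: Rint_ext => x; rewrite !patchE.
  by case: ifP => //; rewrite subrr normr0.
by move: hm; rewrite /= sub0r normrN; apply: le_trans; exact: ler_norm.
Unshelve. all: end_near. 
Qed.

Lemma quarter_eps (a b e : R) : a <= e / 4 -> b <= e / 2 -> a + b + a <= e.
Proof. by move=> *; lra. Qed.

Lemma shifted_gt (x a N M : R) : `|a| <= M -> N + M < `|x| -> N < `|x + a|.
Proof.
move=> aM Nx; have := ler_normB (x + a) a; rewrite addrK => h.
by rewrite -(ltrD2r M) (lt_le_trans Nx)// (le_trans h)// lerD2l.
Qed.

(** The approximation error e / 4 is paid twice, since translations preserve the integral; the
    increments of the approximant tend to 0 by dominated convergence, which takes the remaining e /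
    2. *)
Lemma L1_translation1 f h : intg (leb R) f -> h @ \oo --> (0 : R) ->
  \int[leb R]_x `|f (h n + x) - f x| @[n --> \oo] --> (0 : R).
Proof.
move=> fi h0; apply/cvgrPdist_le => e e0.
have e4 : 0 < e / 4 by rewrite divr_gt0.
have [N [G [N0 cG fG]]] := L1_approx1 fi e4.
pose g := G \_ `[- N, N].
have ig : intg (leb R) g by exact: intg_itv.
have [C C0 hC] : exists2 C, 0 <= C & forall x, `|g x| <= C.
  have [||c _ hc] := @EVT_max R (fun x => `|G x|) (- N) N.
    by rewrite ge0_cp// ltW.
    by apply: continuous_subspaceT => x; apply: continuous_comp; [exact: cG|exact: norm_continuous].
  exists `|G c| => // x; rewrite /g patchE; case: ifPn => [|_]; last by rewrite normr0.
  by rewrite inE => /hc.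
have [M M0 hM] : exists2 M, 0 <= M & forall n, `|h n| <= M.
  have /cvg_seq_bounded [M [_ hM]] : cvgn h by apply/cvg_ex; exists 0.
  exists `|M + 1| => // n; rewrite (le_trans _ (ler_norm _))//.
  by apply: hM => //; rewrite ltrDl.
(* Pointwise convergence is needed almost everywhere only, so the jumps at N and - N are
   harmless. *)
have gc x : x != N -> x != - N -> {for x, continuous g}.
  move=> xN xN'; have nc : `|y| @[y --> x] --> `|x| by apply: cvg_norm; exact: cvg_id.
  have [xlt|xgt|xE] := ltgtP `|x| N.
  - have E : \forall y \near x, G y = g y.
      have := @cvgr_lt R R (nbhs x) _ (fun y => `|y|) `|x| nc N xlt.
      move=> /(_ _); apply: filterS => y yN; rewrite /g patchE mem_setE in_itv/= -ler_norml ltW//.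
    suff : g @ x --> g x by [].
    rewrite -[X in _ --> X](nbhs_singleton E).
    exact: (cvg_trans (near_eq_cvg E) (cG x)).
  - have E : \forall y \near x, 0 = g y.
      have := @cvgr_gt R R (nbhs x) _ (fun y => `|y|) `|x| nc N xgt.
      move=> /(_ _); apply: filterS => y yN; rewrite /g patchE mem_setE in_itv/= -ler_norml leNgt yN//.
    suff : g @ x --> g x by [].
    rewrite -[X in _ --> X](nbhs_singleton E).
    exact: (cvg_trans (near_eq_cvg E) (cvg_cst 0)).
  - move: xN xN'; have [x0|x0] := lerP 0 x.
      by rewrite -xE ger0_norm// eqxx.
    by rewrite -xE ltr0_norm// opprK eqxx.
have cv : \int[leb R]_x `|g (h n + x) - g x| @[n --> \oo] --> \int[leb R]_x (fun=> 0 : R) x.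
  apply: (@Rint_cvg _ _ _ (leb R) (fun n x => `|g (h n + x) - g x|)
    (fun=> 0) (fun x => (2 * C) * \1_(`[- (N + M), N + M]%classic : set R) x)) => //.
  - by move=> n; apply: measurableT_comp => //; apply: (@intg_mfun _ _ _ (leb R)); apply: intgB => //; exact: intg_translate1.
  - near=> x.
    have cx : {for x, continuous g}.
      by apply: gc; near: x; exact: ae_leb_neq.
    have hx : (h n + x) @[n --> \oo] --> x.
      by rewrite -[X in _ --> X]add0r; apply: cvgD => //; exact: cvg_cst.
    apply/norm_cvg0P; rewrite -(subrr (g x)); apply: cvgB; last exact: cvg_cst.
    exact: (cvg_comp _ _ hx cx).
  - apply: intgZ; exact: intg_indic_itv.
  - move=> n; apply: aeW => x; rewrite normr_id indicE mem_setE in_itv/= -ler_norml.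
    case: (lerP `|x| (N + M)) => [_|Mx]; rewrite ?mulr1 ?mulr0.
      by rewrite (le_trans (ler_normB _ _))// mulrDl mul1r lerD.
    rewrite /g !patchE !mem_setE !in_itv/= -!ler_norml !leNgt.
    have Nx : N < `|x| by rewrite (le_lt_trans _ Mx)// lerDl.
    have Nh : N < `|h n + x| by rewrite addrC; exact: shifted_gt (hM n) Mx.
    by rewrite Nx Nh subrr normr0 ltxx.
have z : \int[leb R]_x (fun=> 0 : R) x = 0 by rewrite /Rintegral integral0.
rewrite z in cv.
move/cvgrPdist_le : cv => /(_ _ (divr_gt0 e0 (ltr0n R 2))); apply: filterS => n.
have ifh := intg_translate1 (h n) fi; have igh := intg_translate1 (h n) ig.
have ifg : intg (leb R) (fun x => `|f x - g x|) by exact/intg_norm/intgB.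
rewrite !sub0r !normrN !ger0_norm ?Rint_ge0// => hn.
apply: (@le_trans _ _ (\int[leb R]_x (`|f (h n + x) - g (h n + x)| + `|g (h n + x) - g x| + `|f x - g x|))).
  apply: Rint_le.
  - exact/intg_norm/intgB.
  - by apply: intgD => //; apply: intgD; exact/intg_norm/intgB.
  - move=> x; rewrite (distrC (f x)).
    apply: le_trans (_ : `|(f (h n + x) - g (h n + x)) + (g (h n + x) - g x) + (g x - f x)| <= _).
      by rewrite le_eqVlt; apply/orP; left; apply/eqP; congr `|_|; ring.
    by rewrite (le_trans (ler_normD _ _))// lerD2r ler_normD.
have igg : intg (leb R) (fun x => `|g (h n + x) - g x|) by exact/intg_norm/intgB.
have ifgh : intg (leb R) (fun x => `|f (h n + x) - g (h n + x)|) by exact/intg_norm/intgB.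
rewrite RintD ?RintD//; last exact: intgD.
rewrite -(@Rint_translate1 (h n) (fun x => `|f x - g x|)); last exact: intg_mfun ifg.
exact: quarter_eps.
Unshelve. all: end_near.
Qed.

End L1Translation1.

Section L1Translation2.
Variable R : realType.
Local Notation R2 := (measurableTypeR R * measurableTypeR R)%type.
Implicit Types (f g : R * R -> R).

Lemma addpE (a b c d : R) : ((a, b) : R * R) + (c, d) = (a + c, b + d).
Proof. by []. Qed.

Lemma Rint_swap f : intg (leb2 R) f ->
  \int[leb2 R]_x f (x.2, x.1) = \int[leb2 R]_x f x.
Proof.
by move=> fi; rewrite leb2_Rfubini1 ?leb2_Rfubini2//; exact: intg_swap.
Qed.

(** [L1_translation1] on almost every horizontal line, then dominated convergence in the other
    variable with twice the L1 norm of the line as majorant. *)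
Lemma L1_translation_fst f (h : nat -> R) : intg (leb2 R) f -> h @ \oo --> (0 : R) ->
  \int[leb2 R]_x `|f ((h n, 0) + x) - f x| @[n --> \oo] --> (0 : R).
Proof.
move=> fi h0.
have ig n : intg (leb2 R) (fun x => `|f ((h n, 0) + x) - f x|).
  by apply/intg_norm/intgB => //; exact: intg_translate.
have -> : (fun n => \int[leb2 R]_x `|f ((h n, 0) + x) - f x|) =
    fun n => \int[leb R]_b \int[leb R]_a `|f (h n + a, b) - f (a, b)|.
  apply/funext => n; rewrite (leb2_Rfubini2 (ig n)); apply: Rint_ext => b.
  by apply: Rint_ext => a; rewrite addpE add0r.
have : \int[leb R]_b (fun=> 0 : R) b = 0 by rewrite /Rintegral integral0.
move=> <-.
apply: (@Rint_cvg _ _ _ (leb R) (fun n b => \int[leb R]_a `|f (h n + a, b) - f (a, b)|)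
  (fun=> 0) (fun b => 2 * \int[leb R]_a `|f (a, b)|)) => //.
- move=> n; apply: (@intg_mfun _ _ _ (leb R)).
  have := intg_fubini2 (ig n); apply: intg_ext => b.
  by apply: Rint_ext => a; rewrite addpE add0r.
- apply: filterS (intg_section2 fi) => b fb.
  exact: (L1_translation1 fb h0).
- by apply/intgZ/(@intg_fubini2 _ _ _ _ _ (leb R) (leb R) (fun x => `|f x|))/intg_norm.
- move=> n; apply: filterS (intg_section2 fi) => b fb.
  have fb' := intg_translate1 (h n) fb.
  rewrite ger0_norm ?Rint_ge0//.
  apply: (@le_trans _ _ (\int[leb R]_a (`|f (h n + a, b)| + `|f (a, b)|))).
    apply: Rint_le; [exact/intg_norm/intgB|by apply: intgD; exact: intg_norm|].
    by move=> a; exact: ler_normB.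
  rewrite RintD; [|exact: intg_norm..].
  rewrite -(@Rint_translate1 R (h n) (fun a => `|f (a, b)|)) ?mulr_natl ?mulr2n//.
  exact: (intg_mfun (intg_norm fb)).
Qed.

Lemma L1_translation_snd f (h : nat -> R) : intg (leb2 R) f -> h @ \oo --> (0 : R) ->
  \int[leb2 R]_x `|f ((0, h n) + x) - f x| @[n --> \oo] --> (0 : R).
Proof.
move=> fi h0; have := L1_translation_fst (intg_swap fi) h0.
apply: cvg_trans; apply: near_eq_cvg; apply: nearW => n.
rewrite -[RHS](@Rint_swap (fun x => `|f ((0, h n) + x) - f x|)).
  by apply: Rint_ext => -[a b].
by apply/intg_norm/intgB => //; exact: intg_translate.
Qed.

(** A failure would give a sequence of translations tending to 0 with increments above e. Each is
    split into its two coordinate translations, the second being removed from the first increment by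
    invariance of the measure. *)
Lemma L1_translation f e : intg (leb2 R) f -> 0 < e ->
  exists2 d, 0 < d & forall h : R * R, `|h| <= d ->
    \int[leb2 R]_x `|f (h + x) - f x| <= e.
Proof.
move=> fi e0; apply: contrapT => /forall2NP H.
have /choice[h hh] (n : nat) : exists h : R * R, `|h| <= n.+1%:R^-1 /\
    e < \int[leb2 R]_x `|f (h + x) - f x|.
  have [|] := H n.+1%:R^-1; first by rewrite invr_gt0 ltr0n.
  move=> /existsNP[h /not_implyP[h1 /negP]]; rewrite -ltNge => h2.
  by exists h.
have c0 (g : R * R -> R) : (forall x, `|g x| <= `|x|) -> (fun n => g (h n)) @ \oo --> (0 : R).
  move=> gx; apply/norm_cvg0P; apply: (@squeeze_cvgr _ _ _ _ (fun=> 0) (fun n => n.+1%:R^-1)).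
  - by apply: nearW => n; rewrite normr_ge0 (le_trans (gx _))// (hh n).1.
  - exact: cvg_cst.
  - exact: cvg_harmonic.
have c1 := L1_translation_fst fi (c0 fst (@norm_fst_le R)).
have c2 := L1_translation_snd fi (c0 snd (@norm_snd_le R)).
have c3 : (fun n => \int[leb2 R]_x `|f (((h n).1, 0) + x) - f x| +
    \int[leb2 R]_x `|f ((0, (h n).2) + x) - f x|) @ \oo --> (0 : R).
  by rewrite -[X in _ --> X]addr0; exact: cvgD c1 c2.
have /cvgrPdist_lt/(_ _ e0)[n _ /(_ n (leqnn n))] := c3.
rewrite /= sub0r normrN ltNge => /negP; apply; rewrite (le_trans (ltW (hh n).2))//.
rewrite (le_trans _ (ler_norm _))//.
have i1 := intg_translate (h n) fi.
have i2 := intg_translate (0, (h n).2) fi.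
have i3 : intg (leb2 R) (fun x => `|f (((h n).1, 0) + x) - f x|).
  by apply/intg_norm/intgB => //; exact: intg_translate.
have E x : h n + x = ((h n).1, 0) + ((0, (h n).2) + x).
  by rewrite addrA; case: (h n) x => a b [c d]; rewrite !addpE addr0 add0r.
have := @Rint_translate R (0, (h n).2) _ (intg_mfun i3) => ->.
have i3' := @intg_translate R (0, (h n).2) _ i3.
have i4 : intg (leb2 R) (fun x => `|f ((0, (h n).2) + x) - f x|) by exact/intg_norm/intgB.
rewrite -RintD//; apply: Rint_le; [exact/intg_norm/intgB|exact: intgD|move=> x].
rewrite E; set a := f (_ + (_ + _)); set b := f (_ + x); set c := f x.
by rewrite (le_trans _ (ler_normD _ _))// addrA subrK.
Qed.

End L1Translation2.

(** * The quadratic term *)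

Section TensorDivergence.
Variable R : realType.
Local Notation R2 := (measurableTypeR R * measurableTypeR R)%type.
Implicit Types (f g om : R * R -> R).

Lemma C1c_scaleN L f f1 f2 : C1c L f f1 f2 ->
  C1c L (fun x => - f x) (fun x => - f1 x) (fun x => - f2 x).
Proof.
move=> Cf; have [h f0 f10 f20] := C1c_mul (C1_cst (-1)) Cf.
have E (g : R * R -> R) : (fun x => -1 * g x) = (fun x => - g x).
  by apply/funext => x; rewrite mulN1r.
rewrite E in h f0; split=> //.
- by apply: C1_eq h _ _ => x; rewrite mul0r add0r mulN1r.
- by move=> x Lx; have := f10 x Lx; rewrite mul0r add0r mulN1r.
- by move=> x Lx; have := f20 x Lx; rewrite mul0r add0r mulN1r.
Qed.

Lemma continuous_reflect (x : R * R) g : continuous g ->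
  continuous (fun y : R * R => g (x - y)).
Proof.
move=> cg y; apply: (@continuous_comp _ _ _ (fun y : R * R => x - y) g); last exact: cg.
by apply: cvgB; [exact: cvg_cst|exact: cvg_id].
Qed.

Lemma C1c_reflect L f f1 f2 (x : R * R) : C1c L f f1 f2 ->
  C1c (L + `|x|) (fun y => f (x - y)) (fun y => - f1 (x - y)) (fun y => - f2 (x - y)).
Proof.
move=> [[cf cf1 cf2 d1 d2] f0 f10 f20].
have cs := @continuous_reflect x.
have v g : vanish L g -> vanish (L + `|x|) (fun y => g (x - y)).
  by move=> g0 y Ly; apply: g0; have := lerB_dist y x; rewrite distrC; lra.
have ds (c a : R) : is_derive a (1 : R) (fun s => c - s) (- 1).
  rewrite -[X in is_derive _ _ _ X]add0r.
  exact: (derD (is_derive_cst c a 1) (is_deriveN (is_derive_id a 1))).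
have cN g : continuous g -> continuous (fun y : R * R => - g (x - y)).
  by move=> cg y; apply: cvgN; exact: (cs g cg).
have vN g : vanish L g -> vanish (L + `|x|) (fun y => - g (x - y)).
  by move=> g0 y Ly; rewrite (v g)// oppr0.
split; [split|exact: v|exact: vN|exact: vN].
- exact: cs.
- exact: cN.
- exact: cN.
- move=> a b; rewrite -mulrN1.
  exact: (@is_derive1_comp _ (fun s => f (s, x.2 - b)) (fun s => x.1 - s)).
- move=> a b; rewrite -mulrN1.
  exact: (@is_derive1_comp _ (fun s => f (x.1 - a, s)) (fun s => x.2 - s)).
Qed.

(** The contraction of grad Phi with V (x) V, where (p1, p2) and (q1, q2) are the gradients of the
    two components of Phi. *)
Definition tensor (p1 p2 q1 q2 V1 V2 : R * R -> R) (x : R * R) : R :=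
  (V1 x * p1 x + V2 x * p2 x) * V1 x + (V1 x * q1 x + V2 x * q2 x) * V2 x.

(* The left-hand side plus the integrand on the right is the divergence of
   (Phi . W) W - |W|^2 Phi / 2, where Phi = (P, Q). *)
Lemma Rint_tensor_C1 L P p1 p2 Q q1 q2 W1 W11 W12 W2 W21 W22 :
  C1c L P p1 p2 -> C1c L Q q1 q2 -> (forall x, p1 x + q2 x = 0) ->
  C1 W1 W11 W12 -> C1 W2 W21 W22 -> (forall x, W11 x + W22 x = 0) ->
  \int[leb2 R]_x tensor p1 p2 q1 q2 W1 W2 x =
  - \int[leb2 R]_x ((W21 x - W12 x) * (Q x * W1 x - P x * W2 x)).
Proof.
move=> CP CQ dPQ CW1 CW2 dW.
have A11 := C1_mul CW1 CW1; have A12 := C1_mul CW1 CW2; have A22 := C1_mul CW2 CW2.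
have h := C1_cst (2^-1 : R).
have F1 := C1c_add (C1c_mul (C1_mul h A11) CP)
  (C1c_add (C1c_mul A12 CQ) (C1c_scaleN (C1c_mul (C1_mul h A22) CP))).
have F2 := C1c_add (C1c_mul (C1_mul h A22) CQ)
  (C1c_add (C1c_mul A12 CP) (C1c_scaleN (C1c_mul (C1_mul h A11) CQ))).
have I1 := C1c_int1 F1; have I2 := C1c_int2 F2.
have i1 := intg_cont_vanish (C1_cont1 (C1c_C1 F1)) (C1c_1 F1).
have i2 := intg_cont_vanish (C1_cont2 (C1c_C1 F2)) (C1c_2 F2).
have iG : intg (leb2 R) (fun x => (W21 x - W12 x) * (Q x * W1 x - P x * W2 x)).
  apply: (@intg_cont_vanish _ L).
    move=> x; apply: cvgM; apply: cvgB.
    - exact: (C1_cont1 CW2).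
    - exact: (C1_cont2 CW1).
    - by apply: cvgM; [exact: (C1_cont (C1c_C1 CQ))|exact: (C1_cont CW1)].
    - by apply: cvgM; [exact: (C1_cont (C1c_C1 CP))|exact: (C1_cont CW2)].
  by move=> x Lx; rewrite (C1c_0 CQ)// (C1c_0 CP)// !mul0r subr0 mulr0.
have ID := RintD i1 i2; rewrite I1 I2 addr0 in ID.
rewrite -[RHS]add0r -ID -RintB//; last exact: intgD.
apply: Rint_ext => x; rewrite /tensor.
have -> : q2 x = - p1 x by apply/eqP; rewrite -addr_eq0 addrC dPQ.
have -> : W22 x = - W11 x by apply/eqP; rewrite -addr_eq0 addrC dW.
by field.
Qed.

Lemma C1_of_dir f f1 f2 : continuous f -> continuous f1 -> continuous f2 ->
  (forall x, is_derive x ((1, 0) : R * R) f (f1 x)) ->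
  (forall x, is_derive x ((0, 1) : R * R) f (f2 x)) -> C1 f f1 f2.
Proof.
move=> c c1 c2 h1 h2; split=> // a b.
- have E (s : R) : s *: ((1, 0) : R * R) + (0, b) = (s, b).
    by rewrite /GRing.scale/= [LHS]addpE [s *: 1]mulr1 [s *: 0]mulr0 addr0 add0r.
  have := @is_derive_line R (R * R)%type f (0, b) (1, 0) a (f1 (a, b)).
  rewrite E => -[/(_ (h1 _)) + _].
  by rewrite (_ : (fun s : R => _) = fun s => f (s, b))//; apply/funext => s; rewrite E.
- have E (s : R) : s *: ((0, 1) : R * R) + (a, 0) = (a, s).
    by rewrite /GRing.scale/= [LHS]addpE [s *: 1]mulr1 [s *: 0]mulr0 addr0 add0r.
  have := @is_derive_line R (R * R)%type f (a, 0) (0, 1) b (f2 (a, b)).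
  rewrite E => -[/(_ (h2 _)) + _].
  by rewrite (_ : (fun s : R => _) = fun s => f (a, s))//; apply/funext => s; rewrite E.
Qed.

Section Mollified.
Variables (d : R) (eta eta1 eta2 : R * R -> R) (om : R * R -> R).
Hypotheses (Ceta : C1c d eta eta1 eta2) (iom : intg (leb2 R) om).
Let V1 x := (bs_conv om x).1.
Let V2 x := (bs_conv om x).2.

Lemma kconv_is_L1loc (k : R * R -> R) : measurable_fun (setT : set R2) k ->
  (forall z, `|k z| <= `|z|^-1) -> L1loc (kconv k om).
Proof.
move=> mk kle; split; first exact: (measurable_kconv mk (intg_mfun iom)).
by move=> L; have [] := kconv_L1loc mk kle L iom.
Qed.

Lemma V1_L1loc : L1loc V1.
Proof. exact: kconv_is_L1loc (@measurable_bsK1 R) (@bsK1_le R). Qed.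

Lemma V2_L1loc : L1loc V2.
Proof. exact: kconv_is_L1loc (@measurable_bsK2 R) (@bsK2_le R). Qed.

Lemma C1_conv g : L1loc g -> C1 (conv eta g) (conv eta1 g) (conv eta2 g).
Proof.
move=> lg; have [[c c1 c2 _ _] v v1 v2] := Ceta.
apply: C1_of_dir.
- exact: (conv_continuous c v lg).
- exact: (conv_continuous c1 v1 lg).
- exact: (conv_continuous c2 v2 lg).
- by move=> x; exact: (conv_derive x c v c1 v1 lg (fun x => C1_dir1 x (C1c_C1 Ceta))).
- by move=> x; exact: (conv_derive x c v c2 v2 lg (fun x => C1_dir2 x (C1c_C1 Ceta))).
Qed.

(** The derivatives sit on the mollifier, so this is [bs_grad_test] for the test function y -> eta
    (x - y); the curl below comes in the same way from [bs_perp_test]. *)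
Lemma conv_bs_div x : conv eta1 V1 x + conv eta2 V2 x = 0.
Proof.
have [[c c1 c2 _ _] v v1 v2] := Ceta.
rewrite /conv -RintD; last 2 first.
- exact: conv_int_intg v1 V1_L1loc.
- exact: conv_int_intg v2 V2_L1loc.
have := bs_grad_test iom (C1c_reflect x Ceta).
move/(congr1 -%R); rewrite oppr0 -RintN => E; rewrite -[RHS]E.
by apply: Rint_ext => y; rewrite /V1 /V2; ring.
Qed.

Lemma conv_bs_curl x : conv eta1 V2 x - conv eta2 V1 x = conv eta om x.
Proof.
have [[c c1 c2 _ _] v v1 v2] := Ceta.
rewrite /conv -RintB; last 2 first.
- exact: conv_int_intg v1 V2_L1loc.
- exact: conv_int_intg v2 V1_L1loc.
have := bs_perp_test iom (C1c_reflect x Ceta).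
move/(congr1 -%R); rewrite opprK -RintN => E.
transitivity (\int[leb2 R]_y (om y * eta (x - y))); last by apply: Rint_ext => y; rewrite mulrC.
by rewrite -E; apply: Rint_ext => y; rewrite /V1 /V2; ring.
Qed.

End Mollified.

Lemma conv_intg L eta om : continuous eta -> vanish L eta -> intg (leb2 R) om ->
  intg (leb2 R \x leb2 R)%E (fun z => eta (z.1 - z.2) * om z.2) /\
  intg (leb2 R) (conv eta om).
Proof.
move=> ce ve iom; have ie := intg_cont_vanish ce ve.
have me := continuous_measurable2 ce.
suff i : intg (leb2 R \x leb2 R)%E (fun z => eta (z.1 - z.2) * om z.2).
  by split => //; exact: (intg_fubini1 i).
apply: (@intg_tonelli2 _ _ _ _ _ (leb2 R) (leb2 R) _
  (fun y => (\int[leb2 R]_x `|eta x|) * `|om y|)).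
- apply: measurable_funM; first exact: (measurableT_comp me (@measurable_sub2 R)).
  exact: (measurableT_comp (intg_mfun iom) measurable_snd).
- apply: aeW => y /=.
  have iy : intg (leb2 R) (fun x => eta (x - y)).
    have := intg_translate (- y) ie; apply: intg_ext => x; by rewrite addrC.
  split; first by have := intgZ (om y) iy; apply: intg_ext => x; rewrite mulrC.
  rewrite (Rint_translate (- y) (intg_mfun (intg_norm ie))) mulrC -RintZ; last first.
    by have := intg_norm iy; apply: intg_ext => x; rewrite addrC.
  rewrite le_eqVlt; apply/orP; left; apply/eqP; apply: Rint_ext => x.
  by rewrite normrM mulrC addrC.
- exact/intgZ/intg_norm.
Qed.

Lemma k_le_split (k : R * R -> R) (x y : R * R) : (forall z, `|k z| <= `|z|^-1) ->
  `|k (x - y)| <= box 1 (x - y) * `|x - y|^-1 + 1.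
Proof.
move=> kle.
by have := k_split_le kle `|x| x y; rewrite [box `|x| x]boxE lexx mulr1.
Qed.

Lemma intg_rho_reflect (x : R * R) :
  intg (leb2 R) (fun y => box 1 (x - y) * `|x - y|^-1).
Proof. exact: (intg_reflect x (@intg_rho R 1)). Qed.

Lemma kconv_int_intg (k : R * R -> R) g C x : measurable_fun (setT : set R2) k ->
  (forall z, `|k z| <= `|z|^-1) -> intg (leb2 R) g -> (forall x, `|g x| <= C) ->
  intg (leb2 R) (fun y => k (x - y) * g y).
Proof.
move=> mk kle ig gC; apply: (@intg_le _ _ _ (leb2 R) _
  (fun y => C * (box 1 (x - y) * `|x - y|^-1) + `|g y|)).
- apply: measurable_funM; last exact: intg_mfun ig.
  exact: (measurableT_comp mk (measurable_sub_l x)).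
- move=> y; rewrite normrM; apply: le_trans (ler_wpM2r (normr_ge0 _) (k_le_split x y kle)) _.
  by rewrite mulrDl mul1r lerD2r mulrC ler_wpM2r// mulr_ge0 ?box_ge0.
- by apply: intgD; [exact/intgZ/intg_rho_reflect|exact: intg_norm].
Qed.

(** Associativity of convolution. It makes the mollified velocity the Biot-Savart field of the
    mollified vorticity, which is bounded, so that [Rint_symmetrize] applies to it. *)
Lemma kconv_conv (k : R * R -> R) L eta om x : measurable_fun (setT : set R2) k ->
  (forall z, `|k z| <= `|z|^-1) -> continuous eta -> vanish L eta ->
  intg (leb2 R) om -> conv eta (kconv k om) x = kconv k (conv eta om) x.
Proof.
move=> mk kle ce ve iom.
have me := continuous_measurable2 ce.
have ie := intg_cont_vanish ce ve.
have [C C0 hC] := vanish_bounded ce ve.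
have cr := @continuous_reflect x _ ce.
have vr : vanish (L + `|x|) (fun y => eta (x - y)).
  by move=> y Ly; apply: ve; have := lerB_dist y x; rewrite distrC; lra.
have [D D0 hD] := vanish_box cr vr.
have [i1 E1] := kconv_test mk kle (continuous_measurable2 cr) hD D0 iom.
transitivity (\int[leb2 R]_z (om z * \int[leb2 R]_y (k (y - z) * eta (x - y)))).
  by rewrite -E1; apply: Rint_ext => y; rewrite mulrC.
have iF : intg (leb2 R \x leb2 R)%E (fun z => k (x - z.1) * (eta (z.1 - z.2) * om z.2)).
  have ir := intg_rho_reflect x.
  have ney z : intg (leb2 R) (fun y => `|eta (y - z)|).
    by have := intg_translate (- z) (intg_norm ie); apply: intg_ext => y; rewrite addrC.
  have ib z : intg (leb2 R)
      (fun y => `|om z| * (C * (box 1 (x - y) * `|x - y|^-1) + `|eta (y - z)|)).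
    by apply/intgZ/intgD; [exact: intgZ|exact: ney].
  have bnd y z : `|k (x - y) * (eta (y - z) * om z)| <=
      `|om z| * (C * (box 1 (x - y) * `|x - y|^-1) + `|eta (y - z)|).
    rewrite !normrM mulrA mulrC ler_wpM2l//.
    apply: le_trans (ler_wpM2r (normr_ge0 _) (k_le_split x y kle)) _.
    rewrite mulrDl mul1r lerD2r mulrC ler_wpM2r// mulr_ge0 ?box_ge0//.
  have mF : measurable_fun (setT : set (R2 * R2)%type)
      (fun z => k (x - z.1) * (eta (z.1 - z.2) * om z.2)).
    apply: measurable_funM.
      exact: (measurableT_comp (measurableT_comp mk (measurable_sub_l x)) measurable_fst).
    apply: measurable_funM; first exact: (measurableT_comp me (@measurable_sub2 R)).
    exact: (measurableT_comp (intg_mfun iom) measurable_snd).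
  apply: (@intg_tonelli2 _ _ _ _ _ (leb2 R) (leb2 R) _
    (fun z => (C * \int[leb2 R]_y (box 1 (x - y) * `|x - y|^-1) + \int[leb2 R]_y `|eta y|)
       * `|om z|)) => //; last exact/intgZ/intg_norm.
  apply: aeW => z /=.
  have iz : intg (leb2 R) (fun y => k (x - y) * (eta (y - z) * om z)).
    apply: (@intg_le _ _ _ (leb2 R) _ _ _ (fun y => bnd y z) (ib z)).
    exact: (measurableT_comp mF (@measurable_pair2 _ _ R2 R2 z)).
  split => //.
  apply: le_trans (Rint_le (intg_norm iz) (ib z) (fun y => bnd y z)) _.
  rewrite RintZ ?RintD ?RintZ ?intgD//; try exact: intgZ.
  rewrite mulrC (Rint_translate (- z) (intg_mfun (intg_norm ie))).
  rewrite (_ : \int[leb2 R]_y `|eta (y - z)| = \int[leb2 R]_x0 `|eta (- z + x0)|)//.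
  by apply: Rint_ext => y; rewrite addrC.
transitivity (\int[leb2 R]_z \int[leb2 R]_y (k (x - y) * (eta (y - z) * om z))).
  apply: Rint_ext => z.
  rewrite -RintZ_mfun; last first.
    by apply: measurable_funM; [exact: measurable_kx|exact: continuous_measurable2].
  (* The reflection y -> x + z - y turns k (y - z) eta (x - y) into k (x - y) eta (y - z). *)
  rewrite (@Rint_reflect R (x + z)); last first.
    by do 2 apply: measurable_funM => //; [exact: measurable_kx|exact: continuous_measurable2].
  apply: Rint_ext => y.
  have -> : x + z - y - z = x - y by rewrite addrAC addrK.
  have -> : x - (x + z - y) = y - z by rewrite opprB addrCA opprD (addrA x) subrr add0r.
  by ring.
rewrite -(Rfubini iF); apply: Rint_ext => y /=.
by rewrite RintZ_mfun//; apply: measurable_funM; [exact: (measurableT_comp me (measurable_sub_l y))|exact: intg_mfun iom].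
Qed.

(** [Hbar_kernel] on one time slice, in components: [perp] sends (K1, K2) to (- K2, K1). *)
Definition Hbar (P Q : R * R -> R) (x y : R * R) : R :=
  2^-1 * ((bsK (x - y)).1 * (Q x - Q y) - (bsK (x - y)).2 * (P x - P y)).

Lemma bsK_opp1 (z : R * R) : (bsK (- z)).1 = - (bsK z).1.
Proof. by rewrite !bsK1E /sqn/=; rewrite !sqrrN mulNr opprK mulrN opprK. Qed.

Lemma bsK_opp2 (z : R * R) : (bsK (- z)).2 = - (bsK z).2.
Proof. by rewrite !bsK2E /sqn/=; rewrite !sqrrN mulNr mulrN. Qed.

(** Exchanging x and y does not change the double integral, and K is odd, so the integrand may be
    replaced by its symmetric part. Boundedness of g makes K * g converge at every point and the
    double integral converge absolutely, which is why mollified vorticity comes first. *)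
Lemma Rint_symmetrize L P Q g C : continuous P -> vanish L P -> continuous Q ->
  vanish L Q -> intg (leb2 R) g -> measurable_fun (setT : set R2) g ->
  (forall x, `|g x| <= C) ->
  \int[leb2 R]_x (g x * (Q x * (bs_conv g x).1 - P x * (bs_conv g x).2)) =
  \int[leb2 R]_y \int[leb2 R]_x (Hbar P Q x y * g x * g y).
Proof.
move=> cP vP cQ vQ ig mg gC.
have C0 : 0 <= C by rewrite (le_trans _ (gC 0)).
have T f : continuous f -> vanish L f -> exists2 D, 0 <= D &
    forall x, `|g x * f x| <= D * box L x.
  move=> cf vf; have [D D0 hD] := vanish_box cf vf; exists (C * D) => [|x].
    exact: mulr_ge0.
  by rewrite normrM -mulrA ler_pM.
have [D1 D10 hD1] := T _ cP vP; have [D2 D20 hD2] := T _ cQ vQ.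
have mP : measurable_fun (setT : set R2) (fun x => g x * P x).
  by apply: measurable_funM => //; exact: continuous_measurable2.
have mQ : measurable_fun (setT : set R2) (fun x => g x * Q x).
  by apply: measurable_funM => //; exact: continuous_measurable2.
have i1 := intg_kprod (@measurable_bsK1 R) (@bsK1_le R) mQ hD2 D20 ig.
have i2 := intg_kprod (@measurable_bsK2 R) (@bsK2_le R) mP hD1 D10 ig.
pose B (x y : R * R) := g x * g y * (Q x * (bsK (x - y)).1 - P x * (bsK (x - y)).2).
have iB : intg (leb2 R \x leb2 R)%E (fun z => B z.1 z.2).
  by have := intgB i1 i2; apply: intg_ext => z; rewrite /B; ring.
have iB' := intg_swap iB.
transitivity (\int[leb2 R]_x \int[leb2 R]_y B x y).
  apply: Rint_ext => x; rewrite /B.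
  have k1 := kconv_int_intg x (@measurable_bsK1 R) (@bsK1_le R) ig gC.
  have k2 := kconv_int_intg x (@measurable_bsK2 R) (@bsK2_le R) ig gC.
  have -> : (bs_conv g x).1 = \int[leb2 R]_y ((bsK (x - y)).1 * g y) by [].
  have -> : (bs_conv g x).2 = \int[leb2 R]_y ((bsK (x - y)).2 * g y) by [].
  transitivity (g x * (\int[leb2 R]_y (Q x * ((bsK (x - y)).1 * g y) - P x * ((bsK (x - y)).2 * g y)))).
    by rewrite RintB ?RintZ//; exact: intgZ.
  rewrite -RintZ; last by apply: intgB; exact: intgZ.
  by apply: Rint_ext => y; ring.
have ES (z : R2 * R2) : 2^-1 * (B z.1 z.2 + B z.2 z.1) = Hbar P Q z.1 z.2 * g z.1 * g z.2.
  by rewrite /B /Hbar -(opprB z.1 z.2) bsK_opp1 bsK_opp2; ring.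
have iBB : intg (leb2 R \x leb2 R)%E (fun z => B z.1 z.2 + B z.2 z.1) by exact: intgD.
have iS := intg_ext ES (intgZ 2^-1 iBB).
have := Rfubini2 iS => /= ->.
rewrite -(Rint_ext _ ES) RintZ// RintD//.
have := Rfubini1 iB => /= <-; have := Rfubini2 iB' => /= <-.
by field.
Qed.

End TensorDivergence.

Lemma intg_le_ae d (T : measurableType d) (R : realType)
    (m : {measure set T -> \bar R}) (f g : T -> R) :
  measurable_fun setT f -> intg m g -> {ae m, forall x, `|f x| <= g x} ->
  intg m f /\ \int[m]_x `|f x| <= \int[m]_x g x.
Proof.
move=> mf ig fg; have mg := intg_mfun ig.
have ing := intg_norm ig.
have le : (\int[m]_x `|(f x)%:E| <= \int[m]_x `|(g x)%:E|)%E.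
  apply: ae_ge0_le_integral => //.
  - by apply: measurableT_comp => //; exact/measurable_EFinP.
  - by apply: measurableT_comp => //; exact/measurable_EFinP.
  - by apply: filterS fg => x fgx _; rewrite lee_fin (le_trans fgx)// ler_norm.
have i : intg m f.
  apply/integrableP; split; first exact/measurable_EFinP.
  by apply: le_lt_trans le _; have /integrableP[] := ig.
split => //.
have -> : \int[m]_x g x = \int[m]_x `|g x|.
  apply: Rint_ae => //; first exact: measurableT_comp.
  by apply: filterS fg => x fgx; rewrite ger0_norm// (le_trans _ fgx).
by rewrite -lee_fin -!intg_EFin//; exact: intg_norm.
Qed.

(** * Removal of the mollification in the quadratic identity *)

Section MollifierLimits.
Variable R : realType.
Local Notation R2 := (measurableTypeR R * measurableTypeR R)%type.
Implicit Types (f g h om eta V : R * R -> R).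

Lemma mollifier_C1c d eta : mollifier d eta -> exists eta1 eta2, C1c d eta eta1 eta2.
Proof.
move=> m; have [_ D] := mol_Ck m 1.
have [e1 [[c1 _] d1]] := D (1, 0); have [e2 [[c2 _] d2]] := D (0, 1).
have cc1 := continuous_within_setT c1; have cc2 := continuous_within_setT c2.
have {}d1 x : is_derive x ((1, 0) : R * R) eta (e1 x).
  by apply: d1; rewrite interiorT.
have {}d2 x : is_derive x ((0, 1) : R * R) eta (e2 x).
  by apply: d2; rewrite interiorT.
exists e1, e2; split.
- exact: (C1_of_dir (mol_cont m) cc1 cc2 d1 d2).
- exact: mol_vanish m.
- exact: derive_vanish (mol_vanish m) d1.
- exact: derive_vanish (mol_vanish m) d2.
Qed.

Lemma mollifier_intg d eta : mollifier d eta -> intg (leb2 R) eta.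
Proof. by move=> m; exact: intg_cont_vanish (mol_cont m) (mol_vanish m). Qed.

(** The translation increments of h are averaged against a probability density supported in |y| <=
    d. Both the L1 and the L2 convergence of mollifications rest on this. *)
Lemma mollifier_L1 d eta h e : mollifier d eta -> intg (leb2 R) h ->
  (forall c : R * R, `|c| <= d -> \int[leb2 R]_x `|h (c + x) - h x| <= e) ->
  intg (leb2 R \x leb2 R)%E (fun z => eta z.2 * `|h (z.1 - z.2) - h z.1|) /\
  \int[leb2 R]_x \int[leb2 R]_y (eta y * `|h (x - y) - h x|) <= e.
Proof.
move=> m ih he; have ie := mollifier_intg m; have mh := intg_mfun ih.
have ihy y : intg (leb2 R) (fun x => `|h (x - y) - h x|).
  apply/intg_norm/intgB => //.
  by have := intg_translate (- y) ih; apply: intg_ext => x; rewrite addrC.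
have le y : eta y * \int[leb2 R]_x `|h (x - y) - h x| <= e * eta y.
  have [yd|yd] := lerP `|y| d; last by rewrite (mol_vanish m)// mul0r mulr0.
  rewrite mulrC ler_wpM2r ?(mol_ge0 m)//.
  have := he (- y); rewrite normrN => /(_ yd); apply: le_trans.
  by rewrite le_eqVlt; apply/orP; left; apply/eqP; apply: Rint_ext => x; rewrite (addrC x).
have i : intg (leb2 R \x leb2 R)%E (fun z => eta z.2 * `|h (z.1 - z.2) - h z.1|).
  apply: (@intg_tonelli2 _ _ _ _ _ (leb2 R) (leb2 R) _ (fun y => e * eta y)).
  - apply: measurable_funM.
      exact: (measurableT_comp (continuous_measurable2 (mol_cont m)) measurable_snd).
    apply: measurableT_comp => //; apply: measurable_funB.
      exact: (measurableT_comp mh (@measurable_sub2 R)).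
    exact: (measurableT_comp mh measurable_fst).
  - apply: aeW => y /=; split; first exact: intgZ.
    apply: le_trans (le y); rewrite -RintZ// le_eqVlt; apply/orP; left; apply/eqP.
    by apply: Rint_ext => x; rewrite ger0_norm// mulr_ge0// (mol_ge0 m).
  - exact: intgZ.
split => //; have := Rfubini i => /= ->.
apply: (@le_trans _ _ (\int[leb2 R]_y (e * eta y))).
  apply: Rint_le; [exact: (intg_fubini2 i)|exact: intgZ|move=> y /=].
  by rewrite RintZ.
by rewrite RintZ// (mol_int m) mulr1.
Qed.

Lemma conv_diff d eta g x : mollifier d eta -> L1loc g ->
  intg (leb2 R) (fun y => eta y * (g (x - y) - g x)) /\
  conv eta g x - g x = \int[leb2 R]_y (eta y * (g (x - y) - g x)).
Proof.
move=> m lg; have ie := mollifier_intg m.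
have i0 := conv_int_intg x (mol_cont m) (mol_vanish m) lg.
have i1 : intg (leb2 R) (fun y => eta y * g (x - y)).
  by have := intg_reflect x i0; apply: intg_ext => y; rewrite subKr.
have i2 : intg (leb2 R) (fun y => g x * eta y) by exact: intgZ.
have E y : eta y * g (x - y) - g x * eta y = eta y * (g (x - y) - g x) by ring.
split; first by have := intgB i1 i2; apply: intg_ext => y; exact: E.
transitivity (\int[leb2 R]_y (eta y * g (x - y) - g x * eta y)); last exact: Rint_ext.
rewrite RintB// RintZ// (mol_int m) mulr1; congr (_ - _).
rewrite /conv (Rint_reflect x (intg_mfun i0)).
by apply: Rint_ext => y; rewrite subKr.
Qed.

Lemma conv_L1_close d eta om e : mollifier d eta -> intg (leb2 R) om ->
  (forall c : R * R, `|c| <= d -> \int[leb2 R]_x `|om (c + x) - om x| <= e) ->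
  \int[leb2 R]_x `|conv eta om x - om x| <= e.
Proof.
move=> m iom he; have [iF leF] := mollifier_L1 m iom he.
have [_ ic] := conv_intg (mol_cont m) (mol_vanish m) iom.
apply: le_trans leF; apply: Rint_le.
- exact/intg_norm/intgB.
- exact: (intg_fubini1 iF).
- move=> x; have [i ->] := conv_diff x m (intg_L1loc iom).
  rewrite (le_trans (Rint_norm i))// le_eqVlt; apply/orP; left; apply/eqP.
  by apply: Rint_ext => y; rewrite normrM ger0_norm// (mol_ge0 m).
Qed.

(** The variance of u under the probability density [eta] is nonnegative. *)
Lemma jensen_sq eta u : intg (leb2 R) eta -> (forall x, 0 <= eta x) ->
  \int[leb2 R]_x eta x = 1 -> intg (leb2 R) (fun x => eta x * u x) ->
  intg (leb2 R) (fun x => eta x * u x ^+ 2) ->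
  (\int[leb2 R]_x (eta x * u x)) ^+ 2 <= \int[leb2 R]_x (eta x * u x ^+ 2).
Proof.
move=> ie e0 e1 i1 i2; set m := \int[leb2 R]_x (eta x * u x).
have : 0 <= \int[leb2 R]_x (eta x * (u x - m) ^+ 2).
  by apply: Rint_ge0 => x; rewrite mulr_ge0// sqr_ge0.
have -> : \int[leb2 R]_x (eta x * (u x - m) ^+ 2) =
    \int[leb2 R]_x (eta x * u x ^+ 2 - (2 * m) * (eta x * u x) + m ^+ 2 * eta x).
  by apply: Rint_ext => x; ring.
rewrite RintD; [|by apply: intgB => //; exact: intgZ|exact: intgZ].
rewrite RintB; [|by []|exact: intgZ].
by rewrite !RintZ// e1 -/m; set I := \int[_]_x _; lra.
Qed.

(* Turns continuity of translations in L1 for V |V| into continuity in L2 for V. *)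
Lemma sq_diff_le (a b : R) : (a - b) ^+ 2 <= 2 * `|a * `|a| - b * `|b| |.
Proof.
have h := sqr_ge0 (a + b); have [a0|a0] := ger0P a; have [b0|b0] := ger0P b.
- have [ab|ab] := lerP b a.
    by rewrite ger0_norm ?subr_ge0; nra.
  by rewrite ltr0_norm ?subr_lt0; nra.
- by rewrite ger0_norm ?subr_ge0; nra.
- by rewrite ler0_norm ?subr_le0; nra.
- have [ab|ab] := lerP b a.
    by rewrite ger0_norm ?subr_ge0; nra.
  by rewrite ltr0_norm ?subr_lt0; nra.
Qed.

Lemma box_ball (L : R) (x y : R * R) : `|y| <= 1 -> `|x| <= L -> box (L + 1) (x - y) = 1.
Proof. by move=> y1 xL; rewrite boxE ifT// (le_trans (ler_normB _ _))// lerD. Qed.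

(** [jensen_sq] brings the square inside the average, [sq_diff_le] bounds it by an increment of V
    |V|, and [mollifier_L1] controls the mean increment. As d <= 1, the point x - y stays in the box
    of radius L + 1, where the cut-off equals 1. *)
Lemma conv_L2_close d eta V L e : mollifier d eta -> d <= 1 -> L1loc V ->
  intg (leb2 R) (fun x => V x * `|V x| * box (L + 1) x) ->
  (forall c : R * R, `|c| <= d -> \int[leb2 R]_x
     `|V (c + x) * `|V (c + x)| * box (L + 1) (c + x) - V x * `|V x| * box (L + 1) x| <= e) ->
  intg (leb2 R) (fun x => box L x * (conv eta V x - V x) ^+ 2) /\
  \int[leb2 R]_x (box L x * (conv eta V x - V x) ^+ 2) <= 2 * e.
Proof.
move=> m d1 lV ih he; pose h x := V x * `|V x| * box (L + 1) x.
have [iF leF] := mollifier_L1 m ih he.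
pose G x := \int[leb2 R]_y (eta y * `|h (x - y) - h x|).
have iG : intg (leb2 R) (fun x => 2 * G x) by apply: intgZ; exact: (intg_fubini1 iF).
have cV := conv_continuous (mol_cont m) (mol_vanish m) lV.
have mW : measurable_fun (setT : set R2) (fun x => box L x * (conv eta V x - V x) ^+ 2).
  apply: measurable_funM; first exact: measurable_box.
  apply: measurable_funX; apply: measurable_funB; last exact: lV.1.
  exact: continuous_measurable2.
have le : {ae leb2 R, forall x, `|box L x * (conv eta V x - V x) ^+ 2| <= 2 * G x}.
  apply: filterS (intg_section1 iF) => x /= iFx.
  have G0 : 0 <= G x by apply: Rint_ge0 => y; rewrite mulr_ge0// (mol_ge0 m).
  rewrite boxE; case: ifPn => [xL|_]; last by rewrite mul0r normr0 mulr_ge0.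
  rewrite mul1r ger0_norm ?sqr_ge0//; have [i ->] := conv_diff x m lV.
  have pt y : eta y * (V (x - y) - V x) ^+ 2 <= 2 * (eta y * `|h (x - y) - h x|).
    have [yd|yd] := lerP `|y| d; last by rewrite (mol_vanish m)// !mul0r mulr0.
    rewrite [leRHS]mulrCA ler_wpM2l ?(mol_ge0 m)// /h box_ball ?(le_trans yd)//.
    rewrite [box _ x]boxE ifT ?mulr1; first exact: sq_diff_le.
    by rewrite (le_trans xL)// lerDl.
  have i2 : intg (leb2 R) (fun y => eta y * (V (x - y) - V x) ^+ 2).
    apply: (@intg_le _ _ _ (leb2 R) _ (fun y => 2 * (eta y * `|h (x - y) - h x|))).
    - apply: measurable_funM; first exact: (continuous_measurable2 (mol_cont m)).
      apply: measurable_funX; apply: measurable_funB => //.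
      exact: (measurableT_comp lV.1 (measurable_sub_l x)).
    - by move=> y; rewrite ger0_norm// mulr_ge0 ?(mol_ge0 m)// sqr_ge0.
    - exact: intgZ.
  apply: le_trans (jensen_sq (mollifier_intg m) (mol_ge0 m) (mol_int m) i i2) _.
  by rewrite /G -RintZ//; apply: Rint_le => //; exact: intgZ.
have [i iL] := intg_le_ae mW iG le; split => //.
apply: le_trans (ler_norm _) _; apply: le_trans (Rint_norm i) _; apply: le_trans iL _.
by rewrite RintZ ?ler_wpM2l//; exact: (intg_fubini1 iF).
Qed.

Lemma C1_lipschitz f f1 f2 A B x y : C1 f f1 f2 ->
  (forall x, `|f1 x| <= A) -> (forall x, `|f2 x| <= B) ->
  `|f x - f y| <= (A + B) * `|x - y|.
Proof.
move=> Cf hA hB.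
have [r _] := @MVT_dir R (R * R)%type f y (x - y)
  (fun r => (x - y).1 * f1 (r *: (x - y) + y) + (x - y).2 * f2 (r *: (x - y) + y))
  (fun r _ => C1_dir (r *: (x - y) + y) (x - y) Cf).
rewrite subrK => ->; apply: le_trans (ler_normD _ _) _.
rewrite !normrM mulrDl; apply: lerD.
  by rewrite mulrC ler_pM// norm_fst_le.
by rewrite mulrC ler_pM// norm_snd_le.
Qed.

Lemma C1c_lipschitz L f f1 f2 : C1c L f f1 f2 ->
  exists2 A, 0 <= A & forall x y, `|f x - f y| <= A * `|x - y|.
Proof.
move=> [Cf v0 v1 v2].
have [A A0 hA] := vanish_bounded (C1_cont1 Cf) v1.
have [B B0 hB] := vanish_bounded (C1_cont2 Cf) v2.
exists (A + B) => [|x y]; first exact: addr_ge0.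
exact: C1_lipschitz Cf hA hB.
Qed.

Lemma bilinear_bound A (H : R2 * R2 -> R) f g :
  measurable_fun (setT : set (R2 * R2)%type) H -> (forall z, `|H z| <= A) ->
  intg (leb2 R) f -> intg (leb2 R) g ->
  intg (leb2 R \x leb2 R)%E (fun z => H z * f z.1 * g z.2) /\
  `|\int[(leb2 R \x leb2 R)%E]_z (H z * f z.1 * g z.2)| <=
    A * (\int[leb2 R]_x `|f x| * \int[leb2 R]_x `|g x|).
Proof.
move=> mH HA iF iG.
have ip := intg_prod (intg_norm iF) (intg_norm iG).
have iA := intgZ A ip.
have b z : `|H z * f z.1 * g z.2| <= A * (`|f z.1| * `|g z.2|).
  by rewrite !normrM -mulrA ler_wpM2r// mulr_ge0.
have m : measurable_fun (setT : set (R2 * R2)%type) (fun z => H z * f z.1 * g z.2).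
  apply: measurable_funM; first apply: measurable_funM => //.
    exact: (measurableT_comp (intg_mfun iF) measurable_fst).
  exact: (measurableT_comp (intg_mfun iG) measurable_snd).
split; first exact: (intg_le m b iA).
apply: le_trans (Rint_norm_le m iA b) _.
rewrite RintZ// le_eqVlt; apply/orP; left; apply/eqP; congr (_ * _).
rewrite -(Rfubini1 ip)/=.
transitivity (\int[leb2 R]_x ((\int[leb2 R]_y `|g y|) * `|f x|)).
  apply: Rint_ext => x; rewrite [RHS]mulrC.
  exact: (RintZ _ (intg_norm iG)).
by rewrite (RintZ _ (intg_norm iF)) mulrC.
Qed.

Section HbarBound.
Variables (L : R) (P p1 p2 Q q1 q2 : R * R -> R).
Hypotheses (CP : C1c L P p1 p2) (CQ : C1c L Q q1 q2).

Lemma measurable_Hbar : measurable_fun (setT : set (R2 * R2)%type) (fun z => Hbar P Q z.1 z.2).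
Proof.
have mP := continuous_measurable2 (C1_cont (C1c_C1 CP)).
have mQ := continuous_measurable2 (C1_cont (C1c_C1 CQ)).
apply: measurable_funM => //; apply: measurable_funB; apply: measurable_funM.
- exact: (measurableT_comp (@measurable_bsK1 R) (@measurable_sub2 R)).
- apply: measurable_funB; [exact: (measurableT_comp mQ measurable_fst)|
    exact: (measurableT_comp mQ measurable_snd)].
- exact: (measurableT_comp (@measurable_bsK2 R) (@measurable_sub2 R)).
- apply: measurable_funB; [exact: (measurableT_comp mP measurable_fst)|
    exact: (measurableT_comp mP measurable_snd)].
Qed.

(** The bound 1/|x - y| on K cancels the Lipschitz factor. On the diagonal this inverse is 0 by
    convention, which forces the kernel to vanish there. *)
Lemma Hbar_le (A B : R) (x y : R * R) : 0 <= A -> 0 <= B ->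
  `|P x - P y| <= A * `|x - y| -> `|Q x - Q y| <= B * `|x - y| ->
  `|Hbar P Q x y| <= A + B.
Proof.
move=> A0 B0 hP hQ.
have key k D C : 0 <= C -> `|k| <= `|x - y|^-1 -> `|D| <= C * `|x - y| -> `|k * D| <= C.
  move=> C0 hk hD; rewrite normrM; have [xy|xy] := eqVneq `|x - y| 0.
    by move: hk; rewrite xy invr0 normr_le0 => /eqP ->; rewrite normr0 mul0r.
  by apply: le_trans (ler_pM (normr_ge0 _) (normr_ge0 _) hk hD) _; rewrite mulrCA mulVf// mulr1.
have h1 := key _ _ _ B0 (bsK1_le (x - y)) hQ.
have h2 := key _ _ _ A0 (bsK2_le (x - y)) hP.
rewrite /Hbar normrM ger0_norm ?invr_ge0//.
have h := ler_normB ((bsK (x - y)).1 * (Q x - Q y)) ((bsK (x - y)).2 * (P x - P y)).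
set N := `|_ - _| in h *; lra.
Qed.

Lemma Hbar_bounded : exists2 A, 0 <= A & forall z : R2 * R2, `|Hbar P Q z.1 z.2| <= A.
Proof.
have [A A0 hA] := C1c_lipschitz CP; have [B B0 hB] := C1c_lipschitz CQ.
exists (A + B) => [|z]; first exact: addr_ge0.
exact: Hbar_le.
Qed.

Definition Hform om := \int[leb2 R]_y \int[leb2 R]_x (Hbar P Q x y * om x * om y).

(** Bilinearity: f(x) f(y) - g(x) g(y) is f(x) (f(y) - g(y)) + (f(x) - g(x)) g(y), and the kernel is
    bounded by A. *)
Lemma Hform_close A f g : 0 <= A -> (forall z : R2 * R2, `|Hbar P Q z.1 z.2| <= A) ->
  intg (leb2 R) f -> intg (leb2 R) g ->
  `|Hform f - Hform g| <= A * ((\int[leb2 R]_x `|f x| + \int[leb2 R]_x `|g x|) *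
     \int[leb2 R]_x `|f x - g x|).
Proof.
move=> A0 hA iF iG; have mH := measurable_Hbar; have iD := intgB iF iG.
have [iff _] := bilinear_bound mH hA iF iF; have [igg _] := bilinear_bound mH hA iG iG.
have [ifd Bfd] := bilinear_bound mH hA iF iD; have [idg Bdg] := bilinear_bound mH hA iD iG.
have := Rfubini2 iff => /= E1; have := Rfubini2 igg => /= E2.
rewrite /Hform E1 E2 -RintB//.
have -> : \int[(leb2 R \x leb2 R)%E]_z (Hbar P Q z.1 z.2 * f z.1 * f z.2 - Hbar P Q z.1 z.2 * g z.1 * g z.2)
  = \int[(leb2 R \x leb2 R)%E]_z (Hbar P Q z.1 z.2 * f z.1 * (f z.2 - g z.2) +
      Hbar P Q z.1 z.2 * (f z.1 - g z.1) * g z.2).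
  by apply: Rint_ext => z; ring.
rewrite RintD//; apply: le_trans (ler_normD _ _) _.
rewrite mulrDl mulrDr lerD//; apply: le_trans Bdg _.
by rewrite [X in A * X]mulrC.
Qed.

End HbarBound.

Lemma young (s a v : R) : 0 < s -> 2 * `|a * v| <= s^-1 * a ^+ 2 + s * v ^+ 2.
Proof.
move=> s0; rewrite -(ler_pM2l s0).
have h1 := sqr_ge0 (a - s * v); have h2 := sqr_ge0 (a + s * v).
rewrite [leRHS]mulrDr [X in X + _]mulrA mulfV ?gt_eqF// mul1r.
by have [h|h] := ger0P (a * v); nra.
Qed.

Lemma prod_diff_le (s a b v w : R) : 0 < s <= 1 ->
  2 * `|(v + a) * (w + b) - v * w| <=
  2 * s^-1 * (a ^+ 2 + b ^+ 2) + s * (v ^+ 2 + w ^+ 2).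
Proof.
move=> /andP[s0 s1].
have k1 : 1 <= s^-1 by rewrite invf_ge1.
have y1 := young b v s0; have y2 := young a w s0.
have y3 : 2 * `|a * b| <= a ^+ 2 + b ^+ 2.
  by have := young a b ltr01; rewrite invr1 !mul1r.
have h : `|(v + a) * (w + b) - v * w| <= `|b * v| + `|a * w| + `|a * b|.
  rewrite (_ : _ - _ = b * v + a * w + a * b); last by ring.
  by rewrite (le_trans (ler_normD _ _))// lerD2r ler_normD.
have k2 : a ^+ 2 + b ^+ 2 <= s^-1 * (a ^+ 2 + b ^+ 2).
  by rewrite ler_peMl// addr_ge0// sqr_ge0.
lra.
Qed.

(** Young's inequality with weight s: the squared perturbation is charged 1/s and the unperturbed
    field s. A perturbation whose square is of order s^2 then costs O(s) in total. *)
Lemma tensor_close (p1 p2 q1 q2 V1 V2 W1 W2 : R * R -> R) (B s : R) x : 0 < s <= 1 ->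
  `|p1 x| <= B -> `|p2 x| <= B -> `|q1 x| <= B -> `|q2 x| <= B ->
  `|tensor p1 p2 q1 q2 W1 W2 x - tensor p1 p2 q1 q2 V1 V2 x| <=
  B * (4 * s^-1 * ((W1 x - V1 x) ^+ 2 + (W2 x - V2 x) ^+ 2) + 2 * s * (V1 x ^+ 2 + V2 x ^+ 2)).
Proof.
move=> s01 hp1 hp2 hq1 hq2; rewrite /tensor.
set w1 := W1 x; set w2 := W2 x; set v1 := V1 x; set v2 := V2 x.
pose a := w1 - v1; pose b := w2 - v2.
have w1E : w1 = v1 + a by rewrite /a; ring.
have w2E : w2 = v2 + b by rewrite /b; ring.
have P1 := prod_diff_le a a v1 v1 s01; have P2 := prod_diff_le b b v2 v2 s01.
have P3 := prod_diff_le a b v1 v2 s01.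
rewrite -/a -/b w1E w2E.
set X := (v1 + a) * (v1 + a) - v1 * v1 in P1.
set Y := (v2 + b) * (v2 + b) - v2 * v2 in P2.
set Z := (v1 + a) * (v2 + b) - v1 * v2 in P3.
have -> : ((v1 + a) * p1 x + (v2 + b) * p2 x) * (v1 + a) +
   ((v1 + a) * q1 x + (v2 + b) * q2 x) * (v2 + b) -
   ((v1 * p1 x + v2 * p2 x) * v1 + (v1 * q1 x + v2 * q2 x) * v2) =
   p1 x * X + p2 x * Z + (q1 x * Z + q2 x * Y) by rewrite /X /Y /Z; ring.
have B0 : 0 <= B by rewrite (le_trans _ hp1).
apply: (@le_trans _ _ (B * `|X| + B * `|Z| + (B * `|Z| + B * `|Y|))).
  apply: le_trans (ler_normD _ _) _; apply: lerD; apply: le_trans (ler_normD _ _) _;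
  by apply: lerD; rewrite normrM ler_wpM2r.
rewrite -!mulrDr ler_wpM2l//.
move: P1 P2 P3; clear; set k := s^-1; lra.
Qed.

Lemma conv_bounded L eta om : continuous eta -> vanish L eta -> intg (leb2 R) om ->
  exists C, forall x, `|conv eta om x| <= C.
Proof.
move=> ce ve iom; have [C C0 hC] := vanish_bounded ce ve.
exists (\int[leb2 R]_y (C * `|om y|)) => x.
apply: Rint_norm_le; [|exact/intgZ/intg_norm|by move=> y; rewrite normrM ler_wpM2r].
exact: (intg_mfun (conv_int_intg x ce ve (intg_L1loc iom))).
Qed.

Lemma intg_tensor (L B : R) (p1 p2 q1 q2 V U : R * R -> R) : continuous p1 -> continuous p2 ->
  continuous q1 -> continuous q2 ->
  (forall x, `|p1 x| <= B * box L x) -> (forall x, `|p2 x| <= B * box L x) ->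
  (forall x, `|q1 x| <= B * box L x) -> (forall x, `|q2 x| <= B * box L x) ->
  measurable_fun (setT : set R2) V -> measurable_fun (setT : set R2) U ->
  intg (leb2 R) (fun x => box L x * V x ^+ 2) ->
  intg (leb2 R) (fun x => box L x * U x ^+ 2) -> intg (leb2 R) (tensor p1 p2 q1 q2 V U).
Proof.
move=> /continuous_measurable2 m1 /continuous_measurable2 m2.
move=> /continuous_measurable2 m3 /continuous_measurable2 m4 h1 h2 h3 h4 mV mU iV iU.
apply: (@intg_le _ _ _ (leb2 R) _ (fun x => (B * 4) * (box L x * V x ^+ 2 + box L x * U x ^+ 2))).
- by rewrite /tensor; do ?[apply: measurable_funD|apply: measurable_funM].
- move=> x; have one : 0 < (1 : R) <= 1 by rewrite ltr01 lexx.
  have := tensor_close (fun=> 0) (fun=> 0) V U one (h1 x) (h2 x) (h3 x) (h4 x).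
  rewrite /tensor !mul0r !addr0 !subr0 invr1 expr0n/= addr0 !mulr0 !addr0 mulr1 subr0.
  by move/le_trans; apply; rewrite le_eqVlt; apply/orP; left; apply/eqP; ring.
- by apply: intgZ; exact: intgD.
Qed.

Lemma weighted_regroup (B b k a c s v w : R) :
  B * b * (k * (a + c) + s * (v + w)) = B * (k * (b * a + b * c) + s * (b * v + b * w)).
Proof. ring. Qed.

(* True for the mollified velocity by Rint_tensor_C1 and symmetrization; the left-
   hand side passes to the limit in L2, the right-hand side because Hbar is
   bounded and the mollified vorticity converges in L1. *)
Lemma tensor_identity L P p1 p2 Q q1 q2 om :
  C1c L P p1 p2 -> C1c L Q q1 q2 -> (forall x, p1 x + q2 x = 0) ->
  intg (leb2 R) om ->
  intg (leb2 R) (fun x => (bs_conv om x).1 ^+ 2 * box (L + 1) x) ->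
  intg (leb2 R) (fun x => (bs_conv om x).2 ^+ 2 * box (L + 1) x) ->
  \int[leb2 R]_x tensor p1 p2 q1 q2 (fun x => (bs_conv om x).1) (fun x => (bs_conv om x).2) x
  = - Hform P Q om.
Proof.
move=> CP CQ dPQ iom i1 i2.
set V1 := fun x => (bs_conv om x).1; set V2 := fun x => (bs_conv om x).2.
have lV1 : L1loc V1 := V1_L1loc iom; have lV2 : L1loc V2 := V2_L1loc iom.
have ih V : L1loc V -> intg (leb2 R) (fun x => V x ^+ 2 * box (L + 1) x) ->
    intg (leb2 R) (fun x => V x * `|V x| * box (L + 1) x).
  move=> lV iV; apply: (@intg_le _ _ _ (leb2 R) _ (fun x => V x ^+ 2 * box (L + 1) x)) => //.
    apply: measurable_funM; last exact: measurable_box.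
    by apply: measurable_funM; [exact: lV.1|exact: (measurableT_comp _ lV.1)].
  by move=> x; rewrite normrM (ger0_norm (box_ge0 _ _)) normrM normr_id -normrM -expr2 ger0_norm ?sqr_ge0.
have ih1 := ih _ lV1 i1; have ih2 := ih _ lV2 i2.
have [A A0 hA] := Hbar_bounded CP CQ.
have [B [B0 [hp1 hp2 hq1 hq2]]] : exists B, 0 <= B /\ [/\ forall x, `|p1 x| <= B * box L x,
    forall x, `|p2 x| <= B * box L x, forall x, `|q1 x| <= B * box L x &
    forall x, `|q2 x| <= B * box L x].
  have [B1 B10 h1] := vanish_box (C1_cont1 (C1c_C1 CP)) (C1c_1 CP).
  have [B2 B20 h2] := vanish_box (C1_cont2 (C1c_C1 CP)) (C1c_2 CP).
  have [B3 B30 h3] := vanish_box (C1_cont1 (C1c_C1 CQ)) (C1c_1 CQ).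
  have [B4 B40 h4] := vanish_box (C1_cont2 (C1c_C1 CQ)) (C1c_2 CQ).
  exists (B1 + B2 + (B3 + B4)); split; first by rewrite !addr_ge0.
  by split=> x; [apply: le_trans (h1 x) _|apply: le_trans (h2 x) _|
    apply: le_trans (h3 x) _|apply: le_trans (h4 x) _];
    rewrite ler_wpM2r ?box_ge0//; lra.
have bL x : box L x <= box (L + 1) x.
  rewrite !boxE; case: ifPn => [xL|_]; last by case: ifP.
  by rewrite ifT// (le_trans xL)// lerDl.
have iS V : L1loc V -> intg (leb2 R) (fun x => V x ^+ 2 * box (L + 1) x) ->
    intg (leb2 R) (fun x => box L x * V x ^+ 2).
  move=> lV iV; apply: (@intg_le _ _ _ (leb2 R) _ (fun x => V x ^+ 2 * box (L + 1) x)) => //.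
    by apply: measurable_funM; [exact: measurable_box|apply: measurable_funX; exact: lV.1].
  move=> x; rewrite ger0_norm; last by rewrite mulr_ge0 ?box_ge0 ?sqr_ge0.
  by rewrite [leLHS]mulrC ler_wpM2l ?sqr_ge0.
have iS1 := iS _ lV1 i1; have iS2 := iS _ lV2 i2.
pose S := \int[leb2 R]_x (box L x * V1 x ^+ 2) + \int[leb2 R]_x (box L x * V2 x ^+ 2).
have S0 : 0 <= S by apply: addr_ge0; apply: Rint_ge0 => x; rewrite mulr_ge0 ?box_ge0 ?sqr_ge0.
pose N := \int[leb2 R]_x `|om x|.
have N0 : 0 <= N by apply: Rint_ge0.
apply: (@eq_by_eps _ _ _ (B * (16 + 2 * S) + A * (N + 1 + N))).
  by rewrite addr_ge0// mulr_ge0// ?addr_ge0// mulr_ge0.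
(* s <= 1 is required by [tensor_close], and it also bounds the L1 norm of the mollified vorticity
   by N + 1. *)
move=> t t0; pose s := Num.min t 1.
have s0 : 0 < s by rewrite lt_min t0 ltr01.
have s1 : s <= 1 by rewrite ge_min lexx orbT.
have st : s <= t by rewrite ge_min lexx.
have [d0 d00 hd0] := L1_translation iom s0.
(* The L2 errors get divided by s in [tensor_close], hence the tolerance s^2 for the translations of
   V |V|. *)
have ss0 : 0 < s ^+ 2 by rewrite exprn_gt0.
have [d1 d10 hd1] := L1_translation ih1 ss0.
have [d2 d20 hd2] := L1_translation ih2 ss0.
pose d := Num.min (Num.min d0 d1) (Num.min d2 1).
have dpos : 0 < d by rewrite !lt_min d00 d10 d20 ltr01.
have dd0 : d <= d0 by rewrite !ge_min lexx.
have dd1 : d <= d1 by rewrite !ge_min lexx orbT.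
have dd2 : d <= d2 by rewrite !ge_min lexx !orbT.
have dd3 : d <= 1 by rewrite !ge_min lexx !orbT.
have [eta m] := mollifier_exists dpos.
have [eta1 [eta2 Ceta]] := mollifier_C1c m.
have Lom := conv_L1_close m iom (fun c hc => hd0 c (le_trans hc dd0)).
have [iW1 LW1] := conv_L2_close m dd3 lV1 ih1 (fun c hc => hd1 c (le_trans hc dd1)).
have [iW2 LW2] := conv_L2_close m dd3 lV2 ih2 (fun c hc => hd2 c (le_trans hc dd2)).
have [_ iomd] := conv_intg (mol_cont m) (mol_vanish m) iom.
pose g := conv eta om.
have C1W := C1_conv Ceta lV1; have C2W := C1_conv Ceta lV2.
have TW : \int[leb2 R]_x tensor p1 p2 q1 q2 (conv eta V1) (conv eta V2) x = - Hform P Q g.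
  rewrite (Rint_tensor_C1 CP CQ dPQ C1W C2W (conv_bs_div Ceta iom)); congr (- _).
  have [C gC] := conv_bounded (mol_cont m) (mol_vanish m) iom.
  have := Rint_symmetrize (C1_cont (C1c_C1 CP)) (C1c_0 CP) (C1_cont (C1c_C1 CQ)) (C1c_0 CQ)
    iomd (intg_mfun iomd) gC.
  rewrite /Hform -/g => <-; apply: Rint_ext => x.
  rewrite (conv_bs_curl Ceta iom).
  by rewrite (kconv_conv x (@measurable_bsK1 R) (@bsK1_le R) (mol_cont m) (mol_vanish m) iom)
    (kconv_conv x (@measurable_bsK2 R) (@bsK2_le R) (mol_cont m) (mol_vanish m) iom).
have iT := intg_tensor (C1_cont1 (C1c_C1 CP)) (C1_cont2 (C1c_C1 CP)) (C1_cont1 (C1c_C1 CQ))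
  (C1_cont2 (C1c_C1 CQ)) hp1 hp2 hq1 hq2.
have iTV := iT _ _ lV1.1 lV2.1 iS1 iS2.
have iTW : intg (leb2 R) (tensor p1 p2 q1 q2 (conv eta V1) (conv eta V2)).
  have sq (W : R * R -> R) : continuous W -> intg (leb2 R) (fun x => box L x * W x ^+ 2).
    move=> cW; have [] := @cont_L1loc R (fun x => W x ^+ 2).
      by move=> x; apply: cvgM; exact: cW.
    by move=> _ /(_ L); apply: intg_ext => x; rewrite ger0_norm ?sqr_ge0// mulrC.
  have c1 := C1_cont C1W; have c2 := C1_cont C2W.
  by apply: iT; [exact: continuous_measurable2..|exact: sq|exact: sq].
have T1 : `|\int[leb2 R]_x tensor p1 p2 q1 q2 V1 V2 x -
    \int[leb2 R]_x tensor p1 p2 q1 q2 (conv eta V1) (conv eta V2) x| <= s * (B * (16 + 2 * S)).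
  rewrite distrC -RintB//.
  have iW := intgZ (4 * s^-1) (intgD iW1 iW2); have iSS := intgZ (2 * s) (intgD iS1 iS2).
  apply: le_trans (Rint_norm_le (intg_mfun (intgB iTW iTV)) (intgZ B (intgD iW iSS)) _) _.
    move=> x; have s01 : 0 < s <= 1 by rewrite s0 s1.
    have := tensor_close V1 V2 (conv eta V1) (conv eta V2) s01 (hp1 x) (hp2 x) (hq1 x) (hq2 x).
    by rewrite weighted_regroup.
  rewrite (RintZ _ (intgD iW iSS)) (RintD iW iSS) (RintZ _ (intgD iW1 iW2)) (RintD iW1 iW2).
  rewrite (RintZ _ (intgD iS1 iS2)) (RintD iS1 iS2) -/S.
  (* 16 is 4 (2 + 2): each velocity component has squared L2 error 2 s^2, multiplied by 4 / s. *)
  rewrite [leRHS]mulrCA ler_wpM2l// (_ : s * (16 + 2 * S) = 4 * s^-1 * (2 * s ^+ 2 + 2 * s ^+ 2) + 2 * s * S); last first.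
    by field; rewrite gt_eqF.
  rewrite lerD2r; apply: ler_wpM2l; last exact: (lerD LW1 LW2).
  by apply: mulr_ge0; [exact: ler0n|rewrite invr_ge0; exact: ltW].
have T2 : `|Hform P Q g - Hform P Q om| <= s * (A * (N + 1 + N)).
  apply: le_trans (Hform_close CP CQ A0 hA iomd iom) _.
  rewrite [leRHS]mulrCA ler_wpM2l// mulrC ler_pM//.
  - exact: Rint_ge0.
  - by apply: addr_ge0; exact: Rint_ge0.
  rewrite -/N lerD2r.
  apply: (@le_trans _ _ (\int[leb2 R]_x (`|om x| + `|conv eta om x - om x|))).
    apply: Rint_le.
    - exact: intg_norm.
    - by apply: intgD; [exact: intg_norm|exact/intg_norm/intgB].
    - by move=> x; rewrite -[X in `|X| <= _](subrK (om x)) addrC ler_normD.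
  rewrite RintD; [|exact: intg_norm|exact/intg_norm/intgB].
  by rewrite lerD2l (le_trans Lom).
apply: (@le_trans _ _ (s * (B * (16 + 2 * S) + A * (N + 1 + N)))); last first.
  by rewrite ler_wpM2r// addr_ge0// mulr_ge0// ?addr_ge0// mulr_ge0.
rewrite mulrDr; apply: le_trans (lerD T1 T2); rewrite TW.
set a := \int[_]_x _; rewrite !opprK.
by apply: le_trans (ler_normB _ _); rewrite opprB addrACA subrr addr0.
Qed.

End MollifierLimits.

(** * Test functions on the slab *)

Section PairCk.
Variables (R : realType) (V : normedModType R).
Implicit Types (D : set V) (f g : V -> R) (h : V -> R * R).

Lemma within_fst D h : {within D, continuous h} ->
  {within D, continuous (fun p => (h p).1)}.
Proof.
move=> /subspace_continuousP ch; apply/subspace_continuousP => x Dx.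
exact: (cvg_comp h fst (ch x Dx) cvg_fst).
Qed.

Lemma within_snd D h : {within D, continuous h} ->
  {within D, continuous (fun p => (h p).2)}.
Proof.
move=> /subspace_continuousP ch; apply/subspace_continuousP => x Dx.
exact: (cvg_comp h snd (ch x Dx) cvg_snd).
Qed.

Lemma within_pair D f g : {within D, continuous f} -> {within D, continuous g} ->
  {within D, continuous (fun p => (f p, g p))}.
Proof.
move=> /subspace_continuousP cf /subspace_continuousP cg.
apply/subspace_continuousP => x Dx; exact: (cvg_pair (cf x Dx) (cg x Dx)).
Qed.

Lemma Ck_fst D n h : Ck D n h -> Ck D n (fun p => (h p).1).
Proof.
elim: n h => [|n IH] h [ch dh].
  by split=> //; exact: within_fst.
split; first exact: within_fst.
move=> u; have [g [Cg dg]] := dh u; exists (fun p => (g p).1); split; first exact: IH.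
by move=> p Dp; apply: is_derive_fst; exact: dg.
Qed.

Lemma Ck_snd D n h : Ck D n h -> Ck D n (fun p => (h p).2).
Proof.
elim: n h => [|n IH] h [ch dh].
  by split=> //; exact: within_snd.
split; first exact: within_snd.
move=> u; have [g [Cg dg]] := dh u; exists (fun p => (g p).2); split; first exact: IH.
by move=> p Dp; apply: is_derive_snd; exact: dg.
Qed.

Lemma Ck_pair D n f g : Ck D n f -> Ck D n g -> Ck D n (fun p => (f p, g p)).
Proof.
elim: n f g => [|n IH] f g [cf df] [cg dg].
  by split=> //; exact: within_pair.
split; first exact: within_pair.
move=> u; have [f' [Cf' df']] := df u; have [g' [Cg' dg']] := dg u.
exists (fun p => (f' p, g' p)); split; first exact: IH.
by move=> p Dp; apply: is_derive_pair; [exact: df'|exact: dg'].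
Qed.

Lemma Cc_fst D n h : Cc D n h -> Cc D n (fun p => (h p).1).
Proof.
move=> [Ch [K [cK KD h0]]]; split; first exact: Ck_fst.
by exists K; split=> // p Dp Kp; rewrite h0.
Qed.

Lemma Cc_snd D n h : Cc D n h -> Cc D n (fun p => (h p).2).
Proof.
move=> [Ch [K [cK KD h0]]]; split; first exact: Ck_snd.
by exists K; split=> // p Dp Kp; rewrite h0.
Qed.

Lemma Cc_pair D n f g : Cc D n f -> Cc D n g -> Cc D n (fun p => (f p, g p)).
Proof.
move=> [Cf [K [cK KD f0]]] [Cg [J [cJ JD g0]]]; split; first exact: Ck_pair.
exists (K `|` J); split; first exact: compactU.
  by move=> p [/KD|/JD].
by move=> p Dp /not_orP[Kp Jp]; rewrite f0// g0.
Qed.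

Lemma Cc_scale D n (c : R) f : Cc D n f -> Cc D n (fun p => c * f p).
Proof.
move=> [Cf [K [cK KD f0]]]; split; first exact: Ck_scale.
by exists K; split=> // p Dp Kp; rewrite f0// mulr0.
Qed.

End PairCk.

Section Slab.
Variables (R : realType) (T : R).
Local Notation E := (R * (R * R))%type.
Implicit Types (p q u : E) (f g F : E -> R).

Lemma norm_time_le p : `|p.1| <= `|p|.
Proof. by rewrite prod_normE le_max lexx. Qed.

Lemma norm_space_le p : `|p.2| <= `|p|.
Proof. by rewrite prod_normE le_max lexx orbT. Qed.

Lemma near_ball p e (P : E -> Prop) : 0 < e -> (forall q, `|p - q| < e -> P q) ->
  \forall q \near p, P q.
Proof. by move=> e0 h; apply/nbhs_normP; exists e => //= q pq; exact: h. Qed.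

Lemma open_slab : open (slab T).
Proof.
rewrite (_ : slab T = fst @^-1` `]0, T[%classic); last first.
  by apply/seteqP; split=> [p []|p].
apply: open_comp => [p _|]; [exact: cvg_fst|exact: interval_open].
Qed.

Lemma slab_interior p : slab T p -> interior (slab0 T) p.
Proof.
move=> sp; apply: (filterS _ (open_nbhs_nbhs (conj open_slab sp))) => q [q1 _].
by split=> //; move: q1; rewrite /= !in_itv/= => /andP[/ltW -> ->].
Qed.

Lemma slabE t x : slab T (t, x) <-> 0 < t < T.
Proof. by split=> [[]|h]; [rewrite /= in_itv|split=> //; rewrite /= in_itv]. Qed.

Lemma slab0E t x : slab0 T (t, x) <-> 0 <= t < T.
Proof. by split=> [[]|h]; [rewrite /= in_itv|split=> //; rewrite /= in_itv]. Qed.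

Lemma within_near D f p e : {within D, continuous f} -> D p -> 0 < e ->
  exists2 r, 0 < r & forall q, `|p - q| < r -> D q -> `|f p - f q| < e.
Proof.
move=> /subspace_continuousP/(_ p) h Dp e0.
have /cvgrPdist_lt/(_ _ e0) := h Dp => hn.
exact: (near_norm hn).
Qed.

Lemma deriv_vanish_slab K f g u : closed K ->
  (forall p, slab T p -> is_derive p u f (g p)) ->
  (forall p, slab T p -> ~ K p -> f p = 0) -> forall p, slab T p -> ~ K p -> g p = 0.
Proof.
move=> cK dg f0 p sp Kp; have d1 := dg _ sp.
suff d2 : is_derive p u f 0 by have [_ <-] := d1; have [_ ->] := d2.
have N : \forall q \near p, 0 = f q.
  have n1 := open_nbhs_nbhs (conj open_slab sp).
  have n2 : nbhs p (~` K) by apply: open_nbhs_nbhs; split=> //; exact: closed_openC.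
  by apply: filterS2 n1 n2 => q sq Kq; rewrite f0.
exact: (near_eq_is_derive N).
Qed.

(** For t > 0 the function f vanishes near every point off the closed set K. At t = 0 no derivative
    is available, and g vanishes there as a limit of its zeros at later times. *)
Lemma deriv_vanish K f g u : closed K ->
  {within slab0 T, continuous g} -> (forall p, slab T p -> is_derive p u f (g p)) ->
  (forall p, slab0 T p -> ~ K p -> f p = 0) ->
  forall p, slab0 T p -> ~ K p -> g p = 0.
Proof.
move=> cK cg dg f0.
have step : forall p, slab T p -> ~ K p -> g p = 0.
  apply: (deriv_vanish_slab cK dg) => p sp; apply: f0; exact: interior_subset (slab_interior sp).
move=> [t x] sp Kp; have /slab0E /andP[t0 tT] := sp.
have [tp|tn|t0E] := ltgtP 0 t.
- by apply: step => //; apply/slabE; rewrite tp.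
- by rewrite leNgt tn in t0.
apply/eqP; rewrite -normr_le0; apply/negPn/negP; rewrite -ltNge => g0.
have [r r0 hr] := within_near cg sp g0.
have n2 : nbhs (t, x) (~` K) by apply: open_nbhs_nbhs; split=> //; exact: closed_openC.
have [r' r'0 hr'] := near_norm n2.
pose s := Num.min (Num.min r r') T / 2.
have m0 : 0 < Num.min (Num.min r r') T by rewrite !lt_min r0 r'0 (le_lt_trans t0 tT).
have s0 : 0 < s by rewrite divr_gt0.
have sm : s < Num.min (Num.min r r') T by rewrite gtr_pMr// invf_lt1// ltr1n.
have /andP[/andP[sr sr'] sT] : (s < r) && (s < r') && (s < T) by move: sm; rewrite !lt_min.
have D : `|(t, x) - (s, x)| = s.
  rewrite prod_normE/= -t0E sub0r normrN subrr normr0 gtr0_norm//.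
  by apply/max_idPl; exact: ltW.
have ss : slab T (s, x) by apply/slabE; rewrite s0 sT.
have ss0 : slab0 T (s, x) by apply/slab0E; rewrite (ltW s0) sT.
have gs : g (s, x) = 0 by apply: step ss _; apply: hr'; rewrite D.
by have := hr (s, x); rewrite D gs subr0 => /(_ sr ss0); rewrite ltxx.
Qed.

(** A compact subset of [0, T) x R^2 has a latest time, which is below T; S is taken midway between
    it and T. *)
Lemma slab0_support K : 0 < T -> compact K -> K `<=` slab0 T -> exists S L,
  0 < S < T /\ forall p, K p -> `|p.1| <= S /\ `|p.2| <= L.
Proof.
move=> T0 cK KD; have [K0|K0] := pselect (K !=set0); last first.
  exists (T / 2), 0; split; first by rewrite divr_gt0//= gtr_pMr// invf_lt1// ltr1n.
  by move=> p Kp; case: K0; exists p.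
have [|c Kc hc] := @compact_EVT_max _ _ (fun p : E => p.1) _ K0 cK.
  by apply: continuous_subspaceT => p; exact: cvg_fst.
have [|b _ hb] := @compact_EVT_max _ _ (fun p : E => `|p.2|) _ K0 cK.
  by apply: continuous_subspaceT => p; apply: cvg_norm; exact: cvg_snd.
have cT : c.1 < T by move: Kc; rewrite inE; case: c {hc} => t x /KD/slab0E /andP[].
exists ((Num.max 0 c.1 + T) / 2), (`|b.2|); split.
  have m0 : 0 <= Num.max 0 c.1 by rewrite le_max lexx.
  have mT : Num.max 0 c.1 < T by rewrite gt_max T0 cT.
  by apply/andP; split; lra.
move=> p Kp; split; last by apply: hb; rewrite inE.
have p0 : 0 <= p.1 by case: p Kp => t x /KD/slab0E /andP[].
have := hc p; rewrite inE => /(_ Kp); rewrite ger0_norm// => pc.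
have mc : c.1 <= Num.max 0 c.1 by rewrite le_max lexx orbT.
have mT : Num.max 0 c.1 < T by rewrite gt_max T0 cT.
lra.
Qed.

Definition time_fold p : E := (`|p.1|, p.2).

(* Even reflection in time extends functions on the slab to the whole space. *)
Definition time_ext f p : R := if `|p.1| < T then f (time_fold p) else 0.

(** For |t| < T folding is 1-Lipschitz and transfers continuity from the slab; for |t| >= T the
    extension vanishes on the whole ball of radius T - S. *)
Lemma time_ext_continuous K f S L : {within slab0 T, continuous f} ->
  S < T -> (forall p, K p -> `|p.1| <= S /\ `|p.2| <= L) ->
  (forall p, slab0 T p -> ~ K p -> f p = 0) -> continuous (time_ext f).
Proof.
move=> cf ST KS f0 p; have [pT|pT] := ltP `|p.1| T.
  apply/cvgrPdist_lt => e e0.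
  have sp : slab0 T (time_fold p) by apply/slab0E; rewrite normr_ge0.
  have [r r0 hr] := within_near cf sp e0.
  have m0 : 0 < Num.min r (T - `|p.1|) by rewrite lt_min r0 subr_gt0.
  apply: (near_ball m0) => q; rewrite lt_min => /andP[pr pq].
  have q1 : `|p.1 - q.1| <= `|p - q| := norm_time_le (p - q).
  have qT : `|q.1| < T.
    have := lerB_dist q.1 p.1; rewrite distrC => h.
    by rewrite -(ltrD2r (- `|p.1|)) (le_lt_trans h)// (le_lt_trans q1).
  rewrite /time_ext pT qT; apply: hr; last by apply/slab0E; rewrite normr_ge0.
  apply: le_lt_trans pr; rewrite prod_normE [leRHS]prod_normE/= ge_max le_max.
  by rewrite ler_dist_dist//= le_max lexx orbT.
have d0 : 0 < T - S by rewrite subr_gt0.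
apply/cvgrPdist_lt => e e0; apply: (near_ball d0) => q pq.
have q1 : `|p.1 - q.1| <= `|p - q| := norm_time_le (p - q).
have -> : time_ext f p = 0 by rewrite /time_ext ltNge pT.
rewrite sub0r normrN /time_ext; case: ifPn => qT; last by rewrite normr0.
rewrite f0 ?normr0//; first by apply/slab0E; rewrite normr_ge0.
move=> /KS[+ _]; rewrite /= normr_id => qS.
by have := lerB_dist p.1 q.1; lra.
Qed.

(** Evenness carries vanishing from t >= 0 to all times, giving the global bounds and uniform
    continuity used with [slab_vanE]. *)
Definition even_time f := forall p, f (time_fold p) = f p.

Lemma time_ext_even f : even_time (time_ext f).
Proof. by move=> p; rewrite /time_ext /time_fold/= normr_id. Qed.

(* time_ext extends evenly in time, so F need not be differentiable at t = 0:
   derivatives are only claimed for t > 0. *)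
Record slabC1 (S L : R) f F (G : E -> E -> R) : Prop := SlabC1 {
  sl_time : 0 < S < T;
  sl_eq : forall t x, 0 <= t < T -> f (t, x) = F (t, x);
  sl_cont : continuous F;
  sl_contG : forall u, continuous (G u);
  sl_van : forall p, 0 <= p.1 -> S < p.1 \/ L < `|p.2| -> F p = 0;
  sl_vanG : forall u p, 0 <= p.1 -> S < p.1 \/ L < `|p.2| -> G u p = 0;
  sl_der : forall p u, 0 < p.1 -> is_derive p u F (G u p) }.

Lemma slabC1_exists f : 0 < T -> Cc (slab0 T) 1 f ->
  exists S L F G, [/\ slabC1 S L f F G, even_time F & forall u, even_time (G u)].
Proof.
move=> T0 [[cf /choice[g hg]] [K [cK KD f0]]].
have clK : closed K by apply: compact_closed cK; exact: norm_hausdorff.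
have cg u : {within slab0 T, continuous (g u)} by have [[]] := hg u.
have dg u p : slab T p -> is_derive p u f (g u p).
  by move=> sp; have [_] := hg u; apply; exact: slab_interior.
have g0 u := deriv_vanish clK (cg u) (dg u) f0.
have [S [L [ST KS]]] := slab0_support T0 cK KD.
have /andP[S0 SltT] := ST.
have van h : (forall p, slab0 T p -> ~ K p -> h p = 0) ->
    forall p, 0 <= p.1 -> S < p.1 \/ L < `|p.2| -> time_ext h p = 0.
  move=> h0 p p0 hp; rewrite /time_ext; case: ifPn => // pT.
  apply: h0; first by apply/slab0E; rewrite normr_ge0.
  by move=> /KS /=; rewrite normr_id ger0_norm// => -[h1 h2]; case: hp; rewrite ltNge ?h1 ?h2.
exists S, L, (time_ext f), (fun u => time_ext (g u)).
split; [split=> //|exact: time_ext_even|by move=> u; exact: time_ext_even].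
- by move=> t x /andP[t0 tT]; rewrite /time_ext /= ger0_norm// tT /time_fold/= ger0_norm.
- exact: (time_ext_continuous cf SltT KS f0).
- by move=> u; exact: (time_ext_continuous (cg u) SltT KS (g0 u)).
- exact: van.
- by move=> u; apply: van; exact: g0.
move=> p u p0; have [pT|pT] := ltP p.1 T.
  have sp : slab T p by case: p p0 pT => t x /= t0 tT; apply/slabE; rewrite t0.
  have E0 q : slab T q -> forall h, h q = time_ext h q.
    case: q => t x /slabE /andP[t0 tT] h.
    by rewrite /time_ext /= gtr0_norm// tT /time_fold/= gtr0_norm.
  rewrite -(E0 _ sp); have d := dg u p sp.
  apply: (near_eq_is_derive _ d).
  by apply: filterS (open_nbhs_nbhs (conj open_slab sp)) => q sq; exact: E0.
rewrite van; [|exact: g0|exact: ltW|by left; rewrite (lt_le_trans SltT)].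
have N : \forall q \near p, 0 = time_ext f q.
  have d0 : 0 < p.1 - S by rewrite subr_gt0 (lt_le_trans SltT).
  apply: (near_ball d0) => q pq.
  have q1 : `|p.1 - q.1| <= `|p - q| := norm_time_le (p - q).
  have Sq : S < q.1 by have := ler_norm (p.1 - q.1); lra.
  by rewrite van//; [exact: ltW (lt_trans S0 Sq)|left].
exact: (near_eq_is_derive N).
Qed.

End Slab.

(** Reduces continuity to sequences at distance less than 1 / (n + 1), the form that dominated
    convergence delivers in [line_op_continuous]. *)
Lemma seq_continuous (R : realType) (V : normedModType R) (f : V -> R) (p : V) :
  (forall u : nat -> V, (forall n, `|p - u n| < n.+1%:R^-1) ->
    (fun n => f (u n)) @ \oo --> f p) -> {for p, continuous f}.
Proof.
move=> h; apply: contrapT => nc.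
have [e e0 he] : exists2 e, 0 < e & forall d, 0 < d -> exists2 q, `|p - q| < d & e <= `|f p - f q|.
  apply: contrapT => /forall2NP H; apply: nc.
  suff : f @ p --> f p by [].
  apply/cvgrPdist_lt => e e0; have [//|] := H e.
  move=> /existsNP[d /not_implyP[d0 /forall2NP Hd]].
  apply/nbhs_normP; exists d => //= q pq.
  by have [//|/negP] := Hd q; rewrite -ltNge.
have /choice[u hu] (n : nat) : exists q, `|p - q| < n.+1%:R^-1 /\ e <= `|f p - f q|.
  by have [|q] := he n.+1%:R^-1; [rewrite invr_gt0|exists q].
have /cvgrPdist_lt/(_ _ e0)[n _ /(_ n (leqnn n))] := h u (fun n => (hu n).1).
by rewrite /= ltNge (hu n).2.
Qed.

Lemma seq_cvg (R : realType) (V : normedModType R) (p : V) (u : nat -> V) :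
  (forall n, `|p - u n| < n.+1%:R^-1) -> u @ \oo --> p.
Proof.
move=> hu; apply/cvgrPdist_lt => e e0.
have /cvgrPdist_lt/(_ _ e0) := @cvg_harmonic R.
by apply: filterS => n; rewrite sub0r normrN => h; rewrite (lt_trans (hu n))// (le_lt_trans (ler_norm _) h).
Qed.

(** * Time averages and stream functions *)

Section LineIntegrals.
Variable R : realType.
Local Notation E := (R * (R * R))%type.
Variables (chi : R -> R) (w : E).
Hypothesis mchi : measurable_fun setT chi.
Implicit Types (p q u : E) (f g : E -> R).

(** A weighted integral along the direction w. Primitives in space and averages in time are two
    choices of weight and direction, so continuity and differentiation under the integral are proved
    once. *)
Definition line_op f p : R := \int[leb R]_s (chi s * f (s *: w + p)).

Definition ldom f := forall B, exists C N, 0 <= C /\ forall s p, `|p| <= B ->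
  `|chi s * f (s *: w + p)| <= C * \1_(`[- N, N]%classic : set R) s.

Lemma continuous_line f p : continuous f -> continuous (fun s : R => f (s *: w + p)).
Proof.
move=> cf s; apply: (@continuous_comp _ _ _ (fun s : R => s *: w + p) f); last exact: cf.
by apply: cvgD; [apply: cvgZr_tmp; exact: cvg_id|exact: cvg_cst].
Qed.

Lemma measurable_line f p : continuous f ->
  measurable_fun setT (fun s : R => chi s * f (s *: w + p)).
Proof.
move=> cf; apply: measurable_funM => //.
by apply: continuous_measurable_fun; exact: continuous_line.
Qed.

Lemma line_op_intg f p : continuous f -> ldom f ->
  intg (leb R) (fun s => chi s * f (s *: w + p)).
Proof.
move=> cf /(_ `|p|)[C [N [C0 h]]].
apply: (@intg_le _ _ _ (leb R) _ (fun s => C * \1_(`[- N, N]%classic : set R) s)).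
- exact: measurable_line.
- by move=> s; exact: h.
- by apply: intgZ; exact: intg_indic_itv.
Qed.

Lemma line_op_continuous f : continuous f -> ldom f -> continuous (line_op f).
Proof.
move=> cf df p; apply: seq_continuous => u hu.
have [C [N [C0 h]]] := df (`|p| + 1).
apply: (@Rint_cvg _ _ _ (leb R) (fun n s => chi s * f (s *: w + u n)) _
  (fun s => C * \1_(`[- N, N]%classic : set R) s)).
- by move=> n; exact: measurable_line.
- exact: measurable_line.
- apply: aeW => s; apply: cvgM; first exact: cvg_cst.
  apply: (cvg_comp (fun n => s *: w + u n) f); last exact: cf.
  by apply: cvgD; [exact: cvg_cst|exact: seq_cvg].
- by apply: intgZ; exact: intg_indic_itv.
- move=> n; apply: aeW => s; apply: h.
  have := lerB_dist (u n) p; rewrite distrC => h1.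
  have h2 : n.+1%:R^-1 <= 1 :> R by rewrite invf_le1// ler1n.
  by rewrite -lerBlDl (le_trans h1)// (le_trans (ltW (hu n))).
Qed.

(** f is differentiable at positive times only. The condition on [chi] says that the line never goes
    back in time from p, so every point it meets has a positive time. *)
Lemma line_op_derive f fu p u : continuous f -> ldom f -> continuous fu -> ldom fu ->
  (forall s, chi s != 0 -> 0 <= s * w.1) ->
  (forall q, 0 < q.1 -> is_derive q u f (fu q)) ->
  0 < p.1 -> is_derive p u (line_op f) (line_op fu p).
Proof.
move=> cf lf cfu lfu cw df p0.
pose F (r : R) s := chi s * f (s *: w + (r *: u + p)).
(* For |r| < d the shifted base point r u + p still has positive time. *)
pose d := p.1 / (`|u.1| + 1).
have u1 : 0 < `|u.1| + 1 by rewrite ltr_wpDl.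
have d0 : 0 < d by rewrite divr_gt0.
have pos (r : R) : r \in `](- d), d[ -> 0 < (r *: u + p).1.
  rewrite in_itv/= => rd; have {}rd : `|r| < d by rewrite ltr_norml.
  have : `|r * u.1| < p.1.
    rewrite normrM; have [->|uN] := eqVneq u.1 0; first by rewrite normr0 mulr0.
    apply: (@lt_le_trans _ _ (d * `|u.1|)); first by rewrite ltr_pM2r ?normr_gt0.
    rewrite /d mulrAC ler_pdivrMr// ler_wpM2l//; first exact: ltW.
    by rewrite lerDl.
  by rewrite ltr_norml => /andP[h _]; rewrite /= -ltrBlDr sub0r.
have dF (r : R) (s : R) : r \in `](- d), d[ ->
    is_derive r (1 : R) (F ^~ s) (chi s * fu (s *: w + (r *: u + p))).
  move=> rd; have [c0|c0] := eqVneq (chi s) 0.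
    rewrite /F c0 mul0r (_ : (fun _ => _) = cst 0).
      exact: is_derive_cst.
    by apply/funext => x; rewrite mul0r.
  have q0 : 0 < (r *: u + (s *: w + p)).1.
    rewrite addrCA /= ltr_wpDl ?pos//; exact: cw.
  have := (@is_derive_line R E f (s *: w + p) u r _).1 (df _ q0) => h.
  have := derM (is_derive_cst (chi s) r 1) h.
  rewrite mul0r add0r addrCA (_ : (fun x : R => _) = F ^~ s)//.
  by apply/funext => x; rewrite /F addrCA.
have [C [N [C0 hC]]] := lfu (d * `|u| + `|p|).
have partE (r : R) (s : R) : r \in `](- d), d[ ->
    partial1of2 F r s = chi s * fu (s *: w + (r *: u + p)).
  by move=> rd; rewrite partial1of2E; have [_ ->] := dF r s rd.
have z0 : (0 : R) \in `](- d), d[ by rewrite in_itv/= oppr_lt0 d0.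
have key := @cvg_differentiation_under_integral R _ (measurableTypeR R) (leb R) F setT measurableT
  0 (- d) d _ _ _ (fun s => C * \1_(`[- N, N]%classic : set R) s) _ _ _.
apply/is_derive_lin0/is_deriveE.
have -> : line_op fu p = \int[leb R]_s partial1of2 F 0 s.
  by apply: Rint_ext => s; rewrite partE// scale0r add0r.
have -> : (fun h : R => h^-1 *: (line_op f ((h *: (1 : R) + 0) *: u + p) - line_op f (0 *: u + p))) =
   (fun h : R => h^-1 *: (\int[leb R]_s F (h + 0) s - \int[leb R]_s F 0 s)).
  by apply/funext => h; rewrite [h *: 1]mulr1.
apply: key => //.
- by move=> r _; exact: line_op_intg.
- by move=> r s rd _; have [] := dF r s rd.
- by move=> s; rewrite mulr_ge0.
- by apply: intgZ; exact: intg_indic_itv.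
- move=> r s rd _; rewrite partE//; apply: hC.
  rewrite (le_trans (ler_normD _ _))// lerD2r normrZ ler_wpM2r//.
  by move: rd; rewrite /= in_itv/= -ltr_norml => /ltW.
Qed.

Lemma line_op_ext f g p : (forall s, chi s != 0 -> f (s *: w + p) = g (s *: w + p)) ->
  line_op f p = line_op g p.
Proof.
move=> h; apply: Rint_ext => s; have [->|/h ->//] := eqVneq (chi s) 0.
by rewrite !mul0r.
Qed.

End LineIntegrals.

Section HalfLineAverage.
Variable R : realType.
Local Notation E := (R * (R * R))%type.
Implicit Types (p q u : E) (f g F : E -> R).

Definition vanE (M : R) f := forall p, M < `|p| -> f p = 0.

Lemma vanE_bounded M f : continuous f -> vanE M f ->
  exists2 C, 0 <= C & forall p, `|f p| <= C.
Proof.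
move=> cf f0.
apply: (csupp_bounded (@compact_cube R M M) cf) => p /= h.
apply: f0; rewrite prod_normE lt_max !ltNge -negb_and; apply/negP => /andP[h1 h2].
by apply: h.
Qed.

Lemma vanE_uniform M f : continuous f -> vanE M f -> forall e, 0 < e ->
  exists2 d, 0 < d & forall p q, `|p - q| < d -> `|f p - f q| < e.
Proof.
move=> cf f0; apply: (csupp_uniform (@compact_cube R M M) cf) => p /= h.
apply: f0; rewrite prod_normE lt_max !ltNge -negb_and; apply/negP => /andP[h1 h2].
by apply: h.
Qed.

Lemma cont_locally_bounded f (B : R) : continuous f ->
  exists2 C, 0 <= C & forall p, `|p| <= B -> `|f p| <= C.
Proof.
move=> cf; pose K := [set p : E | `|p.1| <= B /\ `|p.2| <= B].
have [K0|K0] := pselect (K !=set0).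
  have [|c _ hc] := @compact_EVT_max _ _ (fun p => `|f p|) _ K0 (@compact_cube R B B).
    by apply: continuous_subspaceT => p; apply: cvg_norm; exact: cf.
  exists `|f c| => // p pB; apply: hc; rewrite inE.
  by split; apply: le_trans pB; [exact: norm_time_le|exact: norm_space_le].
exists 0 => // p pB; case: K0; exists p.
by split; apply: le_trans pB; [exact: norm_time_le|exact: norm_space_le].
Qed.

Definition halfline : R -> R := \1_(`]-oo, 0]%classic : set R).
Definition unit_itv : R -> R := \1_(`[0, 1]%classic : set R).

Lemma measurable_halfline : measurable_fun setT halfline.
Proof. exact: measurable_indic. Qed.

Lemma measurable_unit_itv : measurable_fun setT unit_itv.
Proof. exact: measurable_indic. Qed.

Definition primitive1 := line_op halfline ((0, (1, 0)) : E).
(* Steklov average over [t, t + e]. *)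
Definition time_avg (e : R) := line_op unit_itv ((e, (0, 0)) : E).

Lemma halflineE s : halfline s = if s <= 0 then 1 else 0.
Proof. by rewrite /halfline indicE mem_setE in_itv/=; case: ifP. Qed.

Lemma unit_itvE s : unit_itv s = if 0 <= s <= 1 then 1 else 0.
Proof. by rewrite /unit_itv indicE mem_setE in_itv/=; case: ifP. Qed.

Lemma ldom_halfline M f : continuous f -> vanE M f ->
  ldom halfline ((0, (1, 0)) : E) f.
Proof.
move=> cf f0 B; have [C C0 hC] := vanE_bounded cf f0.
exists C, (M + B); split=> // s p pB.
rewrite indicE mem_setE in_itv/= -ler_norml; case: (lerP `|s| (M + B)) => sN.
  rewrite mulr1 normrM halflineE; case: ifP => _; first by rewrite normr1 mul1r.
  by rewrite normr0 mul0r.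
rewrite f0 ?mulr0 ?normr0//.
have h := lerB_dist (s *: ((0, (1, 0)) : E)) (- p); rewrite opprK normrN in h.
have n1 : `|s *: ((0, (1, 0)) : E)| = `|s|.
  rewrite normrZ prod_normE prod_normE/= normr0 normr1.
  by rewrite [Num.max 1 0]max_l// max_r// mulr1.
rewrite n1 in h; apply: lt_le_trans h.
by rewrite ltrBrDr (le_lt_trans _ sN)// lerD2l.
Qed.

Lemma ldom_unit e f : continuous f -> ldom unit_itv ((e, (0, 0)) : E) f.
Proof.
move=> cf B; have [C C0 hC] := cont_locally_bounded (`|e| + B) cf.
exists C, 1; split=> // s p pB.
rewrite indicE mem_setE in_itv/= normrM unit_itvE; case: ifPn => [/andP[s0 s1]|_]; last first.
  by rewrite normr0 mul0r mulr_ge0.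
rewrite normr1 mul1r s1 (le_trans _ s0) ?lerN10//= mulr1; apply: hC.
rewrite (le_trans (ler_normD _ _))// lerD// normrZ prod_normE prod_normE/= normr0.
by rewrite [Num.max 0 0]max_l// max_l// ger0_norm// ler_piMl.
Qed.

Lemma primitive1_continuous M f : continuous f -> vanE M f -> continuous (primitive1 f).
Proof.
move=> cf f0; apply: line_op_continuous => //; first exact: measurable_halfline.
exact: ldom_halfline f0.
Qed.

Lemma time_avg_continuous e f : continuous f -> continuous (time_avg e f).
Proof.
by move=> cf; apply: line_op_continuous => //; [exact: measurable_unit_itv|exact: ldom_unit].
Qed.

Lemma primitive1_derive M f fu p u : continuous f -> vanE M f -> continuous fu -> vanE M fu ->
  (forall q, 0 < q.1 -> is_derive q u f (fu q)) ->
  0 < p.1 -> is_derive p u (primitive1 f) (primitive1 fu p).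
Proof.
move=> cf f0 cfu fu0 df p0; apply: line_op_derive => //.
- exact: measurable_halfline.
- exact: ldom_halfline f0.
- exact: ldom_halfline fu0.
- by move=> s _ /=; rewrite mulr0.
Qed.

Lemma time_avg_derive e f fu p u : 0 <= e -> continuous f -> continuous fu ->
  (forall q, 0 < q.1 -> is_derive q u f (fu q)) ->
  0 < p.1 -> is_derive p u (time_avg e f) (time_avg e fu p).
Proof.
move=> e0 cf cfu df p0; apply: line_op_derive => //.
- exact: measurable_unit_itv.
- exact: ldom_unit.
- exact: ldom_unit.
- move=> s; rewrite unit_itvE; case: ifPn => [/andP[s0 _] _|_]; last by rewrite eqxx.
  exact: mulr_ge0.
Qed.

(** Derivatives are taken in the open interval, because a time interval may start at t = 0, where
    slab data are only continuous. *)
Lemma FTC_oo (F f : R -> R) (a b : R) : a < b -> continuous f -> continuous F ->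
  (forall x, a < x < b -> is_derive x (1 : R) F (f x)) ->
  \int[leb R]_(x in `[a, b]) f x = F b - F a.
Proof.
move=> ab cf cF dF; rewrite /Rintegral (@continuous_FTC2 _ f F a b)//.
- exact: continuous_subspaceT.
- split.
  + by move=> x; rewrite in_itv/= => /dF[].
  + by apply: cvg_at_right_filter; exact: cF.
  + by apply: cvg_at_left_filter; exact: cF.
- by move=> x; rewrite in_itv/= => /dF[_]; rewrite derive1E.
Qed.

(** The average of a time derivative is a difference quotient: averaging gains one derivative in
    time, which makes [stream_avg] of class C2. *)
Lemma time_avg_FTC e f ft p : 0 < e -> continuous f -> continuous ft ->
  (forall q, 0 < q.1 -> is_derive q ((1, (0, 0)) : E) f (ft q)) -> 0 <= p.1 ->
  time_avg e ft p = (f ((e, (0, 0)) + p) - f p) / e.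
Proof.
move=> e0 cf cft df p0; pose w : E := (e, (0, 0)).
have wE : w = e *: ((1, (0, 0)) : E).
  apply/pair_equal_spec; split; first by rewrite /= [e *: 1]mulr1.
  exact: (esym (scaler0 _ e)).
apply: (@mulIf _ e); first by rewrite gt_eqF.
rewrite divfK ?gt_eqF// mulrC /time_avg /line_op -RintZ; last first.
  by apply: line_op_intg => //; [exact: measurable_unit_itv|exact: ldom_unit].
transitivity (\int[leb R]_(s in `[0, 1]) (e * ft (s *: w + p))).
  rewrite [RHS]Rint_restrict; apply: Rint_ext => s; rewrite patchE mem_setE in_itv/= unit_itvE.
  by case: ifP => _; rewrite ?mul1r ?mul0r ?mulr0.
have c1 : continuous (fun s : R => e * ft (s *: w + p)).
  by move=> s; apply: cvgM; [exact: cvg_cst|exact: continuous_line].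
have d1 (s : R) : 0 < s < 1 ->
    is_derive s (1 : R) (fun s => f (s *: w + p)) (e * ft (s *: w + p)).
  move=> /andP[s0 s1]; apply/(@is_derive_line R E f p w s); rewrite {2}wE.
  apply: dirZ; apply: df; rewrite /= ltr_wpDr//.
  exact: mulr_gt0.
rewrite (FTC_oo ltr01 c1 (@continuous_line _ w f p cf) d1).
by rewrite scale1r scale0r add0r.
Qed.

Lemma primitive1_FTC M f g p : continuous f -> vanE M f -> continuous g -> vanE M g ->
  (forall s : R, is_derive (s *: ((0, (1, 0)) : E) + p) ((0, (1, 0)) : E) f
     (g (s *: ((0, (1, 0)) : E) + p))) ->
  primitive1 g p = f p.
Proof.
move=> cf f0 cg g0 df; pose w : E := (0, (1, 0)).
pose N := `|M| + `|p| + 1.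
have N0 : - N < 0 by rewrite oppr_lt0 ltr_wpDl.
have far (s : R) : N <= `|s| -> M < `|s *: w + p|.
  move=> Ns; have h := lerB_dist (s *: w) (- p); rewrite opprK normrN in h.
  have n1 : `|s *: w| = `|s|.
    rewrite normrZ prod_normE prod_normE/= normr0 normr1.
    by rewrite [Num.max 1 0]max_l// max_r// mulr1.
  rewrite n1 in h; apply: lt_le_trans h; rewrite ltrBrDr (lt_le_trans _ Ns)// /N.
  apply: (@le_lt_trans _ _ (`|M| + `|p|)); first by rewrite lerD2r ler_norm.
  by rewrite ltrDl.
transitivity (\int[leb R]_(s in `[- N, 0]) g (s *: w + p)).
  rewrite [RHS]Rint_restrict; apply: Rint_ext => s; rewrite patchE mem_setE in_itv/= halflineE.
  have [s0|s0] := leP s 0; last by rewrite andbF mul0r.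
  rewrite andbT mul1r; case: ifPn => //; rewrite -ltNge => sN.
  by rewrite g0//; apply: far; rewrite ler0_norm// lerNr ltW.
have d1 (s : R) : - N < s < 0 ->
    is_derive s (1 : R) (fun s => f (s *: w + p)) (g (s *: w + p)).
  by move=> _; apply/(@is_derive_line R E f p w s); exact: df.
rewrite (FTC_oo N0 (@continuous_line _ w g p cg) (@continuous_line _ w f p cf) d1).
rewrite scale0r add0r [X in _ - X]f0 ?subr0//; apply: far.
by rewrite normrN ler_norm.
Qed.

End HalfLineAverage.

Section SlabData.
Variables (R : realType) (T : R).
Local Notation E := (R * (R * R))%type.
Local Notation et := ((1, (0, 0)) : E).
Local Notation e1 := ((0, (1, 0)) : E).
Local Notation e2 := ((0, (0, 1)) : E).
Implicit Types (p q u : E) (f g F : E -> R).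

Lemma small_time F t0 (d c : R) x : continuous F -> 0 < d ->
  (forall t, t0 < t < t0 + d -> `|F (t, x)| <= c) -> `|F (t0, x)| <= c.
Proof.
move=> cF d0 h; rewrite leNgt; apply/negP => lt.
have e0 : 0 < `|F (t0, x)| - c by rewrite subr_gt0.
have /cvgrPdist_lt/(_ _ e0)/near_norm[r r0 hr] := cF (t0, x).
pose s := Num.min r d / 2.
have m0 : 0 < Num.min r d by rewrite lt_min r0.
have s0 : 0 < s by rewrite divr_gt0.
have : s < Num.min r d by rewrite ltr_pdivrMr// ltr_pMr// ltr1n.
rewrite lt_min => /andP[sr sd].
have := hr (t0 + s, x).
have -> : `|(t0, x) - (t0 + s, x)| = s.
  rewrite prod_normE/= subrr normr0 opprD addrA subrr sub0r normrN gtr0_norm//.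
  by apply/max_idPl; exact: ltW.
move=> /(_ sr); have := h (t0 + s); rewrite ltrDl ltrD2l s0 sd => /(_ isT) h1.
have := lerB_dist (F (t0, x)) (F (t0 + s, x)); lra.
Qed.

Lemma compact_slab_box (S L : R) : compact [set p : E | (0 <= p.1 <= S) /\ `|p.2| <= L].
Proof.
have -> : [set p : E | (0 <= p.1 <= S) /\ `|p.2| <= L] =
    `[0, S] `*` [set x : R * R | `|x| <= L].
  by apply/seteqP; split => -[a b] /=; rewrite in_itv.
by apply: compact_setX; [exact: segment_compact|exact: compact_square].
Qed.

Lemma interior_slab p : interior (slab0 T) p -> slab T p.
Proof.
move=> ip; have := interior_subset ip.
have [r r0 hr] := near_norm ip.
case: p ip hr => t x _ hr /slab0E /andP[t0 tT]; apply/slabE; rewrite tT andbT.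
have r2 : 0 < r / 2 by rewrite divr_gt0.
have /slab0E /andP[+ _] : slab0 T (t - r / 2, x).
  apply: hr; rewrite prod_normE/= subrr normr0 opprB addrCA subrr addr0 gtr0_norm//.
  by rewrite gt_max r0 ltr_pdivrMr// ltr_pMr// ltr1n.
by rewrite subr_ge0; exact: lt_le_trans.
Qed.

Section Slices.
Variables (S L : R) (f F : E -> R) (G : E -> E -> R).
Hypothesis slF : slabC1 T S L f F G.

Let cG u : continuous (G u). Proof. exact: sl_contG slF u. Qed.

Lemma slice_dir_pos t x (u : R * R) : 0 < t ->
  is_derive x u (fun x => F (t, x)) (G (0, u) (t, x)).
Proof.
move=> t0; have := @sl_der _ _ _ _ _ _ _ slF (t, x) (0, u) t0.
move=> /is_deriveE h; apply/is_deriveE; apply: cvg_trans h.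
apply: near_eq_cvg; apply: nearW => h; congr (_ *: (F _ - _)).
by apply/pair_equal_spec; split=> //=; rewrite [h *: 0]mulr0 add0r.
Qed.

(** The case t = 0 is the point: F is differentiable at positive times only. The linearization error
    is estimated there by the mean value theorem, uniformly for small times, and the estimate passes
    to t = 0 by continuity. *)
Lemma slice_dir t x (u : R * R) : 0 <= t ->
  is_derive x u (fun x => F (t, x)) (G (0, u) (t, x)).
Proof.
rewrite le_eqVlt => /orP[/eqP <-|]; last exact: slice_dir_pos.
apply/is_deriveE; apply/cvgrPdist_le => e e0.
have /cvgrPdist_lt/(_ _ e0)/near_norm[r r0 hr] := @cG (0, u) (0, x).
have d0 : 0 < r / (`|u| + 1) by rewrite divr_gt0// ltr_wpDl.
near=> h.
have hN : h != 0 by near: h; exact: nbhs_dnbhs_neq.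
have hd : `|h| * `|u| < r.
  have : `|h| < r / (`|u| + 1).
    by near: h; apply: dnbhs0_lt.
  rewrite ltr_pdivlMr ?ltr_wpDl// => /(le_lt_trans _); apply.
  by rewrite ler_wpM2l// lerDl.
(* The linearization error with increment h u, as a continuous function of time and space; the slope
   stays frozen at (0, x). *)
pose psi (p : E) := F (p.1, h *: u + p.2) - F p - h * G (0, u) (0, x).
have cpsi : continuous psi.
  move=> p; apply: cvgB; last exact: cvg_cst.
  apply: cvgB; last exact: (sl_cont slF).
  apply: (@continuous_comp _ _ _ (fun p : E => (p.1, h *: u + p.2)) F); last exact: (sl_cont slF).
  apply: (@continuous_pair _ R (R * R)%type) => q; first exact: cvg_fst.
  by apply: cvgD; [exact: cvg_cst|exact: cvg_snd].
have key : `|psi (0, x)| <= `|h| * e.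
  apply: (small_time cpsi r0) => t'; rewrite add0r => /andP[t'0 t'r].
  have dh s : 0 <= s <= 1 -> is_derive (s *: (h *: u) + x) (h *: u) (fun x => F (t', x))
      (h * G (0, u) (t', s *: (h *: u) + x)).
    by move=> _; apply: dirZ; exact: slice_dir_pos.
  have [s /andP[s0 s1] E1] := MVT_dir dh.
  rewrite /psi /= E1 -mulrBr normrM ler_wpM2l// distrC ltW//; apply: hr.
  rewrite prod_normE/= sub0r normrN gtr0_norm// gt_max t'r/= opprD addrCA subrr addr0 normrN.
  rewrite normrZ (le_lt_trans _ hd)// normrZ ger0_norm//.
  by rewrite ler_piMl// mulr_ge0.
rewrite (_ : _ - _ = - (h^-1 * psi (0, x))); last first.
  by rewrite /psi /= mulrBr [h^-1 * (h * _)]mulrA mulVf// mul1r opprB.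
rewrite normrN normrM normfV mulrC ler_pdivrMr ?normr_gt0// mulrC.
exact: key.
Unshelve. all: end_near.
Qed.

Lemma slice_C1c t : 0 <= t ->
  C1c L (fun x => F (t, x)) (fun x => G e1 (t, x)) (fun x => G e2 (t, x)).
Proof.
move=> t0.
have cs g : continuous g -> continuous (fun x : R * R => g (t, x)).
  move=> cg x; apply: (@continuous_comp _ _ _ (fun x : R * R => (t, x)) g); last exact: cg.
  exact: (@continuous_pairr R (R * R)%type).
split.
- apply: C1_of_dir.
  + exact: (cs _ (sl_cont slF)).
  + exact: (cs _ (@cG _)).
  + exact: (cs _ (@cG _)).
  + by move=> x; exact: slice_dir.
  + by move=> x; exact: slice_dir.
- by move=> x Lx; rewrite (sl_van slF)//; right.
- by move=> x Lx; rewrite (sl_vanG slF)//; right.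
- by move=> x Lx; rewrite (sl_vanG slF)//; right.
Qed.

(** [G] gives an unrelated function for each direction; homogeneity [dirZ] and additivity [dirD]
    force it to be linear in u at positive times. *)
Lemma slab_linear p u : 0 < p.1 ->
  G u p = u.1 * G et p + u.2.1 * G e1 p + u.2.2 * G e2 p.
Proof.
move=> p0; have d := sl_der slF u p0.
have near_pos : \forall q \near p, 0 < q.1.
  apply: (near_ball p0) => q pq.
  have := norm_time_le (p - q); rewrite /= => h.
  by have := ler_norm (p.1 - q.1); lra.
have uE : u = u.1 *: et + (u.2.1 *: e1 + u.2.2 *: e2).
  case: u {d} => a [b c]; apply/pair_equal_spec; split; rewrite /=.
    by rewrite [a *: 1]mulr1 ![_ *: 0]mulr0 !addr0.
  apply/pair_equal_spec; split; rewrite /= ![_ *: 0]mulr0 ![_ *: 1]mulr1 ?addr0 ?add0r//.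
have nd (c : R) (v : E) : \forall q \near p, is_derive q (c *: v) F (c * G v q).
  by apply: filterS near_pos => q q0; apply: dirZ; exact: (sl_der slF).
have cc (c : R) (v : E) : {for p, continuous (fun q => c * G v q)}.
  by apply: cvgM; [exact: cvg_cst|exact: (sl_contG slF)].
have d2 := dirD (nd u.2.1 e1) (cc _ _) (nbhs_singleton (nd u.2.2 e2)).
have d3 := dirD (nd u.1 et) (cc _ _) d2.
by rewrite -uE in d3; have [_ <-] := d; have [_ ->] := d3; rewrite addrA.
Qed.

Lemma slab_der_f p u : slab T p -> is_derive p u f (G u p).
Proof.
case: p => t x sp; have /slabE /andP[t0 tT] := sp.
have N : \forall q \near ((t, x) : E), F q = f q.
  apply: (filterS _ (open_nbhs_nbhs (conj (@open_slab R T) sp))) => -[s y] /slabE /andP[s0 sT].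
  by rewrite (sl_eq slF)// (ltW s0) sT.
have d : is_derive ((t, x) : E) u F (G u (t, x)) by exact: (sl_der slF).
exact: (near_eq_is_derive N d).
Qed.

Lemma slabC1_weaken S' L' : S <= S' < T -> L <= L' -> slabC1 T S' L' f F G.
Proof.
move=> /andP[SS' S'T] LL'; have [/andP[S0 ST] eq c cG' v vG d] := slF.
split=> //; first by rewrite S'T (lt_le_trans S0).
- by move=> p p0 [h|h]; apply: v => //; [left|right]; exact: le_lt_trans h.
- by move=> u p p0 [h|h]; apply: vG => //; [left|right]; exact: le_lt_trans h.
Qed.

Lemma slab_vanE : even_time F -> vanE (Num.max S L) F.
Proof.
move=> ev p; rewrite prod_normE lt_max !gt_max => h.
rewrite -ev; apply: (sl_van slF); rewrite ?normr_ge0//.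
by move/orP: h => [/andP[h _]|/andP[_ h]]; [left|right].
Qed.

Lemma slab_vanEG u : even_time (G u) -> vanE (Num.max S L) (G u).
Proof.
move=> ev p; rewrite prod_normE lt_max !gt_max => h.
rewrite -ev; apply: (sl_vanG slF); rewrite ?normr_ge0//.
by move/orP: h => [/andP[h _]|/andP[_ h]]; [left|right].
Qed.

Lemma slab_Cc : Cc (slab0 T) 1 F.
Proof.
have /andP[S0 ST] := sl_time slF.
split.
  split; first by apply: continuous_subspaceT; exact: sl_cont slF.
  move=> u; exists (G u); split; first by split=> //; apply: continuous_subspaceT; exact: cG.
  by move=> p /interior_slab sp; case: p sp => t x /slabE /andP[t0 _]; exact: (sl_der slF).
exists [set p | (0 <= p.1 <= S) /\ `|p.2| <= L]; split.
- exact: compact_slab_box.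
- by move=> [t x] /= [/andP[t0 tS] _]; apply/slab0E; rewrite t0 (le_lt_trans tS).
- move=> [t x] /slab0E /andP[t0 tT] /= h; apply: (sl_van slF) => //=.
  have [tS|tS] := ltP S t; first by left.
  by right; rewrite ltNge; apply/negP => xL; apply: h; rewrite t0 tS.
Qed.

End Slices.
End SlabData.

Lemma ae_imp d (T : measurableType d) (R : realType) (m : {measure set T -> \bar R})
    (P Q : T -> Prop) : (forall x, P x -> Q x) ->
  {ae m, forall x, P x} -> {ae m, forall x, Q x}.
Proof. by move=> h; apply: filterS. Qed.

Lemma ae_and d (T : measurableType d) (R : realType) (m : {measure set T -> \bar R})
    (P Q : T -> Prop) : {ae m, forall x, P x} -> {ae m, forall x, Q x} ->
  {ae m, forall x, P x /\ Q x}.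
Proof. by apply: filterS2 => x; split. Qed.

Lemma Rint_off0 (R : realType) (h : R -> R) : measurable_fun setT h ->
  (forall s, s != 0 -> h s = 0) -> \int[leb R]_s h s = 0.
Proof.
move=> mh h0.
transitivity (\int[leb R]_s (fun=> 0 : R) s); last by rewrite /Rintegral integral0.
by apply: Rint_ae => //; exact: ae_imp (ae_leb_neq 0).
Qed.

Section Stream.
Variables (R : realType) (T : R).
Local Notation E := (R * (R * R))%type.
Local Notation et := ((1, (0, 0)) : E).
Local Notation e1 := ((0, (1, 0)) : E).
Local Notation e2 := ((0, (0, 1)) : E).
Implicit Types (p q u : E) (f g F : E -> R).

Lemma is_derive_shift (V : normedModType R) (f : V -> R) (c p u : V) (d : R) :
  is_derive (c + p) u f d -> is_derive p u (fun x => f (c + x)) d.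
Proof.
move=> /is_deriveE h; apply/is_deriveE; apply: cvg_trans h.
by apply: near_eq_cvg; apply: nearW => h; rewrite addrCA.
Qed.

(** s = 0 is a null set. Leaving it out matters at t = 0, where [stream_zero] controls the stream
    function at the later times t + s e only. *)
Lemma time_avg_zero e f p : continuous f ->
  (forall s : R, 0 < s <= 1 -> f (s *: ((e, (0, 0)) : E) + p) = 0) -> time_avg e f p = 0.
Proof.
move=> cf f0; apply: Rint_off0 => [|s sN].
  by apply: measurable_line => //; exact: measurable_unit_itv.
rewrite unit_itvE; case: ifPn => [/andP[s0 s1]|_]; last by rewrite mul0r.
by rewrite mul1r f0// s1 lt_neqAle eq_sym sN s0.
Qed.

Lemma Ck1_slab0 F (G : E -> E -> R) : continuous F -> (forall u, continuous (G u)) ->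
  (forall p u, 0 < p.1 -> is_derive p u F (G u p)) -> Ck (slab0 T) 1 F.
Proof.
move=> cF cG dF; split; first exact: continuous_subspaceT.
move=> u; exists (G u); split; first by split=> //; apply: continuous_subspaceT; exact: cG.
by move=> p /interior_slab sp; case: p sp => t x /slabE /andP[t0 _]; exact: dF.
Qed.

(** The average looks forward in time and stays at the same point of space, so vanishing beyond the
    time S and beyond the radius L is inherited with the same S and L. *)
Lemma slabC1_avg S L f F G e : 0 <= e -> slabC1 T S L f F G ->
  slabC1 T S L (time_avg e F) (time_avg e F) (fun u => time_avg e (G u)).
Proof.
move=> e0 slF; have [st _ cF cG v vG d] := slF.
have van h : (forall p, 0 <= p.1 -> S < p.1 \/ L < `|p.2| -> h p = 0) ->
    forall p, 0 <= p.1 -> S < p.1 \/ L < `|p.2| -> time_avg e h p = 0.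
  move=> h0 p p0 hp; rewrite /time_avg (@line_op_ext _ _ _ _ (fun=> 0)).
    by rewrite /line_op (_ : (fun _ => _) = fun=> 0) ?/Rintegral ?integral0//; apply/funext => s; rewrite mulr0.
  move=> s; rewrite unit_itvE; case: ifPn => [/andP[s0 _] _|_]; last by rewrite eqxx.
  have se : 0 <= s * e by exact: mulr_ge0.
  apply: h0; rewrite /=; first exact: addr_ge0.
  case: hp => hp; [left|right].
    by rewrite (lt_le_trans hp)// lerDr.
  by rewrite [(_ *: _) + _]addpE ![s *: 0]mulr0 !add0r -surjective_pairing.
split => //.
- exact: time_avg_continuous.
- by move=> u; apply: time_avg_continuous; exact: cG.
- exact: van.
- by move=> u; apply: van; exact: vG.
- move=> p u p0.
  exact: (time_avg_derive e0 cF (@cG u) (fun q (q0 : 0 < q.1) => d q u q0) p0).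
Qed.

Variables (S L : R) (fP FP fQ FQ : E -> R) (GP GQ : E -> E -> R).
Hypotheses (slP : slabC1 T S L fP FP GP) (slQ : slabC1 T S L fQ FQ GQ).
Hypotheses (evP : even_time FP) (evGP : forall u, even_time (GP u)).
Hypotheses (evQ : even_time FQ) (evGQ : forall u, even_time (GQ u)).
Hypothesis div : forall p, 0 < p.1 -> GP e1 p + GQ e2 p = 0.

Let M := Num.max S L.
Let cFP : continuous FP. Proof. exact: (sl_cont slP). Qed.
Let cFQ : continuous FQ. Proof. exact: (sl_cont slQ). Qed.
Let cGP u : continuous (GP u). Proof. exact: (sl_contG slP). Qed.
Let cGQ u : continuous (GQ u). Proof. exact: (sl_contG slQ). Qed.
Let vP : vanE M FP. Proof. exact: (slab_vanE slP). Qed.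
Let vQ : vanE M FQ. Proof. exact: (slab_vanE slQ). Qed.
Let vGP u : vanE M (GP u). Proof. exact: (slab_vanEG slP). Qed.
Let vGQ u : vanE M (GQ u). Proof. exact: (slab_vanEG slQ). Qed.

(* As (P, Q) is divergence free, the primitive of Q in the first space variable
   has spatial gradient (Q, - P); it is only C1 in time, so it has to be averaged
   in time to become a C2 test function. *)
Definition stream := primitive1 FQ.
Definition stream_t := primitive1 (GQ et).
Definition stream_grad u p : R := u.1 * stream_t p + u.2.1 * FQ p - u.2.2 * FP p.

Lemma stream_continuous : continuous stream.
Proof. exact: primitive1_continuous vQ. Qed.

Lemma stream_t_continuous : continuous stream_t.
Proof. exact: (primitive1_continuous (@cGQ et) (@vGQ et)). Qed.

Lemma stream_grad_continuous u : continuous (stream_grad u).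
Proof.
move=> p; apply: cvgB; [apply: cvgD|]; apply: cvgM; try exact: cvg_cst.
- exact: stream_t_continuous.
- exact: cFQ.
- exact: cFP.
Qed.

(** The primitive commutes with derivatives. In the second space direction the divergence condition
    replaces the derivative of Q by minus the first derivative of P, whose primitive is P. *)
Lemma stream_derive p u : 0 < p.1 -> is_derive p u stream (stream_grad u p).
Proof.
move=> p0.
have d : is_derive p u stream (primitive1 (GQ u) p).
  exact: (primitive1_derive cFQ vQ (@cGQ u) (@vGQ u) (fun q (q0 : 0 < q.1) => sl_der slQ u q0) p0).
suff E : primitive1 (GQ u) p = stream_grad u p by rewrite -E.
have pos (s : R) : 0 < (s *: e1 + p).1 by rewrite /= [s *: 0]mulr0 add0r.
have I v : intg (leb R) (fun s => halfline s * GQ v (s *: e1 + p)).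
  apply: line_op_intg; [exact: measurable_halfline|exact: cGQ|exact: (ldom_halfline (@cGQ v) (@vGQ v))].
have S1 : primitive1 (GQ e1) p = FQ p.
  exact: (primitive1_FTC cFQ vQ (@cGQ e1) (@vGQ e1) (fun s => sl_der slQ e1 (pos s))).
have S2 : primitive1 (GP e1) p = FP p.
  exact: (primitive1_FTC cFP vP (@cGP e1) (@vGP e1) (fun s => sl_der slP e1 (pos s))).
have S3 : primitive1 (GQ e2) p = - FP p.
  rewrite -S2 /primitive1 /line_op -RintN; apply: Rint_ext => s.
  by rewrite -mulrN; congr (_ * _); apply/eqP; rewrite -addr_eq0 addrC div.
transitivity (u.1 * primitive1 (GQ et) p + u.2.1 * primitive1 (GQ e1) p + u.2.2 * primitive1 (GQ e2) p).
  have J1 := intgZ u.1 (I et); have J2 := intgZ u.2.1 (I e1); have J3 := intgZ u.2.2 (I e2).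
  rewrite /primitive1 /line_op -(RintZ u.1 (I et)) -(RintZ u.2.1 (I e1)) -(RintZ u.2.2 (I e2)).
  rewrite -(RintD J1 J2) -(RintD (intgD J1 J2) J3).
  apply: Rint_ext => s; rewrite (slab_linear slQ u (pos s)); ring.
by rewrite S1 S3 /stream_grad mulrN.
Qed.

(** After time S, above, below and to the left, the path of integration misses the support of Q. To
    the right, the vertical derivative - P of the stream function vanishes, so its value is the one
    high above the support, which is 0. *)
Lemma stream_zero p : 0 < p.1 -> S < p.1 \/ L < `|p.2| -> stream p = 0.
Proof.
have Z h q : (forall s : R, s <= 0 -> h (s *: e1 + q) = 0) -> primitive1 h q = 0.
  move=> h0; rewrite /primitive1 (@line_op_ext _ _ _ _ (fun=> 0)).
    by rewrite /line_op (_ : (fun _ => _) = fun=> 0) ?/Rintegral ?integral0//; apply/funext => s; rewrite mulr0.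
  by move=> s; rewrite halflineE; case: ifPn => [s0 _|_]; [exact: h0|rewrite eqxx].
have shE (s : R) q : s *: e1 + q = (q.1, (s + q.2.1, q.2.2)).
  case: q => t [a b]; rewrite [LHS]surjective_pairing; congr pair.
    by rewrite /= [s *: 0]mulr0 add0r.
  by rewrite [LHS]surjective_pairing /= [s *: 1]mulr1 [s *: 0]mulr0 add0r.
move=> p0 [pS|pL].
  apply: Z => s _; apply: (sl_van slQ); rewrite shE /=; first exact: ltW.
  by left.
have [p2|p2] := ltP L `|p.2.2|.
  apply: Z => s _; apply: (sl_van slQ); rewrite shE /=; first exact: ltW.
  by right; rewrite prod_normE lt_max p2 orbT.
have {}pL : L < `|p.2.1|.
  by move: pL; rewrite prod_normE lt_max => /orP[//|]; rewrite ltNge p2.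
have [pn|pp] := ltP p.2.1 0.
  apply: Z => s s0; apply: (sl_van slQ); rewrite shE /=; first exact: ltW.
  right; rewrite prod_normE lt_max/= (lt_le_trans pL)//.
  have h : s + p.2.1 <= p.2.1 by rewrite gerDr.
  by rewrite (ltr0_norm pn) ltr0_norm ?lerN2// (le_lt_trans h pn).
(* The vertical shift c brings the second coordinate above L. *)
pose c : R := `|L| + `|p.2.2| + 1.
pose w : E := (0, (0, c)).
have wE (r : R) : r *: w + p = (p.1, (p.2.1, r * c + p.2.2)).
  case: (p) => t [a b]; rewrite [LHS]surjective_pairing; congr pair.
    by rewrite /= [r *: 0]mulr0 add0r.
  by rewrite [LHS]surjective_pairing /= [r *: 0]mulr0 add0r.
have [r _ E] := @MVT_dir R E stream p w (fun r => stream_grad w (r *: w + p))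
  (fun r _ => stream_derive w (etrans (f_equal (fun q : E => 0 < q.1) (wE r)) p0)).
have G0 : stream_grad w (r *: w + p) = 0.
  rewrite /stream_grad /w /= !mul0r addr0 sub0r (sl_van slP) ?mulr0 ?oppr0//.
    by rewrite wE /= ltW.
  by right; rewrite wE prod_normE lt_max/= pL.
have Z1 : stream (w + p) = 0.
  apply: Z => s _; rewrite shE.
  have := wE 1; rewrite scale1r => -> /=; rewrite mul1r.
  apply: (sl_van slQ) => /=; first exact: ltW.
  right; rewrite prod_normE lt_max/=; apply/orP; right.
  have := lerB_dist c (- p.2.2); rewrite opprK normrN.
  rewrite (ger0_norm (_ : 0 <= c)) ?addr_ge0//.
  by apply: lt_le_trans; rewrite /c; have := ler_norm L; lra.
by move: E; rewrite G0 Z1 sub0r => /eqP; rewrite oppr_eq0 => /eqP.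
Qed.

Variable e : R.
Hypothesis e0 : 0 < e.

Definition stream_avg := time_avg e stream.
Definition stream_avg_grad u p : R :=
  u.1 * e^-1 * (stream ((e, (0, 0)) + p) - stream p) + u.2.1 * time_avg e FQ p - u.2.2 * time_avg e FP p.

Lemma stream_avg_derive p u : 0 < p.1 -> is_derive p u stream_avg (stream_avg_grad u p).
Proof.
move=> p0.
have d := @time_avg_derive R e stream (stream_grad u) p u (ltW e0) stream_continuous
  (@stream_grad_continuous u) (fun q (q0 : 0 < q.1) => stream_derive u q0) p0.
suff <- : time_avg e (stream_grad u) p = stream_avg_grad u p by [].
have dt q : 0 < q.1 -> is_derive q et stream (stream_t q).
  move=> q0; have := stream_derive et q0.
  by rewrite /stream_grad /= mul1r !mul0r addr0 subr0.
have F := time_avg_FTC e0 stream_continuous stream_t_continuous dt (ltW p0).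
have I f : continuous f -> intg (leb R) (fun s => unit_itv s * f (s *: ((e, (0, 0)) : E) + p)).
  by move=> cf; apply: line_op_intg => //; [exact: measurable_unit_itv|exact: ldom_unit].
have I1 := I _ stream_t_continuous; have I2 := I _ cFQ; have I3 := I _ cFP.
transitivity (u.1 * time_avg e stream_t p + u.2.1 * time_avg e FQ p - u.2.2 * time_avg e FP p).
  rewrite /time_avg /line_op -!RintZ// -RintD; [|exact: intgZ|exact: intgZ].
  rewrite -RintB; [|by apply: intgD; exact: intgZ|exact: intgZ].
  by apply: Rint_ext => s; rewrite /stream_grad; ring.
by rewrite F /stream_avg_grad; ring.
Qed.

(** Every directional derivative combines a time difference of the stream function with averages of
    P and Q, all of class C1. The support stays in t <= S because the averages look forward. *)
Lemma stream_avg_Cc : Cc (slab0 T) 2 stream_avg.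
Proof.
have C1 : Ck (slab0 T) 1 stream.
  by apply: Ck1_slab0 stream_continuous stream_grad_continuous _ => p u; exact: stream_derive.
have C2 : Ck (slab0 T) 1 (fun p => stream ((e, (0, 0)) + p)).
  apply: (@Ck1_slab0 _ (fun u p => stream_grad u ((e, (0, 0)) + p))).
  - move=> p; apply: (@continuous_comp _ _ _ (fun p : E => (e, (0, 0)) + p) stream).
      by apply: cvgD; [exact: cvg_cst|exact: cvg_id].
    exact: stream_continuous.
  - move=> u p; apply: (@continuous_comp _ _ _ (fun p : E => (e, (0, 0)) + p) (stream_grad u)).
      by apply: cvgD; [exact: cvg_cst|exact: cvg_id].
    exact: stream_grad_continuous.
  - by move=> p u p0; apply: is_derive_shift; apply: stream_derive; rewrite /= addr_gt0.
have [C3 _] := slab_Cc (slabC1_avg (ltW e0) slQ).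
have [C4 _] := slab_Cc (slabC1_avg (ltW e0) slP).
split.
  split; first by apply: continuous_subspaceT; apply: time_avg_continuous; exact: stream_continuous.
  move=> u; exists (stream_avg_grad u); split; last first.
    by move=> p /interior_slab sp; case: p sp => t x /slabE /andP[t0 _]; exact: stream_avg_derive.
  have := Ck_add (Ck_add (Ck_scale (u.1 * e^-1) (Ck_add C2 (Ck_scale (-1) C1))) (Ck_scale u.2.1 C3))
    (Ck_scale (- u.2.2) C4).
  by apply: Ck_ext => p; rewrite /stream_avg_grad mulN1r mulNr.
have /andP[S0 ST] := sl_time slQ.
exists [set p | (0 <= p.1 <= S) /\ `|p.2| <= L]; split.
- exact: compact_slab_box.
- by move=> [t x] /= [/andP[t0 tS] _]; apply/slab0E; rewrite t0 (le_lt_trans tS).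
move=> [t x] /slab0E /andP[t0 tT] /= h.
have {}h : S < t \/ L < `|x|.
  have [tS|tS] := ltP S t; first by left.
  by right; rewrite ltNge; apply/negP => xL; apply: h; rewrite t0 tS.
apply: time_avg_zero; first exact: stream_continuous.
move=> s /andP[sp s1]; have se : 0 < s * e by exact: mulr_gt0.
rewrite stream_zero//=; first by rewrite ltr_pwDl.
case: h => h; [left|right]; first by rewrite (lt_le_trans h)// lerDr ltW.
by rewrite [(_ *: _) + _]addpE ![s *: 0]mulr0 !add0r -surjective_pairing.
Qed.

End Stream.

(** * Comparison of the weak formulations *)

Section HformAlgebra.
Variable R : realType.
Local Notation R2 := (measurableTypeR R * measurableTypeR R)%type.
Implicit Types (P Q om : R * R -> R).

Lemma Hform_bound A P Q om :
  measurable_fun (setT : set (R2 * R2)%type) (fun z => Hbar P Q z.1 z.2) ->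
  (forall z : R2 * R2, `|Hbar P Q z.1 z.2| <= A) -> intg (leb2 R) om ->
  `|Hform P Q om| <= A * (\int[leb2 R]_x `|om x| * \int[leb2 R]_x `|om x|).
Proof.
move=> mH hA iom; have [i B] := bilinear_bound mH hA iom iom.
by have := Rfubini2 i => /= E; rewrite /Hform E.
Qed.

Lemma HformB A A' P Q P' Q' om :
  measurable_fun (setT : set (R2 * R2)%type) (fun z => Hbar P Q z.1 z.2) ->
  (forall z : R2 * R2, `|Hbar P Q z.1 z.2| <= A) ->
  measurable_fun (setT : set (R2 * R2)%type) (fun z => Hbar P' Q' z.1 z.2) ->
  (forall z : R2 * R2, `|Hbar P' Q' z.1 z.2| <= A') -> intg (leb2 R) om ->
  Hform P Q om - Hform P' Q' om = Hform (fun x => P x - P' x) (fun x => Q x - Q' x) om.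
Proof.
move=> mH hA mH' hA' iom.
have [i _] := bilinear_bound mH hA iom iom.
have [i' _] := bilinear_bound mH' hA' iom iom.
have E (z : R2 * R2) : Hbar P Q z.1 z.2 * om z.1 * om z.2 - Hbar P' Q' z.1 z.2 * om z.1 * om z.2 =
    Hbar (fun x => P x - P' x) (fun x => Q x - Q' x) z.1 z.2 * om z.1 * om z.2.
  by rewrite /Hbar; ring.
have i2 := intg_ext E (intgB i i').
have := Rfubini2 i2 => /= E2; rewrite [RHS]/Hform E2.
have := Rfubini2 i => /= E3; have := Rfubini2 i' => /= E4.
by rewrite /Hform E3 E4 -RintB//; apply: Rint_ext.
Qed.

End HformAlgebra.

Lemma ae_time_bound (R : realType) (T C : R) (f : R -> R) : 0 < T -> 0 <= C ->
  measurable_fun (setT : set (measurableTypeR R)) f ->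
  (forall t, ~~ (0 < t < T) -> f t = 0) ->
  {ae leb R, forall t, `|f t| <= C} ->
  intg (leb R) f /\ `|\int[leb R]_t f t| <= C * T.
Proof.
move=> T0 C0 mf f0 hC.
pose g (t : R) := C * \1_(`[0, T]%classic : set R) t.
have ig : intg (leb R) g by apply: intgZ; exact: intg_indic_itv.
have fg : {ae leb R, forall t, `|f t| <= g t}.
  apply: ae_imp hC => t ht; rewrite /g indicE mem_setE in_itv/=.
  have [h|h] := boolP (0 < t < T).
    by move/andP: h => [/ltW -> /ltW ->]; rewrite mulr1.
  by rewrite f0// normr0 mulr_ge0.
have [i le] := intg_le_ae mf ig fg; split => //.
apply: le_trans (Rint_norm i) _; apply: le_trans le _.
rewrite /g RintZ; last exact: intg_indic_itv.
rewrite ler_wpM2l// (_ : \int[leb R]_x _ = T)//.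
transitivity (\int[leb R]_x (\1_(`[- (T / 2), T / 2]%classic : set R) x)); last first.
  by rewrite Rint_indic_itv ?divr_ge0 ?ltW//; field.
rewrite (@Rint_translate1 R (T / 2)); last exact: measurable_indic.
apply: Rint_ext => x; rewrite !indicE !mem_setE !in_itv/=; congr (nat_of_bool _)%:R.
by apply/idP/idP => /andP[h1 h2]; apply/andP; split; lra.
Qed.

Section TimeFunctionals.
Variables (R : realType) (T M : R).
Local Notation E := (R * (R * R))%type.
Local Notation R2 := (measurableTypeR R * measurableTypeR R)%type.
Local Notation E3 := (measurableTypeR R * (measurableTypeR R * measurableTypeR R))%type.
Variables W V1 V2 : E -> R.
Hypotheses (T0 : 0 < T) (M0 : 0 <= M).
Hypothesis mW : measurable_fun (setT : set E3) W.
Hypothesis mV1 : measurable_fun (setT : set E3) V1.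
Hypothesis mV2 : measurable_fun (setT : set E3) V2.
Hypothesis off : forall t x, ~~ (0 < t < T) -> [/\ W (t, x) = 0, V1 (t, x) = 0 & V2 (t, x) = 0].

(** At these times the slice identities for K * om apply, with an L1 bound common to all of them. By
    [good_time_ae] they are almost all times, those outside (0, T) included thanks to the extension
    by 0. *)
Definition good_time (t : R) : Prop :=
  let om x := W (t, x) in
  [/\ intg (leb2 R) om, \int[leb2 R]_x `|om x| <= M,
      {ae leb2 R, forall x, V1 (t, x) = (bs_conv om x).1} &
      {ae leb2 R, forall x, V2 (t, x) = (bs_conv om x).2}].

Hypothesis ae_good : {ae leb R, forall t, good_time t}.
Implicit Types (p q P Q : E -> R).

Definition slice_pairing p q (t : R) : R := \int[leb2 R]_x (p (t, x) * V1 (t, x) + q (t, x) * V2 (t, x)).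
Definition slice_Hform P Q (t : R) : R :=
  Hform (fun x => P (t, x)) (fun x => Q (t, x)) (fun x => W (t, x)).

Lemma measurable_slice p t : measurable_fun (setT : set E3) p ->
  measurable_fun (setT : set R2) (fun x => p (t, x)).
Proof. by move=> mp; exact: (measurableT_comp mp (@pair1_measurable _ _ _ _ t)). Qed.

Lemma measurable_slice_pairing p q : measurable_fun (setT : set E3) p ->
  measurable_fun (setT : set E3) q -> measurable_fun (setT : set (measurableTypeR R)) (slice_pairing p q).
Proof.
move=> mp mq; apply: (@measurable_Rint _ _ _ _ _ (leb2 R)
  (fun z : E3 => p z * V1 z + q z * V2 z)).
by apply: measurable_funD; exact: measurable_funM.
Qed.

Lemma measurable_slice_Hform P Q : measurable_fun (setT : set E3) P ->
  measurable_fun (setT : set E3) Q -> measurable_fun (setT : set (measurableTypeR R)) (slice_Hform P Q).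
Proof.
move=> mP mQ.
pose F (z : (measurableTypeR R * R2) * R2) : R :=
  Hbar (fun x => P (z.1.1, x)) (fun x => Q (z.1.1, x)) z.2 z.1.2 * W (z.1.1, z.2) * W z.1.
suff mF : measurable_fun setT F.
  exact: (@measurable_Rint _ _ _ _ _ (leb2 R) _ (@measurable_Rint _ _ _ _ _ (leb2 R) F mF)).
have m1 : measurable_fun setT (fun z : (measurableTypeR R * R2) * R2 => (z.1.1, z.2)).
  by apply: measurable_fun_pair; [exact: measurableT_comp measurable_fst measurable_fst|exact: measurable_snd].
have m2 : measurable_fun setT (fun z : (measurableTypeR R * R2) * R2 => (z.2, z.1.2)).
  by apply: measurable_fun_pair; [exact: measurable_snd|exact: measurableT_comp measurable_snd measurable_fst].
have m3 : measurable_fun setT (fun z : (measurableTypeR R * R2) * R2 => (z.1.1, z.1.2)).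
  by apply: measurable_fun_pair; apply: measurableT_comp measurable_fst => //.
have md := measurableT_comp (@measurable_sub2 R) m2.
apply: measurable_funM; last exact: (measurableT_comp mW measurable_fst).
apply: measurable_funM; last exact: (measurableT_comp mW m1).
apply: measurable_funM => //; apply: measurable_funB; apply: measurable_funM.
- exact: (measurableT_comp (@measurable_bsK1 R) md).
- by apply: measurable_funB; [exact: (measurableT_comp mQ m1)|exact: (measurableT_comp mQ m3)].
- exact: (measurableT_comp (@measurable_bsK2 R) md).
- by apply: measurable_funB; [exact: (measurableT_comp mP m1)|exact: (measurableT_comp mP m3)].
Qed.

Lemma slice_pairing_intg B L p q t : measurable_fun (setT : set E3) p ->
  measurable_fun (setT : set E3) q -> 0 <= B ->
  (forall x, `|p (t, x)| <= B * box L x) -> (forall x, `|q (t, x)| <= B * box L x) ->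
  good_time t -> [/\ intg (leb2 R) (fun x => p (t, x) * V1 (t, x)),
    intg (leb2 R) (fun x => q (t, x) * V2 (t, x)) &
    `|slice_pairing p q t| <= B * (2 * (kmass L * M))].
Proof.
move=> mp mq B0 hp hq [iom leM e1 e2].
have key (k V f : R * R -> R) : measurable_fun (setT : set R2) k ->
    (forall z, `|k z| <= `|z|^-1) -> measurable_fun (setT : set R2) V ->
    measurable_fun (setT : set R2) f ->
    (forall x, `|f x| <= B * box L x) ->
    {ae leb2 R, forall x, V x = kconv k (fun x => W (t, x)) x} ->
    intg (leb2 R) (fun x => f x * V x) /\ \int[leb2 R]_x `|f x * V x| <= B * (kmass L * M).
  move=> mk kle mV mf hf e.
  have [iL leL] := kconv_L1loc mk kle L iom.
  have le0 : {ae leb2 R, forall x,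
      `|f x * V x| <= B * (`|kconv k (fun x => W (t, x)) x| * box L x)}.
    by apply: ae_imp e => x ->; rewrite normrM mulrCA mulrC ler_wpM2l.
  have [i le] := intg_le_ae (measurable_funM mf mV) (intgZ B iL) le0.
  split => //; apply: le_trans le _; rewrite RintZ// ler_wpM2l//.
  by apply: le_trans leL _; rewrite ler_wpM2l// kmass_ge0.
have [i1 l1] := key _ _ _ (@measurable_bsK1 R) (@bsK1_le R) (measurable_slice t mV1)
  (measurable_slice t mp) hp e1.
have [i2 l2] := key _ _ _ (@measurable_bsK2 R) (@bsK2_le R) (measurable_slice t mV2)
  (measurable_slice t mq) hq e2.
split => //; rewrite /slice_pairing RintD//; apply: le_trans (ler_normD _ _) _.
have := Rint_norm i1; have := Rint_norm i2.
rewrite (_ : B * (2 * (kmass L * M)) = B * (kmass L * M) + B * (kmass L * M)); last by ring.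
by move=> h2 h1; apply: lerD; [apply: le_trans h1 l1|apply: le_trans h2 l2].
Qed.

Lemma slice_pairing_off p q t : ~~ (0 < t < T) -> slice_pairing p q t = 0.
Proof.
move=> ht; rewrite /slice_pairing (_ : (fun _ => _) = fun=> 0) ?/Rintegral ?integral0//.
by apply/funext => x; have [_ -> ->] := off x ht; rewrite !mulr0 addr0.
Qed.

Lemma slice_Hform_off P Q t : ~~ (0 < t < T) -> slice_Hform P Q t = 0.
Proof.
move=> ht; rewrite /slice_Hform /Hform.
transitivity (\int[leb2 R]_y (fun=> 0 : R) y); last by rewrite /Rintegral integral0.
apply: Rint_ext => y; rewrite (_ : (fun _ => _) = fun=> 0) ?/Rintegral ?integral0//.
by apply/funext => x; have [-> _ _] := off x ht; rewrite mulr0 mul0r.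
Qed.

End TimeFunctionals.

Section ZeroExtension.
Variables (R : realType) (T : R).
Local Notation E := (R * (R * R))%type.
Local Notation R2 := (measurableTypeR R * measurableTypeR R)%type.
Local Notation E3 := (measurableTypeR R * (measurableTypeR R * measurableTypeR R))%type.

(** This turns integrals over (0, T) into integrals over the line, and functions measurable on the
    slab into functions measurable on the whole space. *)
Definition zext (f : E -> R) (p : E) : R := if 0 < p.1 < T then f p else 0.

Lemma measurable_slab : measurable (slab T : set E3).
Proof. exact: measurableX. Qed.

Lemma zextE f p : zext f p = (f \_ (slab T)) p.
Proof.
rewrite patchE /zext; case: ifPn => [h|h]; [rewrite ifT//|rewrite ifF//].
  by rewrite inE; case: p h => t x h; apply/slabE.
by apply/negbTE/negP; rewrite inE; case: p h => t x h /slabE h'; rewrite h' in h.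
Qed.

Lemma measurable_zext (f : E -> R) : measurable_fun (slab T) f ->
  measurable_fun (setT : set E3) (zext f).
Proof.
move=> mf; rewrite (_ : zext f = f \_ (slab T)); last by apply/funext => p; exact: zextE.
have [h _] := measurable_restrictT f measurable_slab.
exact: (h mf).
Qed.

Lemma measurable_slab_fst (v : E -> R * R) : measurable_fun (slab T) v ->
  measurable_fun (slab T : set E3) (fun p => (v p).1) /\
  measurable_fun (slab T : set E3) (fun p => (v p).2).
Proof.
move=> mv; split.
- exact: (measurableT_comp measurable_fst mv).
- exact: (measurableT_comp measurable_snd mv).
Qed.

Lemma ess_sup_bound (f : R -> \bar R) : (ess_sup (leb R) f < +oo)%E ->
  exists2 M : R, 0 <= M & {ae leb R, forall t, (f t <= M%:E)%E}.
Proof.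
have h := ess_sup_ge (leb R) f; move: h.
case: ess_sup => [r|//|] h _.
- exists `|r| => //; apply: ae_imp h => t; move/le_trans; apply.
  by rewrite lee_fin ler_norm.
- by exists 0 => //; apply: ae_imp h => t; move/le_trans; apply; rewrite leNye.
Qed.

Lemma good_time_ae (w : E -> R) (v : E -> R * R) : in_Linf_L1 T w -> is_bs_velocity T w v ->
  exists2 M, 0 <= M & {ae leb R, forall t,
    good_time M (zext w) (zext (fun p => (v p).1)) (zext (fun p => (v p).2)) t}.
Proof.
move=> [mw /ess_sup_bound[M M0 hM]] [mv hv].
exists M => //; apply: ae_imp (ae_and hM hv) => t [].
have [ht|ht] := boolP (0 < t < T); last first.
  move=> _ _; have z f x : zext f (t, x) = 0 by rewrite /zext /= (negbTE ht).
  have z0 (k : R * R -> R) x : \int[leb2 R]_y (k (x - y) * zext w (t, y)) = 0.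
    transitivity (\int[leb2 R]_y (fun=> 0 : R) y); last by rewrite /Rintegral integral0.
    by apply: Rint_ext => y; rewrite z mulr0.
  split.
  - by have := intg0 (leb2 R); apply: intg_ext => x; rewrite z.
  - rewrite (_ : \int[leb2 R]_x _ = \int[leb2 R]_x (fun=> 0 : R) x).
      by rewrite /Rintegral integral0.
    by apply: Rint_ext => x; rewrite z normr0.
  - by apply: aeW => x; rewrite z; exact: (esym (z0 (fun z => (bsK z).1) x)).
  - by apply: aeW => x; rewrite z; exact: (esym (z0 (fun z => (bsK z).2) x)).
move=> N1 hb.
have z f : (fun x => zext f (t, x)) = fun x => f (t, x).
  by apply/funext => x; rewrite /zext /= ht.
have tT : `]0, T[%classic t by rewrite /= in_itv.
have mz := measurable_slice t (measurable_zext mw); rewrite z in mz.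
have N : (\int[leb2 R]_x `|(w (t, x))%:E| <= M%:E)%E.
  by move: N1; rewrite patchE mem_set// Lnorm1.
have iw : intg (leb2 R) (fun x => w (t, x)).
  apply/integrableP; split; first exact/measurable_EFinP.
  by apply: le_lt_trans N _; rewrite ltry.
have := hb tT => {}hb.
rewrite /good_time !z; split => //.
- rewrite (_ : \int[leb2 R]_x _ = \int[leb2 R]_x `|w (t, x)|).
    by rewrite -lee_fin -intg_EFin//; exact: intg_norm.
  by apply: Rint_ext => x; rewrite /zext /= ht.
- by apply: ae_imp hb => x; rewrite /zext /= ht => ->.
- by apply: ae_imp hb => x; rewrite /zext /= ht => ->.
Qed.

End ZeroExtension.

Lemma normr_combine3 (R : realType) (a b c a' b' c' x y z : R) :
  `|a - a'| <= x -> `|b - b'| <= y -> `|c - c'| <= z ->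
  `|(a - b + c) - (a' - b' + c')| <= x + y + z.
Proof.
move=> h1 h2 h3.
rewrite (_ : _ - _ = (a - a') - (b - b') + (c - c')); last by ring.
apply: le_trans (ler_normD _ _) _; apply: lerD => //.
by apply: le_trans (ler_normB _ _) _; exact: lerD.
Qed.

Section VelocityFunctional.
Variables (R : realType) (T M : R).
Local Notation E := (R * (R * R))%type.
Local Notation R2 := (measurableTypeR R * measurableTypeR R)%type.
Local Notation E3 := (measurableTypeR R * (measurableTypeR R * measurableTypeR R))%type.
Local Notation et := ((1, (0, 0)) : E).
Local Notation e1 := ((0, (1, 0)) : E).
Local Notation e2 := ((0, (0, 1)) : E).
Variables (W V1 V2 : E -> R) (v01 v02 : R * R -> R).
Hypotheses (T0 : 0 < T) (M0 : 0 <= M).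
Hypothesis mW : measurable_fun (setT : set E3) W.
Hypothesis mV1 : measurable_fun (setT : set E3) V1.
Hypothesis mV2 : measurable_fun (setT : set E3) V2.
Hypothesis off : forall t x, ~~ (0 < t < T) -> [/\ W (t, x) = 0, V1 (t, x) = 0 & V2 (t, x) = 0].
Hypothesis ae_good : {ae leb R, forall t, good_time M W V1 V2 t}.
Hypotheses (l1 : L1loc v01) (l2 : L1loc v02).
Implicit Types (p q P Q : E -> R).

Let K1 L := 2 * (kmass L * M).

Lemma kmass_M_ge0 L : 0 <= kmass L * M.
Proof. by rewrite mulr_ge0// kmass_ge0. Qed.

Lemma slice_pairing_time B L p q : measurable_fun (setT : set E3) p ->
  measurable_fun (setT : set E3) q -> 0 <= B ->
  (forall t x, 0 < t < T -> `|p (t, x)| <= B * box L x) ->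
  (forall t x, 0 < t < T -> `|q (t, x)| <= B * box L x) ->
  intg (leb R) (slice_pairing V1 V2 p q) /\ `|\int[leb R]_t slice_pairing V1 V2 p q t| <= B * K1 L * T.
Proof.
move=> mp mq B0 hp hq.
have C0 : 0 <= B * K1 L by rewrite mulr_ge0// mulr_ge0// kmass_M_ge0.
apply: ae_time_bound => //.
- exact: measurable_slice_pairing.
- by move=> t; exact: (slice_pairing_off off).
apply: ae_imp ae_good => t gt; have [ht|ht] := boolP (0 < t < T).
  by have [] := slice_pairing_intg mV1 mV2 mp mq B0 (fun x => hp t x ht) (fun x => hq t x ht) gt.
by rewrite (slice_pairing_off off)// normr0.
Qed.

Definition Hbar_slices A P Q := forall t, 0 < t < T ->
  measurable_fun (setT : set (R2 * R2)%type)
    (fun z => Hbar (fun x => P (t, x)) (fun x => Q (t, x)) z.1 z.2) /\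
  forall z : R2 * R2, `|Hbar (fun x => P (t, x)) (fun x => Q (t, x)) z.1 z.2| <= A.

Lemma slice_Hform_time A P Q : measurable_fun (setT : set E3) P ->
  measurable_fun (setT : set E3) Q -> 0 <= A -> Hbar_slices A P Q ->
  intg (leb R) (slice_Hform W P Q) /\ `|\int[leb R]_t slice_Hform W P Q t| <= A * (M * M) * T.
Proof.
move=> mP mQ A0 hA.
have C0 : 0 <= A * (M * M) by rewrite !mulr_ge0.
apply: ae_time_bound => //.
- exact: measurable_slice_Hform.
- by move=> t; exact: (slice_Hform_off off).
apply: ae_imp ae_good => t [iom leM _ _]; have [ht|ht] := boolP (0 < t < T); last first.
  by rewrite (slice_Hform_off off)// normr0.
have [mH bH] := hA _ ht; apply: le_trans (Hform_bound mH bH iom) _.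
by rewrite ler_wpM2l// ler_pM// Rint_ge0.
Qed.

(** The time derivatives are separate arguments: they are supplied by the data [G] of [slabC1],
    meaningful for t > 0, since the even extensions may fail to be differentiable at t = 0. *)
Definition velocity_form P Q Pt Qt : R := \int[leb R]_t slice_pairing V1 V2 Pt Qt t -
  \int[leb R]_t slice_Hform W P Q t + \int[leb2 R]_x (P (0, x) * v01 x + Q (0, x) * v02 x).

Lemma cont_E3 p : continuous p -> measurable_fun (setT : set E3) p.
Proof. exact: continuous_measurable3. Qed.

Section OneField.
Variables (S L : R) (f F : E -> R) (G : E -> E -> R).
Hypothesis slF : slabC1 T S L f F G.

Lemma slab_box_bound u : exists2 B, 0 <= B & forall t x, 0 <= t -> `|G u (t, x)| <= B * box L x.
Proof.
have [B B0 hB] := @cont_locally_bounded R (G u) (Num.max S L) (@sl_contG _ _ _ _ _ _ _ slF u).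
exists B => // t x t0; rewrite boxE; case: ifPn => xL; last first.
  by rewrite (sl_vanG slF) ?normr0 ?mulr0//=; right; rewrite ltNge.
have [tS|tS] := leP t S; last by rewrite (sl_vanG slF) ?normr0 ?mulr1//; left.
by rewrite mulr1; apply: hB; rewrite prod_normE ge_max/= (ger0_norm t0) !le_max tS xL orbT.
Qed.

End OneField.

Lemma slab_Hbar S L fP P GP fQ Q GQ : slabC1 T S L fP P GP -> slabC1 T S L fQ Q GQ ->
  exists2 A, 0 <= A & Hbar_slices A P Q.
Proof.
move=> slP slQ.
have [B1 B10 h1] := slab_box_bound slP e1; have [B2 B20 h2] := slab_box_bound slP e2.
have [B3 B30 h3] := slab_box_bound slQ e1; have [B4 B40 h4] := slab_box_bound slQ e2.
have bx (B y : R) x : 0 <= B -> y <= B * box L x -> y <= B.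
  by move=> B0 /le_trans; apply; rewrite boxE; case: ifP; rewrite ?mulr1 ?mulr0.
exists ((B1 + B2) + (B3 + B4)); first by rewrite !addr_ge0.
move=> t /andP[t0 _]; have CP := slice_C1c slP (ltW t0); have CQ := slice_C1c slQ (ltW t0).
split; first exact: (measurable_Hbar CP CQ).
move=> z; apply: Hbar_le; [exact: addr_ge0|exact: addr_ge0| |].
- apply: (C1_lipschitz _ _ (C1c_C1 CP)) => x.
    by apply: (bx _ _ x B10); exact: h1 (ltW t0).
  by apply: (bx _ _ x B20); exact: h2 (ltW t0).
- apply: (C1_lipschitz _ _ (C1c_C1 CQ)) => x.
    by apply: (bx _ _ x B30); exact: h3 (ltW t0).
  by apply: (bx _ _ x B40); exact: h4 (ltW t0).
Qed.

Lemma slab_slice_pairing S L fP P GP fQ Q GQ u : slabC1 T S L fP P GP -> slabC1 T S L fQ Q GQ ->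
  intg (leb R) (slice_pairing V1 V2 (GP u) (GQ u)).
Proof.
move=> slP slQ.
have [B1 B10 h1] := slab_box_bound slP u; have [B2 B20 h2] := slab_box_bound slQ u.
have [] := @slice_pairing_time (B1 + B2) L (GP u) (GQ u) => //.
- by apply: cont_E3; exact: (sl_contG slP).
- by apply: cont_E3; exact: (sl_contG slQ).
- exact: addr_ge0.
- move=> t x /andP[t0 _]; apply: le_trans (h1 _ _ (ltW t0)) _.
  by rewrite ler_wpM2r ?box_ge0// lerDl.
- move=> t x /andP[t0 _]; apply: le_trans (h2 _ _ (ltW t0)) _.
  by rewrite ler_wpM2r ?box_ge0// lerDr.
Qed.

Definition closeG (eta : R) (G G' : E -> E -> R) := forall x : E, 0 < x.1 ->
  [/\ `|G et x - G' et x| <= eta, `|G e1 x - G' e1 x| <= eta & `|G e2 x - G' e2 x| <= eta].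

(** The Lipschitz constant of the velocity functional for C1 distance: the L1_loc bound on the
    velocity over time, the kernel bound 4 eta (two components, two space derivatives each), and the
    local mass of the initial velocity. *)
Definition velocity_modulus L : R := K1 L * T + 4 * (M * M) * T +
  (\int[leb2 R]_x (`|v01 x| * box L x) + \int[leb2 R]_x (`|v02 x| * box L x)).

(** All three terms are linear in the field, so the estimate is that of a single field of C1 size
    eta supported in the box of radius L. The differences of slice integrals are formed at good
    times, where the integrals converge. *)
Lemma velocity_form_close S L eta fP P GP fQ Q GQ fP' P' GP' fQ' Q' GQ' : 0 <= eta ->
  slabC1 T S L fP P GP -> slabC1 T S L fQ Q GQ ->
  slabC1 T S L fP' P' GP' -> slabC1 T S L fQ' Q' GQ' ->
  closeG eta GP GP' -> closeG eta GQ GQ' ->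
  (forall x, `|P (0, x) - P' (0, x)| <= eta) -> (forall x, `|Q (0, x) - Q' (0, x)| <= eta) ->
  `|velocity_form P Q (GP et) (GQ et) - velocity_form P' Q' (GP' et) (GQ' et)| <= eta * velocity_modulus L.
Proof.
move=> eta0 slP slQ slP' slQ' cP cQ iP iQ.
have bdiff F F' f f' G G' u t x : slabC1 T S L f F G -> slabC1 T S L f' F' G' -> 0 < t ->
    `|G u (t, x) - G' u (t, x)| <= eta -> `|G u (t, x) - G' u (t, x)| <= eta * box L x.
  move=> sl sl' t0 h; rewrite boxE; case: ifPn => xL; first by rewrite mulr1.
  by rewrite (sl_vanG sl) ?(sl_vanG sl') ?subrr ?normr0 ?mulr0//=; try exact: ltW;
    right; rewrite ltNge.
have T1 : `|\int[leb R]_t slice_pairing V1 V2 (GP et) (GQ et) t -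
    \int[leb R]_t slice_pairing V1 V2 (GP' et) (GQ' et) t| <= eta * (K1 L * T).
  have mD F F' f f' G G' : slabC1 T S L f F G -> slabC1 T S L f' F' G' ->
      measurable_fun (setT : set E3) (fun z : E => G et z - G' et z).
    move=> sl sl'; apply: measurable_funB; apply: cont_E3.
      exact: (sl_contG sl).
    exact: (sl_contG sl').
  have hD F F' f f' G G' : slabC1 T S L f F G -> slabC1 T S L f' F' G' -> closeG eta G G' ->
      forall t x, 0 < t < T -> `|G et (t, x) - G' et (t, x)| <= eta * box L x.
    move=> sl sl' cl t x /andP[t0 _]; have [h _ _] := cl (t, x) t0.
    exact: (bdiff _ _ _ _ _ _ _ _ _ sl sl' t0 h).
  have [iD bD] := slice_pairing_time (mD _ _ _ _ _ _ slP slP') (mD _ _ _ _ _ _ slQ slQ') eta0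
    (hD _ _ _ _ _ _ slP slP' cP) (hD _ _ _ _ _ _ slQ slQ' cQ).
  have j := slab_slice_pairing et slP slQ; have j' := slab_slice_pairing et slP' slQ'.
  rewrite mulrA; rewrite -(RintB j j').
  suff -> : \int[leb R]_t (slice_pairing V1 V2 (GP et) (GQ et) t - slice_pairing V1 V2 (GP' et) (GQ' et) t) =
    \int[leb R]_t slice_pairing V1 V2 (fun z => GP et z - GP' et z) (fun z => GQ et z - GQ' et z) t.
    exact: bD.
  apply: (Rint_ae (intg_mfun (intgB j j')) (intg_mfun iD)).
  apply: ae_imp ae_good => t gt; have [ht|ht] := boolP (0 < t < T); last first.
    by rewrite !(slice_pairing_off off)// subrr.
  have /andP[t0 _] := ht.
  have It fa Fa Ga fb Fb Gb : slabC1 T S L fa Fa Ga -> slabC1 T S L fb Fb Gb ->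
      intg (leb2 R) (fun x => Ga et (t, x) * V1 (t, x) + Gb et (t, x) * V2 (t, x)).
    move=> sa sb; have [B1 B10 h1] := slab_box_bound sa et; have [B2 B20 h2] := slab_box_bound sb et.
    have hp x : `|Ga et (t, x)| <= (B1 + B2) * box L x.
      by apply: le_trans (h1 _ _ (ltW t0)) _; rewrite ler_wpM2r ?box_ge0// lerDl.
    have hq x : `|Gb et (t, x)| <= (B1 + B2) * box L x.
      by apply: le_trans (h2 _ _ (ltW t0)) _; rewrite ler_wpM2r ?box_ge0// lerDr.
    have [i1 i2 _] := slice_pairing_intg mV1 mV2 (cont_E3 (@sl_contG _ _ _ _ _ _ _ sa et))
      (cont_E3 (@sl_contG _ _ _ _ _ _ _ sb et)) (addr_ge0 B10 B20) hp hq gt.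
    exact: intgD.
  rewrite /slice_pairing -RintB; [|exact: It slP slQ|exact: It slP' slQ'].
  by apply: Rint_ext => x; ring.
have T2 : `|\int[leb R]_t slice_Hform W P Q t - \int[leb R]_t slice_Hform W P' Q' t| <= eta * (4 * (M * M) * T).
  have [A A0 hA] := slab_Hbar slP slQ; have [A' A'0 hA'] := slab_Hbar slP' slQ'.
  have cp F f G : slabC1 T S L f F G -> continuous F by move=> sl; exact: (sl_cont sl).
  have m1 := cont_E3 (cp _ _ _ slP); have m2 := cont_E3 (cp _ _ _ slQ).
  have m3 := cont_E3 (cp _ _ _ slP'); have m4 := cont_E3 (cp _ _ _ slQ').
  have [j _] := slice_Hform_time m1 m2 A0 hA; have [j' _] := slice_Hform_time m3 m4 A'0 hA'.
  have hD : Hbar_slices (4 * eta) (fun z => P z - P' z) (fun z => Q z - Q' z).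
    move=> t /andP[t0 _].
    have CP := C1c_add (slice_C1c slP (ltW t0)) (C1c_scaleN (slice_C1c slP' (ltW t0))).
    have CQ := C1c_add (slice_C1c slQ (ltW t0)) (C1c_scaleN (slice_C1c slQ' (ltW t0))).
    split; first exact: (measurable_Hbar CP CQ).
    move=> z; rewrite (_ : 4 * eta = (eta + eta) + (eta + eta)); last by ring.
    apply: Hbar_le; rewrite ?addr_ge0//.
      by apply: (C1_lipschitz _ _ (C1c_C1 CP)) => x; have [] := cP (t, x) t0.
    by apply: (C1_lipschitz _ _ (C1c_C1 CQ)) => x; have [] := cQ (t, x) t0.
  have e4 : 0 <= 4 * eta by rewrite mulr_ge0.
  have [iD bD] := slice_Hform_time (measurable_funB m1 m3) (measurable_funB m2 m4) e4 hD.
  rewrite (_ : eta * _ = 4 * eta * (M * M) * T); last by ring.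
  rewrite -(RintB j j'); suff -> : \int[leb R]_t (slice_Hform W P Q t - slice_Hform W P' Q' t) =
    \int[leb R]_t slice_Hform W (P \- P') (Q \- Q') t by exact: bD.
  apply: (Rint_ae (intg_mfun (intgB j j')) (intg_mfun iD)).
  apply: ae_imp ae_good => t [iom _ _ _]; have [ht|ht] := boolP (0 < t < T); last first.
    by rewrite !(slice_Hform_off off)// subrr.
  have [mH bH] := hA _ ht; have [mH' bH'] := hA' _ ht.
  exact: (HformB mH bH mH' bH' iom).
have T3 : `|\int[leb2 R]_x (P (0, x) * v01 x + Q (0, x) * v02 x) -
    \int[leb2 R]_x (P' (0, x) * v01 x + Q' (0, x) * v02 x)| <=
    eta * (\int[leb2 R]_x (`|v01 x| * box L x) + \int[leb2 R]_x (`|v02 x| * box L x)).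
  have sl0 F f G : slabC1 T S L f F G -> continuous (fun x => F (0, x)) /\ vanish L (fun x => F (0, x)).
    by move=> sl; have C := slice_C1c sl (lexx 0); split; [exact: (C1_cont (C1c_C1 C))|exact: (C1c_0 C)].
  have I F f G g : slabC1 T S L f F G -> L1loc g -> intg (leb2 R) (fun x => F (0, x) * g x).
    move=> sl lg; have [c v] := sl0 _ _ _ sl; have [C C0 hC] := vanish_box c v.
    by have [] := L1loc_intg lg (continuous_measurable2 c) hC C0.
  have D F f G F' f' G' g : slabC1 T S L f F G -> slabC1 T S L f' F' G' -> L1loc g ->
      (forall x, `|F (0, x) - F' (0, x)| <= eta) ->
      `|\int[leb2 R]_x ((F (0, x) - F' (0, x)) * g x)| <= eta * \int[leb2 R]_x (`|g x| * box L x).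
    move=> sl sl' lg h; have [c v] := sl0 _ _ _ sl; have [c' v'] := sl0 _ _ _ sl'.
    have hb x : `|F (0, x) - F' (0, x)| <= eta * box L x.
      rewrite boxE; case: ifPn => xL; first by rewrite mulr1.
      by rewrite v ?v' ?subrr ?normr0 ?mulr0// ltNge.
    have [i le] := L1loc_intg lg
      (measurable_funB (continuous_measurable2 c) (continuous_measurable2 c')) hb eta0.
    exact: le_trans (Rint_norm i) le.
  rewrite -RintB; [|by apply: intgD; [exact: I slP l1|exact: I slQ l2]|
    by apply: intgD; [exact: I slP' l1|exact: I slQ' l2]].
  have -> : \int[leb2 R]_x (P (0, x) * v01 x + Q (0, x) * v02 x - (P' (0, x) * v01 x + Q' (0, x) * v02 x))
      = \int[leb2 R]_x ((P (0, x) - P' (0, x)) * v01 x + (Q (0, x) - Q' (0, x)) * v02 x).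
    by apply: Rint_ext => x; ring.
  have J F f G F' f' G' g : slabC1 T S L f F G -> slabC1 T S L f' F' G' -> L1loc g ->
      intg (leb2 R) (fun x => (F (0, x) - F' (0, x)) * g x).
    move=> sl sl' lg; have := intgB (I _ _ _ _ sl lg) (I _ _ _ _ sl' lg).
    by apply: intg_ext => x; rewrite mulrBl.
  rewrite RintD; [|exact: J slP slP' l1|exact: J slQ slQ' l2].
  by rewrite mulrDr; apply: le_trans (ler_normD _ _) _; apply: lerD;
    [exact: D slP slP' l1 iP|exact: D slQ slQ' l2 iQ].
have -> : eta * velocity_modulus L = eta * (K1 L * T) + eta * (4 * (M * M) * T) +
    eta * (\int[leb2 R]_x (`|v01 x| * box L x) + \int[leb2 R]_x (`|v02 x| * box L x)).
  by rewrite /velocity_modulus 2!mulrDr.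
exact: (normr_combine3 T1 T2 T3).
Qed.

End VelocityFunctional.

(** * Equivalence of the velocity and vorticity formulations *)

Section Formulations.
Variables (R : realType) (T M : R).
Local Notation E := (R * (R * R))%type.
Local Notation R2 := (measurableTypeR R * measurableTypeR R)%type.
Local Notation E3 := (measurableTypeR R * (measurableTypeR R * measurableTypeR R))%type.
Local Notation et := ((1, (0, 0)) : E).
Local Notation e1 := ((0, (1, 0)) : E).
Local Notation e2 := ((0, (0, 1)) : E).
Variables (w0 : R * R -> R) (v0 : R * R -> R * R) (w : E -> R) (v : E -> R * R).
Local Notation W := (zext T w).
Local Notation V1 := (zext T (fun p => (v p).1)).
Local Notation V2 := (zext T (fun p => (v p).2)).
Local Notation v01 := (fun x => (v0 x).1).
Local Notation v02 := (fun x => (v0 x).2).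
Hypotheses (T0 : 0 < T) (M0 : 0 <= M).
Hypothesis mw : measurable_fun (slab T) w.
Hypothesis mv : measurable_fun (slab T) v.
Hypothesis ae_good : {ae leb R, forall t, good_time M W V1 V2 t}.
Hypotheses (l1 : L1loc v01) (l2 : L1loc v02) (lw0 : L1loc w0) (curl0 : curl_eq v0 w0).
Implicit Types (p q u : E) (F : E -> R).

Local Notation Lv := (velocity_form W V1 V2 v01 v02).

Definition velocity_lhs (phi : E -> R * R) : R :=
  \int[leb R]_(t in `]0, T[) (\int[leb2 R]_x dot (dt phi (t, x)) (v (t, x)))
      - \int[leb R]_(t in `]0, T[) (\int[leb2 R]_y (\int[leb2 R]_x
          (Hbar_kernel phi t x y * w (t, x) * w (t, y))))
      + \int[leb2 R]_x dot (phi (0, x)) (v0 x).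

Definition vorticity_lhs (phi : E -> R) : R :=
  \int[leb R]_(t in `]0, T[) (\int[leb2 R]_x (dt phi (t, x) * w (t, x)))
      - \int[leb R]_(t in `]0, T[) (\int[leb2 R]_y (\int[leb2 R]_x
          (H_kernel phi t x y * w (t, x) * w (t, y))))
      + \int[leb2 R]_x (phi (0, x) * w0 x).

Lemma zext_off t x : ~~ (0 < t < T) -> [/\ W (t, x) = 0, V1 (t, x) = 0 & V2 (t, x) = 0].
Proof. by move=> h; rewrite /zext /= (negbTE h). Qed.

Lemma zext_in f t x : 0 < t < T -> zext T f (t, x) = f (t, x).
Proof. by move=> h; rewrite /zext /= h. Qed.

Lemma Rint_time (f g : R -> R) : (forall t, 0 < t < T -> f t = g t) ->
  (forall t, ~~ (0 < t < T) -> g t = 0) ->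
  \int[leb R]_(t in `]0, T[) f t = \int[leb R]_t g t.
Proof.
move=> fg g0; rewrite Rint_restrict; apply: Rint_ext => t.
rewrite patchE mem_setE in_itv/=; case: ifPn => [h|h]; first exact: fg.
by rewrite g0.
Qed.

Lemma slab_dir_f S L f F G u t x : slabC1 T S L f F G -> 0 < t < T ->
  is_derive ((t, x) : E) u f (G u (t, x)).
Proof. by move=> sl h; apply: (slab_der_f sl u); apply/slabE. Qed.

Lemma pair_dir S L (phi : E -> R * R) FP GP FQ GQ u t x :
  slabC1 T S L (fun p => (phi p).1) FP GP -> slabC1 T S L (fun p => (phi p).2) FQ GQ ->
  0 < t < T -> 'D_u phi (t, x) = (GP u (t, x), GQ u (t, x)).
Proof.
move=> sP sQ h; have d := is_derive_pair (slab_dir_f u x sP h) (slab_dir_f u x sQ h).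
have E : (fun p => ((phi p).1, (phi p).2)) = phi by apply/funext => p; rewrite -surjective_pairing.
by rewrite E in d; have [_ ->] := d.
Qed.

Lemma velocity_lhsE S L (phi : E -> R * R) FP GP FQ GQ :
  slabC1 T S L (fun p => (phi p).1) FP GP -> slabC1 T S L (fun p => (phi p).2) FQ GQ ->
  velocity_lhs phi = Lv FP FQ (GP et) (GQ et).
Proof.
move=> sP sQ.
have T1 : \int[leb R]_(t in `]0, T[) (\int[leb2 R]_x dot (dt phi (t, x)) (v (t, x))) =
    \int[leb R]_t slice_pairing V1 V2 (GP et) (GQ et) t.
  apply: Rint_time => [t h|t h]; last exact: (slice_pairing_off zext_off).
  by apply: Rint_ext => x; rewrite /dt (pair_dir _ _ sP sQ h) /dot !zext_in.
have T2 : \int[leb R]_(t in `]0, T[) (\int[leb2 R]_y (\int[leb2 R]_x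
          (Hbar_kernel phi t x y * w (t, x) * w (t, y)))) = \int[leb R]_t slice_Hform W FP FQ t.
  apply: Rint_time => [t h|t h]; last exact: (slice_Hform_off zext_off).
  apply: Rint_ext => y; apply: Rint_ext => x; rewrite (zext_in w x h) (zext_in w y h).
  congr (_ * _ * _).
  have h' : 0 <= t < T by move/andP: h => [/ltW -> ->].
  rewrite /Hbar_kernel /Hbar /dot /perp /= -(sl_eq sP x h') -(sl_eq sP y h') -(sl_eq sQ x h') -(sl_eq sQ y h').
  by congr (_ * _); ring.
have T3 : \int[leb2 R]_x dot (phi (0, x)) (v0 x) =
    \int[leb2 R]_x (FP (0, x) * (v0 x).1 + FQ (0, x) * (v0 x).2).
  apply: Rint_ext => x; rewrite /dot; have h : 0 <= (0 : R) < T by rewrite lexx T0.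
  by rewrite -(sl_eq sP x h) -(sl_eq sQ x h).
by rewrite /velocity_lhs /velocity_form T1 T2 T3.
Qed.

Lemma slab_pair_exists (phi : E -> R * R) : Cc (slab0 T) 1 phi ->
  exists S L FP GP FQ GQ, [/\ slabC1 T S L (fun p => (phi p).1) FP GP,
    slabC1 T S L (fun p => (phi p).2) FQ GQ, even_time FP /\ (forall u, even_time (GP u)) &
    even_time FQ /\ (forall u, even_time (GQ u))].
Proof.
move=> Cphi.
have [S [L [FP [GP [sP eP eGP]]]]] := slabC1_exists T0 (Cc_fst Cphi).
have [S' [L' [FQ [GQ [sQ eQ eGQ]]]]] := slabC1_exists T0 (Cc_snd Cphi).
have /andP[S0 ST] := sl_time sP; have /andP[S'0 S'T] := sl_time sQ.
exists (Num.max S S'), (Num.max L L'), FP, GP, FQ, GQ; split => //.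
- by apply: (slabC1_weaken sP); rewrite ?gt_max ?le_max ?lexx ?ST ?S'T.
- by apply: (slabC1_weaken sQ); rewrite ?gt_max ?le_max ?lexx ?ST ?S'T ?orbT.
Qed.

Lemma eq_at_zero F F' x : continuous F -> continuous F' ->
  (forall t, 0 < t < T -> F (t, x) = F' (t, x)) -> F (0, x) = F' (0, x).
Proof.
move=> cF cF' h; apply/eqP; rewrite -subr_eq0 -normr_le0.
apply: (@small_time R (fun p => F p - F' p) 0 T 0 x) => //.
  by move=> p; apply: cvgB; [exact: cF|exact: cF'].
by move=> t; rewrite add0r => /h ->; rewrite subrr normr0.
Qed.

(* phi is a stream function of (P, Q): the time derivative of grad phi is moved
   onto dt phi by Schwarz, and int psi w = - int grad^perp psi . v is the curl
   equation of the Biot-Savart velocity. *)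
Lemma vorticity_lhsE S L fP FP GP fQ FQ GQ (phi : E -> R) : Cc (slab0 T) 2 phi ->
  slabC1 T S L fP FP GP -> slabC1 T S L fQ FQ GQ ->
  (forall p, slab T p -> is_derive p e1 phi (FQ p)) ->
  (forall p, slab T p -> is_derive p e2 phi (- FP p)) ->
  vorticity_lhs phi = - Lv FP FQ (GP et) (GQ et).
Proof.
move=> Cphi sP sQ d1 d2.
have [[cphi dphi] [K [cK KD phi0]]] := Cphi.
have C1phi : Cc (slab0 T) 1 phi by split; [exact: CkW Cphi.1|exists K].
have clK : closed K by apply: compact_closed cK; exact: norm_hausdorff.
have [gt [Cgt dgt']] := dphi et.
have dgt p : slab T p -> is_derive p et phi (gt p) by move=> sp; apply: dgt'; exact: slab_interior.
have Ccgt : Cc (slab0 T) 1 gt.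
  split => //; exists K; split => //.
  have [cgt _] := Cgt; exact: (deriv_vanish clK cgt dgt phi0).
have [S1 [L1 [F [G [sF _ _]]]]] := slabC1_exists T0 C1phi.
(* The time derivative of phi is itself C1 with support in K, so its slices are admissible tests for
   the weak curl of the velocity. *)
have [S2 [L2 [Ft [Gt [sFt _ _]]]]] := slabC1_exists T0 Ccgt.
have uniq_dir p u a b (f : E -> R) : is_derive p u f a -> is_derive p u f b -> a = b.
  by move=> [_ <-] [_ ->].
have GE1 t x : 0 < t < T -> G e1 (t, x) = FQ (t, x).
  move=> h; apply: uniq_dir (slab_dir_f e1 x sF h) _; apply: d1; exact/slabE.
have GE2 t x : 0 < t < T -> G e2 (t, x) = - FP (t, x).
  move=> h; apply: uniq_dir (slab_dir_f e2 x sF h) _; apply: d2; exact/slabE.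
have nslab (P : E -> Prop) p : (forall q, slab T q -> P q) -> slab T p -> \forall q \near p, P q.
  by move=> h sp; apply: (filterS _ (open_nbhs_nbhs (conj (@open_slab R T) sp))).
have slab_pos p : slab T p -> 0 < p.1 by case: p => t x /slabE /andP[].
have Sch1 t x : 0 < t < T -> Gt e1 (t, x) = GQ et (t, x).
  move=> h; have sp : slab T (t, x) by apply/slabE.
  apply: (@schwarz_dir R E phi gt FQ (Gt e1) (GQ et) (t, x) et e1).
  - exact: (nslab _ _ dgt sp).
  - exact: (nslab _ _ d1 sp).
  - by apply: nslab sp => q sq; exact: (slab_der_f sFt _ sq).
  - by apply: nslab sp => q sq; apply: (sl_der sQ); exact: slab_pos.
  - exact: (sl_contG sFt).
  - exact: (sl_contG sQ).
have Sch2 t x : 0 < t < T -> Gt e2 (t, x) = - GP et (t, x).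
  move=> h; have sp : slab T (t, x) by apply/slabE.
  apply: (@schwarz_dir R E phi gt (fun p => - FP p) (Gt e2) (fun p => - GP et p) (t, x) et e2).
  - exact: (nslab _ _ dgt sp).
  - exact: (nslab _ _ d2 sp).
  - by apply: nslab sp => q sq; exact: (slab_der_f sFt _ sq).
  - by apply: nslab sp => q sq; apply: is_deriveN; apply: (sl_der sP); exact: slab_pos.
  - exact: (sl_contG sFt).
  - by apply: cvgN; exact: (sl_contG sP).
have regroup (a b c : R) : - a - - b + - c = - (a - b + c) by ring.
pose tau (t : R) := \int[leb2 R]_x (Ft (t, x) * W (t, x)).
have T1 : \int[leb R]_(t in `]0, T[) (\int[leb2 R]_x (dt phi (t, x) * w (t, x))) =
    - \int[leb R]_t slice_pairing V1 V2 (GP et) (GQ et) t.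
  transitivity (\int[leb R]_t tau t).
    apply: Rint_time => t h; last first.
      rewrite /tau (_ : (fun _ => _) = fun=> 0) ?/Rintegral ?integral0//.
      by apply/funext => x; have [-> _ _] := zext_off x h; rewrite mulr0.
    apply: Rint_ext => x; rewrite zext_in//; congr (_ * _).
    have h' : 0 <= t < T by move/andP: h => [/ltW -> ->].
    rewrite -(sl_eq sFt)//; have sp : slab T (t, x) by apply/slabE.
    by rewrite /dt; have [_ ->] := dgt _ sp.
  have mtau : measurable_fun (setT : set (measurableTypeR R)) tau.
    apply: (@measurable_Rint _ _ _ _ _ (leb2 R) (fun z : E3 => Ft z * W z)).
    apply: measurable_funM; last exact: measurable_zext.
    by apply: cont_E3; exact: (sl_cont sFt).
  have [mv1 mv2] := measurable_slab_fst mv.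
  have mtm : measurable_fun (setT : set (measurableTypeR R)) (fun t => - slice_pairing V1 V2 (GP et) (GQ et) t).
    apply: measurable_funN; apply: measurable_slice_pairing; [exact: measurable_zext|exact: measurable_zext| |].
      by apply: cont_E3; exact: (sl_contG sP).
    by apply: cont_E3; exact: (sl_contG sQ).
  rewrite -RintN; apply: (Rint_ae mtau mtm).
  apply: ae_imp ae_good => t gt'; have [h|h] := boolP (0 < t < T); last first.
    rewrite (slice_pairing_off zext_off)// oppr0 /tau (_ : (fun _ => _) = fun=> 0) ?/Rintegral ?integral0//.
    by apply/funext => x; have [-> _ _] := zext_off x h; rewrite mulr0.
  have [iom _ b1 b2] := gt'; have /andP[t0 tT] := h.
  have := bs_perp_test iom (slice_C1c sFt (ltW t0)).
  set I := \int[_]_x _ => hI.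
  have -> : tau t = - I.
    rewrite hI opprK; apply: Rint_ext => x; exact: mulrC.
  congr (- _); rewrite /I /slice_pairing.
  have m1 := measurable_slice t (measurable_zext mv1); have m2 := measurable_slice t (measurable_zext mv2).
  have cs (H : E -> R) : continuous H -> measurable_fun (setT : set R2) (fun x : R * R => H (t, x)).
    by move=> /cont_E3; exact: measurable_slice.
  apply: Rint_ae.
  - apply: measurable_funB; apply: measurable_funM.
    + exact: (measurable_kconv (@measurable_bsK2 R) (intg_mfun iom)).
    + by apply: cs; exact: (sl_contG sFt).
    + exact: (measurable_kconv (@measurable_bsK1 R) (intg_mfun iom)).
    + by apply: cs; exact: (sl_contG sFt).
  - apply: measurable_funD; apply: measurable_funM => //.
    + by apply: cs; exact: (sl_contG sP).
    + by apply: cs; exact: (sl_contG sQ).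
  apply: ae_imp (ae_and b1 b2) => x [-> ->]; rewrite Sch1// Sch2//; ring.
have T2 : \int[leb R]_(t in `]0, T[) (\int[leb2 R]_y (\int[leb2 R]_x
          (H_kernel phi t x y * w (t, x) * w (t, y)))) = - \int[leb R]_t slice_Hform W FP FQ t.
  rewrite -RintN; apply: Rint_time => t h; last by rewrite (slice_Hform_off zext_off)// oppr0.
  rewrite /slice_Hform /Hform -RintN; apply: Rint_ext => y; rewrite -RintN; apply: Rint_ext => x.
  rewrite !zext_in// /H_kernel /Hbar /dot /gradx /=.
  have sp z : slab T (t, z) by apply/slabE.
  have D1 z : dx1 phi (t, z) = FQ (t, z) by rewrite /dx1; have [_ ->] := d1 _ (sp z).
  have D2 z : dx2 phi (t, z) = - FP (t, z) by rewrite /dx2; have [_ ->] := d2 _ (sp z).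
  by rewrite !D1 !D2; ring.
have T3 : \int[leb2 R]_x (phi (0, x) * w0 x) =
    - \int[leb2 R]_x (FP (0, x) * (v0 x).1 + FQ (0, x) * (v0 x).2).
  have := curl_eq_C1c l1 l2 lw0 curl0 (slice_C1c sF (lexx 0)).
  set I := \int[_]_x _ => hI.
  have -> : \int[leb2 R]_x (phi (0, x) * w0 x) = I.
    rewrite hI; apply: Rint_ext => x; rewrite (sl_eq sF) ?lexx// mulrC//.
  rewrite /I -RintN; apply: Rint_ext => x.
  (* The gradient of phi is known for t > 0; continuity gives it at the initial time. *)
  have -> : G e1 (0, x) = FQ (0, x).
    by apply: eq_at_zero => [||t h]; [exact: (sl_contG sF)|exact: (sl_cont sQ)|exact: GE1].
  have -> : G e2 (0, x) = - FP (0, x).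
    apply: (@eq_at_zero (G e2) (fun p => - FP p)) => [||t h]; [exact: (sl_contG sF)| |exact: GE2].
    by move=> p; apply: cvgN; exact: (sl_cont sP).
  ring.
by rewrite /vorticity_lhs /velocity_form T1 T2 T3 regroup.
Qed.

(** F is uniformly continuous and the average runs over points at distance at most e. *)
Lemma time_avg_close K F eta : continuous F -> vanE K F -> 0 < eta ->
  \forall e \near (0 : R)^'+, forall p, `|F p - time_avg e F p| <= eta.
Proof.
move=> cF vF eta0; have [d d0 hd] := vanE_uniform cF vF eta0.
near=> e => p; have e0 : 0 < e by near: e; exact: nbhs_right_gt.
have ed : e < d by near: e; exact: nbhs_right_lt.
have i1 : intg (leb R) (fun s : R => unit_itv s * F (s *: ((e, (0, 0)) : E) + p)).
  by apply: line_op_intg => //; [exact: measurable_unit_itv|exact: ldom_unit].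
have iu : intg (leb R) (@unit_itv R) by exact: (intg_indic_itv 0 1).
have i2 : intg (leb R) (fun s : R => unit_itv s * F p).
  by rewrite (_ : (fun s : R => _) = fun s => F p * unit_itv s); [exact: intgZ|apply/funext => s; rewrite mulrC].
have I1 : \int[leb R]_s unit_itv s = 1 :> R.
  rewrite /Rintegral /unit_itv integral_indic//= setIT lebesgue_measure_itv/=.
  by rewrite lte_fin ltr01 oppr0 adde0.
have -> : F p = \int[leb R]_s (unit_itv s * F p).
  rewrite -[LHS]mulr1 -I1 -RintZ//; apply: Rint_ext => s; exact: mulrC.
rewrite -(RintB i2 i1) -[leRHS]mulr1 -I1 -(RintZ _ iu).
have mD : measurable_fun setT (fun s : R => unit_itv s * F p - unit_itv s * F (s *: ((e, (0, 0)) : E) + p)).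
  by apply: measurable_funB; [exact: (intg_mfun i2)|exact: (intg_mfun i1)].
apply: (@Rint_norm_le _ _ _ (leb R) _ (fun s => eta * unit_itv s) mD (intgZ _ iu)) => s.
rewrite -mulrBr unit_itvE; case: ifPn => [/andP[s0 s1]|_]; last by rewrite mul0r normr0 mulr0.
rewrite mul1r mulr1 ltW//; apply: hd.
rewrite opprD addrCA subrr addr0 normrN normrZ prod_normE prod_normE/= normr0.
rewrite [Num.max 0 0]max_l// max_l// ger0_norm// ger0_norm ?(ltW e0)//.
by apply: le_lt_trans ed; rewrite ler_piMl// ltW.
Unshelve. all: by end_near. Qed.

Lemma vorticity_of_velocity : (forall phi, solenoidal_test T phi -> velocity_lhs phi = 0) ->
  forall phi, Cc (slab0 T) 2 phi -> vorticity_lhs phi = 0.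
Proof.
move=> hvel phi Cphi; have [[cphi dphi] [K [cK KD phi0]]] := Cphi.
have clK : closed K by apply: compact_closed cK; exact: norm_hausdorff.
have [g1 [Cg1 d1']] := dphi e1; have [g2 [Cg2 d2']] := dphi e2.
have d1 p : slab T p -> is_derive p e1 phi (g1 p) by move=> sp; apply: d1'; exact: slab_interior.
have d2 p : slab T p -> is_derive p e2 phi (g2 p) by move=> sp; apply: d2'; exact: slab_interior.
have Cc1 : Cc (slab0 T) 1 g1.
  by split => //; exists K; split => //; have [cg _] := Cg1; exact: (deriv_vanish clK cg d1 phi0).
have Cc2 : Cc (slab0 T) 1 g2.
  by split => //; exists K; split => //; have [cg _] := Cg2; exact: (deriv_vanish clK cg d2 phi0).
pose Phi p := (-1 * g2 p, g1 p).
have CPhi : Cc (slab0 T) 1 Phi by apply: Cc_pair => //; exact: Cc_scale.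
have [S [L [FP [GP [FQ [GQ [sP sQ _ _]]]]]]] := slab_pair_exists CPhi.
have Pin p : slab T p -> FP p = - g2 p /\ FQ p = g1 p.
  case: p => t x /slabE/andP[t0 tT]; have h : 0 <= t < T by rewrite ltW.
  by rewrite -(sl_eq sP x h) -(sl_eq sQ x h) /= mulN1r.
have nslab (P : E -> Prop) p : (forall q, slab T q -> P q) -> slab T p -> \forall q \near p, P q.
  by move=> h sp; apply: (filterS _ (open_nbhs_nbhs (conj (@open_slab R T) sp))).
have dg1 q u : slab T q -> is_derive q u g1 (GQ u q) by move=> sq; exact: (slab_der_f sQ u sq).
have dg2 q u : slab T q -> is_derive q u g2 (- GP u q).
  move=> sq; have d := slab_der_f sP u sq.
  have d' : is_derive q u (- (fun p => -1 * g2 p)) (- GP u q) by exact: is_deriveN.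
  have E2 : - (fun p => -1 * g2 p) = g2 by apply/funext => p; rewrite /= [LHS]/GRing.opp /= mulN1r opprK.
  by rewrite E2 in d'.
have sol : solenoidal_test T Phi.
  split => // -[t x] sp; have /slabE h := sp.
  rewrite /divx /dx1 /dx2 (pair_dir e1 x sP sQ h) (pair_dir e2 x sP sQ h) /=.
  have -> : GQ e2 (t, x) = - GP e1 (t, x); last by rewrite subrr.
  apply: (@schwarz_dir R E phi g1 g2 (GQ e2) (fun p => - GP e1 p) (t, x) e1 e2).
  - exact: (nslab _ _ d1 sp).
  - exact: (nslab _ _ d2 sp).
  - exact: (nslab _ _ (fun q => @dg1 q e2) sp).
  - exact: (nslab _ _ (fun q => @dg2 q e1) sp).
  - exact: (sl_contG sQ).
  - by apply: cvgN; exact: (sl_contG sP).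
have D1 p : slab T p -> is_derive p e1 phi (FQ p).
  by move=> sp; have [_ ->] := Pin p sp; exact: d1.
have D2 p : slab T p -> is_derive p e2 phi (- FP p).
  by move=> sp; have [-> _] := Pin p sp; rewrite opprK; exact: d2.
by rewrite (vorticity_lhsE Cphi sP sQ D1 D2) -(velocity_lhsE sP sQ) hvel// oppr0.
Qed.

Lemma velocity_modulus_ge0 L : 0 <= velocity_modulus T M v01 v02 L.
Proof.
rewrite /velocity_modulus; apply: addr_ge0; last by apply: addr_ge0; apply: Rintegral_ge0 => x _; rewrite mulr_ge0// box_ge0.
rewrite addr_ge0// !mulr_ge0//; first exact: kmass_ge0.
all: exact: ltW.
Qed.

Lemma velocity_of_vorticity : (forall phi, Cc (slab0 T) 2 phi -> vorticity_lhs phi = 0) ->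
  forall phi, solenoidal_test T phi -> velocity_lhs phi = 0.
Proof.
move=> hvort phi [Cphi dphi].
have [S [L [FP [GP [FQ [GQ [sP sQ [evP evGP] [evQ evGQ]]]]]]]] := slab_pair_exists Cphi.
have /andP[S0 ST] := sl_time sP.
(* The stream function requires zero divergence at all positive times; beyond T, hence beyond S, all
   derivatives vanish. *)
have div p : 0 < p.1 -> GP e1 p + GQ e2 p = 0.
  case: p => t x /= t0; have [tT|Tt] := ltP t T.
    have h : 0 < t < T by rewrite t0.
    have := dphi (t, x); rewrite /divx /dx1 /dx2 (pair_dir e1 x sP sQ h) (pair_dir e2 x sP sQ h).
    by apply; apply/slabE.
  have St : S < t by exact: lt_le_trans Tt.
  have t0' : 0 <= ((t, x) : E).1 by exact: ltW.
  have h : S < ((t, x) : E).1 \/ L < `|((t, x) : E).2| by left.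
  by rewrite (sl_vanG sP _ t0' h) (sl_vanG sQ _ t0' h) addr0.
rewrite (velocity_lhsE sP sQ).
apply: (eq_by_eps (velocity_modulus_ge0 L)) => eta eta0.
(* One e serves the two components and their derivatives in three directions. *)
have [e [e0 nP nGP nQ nGQ]] : exists e, [/\ 0 < e, forall p, `|FP p - time_avg e FP p| <= eta,
    [/\ forall p, `|GP et p - time_avg e (GP et) p| <= eta, forall p, `|GP e1 p - time_avg e (GP e1) p| <= eta &
    forall p, `|GP e2 p - time_avg e (GP e2) p| <= eta],
    forall p, `|FQ p - time_avg e FQ p| <= eta &
    [/\ forall p, `|GQ et p - time_avg e (GQ et) p| <= eta, forall p, `|GQ e1 p - time_avg e (GQ e1) p| <= eta &
    forall p, `|GQ e2 p - time_avg e (GQ e2) p| <= eta]].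
  have nG f F G u : slabC1 T S L f F G -> even_time (G u) ->
      \forall e \near (0 : R)^'+, forall p, `|G u p - time_avg e (G u) p| <= eta.
    by move=> sF ev; exact: (time_avg_close (@sl_contG _ _ _ _ _ _ _ sF u) (slab_vanEG sF ev) eta0).
  near (0 : R)^'+ => e; exists e; split; last split; [|by near: e; exact: (time_avg_close (sl_cont sP) (slab_vanE sP evP) eta0)|split| by near: e; exact: (time_avg_close (sl_cont sQ) (slab_vanE sQ evQ) eta0)| | |].
  - by near: e; exact: nbhs_right_gt.
  - by near: e; exact: (nG _ _ _ et sP (evGP et)).
  - by near: e; exact: (nG _ _ _ e1 sP (evGP e1)).
  - by near: e; exact: (nG _ _ _ e2 sP (evGP e2)).
  - by near: e; exact: (nG _ _ _ et sQ (evGQ et)).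
  - by near: e; exact: (nG _ _ _ e1 sQ (evGQ e1)).
  - by near: e; exact: (nG _ _ _ e2 sQ (evGQ e2)).
have sP' := slabC1_avg (ltW e0) sP; have sQ' := slabC1_avg (ltW e0) sQ.
have sder p u : slab T p -> is_derive p u (stream_avg FQ e) (stream_avg_grad FP FQ e u p).
  case: p => t x /slabE/andP[t0 _].
  have := stream_avg_derive sP sQ evP evGP evQ evGQ div e0.
  by apply.
(* The averaged stream function is C2 and its spatial gradient is the average of (Q, - P), so
   [vorticity_lhsE] links it to the averaged field. *)
have Z : Lv (time_avg e FP) (time_avg e FQ) (time_avg e (GP et)) (time_avg e (GQ et)) = 0.
  have CA := stream_avg_Cc sP sQ evP evGP evQ evGQ div e0.
  have D1 p : slab T p -> is_derive p e1 (stream_avg FQ e) (time_avg e FQ p).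
    move=> sp; have := sder p e1 sp; rewrite /stream_avg_grad /=.
    by rewrite !mul0r mul1r add0r subr0.
  have D2 p : slab T p -> is_derive p e2 (stream_avg FQ e) (- time_avg e FP p).
    move=> sp; have := sder p e2 sp; rewrite /stream_avg_grad /=.
    by rewrite !mul0r mul1r !add0r.
  have EQ := vorticity_lhsE CA sP' sQ' D1 D2.
  have E0 := hvort _ CA; rewrite EQ in E0.
  by apply: oppr_inj; rewrite oppr0; exact: E0.
have mW := measurable_zext mw; have [mv1 mv2] := measurable_slab_fst mv.
have cP : closeG eta GP (fun u => time_avg e (GP u)).
  by move=> p _; have [h1 h2 h3] := nGP; split.
have cQ : closeG eta GQ (fun u => time_avg e (GQ u)).
  by move=> p _; have [h1 h2 h3] := nGQ; split.
have C := velocity_form_close T0 M0 mW (measurable_zext mv1) (measurable_zext mv2) zext_off ae_good l1 l2 (ltW eta0) sP sQ sP' sQ'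
  cP cQ (fun x => nP (0, x)) (fun x => nQ (0, x)).
by move: C; cbv beta; rewrite Z.
Unshelve. all: by end_near. Qed.

End Formulations.

(** * Local square integrability and the Euler formulation *)

Section SquareIntegrable.
Variable R : realType.
Local Notation R2 := (measurableTypeR R * measurableTypeR R)%type.
Implicit Types (u : R * R -> R * R).

Lemma Rint_eq0 (f : R * R -> R) : (forall x, f x = 0) -> \int[leb2 R]_x f x = 0.
Proof.
move=> f0; rewrite (_ : f = fun=> 0); last exact/funext.
by rewrite /Rintegral integral0.
Qed.

Lemma enorm_le_norm (x : R * R) : enorm x <= 2 * `|x|.
Proof.
rewrite enormE -(ler_pXn2r (n := 2))// ?nnegrE ?sqrtr_ge0// ?mulr_ge0//.
rewrite sqr_sqrtr ?sqn_ge0// /sqn -[x.1 ^+ 2]real_normK ?num_real// -[x.2 ^+ 2]real_normK ?num_real//.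
have h1 : `|x.1| <= `|x| by rewrite prod_normE le_max lexx.
have h2 : `|x.2| <= `|x| by rewrite prod_normE le_max lexx orbT.
have k1 : `|x.1| ^+ 2 <= `|x| ^+ 2 by rewrite lerXn2r ?nnegrE.
have k2 : `|x.2| ^+ 2 <= `|x| ^+ 2 by rewrite lerXn2r ?nnegrE.
have k0 : 0 <= `|x| ^+ 2 by exact: sqr_ge0.
rewrite exprMn; lra.
Qed.

(** The Euclidean norm is at most twice the max norm, so the open Euclidean ball of radius 2 |L| + 1
    contains the box of radius L. *)
Lemma L2_box_intg u L : measurable_fun (setT : set R2) u ->
  ('N[leb2 R]_(2%:E)[(fun x => (enorm (u x))%:E) \_ (eball (2 * `|L| + 1))] < +oo)%E ->
  intg (leb2 R) (fun x => box L x * (u x).1 ^+ 2) /\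
  intg (leb2 R) (fun x => box L x * (u x).2 ^+ 2).
Proof.
move=> mu0; set B := eball _.
have m1 : measurable_fun (setT : set R2) (fun x => (u x).1).
  exact: (measurableT_comp measurable_fst mu0).
have m2 : measurable_fun (setT : set R2) (fun x => (u x).2).
  exact: (measurableT_comp measurable_snd mu0).
have me : measurable_fun (setT : set R2) (fun x : R * R => enorm x).
  rewrite (_ : (fun x => _) = fun x => Num.sqrt (sqn x)); last by apply/funext => x; rewrite enormE.
  by apply: (measurableT_comp (continuous_measurable_fun (@sqrt_continuous R))); exact: measurable_sqn.
have mB : measurable (B : set R2).
  by rewrite /B /eball -[X in measurable X]setTI; apply: measurable_fun_ltr.
have mg : measurable_fun (setT : set R2) (fun x => \1_B x * sqn (u x)).
  apply: measurable_funM; first exact: measurable_indic.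
  by apply: measurable_funD; exact: measurable_funX.
move=> /(poweR_lty 2); rewrite poweR_Lnorm// => fin.
have ig : intg (leb2 R) (fun x => \1_B x * sqn (u x)).
  apply: intg_ge0P => // [x|]; first by rewrite mulr_ge0 ?sqn_ge0.
  apply: le_lt_trans fin; rewrite le_eqVlt; apply/orP; left; apply/eqP.
  apply: eq_integral => x _; rewrite patchE indicE.
  case: ifPn => xB /=; last by rewrite mul0r normr0 powR0.
  rewrite mul1r powR_mulrn// ger0_norm ?enorm_ge0// enormE sqr_sqrtr ?sqn_ge0//.
have sub (x : R * R) : box L x <= \1_B x.
  rewrite boxE indicE; case: ifP => [xL|_]; last by rewrite ler0n.
  rewrite mem_set// /B /eball /= (le_lt_trans (enorm_le_norm x))//.
  by have := le_trans xL (ler_norm L); lra.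
have key (f : R * R -> R) : measurable_fun (setT : set R2) f -> (forall x, f x ^+ 2 <= sqn (u x)) ->
    intg (leb2 R) (fun x => box L x * f x ^+ 2).
  move=> mf hf; apply: (intg_le _ _ ig) => [|x].
    by apply: measurable_funM; [exact: measurable_box|exact: measurable_funX].
  rewrite ger0_norm; last exact: (mulr_ge0 (box_ge0 _ _) (sqr_ge0 _)).
  exact: (ler_pM (box_ge0 _ _) (sqr_ge0 _) (sub _) (hf _)).
by split; apply: key => // x; rewrite /sqn ?lerDl ?lerDr sqr_ge0.
Qed.

End SquareIntegrable.

Section Euler.
Variables (R : realType) (T M : R).
Local Notation E := (R * (R * R))%type.
Local Notation R2 := (measurableTypeR R * measurableTypeR R)%type.
Local Notation E3 := (measurableTypeR R * (measurableTypeR R * measurableTypeR R))%type.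
Local Notation et := ((1, (0, 0)) : E).
Local Notation e1 := ((0, (1, 0)) : E).
Local Notation e2 := ((0, (0, 1)) : E).

(** The support is compact in the open slab, away from t = 0, so extension by 0 keeps the
    derivatives and no reflection in time is involved. *)
Lemma zext_slabC1 (psi : E -> R) : 0 < T -> Cc (slab T) 1 psi ->
  exists S L G, slabC1 T S L (zext T psi) (zext T psi) G /\
    forall p u, slab T p -> is_derive p u psi (G u p).
Proof.
move=> T0 [[cf /choice[g hg]] [K [cK KD f0]]].
have clK : closed K by apply: compact_closed cK; exact: norm_hausdorff.
have inK p : slab T p -> interior (slab T) p.
  by move=> sp; exact: (open_nbhs_nbhs (conj (@open_slab R T) sp)).
have dg u p : slab T p -> is_derive p u psi (g u p).
  by move=> sp; have [_] := hg u; apply; exact: inK.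
have cg u : {within slab T, continuous (g u)} by have [[]] := hg u.
have g0 u := deriv_vanish_slab clK (dg u) f0.
have zin f p : slab T p -> zext T f p = f p.
  by case: p => t x /slabE h; rewrite zext_in.
have zout f p : ~ slab T p -> zext T f p = 0.
  by case: p => t x h; rewrite /zext /=; case: ifPn => // h'; case: h; apply/slabE.
have nin p : slab T p -> \forall q \near p, slab T q.
  by move=> sp; exact: (open_nbhs_nbhs (conj (@open_slab R T) sp)).
have z0 f p : (forall q, slab T q -> ~ K q -> f q = 0) -> ~ K p ->
    \forall q \near p, zext T f q = 0.
  move=> h Kp; have n2 : nbhs p (~` K) by apply: open_nbhs_nbhs; split=> //; exact: closed_openC.
  apply: (filterS _ n2) => q Kq; have [sq|sq] := pselect (slab T q); last exact: zout.
  by rewrite zin// h.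
have zcont f : {within slab T, continuous f} -> (forall q, slab T q -> ~ K q -> f q = 0) ->
    continuous (zext T f).
  move=> cwf h p; have [Kp|Kp] := pselect (K p).
    have sp := KD _ Kp.
    have cp : {for p, continuous f}.
      by move: cwf; rewrite continuous_open_subspace; [apply; rewrite inE|exact: open_slab].
    rewrite /continuous_at zin//; apply: cvg_trans cp.
    by apply: near_eq_cvg; apply: (filterS _ (nin p sp)) => q sq; rewrite zin.
  have zp := nbhs_singleton (z0 _ _ h Kp).
  rewrite /continuous_at zp; apply: (cvg_trans _ (@cvg_cst _ (0 : R) _ (nbhs p) _)).
  by apply: near_eq_cvg; apply: (filterS _ (z0 _ _ h Kp)) => q ->.
have K0 p : K p -> slab0 T p by move=> /KD; case: p => t x /slabE /andP[t0 tT]; apply/slab0E; rewrite (ltW t0).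
have [S [L [ST KS]]] := slab0_support T0 cK K0.
have van f : (forall q, slab T q -> ~ K q -> f q = 0) -> forall p, 0 <= p.1 ->
    S < p.1 \/ L < `|p.2| -> zext T f p = 0.
  move=> h p p0 hp; apply: (nbhs_singleton (z0 _ _ h _)) => /KS[h1 h2].
  by rewrite ger0_norm// in h1; case: hp; rewrite ltNge ?h1 ?h2.
exists S, L, (fun u => zext T (g u)); split; last first.
  by move=> p u sp; rewrite zin//; exact: dg.
split => //.
- exact: zcont.
- by move=> u; exact: (zcont _ (cg u) (g0 u)).
- exact: van.
- by move=> u; exact: (van _ (g0 u)).
move=> p u _; have [Kp|Kp] := pselect (K p).
  have sp := KD _ Kp; rewrite zin//.
  have N : \forall q \near p, psi q = zext T psi q.
    by apply: (filterS _ (nin p sp)) => q sq; rewrite zin.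
  have d := dg u p sp.
  exact: (near_eq_is_derive N).
rewrite (nbhs_singleton (z0 _ _ (g0 u) Kp)).
have N : \forall q \near p, 0 = zext T psi q.
  by apply: (filterS _ (z0 _ _ f0 Kp)) => q ->.
exact: (near_eq_is_derive N).
Qed.

Variables (v0 : R * R -> R * R) (w : E -> R) (v : E -> R * R).
Local Notation W := (zext T w).
Local Notation V1 := (zext T (fun p => (v p).1)).
Local Notation V2 := (zext T (fun p => (v p).2)).
Hypotheses (T0 : 0 < T) (M0 : 0 <= M).
Hypothesis mw : measurable_fun (slab T) w.
Hypothesis mv : measurable_fun (slab T) v.
Hypothesis ae_good : {ae leb R, forall t, good_time M W V1 V2 t}.
Implicit Types (p q u : E) (F : E -> R).

Let mV1 : measurable_fun (setT : set E3) V1.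
Proof. by apply: measurable_zext; have [] := measurable_slab_fst mv. Qed.

Let mV2 : measurable_fun (setT : set E3) V2.
Proof. by apply: measurable_zext; have [] := measurable_slab_fst mv. Qed.

(** At each good time this is [bs_grad_test] for the slice of the extended test function. *)
Lemma bs_velocity_div_free : div_free T v.
Proof.
move=> psi [Cpsi spsi].
have [S [L [G [sG dG]]]] := zext_slabC1 T0 (conj (Cpsi 1%N) spsi).
transitivity (\int[leb R]_t slice_pairing V1 V2 (G e1) (G e2) t).
  apply: Rint_time => t h; last exact: (slice_pairing_off (@zext_off R T w v)).
  apply: Rint_ext => x; rewrite !zext_in//.
  have sp : slab T (t, x) by apply/slabE.
  have D1 : dx1 psi (t, x) = G e1 (t, x) by rewrite /dx1; have [_ ->] := dG _ e1 sp.
  have D2 : dx2 psi (t, x) = G e2 (t, x) by rewrite /dx2; have [_ ->] := dG _ e2 sp.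
  by rewrite /dot /gradx /= D1 D2 mulrC [X in _ + X]mulrC.
transitivity (\int[leb R]_t (fun=> 0 : R) t); last by rewrite /Rintegral integral0.
have mG u : measurable_fun (setT : set E3) (G u) by apply: cont_E3; exact: (sl_contG sG).
apply: Rint_ae => //; first exact: measurable_slice_pairing.
apply: ae_imp ae_good => t gt; have [h|h] := boolP (0 < t < T); last first.
  exact: (slice_pairing_off (@zext_off R T w v)).
have [iom _ b1 b2] := gt; have /andP[t0 _] := h.
apply: (etrans _ (bs_grad_test iom (slice_C1c sG (ltW t0)))).
have m1 := measurable_slice t mV1; have m2 := measurable_slice t mV2.
have s1 := measurable_slice t (mG e1); have s2 := measurable_slice t (mG e2).
apply: Rint_ae.
- by apply: measurable_funD; exact: measurable_funM.
- apply: measurable_funD; apply: measurable_funM => //.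
  + exact: (measurable_kconv (@measurable_bsK1 R) (intg_mfun iom)).
  + exact: (measurable_kconv (@measurable_bsK2 R) (intg_mfun iom)).
apply: ae_imp (ae_and b1 b2) => x [-> ->]; rewrite mulrC; congr (_ + _); exact: mulrC.
Qed.

Lemma ae_square_integrable L : in_Linf_L2loc T v ->
  {ae leb R, forall t, intg (leb2 R) (fun x => box L x * V1 (t, x) ^+ 2) /\
    intg (leb2 R) (fun x => box L x * V2 (t, x) ^+ 2)}.
Proof.
move=> [_ hv]; have r0 : 0 < 2 * `|L| + 1 by rewrite ltr_wpDl// mulr_ge0.
have [B B0 hB] := ess_sup_bound (hv _ r0).
apply: ae_imp hB => t ht; have [h|h] := boolP (0 < t < T); last first.
  have Z (V : E -> R) : (forall x, V (t, x) = 0) -> intg (leb2 R) (fun x => box L x * V (t, x) ^+ 2).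
    by move=> V0; apply: (intg_ext _ (intg0 _)) => x; rewrite V0 expr0n mulr0.
  by split; apply: Z => x; have [_ h1 h2] := zext_off w v x h.
pose u x := (V1 (t, x), V2 (t, x)).
have mu : measurable_fun (setT : set R2) u.
  by apply: measurable_fun_pair; apply: measurable_slice.
apply: (L2_box_intg mu); move: ht; rewrite patchE mem_setE in_itv/= h => ht.
apply: le_lt_trans (ltry B); apply: le_trans ht.
rewrite (_ : (fun x => (enorm (u x))%:E) = fun x => (enorm (v (t, x)))%:E)//.
by apply/funext => x; rewrite /u !zext_in// -surjective_pairing.
Qed.

(** Square integrability splits the Euler integrand into two separately integrable pieces; the
    quadratic one is given by [tensor_identity] after replacing the velocity slice by the almost
    everywhere equal K * om. *)
Lemma slice_balance S L fP FP GP fQ FQ GQ t : slabC1 T S L fP FP GP -> slabC1 T S L fQ FQ GQ ->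
  0 < t -> (forall x, GP e1 (t, x) + GQ e2 (t, x) = 0) -> good_time M W V1 V2 t ->
  intg (leb2 R) (fun x => box (L + 1) x * V1 (t, x) ^+ 2) ->
  intg (leb2 R) (fun x => box (L + 1) x * V2 (t, x) ^+ 2) ->
  \int[leb2 R]_x ((GP et (t, x) * V1 (t, x) + GQ et (t, x) * V2 (t, x)) +
    ((V1 (t, x) * GP e1 (t, x) + V2 (t, x) * GP e2 (t, x)) * V1 (t, x) +
     (V1 (t, x) * GQ e1 (t, x) + V2 (t, x) * GQ e2 (t, x)) * V2 (t, x))) =
  slice_pairing V1 V2 (GP et) (GQ et) t - slice_Hform W FP FQ t.
Proof.
move=> sP sQ t0 div gt i1 i2; have [iom _ b1 b2] := gt.
have m1 := measurable_slice t mV1; have m2 := measurable_slice t mV2.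
pose om x := W (t, x).
have mb1 : measurable_fun (setT : set R2) (fun x => (bs_conv om x).1).
  exact: (measurable_kconv (@measurable_bsK1 R) (intg_mfun iom)).
have mb2 : measurable_fun (setT : set R2) (fun x => (bs_conv om x).2).
  exact: (measurable_kconv (@measurable_bsK2 R) (intg_mfun iom)).
have j1 : intg (leb2 R) (fun x => (bs_conv om x).1 ^+ 2 * box (L + 1) x).
  apply: (intg_ae _ _ i1); first by apply: measurable_funM; [exact: measurable_funX|exact: measurable_box].
  by apply: ae_imp b1 => x ->; rewrite mulrC.
have j2 : intg (leb2 R) (fun x => (bs_conv om x).2 ^+ 2 * box (L + 1) x).
  apply: (intg_ae _ _ i2); first by apply: measurable_funM; [exact: measurable_funX|exact: measurable_box].
  by apply: ae_imp b2 => x ->; rewrite mulrC.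
have CP := slice_C1c sP (ltW t0); have CQ := slice_C1c sQ (ltW t0).
have TI := tensor_identity CP CQ div iom j1 j2.
have [[_ cP1 cP2 _ _] _ vP1 vP2] := CP; have [[_ cQ1 cQ2 _ _] _ vQ1 vQ2] := CQ.
pose tens V U := tensor (fun x => GP e1 (t, x)) (fun x => GP e2 (t, x))
  (fun x => GQ e1 (t, x)) (fun x => GQ e2 (t, x)) V U.
have mtens V U : measurable_fun (setT : set R2) V -> measurable_fun (setT : set R2) U ->
    measurable_fun (setT : set R2) (tens V U).
  move=> mV mU; have n1 := continuous_measurable2 cP1; have n2 := continuous_measurable2 cP2.
  have n3 := continuous_measurable2 cQ1; have n4 := continuous_measurable2 cQ2.
  by rewrite /tens /tensor; do ?[apply: measurable_funD|apply: measurable_funM].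
have TI' : \int[leb2 R]_x tens (fun x => V1 (t, x)) (fun x => V2 (t, x)) x = - slice_Hform W FP FQ t.
  rewrite -[RHS]TI; apply: Rint_ae; [exact: mtens|exact: mtens|].
  by apply: ae_imp (ae_and b1 b2) => x [h1 h2]; rewrite /tens /tensor h1 h2.
have [B1 B10 h1] := slab_box_bound sP e1; have [B2 B20 h2] := slab_box_bound sP e2.
have [B3 B30 h3] := slab_box_bound sQ e1; have [B4 B40 h4] := slab_box_bound sQ e2.
have [B5 B50 h5] := slab_box_bound sP et; have [B6 B60 h6] := slab_box_bound sQ et.
pose B := B1 + B2 + B3 + B4 + B5 + B6.
have mono b x c : b <= B -> c <= b * box L x -> c <= B * box (L + 1) x.
  move=> bB h; apply: (le_trans h); rewrite !boxE.
  have B0 : 0 <= B by rewrite !addr_ge0.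
  case: ifP => [xL|_]; last by rewrite mulr0; apply: mulr_ge0 => //; case: ifP.
  by rewrite (le_trans xL) ?lerDl// !mulr1.
have it : intg (leb2 R) (tens (fun x => V1 (t, x)) (fun x => V2 (t, x))).
  apply: (@intg_tensor R (L + 1) B) => //.
  - by move=> x; apply: (mono B1 _ _ _ (h1 t x (ltW t0))); rewrite /B; lra.
  - by move=> x; apply: (mono B2 _ _ _ (h2 t x (ltW t0))); rewrite /B; lra.
  - by move=> x; apply: (mono B3 _ _ _ (h3 t x (ltW t0))); rewrite /B; lra.
  - by move=> x; apply: (mono B4 _ _ _ (h4 t x (ltW t0))); rewrite /B; lra.
have mGP : measurable_fun (setT : set E3) (GP et) by apply: cont_E3; exact: (sl_contG sP).
have mGQ : measurable_fun (setT : set E3) (GQ et) by apply: cont_E3; exact: (sl_contG sQ).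
have [|x|x|iP iQ _] := @slice_pairing_intg R M W V1 V2 mV1 mV2 B (L + 1) (GP et) (GQ et) t mGP mGQ _ _ _ gt.
- by rewrite /B !addr_ge0.
- by apply: (mono B5 _ _ _ (h5 t x (ltW t0))); rewrite /B; lra.
- by apply: (mono B6 _ _ _ (h6 t x (ltW t0))); rewrite /B; lra.
rewrite /slice_pairing -TI' -(RintD (intgD iP iQ) it); exact: Rint_ext.
Qed.

Definition euler_lhs (phi : E -> R * R) : R :=
  \int[leb R]_(t in `]0, T[) (\int[leb2 R]_x
          (dot (dt phi (t, x)) (v (t, x)) + grad_tensor phi (t, x) (v (t, x))))
      + \int[leb2 R]_x dot (phi (0, x)) (v0 x).

Lemma velocity_lhs_euler phi : in_Linf_L2loc T v -> solenoidal_test T phi ->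
  velocity_lhs T v0 w v phi = euler_lhs phi.
Proof.
move=> hv [Cphi dphi].
have [S [L [FP [GP [FQ [GQ [sP sQ _ _]]]]]]] := slab_pair_exists T0 Cphi.
have cG u : continuous (GP u) /\ continuous (GQ u) by split; [exact: (sl_contG sP)|exact: (sl_contG sQ)].
have mGP u : measurable_fun (setT : set E3) (GP u) by apply: cont_E3; have [] := cG u.
have mGQ u : measurable_fun (setT : set E3) (GQ u) by apply: cont_E3; have [] := cG u.
have mW := measurable_zext mw.
have mFP : measurable_fun (setT : set E3) FP by apply: cont_E3; exact: (sl_cont sP).
have mFQ : measurable_fun (setT : set E3) FQ by apply: cont_E3; exact: (sl_cont sQ).
pose inner (t : R) := \int[leb2 R]_x ((GP et (t, x) * V1 (t, x) + GQ et (t, x) * V2 (t, x)) +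
    ((V1 (t, x) * GP e1 (t, x) + V2 (t, x) * GP e2 (t, x)) * V1 (t, x) +
     (V1 (t, x) * GQ e1 (t, x) + V2 (t, x) * GQ e2 (t, x)) * V2 (t, x))).
have E1 : \int[leb R]_(t in `]0, T[) (\int[leb2 R]_x
    (dot (dt phi (t, x)) (v (t, x)) + grad_tensor phi (t, x) (v (t, x)))) = \int[leb R]_t inner t.
  apply: Rint_time => t h; last first.
    apply: Rint_eq0 => x; have [_ -> ->] := zext_off w v x h; by rewrite !(mulr0, mul0r, addr0).
  apply: Rint_ext => x; rewrite !zext_in// /grad_tensor /dt /dx1 /dx2.
  by rewrite (pair_dir et x sP sQ h) (pair_dir e1 x sP sQ h) (pair_dir e2 x sP sQ h).
have minner : measurable_fun (setT : set (measurableTypeR R)) inner.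
  apply: (@measurable_Rint _ _ _ _ _ (leb2 R) (fun z : E3 => (GP et z * V1 z + GQ et z * V2 z) +
    ((V1 z * GP e1 z + V2 z * GP e2 z) * V1 z + (V1 z * GQ e1 z + V2 z * GQ e2 z) * V2 z))).
  by do ?[apply: measurable_funD|apply: measurable_funM].
have mR : measurable_fun (setT : set (measurableTypeR R))
    (fun t => slice_pairing V1 V2 (GP et) (GQ et) t - slice_Hform W FP FQ t).
  by apply: measurable_funB; [exact: measurable_slice_pairing|exact: measurable_slice_Hform].
have E2 : \int[leb R]_t inner t = \int[leb R]_t (slice_pairing V1 V2 (GP et) (GQ et) t - slice_Hform W FP FQ t).
  (* The box of radius L + 1 leaves the margin that mollification uses in [tensor_identity]. *)
  apply: (Rint_ae minner mR); apply: ae_imp (ae_and ae_good (ae_square_integrable (L + 1) hv)) => t [gt [i1 i2]].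
  have [h|h] := boolP (0 < t < T); last first.
    rewrite (slice_pairing_off (@zext_off R T w v))// (slice_Hform_off (@zext_off R T w v))// subrr.
    apply: Rint_eq0 => x; have [_ -> ->] := zext_off w v x h; by rewrite !(mulr0, mul0r, addr0).
  have /andP[t0 _] := h; apply: (slice_balance sP sQ) => // x.
  have := dphi (t, x); rewrite /divx /dx1 /dx2 (pair_dir e1 x sP sQ h) (pair_dir e2 x sP sQ h).
  by apply; apply/slabE.
have jm := slab_slice_pairing T0 M0 mV1 mV2 (@zext_off R T w v) ae_good et sP sQ.
have [A A0 hA] := slab_Hbar sP sQ.
have [jH _] := slice_Hform_time T0 M0 mW (@zext_off R T w v) ae_good mFP mFQ A0 hA.
rewrite (velocity_lhsE v0 w v T0 sP sQ) /velocity_form /euler_lhs E1 E2 (RintB jm jH).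
f_equal; apply: Rint_ext => x; rewrite /dot; have h : 0 <= (0 : R) < T by rewrite lexx T0.
by rewrite -(sl_eq sP x h) -(sl_eq sQ x h).
Qed.

End Euler.

Theorem proposition3p5 (R : realType) (T : R)
    (w0 : R * R -> R) (v0 : R * R -> R * R)
    (w : R * (R * R) -> R) (v : R * (R * R) -> R * R) :
  0 < T ->
  initial_datum w0 v0 ->
  in_Linf_L1 T w ->
  is_bs_velocity T w v ->
  (symmetrized_velocity_solution T w0 v0 w v <->
   symmetrized_vorticity_solution T w0 v0 w v) /\
  (in_Linf_L2loc T v -> in_L2loc v0 ->
   (symmetrized_velocity_solution T w0 v0 w v <->
    euler_velocity_weak_solution T v0 v)).
Proof.
move=> T0 init hw hv; have [[iw0 hM2 curl0] [mw _] [mv _]] := And3 init hw hv.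
have [l1 l2] := in_M2_L1loc hM2; have lw0 := intg_L1loc iw0.
have [M M0 ae_good] := good_time_ae hw hv.
split; [split=> -[_ _ _ h]; split=> //|].
- exact: (vorticity_of_velocity T0 mw mv ae_good l1 l2 lw0 curl0 h).
- exact: (velocity_of_vorticity T0 M0 mw mv ae_good l1 l2 lw0 curl0 h).
move=> vL2 v0L2; split=> -[_ _ _ h]; split=> //.
- exact: (bs_velocity_div_free T0 mv ae_good).
- move=> phi sphi; exact: (etrans (esym (velocity_lhs_euler v0 T0 M0 mw mv ae_good vL2 sphi)) (h phi sphi)).
- move=> phi sphi; exact: (etrans (velocity_lhs_euler v0 T0 M0 mw mv ae_good vL2 sphi) (h phi sphi)).
Qed.
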